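(* Let $n\in\mathbb N$, $1\le p\le q<\infty$, and let $\alpha,\beta>-1$ satisfy $$\frac qp\le\frac{\beta+2}{\alpha+2}.$$ Fix $r\in(0,1)$. Let $g$ be analytic in $\mathbb D$, and assume that $T_{g,n}:A_\alpha^p\to A_\beta^q$ is bounded. Define $$d\mu_n(z)=|g'(z)|^q(1-|z|^2)^{\beta+nq}\,dA(z).$$ Then $$\left(\|T_{g,n}\|_e^{A_\alpha^p\to A_\beta^q}\right)^q\asymp_{\alpha,\beta,p,q,n,r}\limsup_{|a|\to1^-}\frac{\mu_n(D(a,r))}{(1-|a|^2)^{q(2+\alpha)/p}}.$$ In particular, $T_{g,n}:A_\alpha^p\to A_\beta^q$ is compact if and only if the right-hand side equals $0$.
   Context: $\mathbb D=\{z\in\mathbb C:|z|<1\}$, $dA=\frac1\pi\,dx\,dy$. For $\alpha>-1$ and $1\le p<\infty$, the weighted Bergman space $A_\alpha^p$ consists of analytic $f$ in $\mathbb D$ with $\|f\|_{A_\alpha^p}^p=\int_{\mathbb D}|f(z)|^p(\alpha+1)(1-|z|^2)^\alpha\,dA(z)<\infty$. For analytic $f,g$ in $\mathbb D$ and $n\in\mathbb N=\{1,2,\dots\}$, $$T_{g,n}[f](z)=\int_0^z\int_0^{t_1}\cdots\int_0^{t_{n-1}} f(t_n)g'(t_n)\,dt_n\cdots dt_1,\quad z\in\mathbb D,$$ an $n$-fold iterated integral, equivalently $T_{g,n}[f](z)=\frac1{(n-1)!}\int_0^z(z-t)^{n-1}f(t)g'(t)\,dt$. For $a\in\mathbb D$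 and $r\in(0,1)$, $D(a,r)=\{z\in\mathbb D:|z-a|<r(1-|a|)\}$. The essential norm of a bounded operator $T:X\to Y$ between Banach spaces is $\|T\|_e^{X\to Y}=\inf\{\|T-K\|_{X\to Y}: K:X\to Y\text{ compact}\}$. $A\asymp B$ with subscripts means $C^{-1}B\le A\le CB$ with a constant $C\geq 1$ depending only on the subscripted parameters. *)

(* Defs.v *)
From HB Require Import structures.
From mathcomp Require Import all_boot all_order all_algebra.
From mathcomp Require Import all_classical all_reals all_analysis.
From mathcomp Require Export complex.

Set Implicit Arguments.
Unset Strict Implicit.
Unset Printing Implicit Defensive.

Import Order.TTheory GRing.Theory Num.Theory.
Import numFieldNormedType.Exports.

Local Open Scope classical_set_scope.
Local Open Scope complex_scope.
Local Open Scope ring_scope.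

(** The real modulus [Normc.normc z : R] is used instead of the norm of the
    numDomainType [R[i]], which takes its values in [R[i]]. *)
Notation cabs := Normc.normc.

Section Disc.
Context {R : realType}.
Local Notation C := (R[i]).

Definition disc : set C := [set z | cabs z < 1].

(** [R[i]^o] is [R[i]] as a normed module over itself, so that [derivable] and
    [derive1] are complex differentiability and the complex derivative.
    Functions on the disc are total functions [C -> C] whose values outside
    [disc] are irrelevant. *)
Definition analytic (f : C -> C) : Prop :=
  forall z, disc z -> derivable (f : C^o -> C^o) z 1.

Definition cderiv (f : C -> C) : C -> C := derive1 (f : C^o -> C^o).

Definition carleson_disc (a : C) (r : R) : set C :=
  disc `&` [set z | cabs (z - a) < r * (1 - cabs a)].

(** Integral over [E] against [dA = dx dy / pi], [C] being identified with
    [R * R] through [(x, y) |-> x +i* y]. *)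
Definition area_integral (E : set C) (F : C -> R) : \bar R :=
  ((@trigo.pi R)^-1%:E *
   \int[(@lebesgue_measure R \x @lebesgue_measure R)%E]_(u in
        [set u | E (u.1 +i* u.2)]) (F (u.1 +i* u.2))%:E)%E.

End Disc.

Section Bergman.
Context {R : realType}.
Local Notation C := (R[i]).

Definition bergman_norm (p alpha : R) (f : C -> C) : \bar R :=
  poweR (area_integral disc
    (fun z => cabs (f z) `^ p *
              ((alpha + 1) * (1 - cabs z ^+ 2) `^ alpha))) p^-1.

Definition bergman (p alpha : R) : set (C -> C) :=
  [set f | analytic f /\ (bergman_norm p alpha f < +oo)%E].

Definition operator := (C -> C) -> (C -> C).

(** Elements of a Bergman space are equal when they agree on [disc]; the second
    clause says that [T] is well defined up to this identification. *)
Definition linear_operator (p alpha q beta : R) (T : operator) : Prop :=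
  [/\ forall f, bergman p alpha f -> bergman q beta (T f),
      forall f h, bergman p alpha f -> bergman p alpha h ->
        (forall z, disc z -> f z = h z) ->
        forall z, disc z -> T f z = T h z
    & forall (c : C) f h, bergman p alpha f -> bergman p alpha h ->
        forall z, disc z ->
          T (fun w => c * f w + h w) z = c * T f z + T h z].

Definition bounded_operator (p alpha q beta : R) (T : operator) : Prop :=
  linear_operator p alpha q beta T /\
  exists M : R, forall f, bergman p alpha f ->
    (bergman_norm q beta (T f) <= M%:E * bergman_norm p alpha f)%E.

(** Every norm-bounded sequence is mapped to a sequence having a subsequence
    that converges in the target space. *)
Definition compact_operator (p alpha q beta : R) (K : operator) : Prop :=
  linear_operator p alpha q beta K /\
  forall (f : nat -> C -> C) (M : R),
    (forall k, bergman p alpha (f k)) ->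
    (forall k, (bergman_norm p alpha (f k) <= M%:E)%E) ->
    exists (phi : nat -> nat) (h : C -> C),
      [/\ {homo phi : i j / (i < j)%N},
          bergman q beta h
        & (fun k => bergman_norm q beta (K (f (phi k)) \- h)) @ \oo
            --> (0 : \bar R)%E].

Definition operator_norm (p alpha q beta : R) (T : operator) : \bar R :=
  ereal_sup [set bergman_norm q beta (T f) |
    f in bergman p alpha `&` [set f | (bergman_norm p alpha f <= 1)%E]].

Definition essential_norm (p alpha q beta : R) (T : operator) : \bar R :=
  ereal_inf [set operator_norm p alpha q beta (fun f => T f \- K f) |
    K in compact_operator p alpha q beta].

End Bergman.

Section Volterra.
Context {R : realType}.
Local Notation C := (R[i]).

(** [int_0^z h(t) dt] along the segment [t = s z], [0 <= s <= 1]. *)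
Definition path_integral (h : C -> C) (z : C) : C :=
  z * (Rintegral (@lebesgue_measure R) `[0, 1]
         (fun s => complex.Re (h (s%:C * z)))
       +i* Rintegral (@lebesgue_measure R) `[0, 1]
         (fun s => complex.Im (h (s%:C * z)))).

Definition Tgn (g : C -> C) (n : nat) : operator :=
  fun f => iter n path_integral (fun t => f t * cderiv g t).

Definition mu_n (g : C -> C) (n : nat) (q beta : R) (E : set C) : \bar R :=
  area_integral E
    (fun z => cabs (cderiv g z) `^ q *
              (1 - cabs z ^+ 2) `^ (beta + n%:R * q)).

(** The filter [|a| -> 1^-] on [C]. *)
Definition to_boundary : set_system C^o :=
  @filter_from R C^o [set d : R | 0 < d]
    (fun d => [set a : C | 1 - d < cabs a < 1]).

Definition limsup_mu (g : C -> C) (n : nat) (p q alpha beta r : R) : \bar R :=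
  limf_esup
    (fun a : C^o => mu_n g n q beta (carleson_disc a r) *
       ((1 - cabs a ^+ 2) `^ (q * (2 + alpha) / p))^-1%:E)%E
    to_boundary.

End Volterra.

(* Main.v *)
Require Import Defs.
From HB Require Import structures.
From mathcomp Require Import all_boot all_order all_algebra.
From mathcomp Require Import all_classical all_reals all_analysis.
From mathcomp Require Import complex.
From mathcomp Require Import measurable_realfun ring lra.

Set Implicit Arguments.
Unset Strict Implicit.
Unset Printing Implicit Defensive.

Import Order.TTheory GRing.Theory Num.Theory.
Import numFieldNormedType.Exports.

Local Open Scope classical_set_scope.
Local Open Scope ring_scope.
Local Open Scope complex_scope.

(** Write N_e(F) for the integral of |F|^q (1-|z|)^e over the disc.  The two
    Littlewood-Paley inequalities N_b(F) ~ N_(b+q)(F') for F(0) = 0, applied n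
    times, turn ||T_(g,n) f||^q into the integral of |f|^q against mu_n, so that
    everything becomes a statement on the embedding of A^p_alpha into L^q(mu_n).
    Averaging the local bound of |f|^p over discs of radius comparable to 1-|z|
    and exchanging integrals (no covering is needed) controls the part of this
    embedding near the circle by the supremum of
    mu_n(D(a,r)) / (1-|a|^2)^(q(2+alpha)/p).

    Upper bound: compare T with the operators f |-> T (f(rho .)), which are
    compact by Montel's theorem.  Lower bound: for normalized kernels f_a and a
    compact K, choose points a_i along which K f_(a_i) is a Cauchy sequence and
    test T - K on f_(a_i) - f_(a_j) for j much larger than i; on D(a_i,r) the
    second term is negligible, and weak convergence is never used. *)

(** * Complex differentiability and line integrals *)

(** The constant has to be fixed before [g], so every estimate carries its constant outside the
    quantifiers over functions. Quantities that depend on [g], such as the mass of [mu_n], the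
    dilation factor or the width of the annulus near the circle, must drop out in the end: they only
    enter terms that are made small, or bounds that are uniform in them. Norms are handled through
    their p-th powers [Nrm], with 2^p as the constant of the triangle inequality. Function theory is
    built on squares instead of circles: a side is affine in its parameter and lies on a coordinate
    line, which suits Tonelli's theorem, and the constant 2 pi i is replaced by a contour integral
    that is only bounded from below. Iterated integration produces functions vanishing at 0, and
    each Littlewood-Paley step moves the weight exponent from e > -1 up to e + q, so the admissible
    range is never left. *)

Section ComplexBasics.
Context {R : realType}.
Local Notation C := R[i].
Implicit Types (z w h : C) (f g : C -> C).

Lemma cabs_ge0 z : 0 <= cabs z.
Proof. by case: z => a b; exact: sqrtr_ge0. Qed.

Lemma normC_cabs z : `|z| = (cabs z)%:C.
Proof. by case: z. Qed.

Lemma cabs_le_normD z w : cabs (z + w) <= cabs z + cabs w.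
Proof. exact: le_normcD. Qed.

Lemma cabsB z w : cabs (z - w) = cabs (w - z).
Proof. by rewrite -normcN opprB. Qed.

Lemma cabs0 : cabs (0 : C) = 0.
Proof. exact: Normc.normc0. Qed.

Lemma cabs1 : cabs (1 : C) = 1.
Proof. exact: Normc.normc1. Qed.

Lemma cabs_eq0 z : (cabs z == 0) = (z == 0).
Proof.
by apply/eqP/eqP => [/Normc.eq0_normc //|->]; exact: cabs0.
Qed.

Lemma cabs_gt0 z : (0 < cabs z) = (z != 0).
Proof. by rewrite lt_neqAle cabs_ge0 andbT eq_sym cabs_eq0. Qed.

Lemma cabsM z w : cabs (z * w) = cabs z * cabs w.
Proof. exact: Normc.normcM. Qed.

Lemma cabsV z : cabs z^-1 = (cabs z)^-1.
Proof. exact: Normc.normcV. Qed.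

Lemma cabsX z n : cabs (z ^+ n) = cabs z ^+ n.
Proof.
elim: n => [|n IH]; first by rewrite !expr0 cabs1.
by rewrite !exprS cabsM IH.
Qed.

Lemma cabsR (x : R) : cabs x%:C = `|x|.
Proof. by rewrite /= expr0n /= addr0 sqrtr_sqr. Qed.

Lemma cabs_Re z : `|complex.Re z| <= cabs z.
Proof.
case: z => a b /=; rewrite -sqrtr_sqr ler_wsqrtr //.
by rewrite lerDl sqr_ge0.
Qed.

Lemma cabs_Im z : `|complex.Im z| <= cabs z.
Proof.
case: z => a b /=; rewrite -sqrtr_sqr ler_wsqrtr //.
by rewrite lerDr sqr_ge0.
Qed.

Lemma cabs_le_ReIm z : cabs z <= `|complex.Re z| + `|complex.Im z|.
Proof.
case: z => a b /=; rewrite -(@ger0_norm _ (`|a| + `|b|)) ?addr_ge0 //.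
rewrite -sqrtr_sqr ler_wsqrtr // sqrrD !real_normK ?num_real //.
by rewrite -addrA lerD2l lerDr mulrn_wge0 // mulr_ge0.
Qed.

Lemma cabs_sqr z : cabs z ^+ 2 = complex.Re z ^+ 2 + complex.Im z ^+ 2.
Proof. by case: z => a b /=; rewrite sqr_sqrtr // addr_ge0 ?sqr_ge0. Qed.

Lemma cabs_le_subD z w : cabs z - cabs w <= cabs (z - w).
Proof. by rewrite lerBlDr -{1}(subrK w z) cabs_le_normD. Qed.

Lemma cabs_conj z : cabs z^* = cabs z.
Proof. by case: z => a b /=; rewrite sqrrN. Qed.

(** First-order expansion with a real modulus. The non-strict bound is trivial at h = 0, so no
    punctured neighbourhood is needed and derivative rules reduce to real inequalities. *)
Definition cdiff (f : C -> C) (z d : C) := forall e : R, 0 < e ->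
  exists2 de : R, 0 < de & forall h, cabs h < de ->
    cabs (f (z + h) - f z - d * h) <= e * cabs h.

Lemma cdiff_uniq f z d d' : cdiff f z d -> cdiff f z d' -> d = d'.
Proof.
move=> D1 D2; apply/eqP; rewrite -subr_eq0 -cabs_eq0; apply/negPn/negP => dn0.
have e0 : 0 < cabs (d - d') / 4 by rewrite divr_gt0 // lt_def dn0 cabs_ge0.
have [d1 d10 H1] := D1 _ e0.
have [d2 d20 H2] := D2 _ e0.
pose t : R := Num.min d1 d2 / 2.
have t0 : 0 < t by rewrite divr_gt0 // lt_min d10.
have m0 : 0 < Num.min d1 d2 by rewrite lt_min d10.
have tt : cabs t%:C = t by rewrite cabsR gtr0_norm.
have lt1 : t < d1 by have := ge_min d1 d1 d2; rewrite lexx /= /t => ?; lra.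
have lt2 : t < d2.
  by have := ge_min d2 d1 d2; rewrite lexx orbT /= /t => ?; lra.
have := H1 t%:C; rewrite tt => /(_ lt1) A1.
have := H2 t%:C; rewrite tt => /(_ lt2) A2.
have : cabs ((d - d') * t%:C) <= 2 * (cabs (d - d') / 4 * t).
  have -> : (d - d') * t%:C = (f (z + t%:C) - f z - d' * t%:C)
     - (f (z + t%:C) - f z - d * t%:C) by ring.
  apply: le_trans (cabs_le_normD _ _) _; rewrite normcN; lra.
rewrite cabsM tt => A3.
have : 0 < cabs (d - d') * t by rewrite mulr_gt0 // lt_def dn0 cabs_ge0.
lra.
Qed.

(** Radii of balls in [C^o] are positive elements of [R[i]], and positivity there forces them to be
    real; this is the bridge to radii in [R]. *)
Lemma nbhs0_cabs (A : set C^o) :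
  nbhs (0 : C^o) A <-> exists2 de : R, 0 < de & forall h, cabs h < de -> A h.
Proof.
split.
- move=> /nbhs_ballP [e /= e0 He].
  have [r er] : exists r : R, e = r%:C.
    by apply/complex_realP; rewrite gtr0_real.
  subst e; move: e0; rewrite ltcR => r0; exists r => // h hr; apply: He.
  by rewrite -ball_normE /= sub0r normrN normC_cabs ltcR.
- case=> de d0 Hd; apply/nbhs_ballP; exists de%:C => /=; first by rewrite ltcR.
  move=> h; rewrite -ball_normE /= sub0r normrN normC_cabs ltcR; exact: Hd.
Qed.

Lemma cdiff_cvg (f : C -> C) z d : cdiff f z d <->
  (fun h : C^o => h^-1 *: ((f : C^o -> C^o) (h + z) - f z)) @ (0 : C^o)^'
    --> (d : C^o).
Proof.
split.
- move=> D; apply/cvgrPdist_le => /= e e0.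
  have [r er] : exists r : R, e = r%:C.
    by apply/complex_realP; rewrite gtr0_real.
  subst e; move: e0; rewrite ltcR => r0.
  have [de d0 H] := D _ r0.
  apply/nbhs0_cabs; exists de => // h hd h0.
  rewrite normC_cabs lecR.
  have hn0 : h != 0 by exact: h0.
  have -> : (d - h^-1 *: (f (h + z) - f z) : C) =
            - (h^-1 * (f (z + h) - f z - d * h)).
    by rewrite [h + z]addrC /GRing.scale /=; field.
  rewrite normcN cabsM cabsV ler_pdivrMl ?cabs_gt0 //.
  by rewrite [_ * r]mulrC; exact: H.
- move=> /cvgrPdist_le /= D e e0.
  have [de d0 H] : exists2 de : R, 0 < de & forall h, cabs h < de ->
      h != 0 -> `|d - h^-1 *: (f (h + z) - f z)| <= e%:C :> C.
    by apply/nbhs0_cabs; apply: D; rewrite ltcR.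
  exists de => // h hd; have [->|hn0] := eqVneq h 0.
    by rewrite addr0 subrr mulr0 subrr cabs0 mulr0.
  have := H h hd hn0; rewrite normC_cabs lecR.
  have -> : (d - h^-1 *: (f (h + z) - f z) : C) =
            - (h^-1 * (f (z + h) - f z - d * h)).
    by rewrite [h + z]addrC /GRing.scale /=; field.
  by rewrite normcN cabsM cabsV ler_pdivrMl ?cabs_gt0 // [_ * e]mulrC.
Qed.

Lemma cdiff_derivable (f : C -> C) z d : cdiff f z d ->
  derivable (f : C^o -> C^o) z 1 /\ cderiv f z = d.
Proof.
move=> /cdiff_cvg D; split.
- rewrite /derivable; apply/cvg_ex; exists (d : C^o).
  apply: cvg_trans D; apply: near_eq_cvg; near=> h => /=.
  by rewrite /GRing.scale /= mulr1.
- exact: (cvg_lim (@norm_hausdorff C (C^o : normedModType C)) D).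
Unshelve. all: by end_near. Qed.

Lemma derivable_cdiff (f : C -> C) z :
  derivable (f : C^o -> C^o) z 1 -> cdiff f z (cderiv f z).
Proof.
rewrite /derivable => /cvg_ex [d Hd]; have D : cdiff f z d.
  apply/cdiff_cvg; apply: cvg_trans Hd.
  apply: near_eq_cvg; near=> h => /=.
  by rewrite /GRing.scale /= mulr1.
by rewrite (cdiff_derivable D).2.
Unshelve. all: by end_near. Qed.

Lemma cdiffP (f : C -> C) z d :
  cdiff f z d <-> is_derive (z : C^o) 1 (f : C^o -> C^o) d.
Proof.
split.
- move=> /cdiff_derivable [D1 D2]; apply: (DeriveDef D1).
  by rewrite -derive1E; exact: D2.
- move=> [D <-]; have := derivable_cdiff D.
  by rewrite /cderiv derive1E.
Qed.

Lemma cdiff_cst (c : C) z : cdiff (fun=> c) z 0.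
Proof. by apply/cdiffP; exact: is_derive_cst. Qed.

Lemma cdiff_id z : cdiff (fun w => w) z 1.
Proof. by apply/cdiffP; exact: is_derive_id. Qed.

Lemma cdiffD f g z d d' : cdiff f z d -> cdiff g z d' ->
  cdiff (fun w => f w + g w) z (d + d').
Proof. by move=> /cdiffP D /cdiffP D'; apply/cdiffP; exact: is_deriveD. Qed.

Lemma cdiffN f z d : cdiff f z d -> cdiff (fun w => - f w) z (- d).
Proof. by move=> /cdiffP D; apply/cdiffP; exact: is_deriveN. Qed.

Lemma cdiffB f g z d d' : cdiff f z d -> cdiff g z d' ->
  cdiff (fun w => f w - g w) z (d - d').
Proof. by move=> D D'; apply: cdiffD => //; exact: cdiffN. Qed.

Lemma cdiffM f g z d d' : cdiff f z d -> cdiff g z d' ->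
  cdiff (fun w => f w * g w) z (d * g z + f z * d').
Proof.
move=> /cdiffP D /cdiffP D'; apply/cdiffP.
have := is_deriveM D D'; congr is_derive.
by rewrite /GRing.scale /=; ring.
Qed.

Lemma cdiff_small f z d : cdiff f z d -> forall e : R, 0 < e ->
  exists2 de : R, 0 < de & forall h, cabs h < de -> cabs (f (z + h) - f z) < e.
Proof.
move=> D e e0; have [de d0 H] := D 1 ltr01.
have p : 0 < cabs d + 1 by rewrite ltr_wpDl // cabs_ge0.
exists (Num.min de (e / (cabs d + 1))); first by rewrite lt_min d0 divr_gt0.
move=> h; rewrite lt_min => /andP[h1 h2].
have -> : f (z + h) - f z = (f (z + h) - f z - d * h) + d * h by ring.
apply: le_lt_trans (cabs_le_normD _ _) _.
have := H _ h1; rewrite cabsM; move: h2; rewrite ltr_pdivlMr // => h2 h3.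
lra.
Qed.

(** With a = f z and k = f (z + h) - f z, the remainder is exactly (- a (k - d h) + d h k) / (a^2 (a
    + k)). Once |a + k| >= |a| / 2, each of the two terms may cost e |a|^3 |h| / 4, which dictates
    the tolerances. *)
Lemma cdiffV f z d : f z != 0 -> cdiff f z d ->
  cdiff (fun w => (f w)^-1) z (- d / (f z ^+ 2)).
Proof.
move=> f0 D e e0; set a := f z in f0 *.
have a0 : 0 < cabs a by rewrite cabs_gt0.
have p : 0 < cabs d + 1 by rewrite ltr_wpDl // cabs_ge0.
have e1 : 0 < e * cabs a ^+ 2 / 4 by rewrite divr_gt0 // mulr_gt0 // exprn_gt0.
have [d1 d10 H1] := D _ e1.
have [d2 d20 H2] := cdiff_small D (divr_gt0 a0 (ltr0Sn _ 1)).
have e3 : 0 < e * cabs a ^+ 3 / (4 * (cabs d + 1)).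
  by rewrite divr_gt0 // mulr_gt0 // exprn_gt0.
have [d3 d30 H3] := cdiff_small D e3.
exists (Num.min d1 (Num.min d2 d3)); first by rewrite !lt_min d10 d20.
move=> h; rewrite !lt_min => /and3P[/H1 k1 /H2 k2 /H3 k3].
rewrite -/a in k1 k2 k3; set k := f (z + h) - a in k1 k2 k3.
have -> : f (z + h) = a + k by rewrite /k; ring.
have ak : cabs a / 2 <= cabs (a + k).
  have := cabs_le_subD a (- k); rewrite normcN opprK; lra.
have ak0 : a + k != 0 by rewrite -cabs_gt0; lra.
have -> : (a + k)^-1 - a^-1 - - d / a ^+ 2 * h =
   (- a * (k - d * h) + d * h * k) / (a ^+ 2 * (a + k)) by field; rewrite f0 ak0.
rewrite cabsM cabsV ler_pdivrMr ?cabs_gt0 ?mulf_neq0 ?expf_neq0 //.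
rewrite cabsM cabsX.
apply: (@le_trans _ _ (e * cabs h * (cabs a ^+ 2 * (cabs a / 2)))); last first.
  apply: ler_wpM2l; first by rewrite mulr_ge0 ?cabs_ge0 ?ltW.
  by apply: ler_wpM2l => //; rewrite exprn_ge0 ?cabs_ge0.
apply: le_trans (cabs_le_normD _ _) _; rewrite !cabsM normcN.
have A1 : cabs a * cabs (k - d * h) <= cabs a * (e * cabs a ^+ 2 / 4 * cabs h).
  by apply: ler_wpM2l => //; exact: cabs_ge0.
have A2 : cabs d * cabs k <= e * cabs a ^+ 3 / 4.
  have : cabs d * cabs k <= (cabs d + 1) * cabs k.
    by apply: ler_wpM2r; [exact: cabs_ge0|rewrite lerDl].
  move: k3; rewrite ltr_pdivlMr ?mulr_gt0 // => k3 k4; lra.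
have A3 : cabs h * (cabs d * cabs k) <= cabs h * (e * cabs a ^+ 3 / 4).
  by apply: ler_wpM2l => //; exact: cabs_ge0.
rewrite (_ : cabs d * cabs h * cabs k = cabs h * (cabs d * cabs k)); last by ring.
apply: le_trans (lerD A1 A3) _.
by rewrite le_eqVlt; apply/orP; left; apply/eqP; field.
Qed.

Lemma cdiff_affine f (a b : C) z d : cdiff f (a * z + b) d ->
  cdiff (fun w => f (a * w + b)) z (a * d).
Proof.
move=> D e e0.
have p : 0 < cabs a + 1 by rewrite ltr_wpDl // cabs_ge0.
have [de d0 H] := D (e / (cabs a + 1)) (divr_gt0 e0 p).
exists (de / (cabs a + 1)); first by rewrite divr_gt0.
move=> h hd.
have ah : cabs (a * h) <= (cabs a + 1) * cabs h.
  by rewrite cabsM ler_wpM2r ?cabs_ge0 // lerDl.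
have ha : cabs (a * h) < de.
  by apply: le_lt_trans ah _; rewrite mulrC -ltr_pdivlMr.
have := H _ ha.
have -> : a * z + b + a * h = a * (z + h) + b by ring.
have -> : d * (a * h) = a * d * h by ring.
move=> A; apply: le_trans A _.
rewrite mulrAC ler_pdivrMr // -!mulrA [cabs h * _]mulrC.
by apply: ler_wpM2l => //; exact: ltW.
Qed.

Lemma cdiff_ext f g z d (r : R) : 0 < r ->
  (forall h, cabs h < r -> f (z + h) = g (z + h)) ->
  cdiff f z d -> cdiff g z d.
Proof.
move=> r0 fg D e e0; have [de d0 H] := D e e0.
exists (Num.min de r); first by rewrite lt_min d0.
move=> h; rewrite lt_min => /andP[h1 h2].
have := fg 0; rewrite cabs0 addr0 => /(_ r0) <-.
by rewrite -fg //; exact: H.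
Qed.

Lemma cont_cabsP (T : topologicalType) (phi : T -> C) (t : T) :
  {for t, continuous (phi : T -> C^o)} <->
  forall e : R, 0 < e -> \forall s \near t, cabs (phi s - phi t) < e.
Proof.
split.
- move=> /cvgrPdist_lt H e e0; have := H e%:C; rewrite ltcR => /(_ e0).
  by apply: filterS => s /=; rewrite normC_cabs ltcR cabsB.
- move=> H; apply/cvgrPdist_lt => e e0.
  have [r er] : exists r : R, e = r%:C.
    by apply/complex_realP; rewrite gtr0_real.
  subst e; move: e0; rewrite ltcR => /H.
  by apply: filterS => s /=; rewrite normC_cabs ltcR cabsB.
Qed.

Lemma cdiff_cont f z d : cdiff f z d -> {for z, continuous (f : C^o -> C^o)}.
Proof.
move=> /cdiff_derivable [D _].
by apply: differentiable_continuous; apply/derivable1_diffP.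
Qed.

Lemma real_cdiffP (f : R -> R) (x d : R) :
  (forall e : R, 0 < e -> exists2 de : R, 0 < de & forall y : R, `|y| < de ->
    `|f (x + y) - f x - d * y| <= e * `|y|) <->
  is_derive x 1 f d.
Proof.
split=> [D|[D E]].
  have H : (fun h : R => h^-1 *: (f (h + x) - f x)) @ (0 : R)^' --> d.
    apply/cvgrPdist_le => /= e e0.
    have [de d0 H] := D _ e0.
    apply/nbhs_ballP; exists de => //= h; rewrite -ball_normE /= sub0r normrN.
    move=> hd h0; have hn0 : h != 0 by exact: h0.
    have -> : d - h^-1 *: (f (h + x) - f x) =
              - (h^-1 * (f (x + h) - f x - d * h)).
      by rewrite [h + x]addrC /GRing.scale /=; field.
    rewrite normrN normrM normfV ler_pdivrMl ?normr_gt0 //.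
    by rewrite [_ * e]mulrC; exact: H.
  apply: DeriveDef.
    rewrite /derivable; apply/cvg_ex; exists d.
    apply: cvg_trans H; apply: near_eq_cvg; near=> h => /=.
    by rewrite /GRing.scale /= mulr1.
  by rewrite -derive1E /derive1; exact: (cvg_lim (@norm_hausdorff _ _) H).
have H : (fun h : R => h^-1 *: (f (h + x) - f x)) @ (0 : R)^' --> d.
  rewrite -E; move: D; rewrite /derivable /derive => D.
  apply: cvg_trans D; apply: near_eq_cvg; near=> h => /=.
  by rewrite /GRing.scale /= mulr1.
move=> e e0; move/cvgrPdist_le: H => /(_ e e0) /nbhs_ballP [de /= d0 H].
exists de => // h hd; have [->|hn0] := eqVneq h 0.
  by rewrite addr0 subrr mulr0 subrr normr0 mulr0.
have := H h; rewrite -ball_normE /= sub0r normrN => /(_ hd hn0).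
have -> : d - h^-1 *: (f (h + x) - f x) =
          - (h^-1 * (f (x + h) - f x - d * h)).
  by rewrite [h + x]addrC /GRing.scale /=; field.
by rewrite normrN normrM normfV ler_pdivrMl ?normr_gt0 // [_ * e]mulrC.
Unshelve. all: by end_near. Qed.

End ComplexBasics.

(** * Integrals of complex functions over the unit interval *)

Section Integral01.
Context {R : realType}.
Local Notation C := R[i].
Local Notation leb := (@lebesgue_measure R).

Definition rint (f : R -> R) : R := Rintegral leb `[0, 1] f.

Definition rcont (f : R -> R) := forall t : R, 0 <= t <= 1 -> {for t, continuous f}.

Lemma rcont_within f : rcont f -> {within `[0, 1], continuous f}.
Proof.
move=> cf; apply: continuous_in_subspaceT => x.
by rewrite inE /= in_itv /= => /cf.
Qed.

Lemma rcont_integrable f : rcont f -> leb.-integrable `[0, 1] (EFin \o f).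
Proof.
move=> cf; apply: continuous_compact_integrable; first exact: segment_compact.
exact: rcont_within.
Qed.

Lemma rint_FTC (F f : R -> R) : rcont f ->
  (forall t : R, 0 <= t <= 1 -> is_derive t 1 F (f t)) -> rint f = F 1 - F 0.
Proof.
move=> cf dF; rewrite /rint /Rintegral.
have dc t : 0 <= t <= 1 -> {for t, continuous F}.
  move=> /dF [D _]; apply: differentiable_continuous; exact/derivable1_diffP.
rewrite (@continuous_FTC2 R f F 0 1) //.
- exact: rcont_within.
- split.
  + move=> x; rewrite in_itv /= => /andP[x0 x1].
    by have [] := dF x; rewrite ?ltW.
  + by apply: cvg_at_right_filter; apply: dc; rewrite lexx ler01.
  + by apply: cvg_at_left_filter; apply: dc; rewrite lexx ler01.
- move=> x; rewrite in_itv /= => /andP[x0 x1].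
  by rewrite derive1E; have [] := dF x; rewrite ?ltW.
Qed.

(** Clamping the argument to [0, 1] makes the integrand continuous on the whole line; integrating it
    from -1 then gives a two-sided derivative even at the endpoints 0 and 1. *)
Lemma rprim f : rcont f ->
  exists F : R -> R, forall t : R, 0 <= t <= 1 -> is_derive t 1 F (f t).
Proof.
move=> cf; pose cl (t : R) : R := Num.max 0 (Num.min 1 t).
have cl01 t : 0 <= cl t <= 1.
  by rewrite /cl le_max lexx /= ge_max ler01 ge_min lexx.
have clE t : 0 <= t <= 1 -> cl t = t.
  by move=> /andP[t0 t1]; rewrite /cl (min_idPr t1) (max_idPr t0).
pose g := f \o cl.
have cg : continuous g.
  move=> t; apply: continuous_comp; last exact: cf.
  apply: continuous_max; first exact: cst_continuous.
  by apply: continuous_min; [exact: cst_continuous|exact: cvg_id].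
exists (fun x => Rintegral leb `[-1, x] g) => t t01.
have [t0 t1] := andP t01.
have [] := @continuous_FTC1_closed R g (-1) t 2.
- by lra.
- apply: continuous_compact_integrable; first exact: segment_compact.
  exact: continuous_subspaceT.
- by lra.
- exact: cg.
- move=> D1 D2; apply: DeriveDef => //.
  by rewrite -derive1E D2 /g /= clE.
Qed.

Lemma rcont_rint_le f g : rcont f -> rcont g ->
  (forall t : R, 0 <= t <= 1 -> f t <= g t) -> rint f <= rint g.
Proof.
by move=> cf cg fg; apply: le_Rintegral => //; exact: rcont_integrable.
Qed.

Lemma rint_cst (M : R) : rint (fun=> M) = M.
Proof.
have := @rint_FTC (fun t => t * M) (fun=> M).
rewrite mul1r mul0r subr0; apply.
  by move=> t _; exact: cst_continuous.
move=> t _; apply/real_cdiffP => e e0; exists 1 => // y _.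
rewrite (_ : _ - _ - _ = 0); last by ring.
by rewrite normr0 mulr_ge0 // ltW.
Qed.

Implicit Types (phi psi : R -> C) (c d : C).

(** Locked, so that [done] does not unfold it into topological goals. *)
Definition ccont phi : Prop := locked (forall t : R, 0 <= t <= 1 ->
  {for t, continuous (phi : R -> C^o)}).

Lemma ccontP phi : ccont phi <->
  forall t : R, 0 <= t <= 1 -> {for t, continuous (phi : R -> C^o)}.
Proof. by rewrite /ccont -lock. Qed.

Definition cint phi : C :=
  Complex (rint (fun t => complex.Re (phi t)))
          (rint (fun t => complex.Im (phi t))).

Definition rderiv phi (t : R) (d : C) := forall e : R, 0 < e ->
  exists2 de : R, 0 < de & forall y : R, `|y| < de ->
    cabs (phi (t + y) - phi t - d * y%:C) <= e * `|y|.

Lemma ReB (z w : C) : complex.Re (z - w) = complex.Re z - complex.Re w.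
Proof. by case: z; case: w. Qed.

Lemma ImB (z w : C) : complex.Im (z - w) = complex.Im z - complex.Im w.
Proof. by case: z; case: w. Qed.

Lemma ReMr (z : C) (y : R) : complex.Re (z * y%:C) = complex.Re z * y.
Proof. by case: z => a b /=; rewrite mulr0 subr0. Qed.

Lemma ImMr (z : C) (y : R) : complex.Im (z * y%:C) = complex.Im z * y.
Proof. by case: z => a b /=; rewrite mulr0 add0r. Qed.

Lemma rderivP phi t d : rderiv phi t d <->
  is_derive t 1 (fun s => complex.Re (phi s)) (complex.Re d) /\
  is_derive t 1 (fun s => complex.Im (phi s)) (complex.Im d).
Proof.
split=> [D|[/real_cdiffP D1 /real_cdiffP D2] e e0].
  split; apply/real_cdiffP => e e0; have [de d0 H] := D _ e0;
    exists de => // y yd; apply: le_trans (H y yd).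
    by rewrite -ReMr -!ReB cabs_Re.
  by rewrite -ImMr -!ImB cabs_Im.
have e20 : 0 < e / 2 by rewrite divr_gt0.
have [d1 d10 H1] := D1 _ e20.
have [d2 d20 H2] := D2 _ e20.
exists (Num.min d1 d2); first by rewrite lt_min d10.
move=> y; rewrite lt_min => /andP[/H1 h1 /H2 h2].
apply: le_trans (cabs_le_ReIm _) _.
rewrite !ReB !ImB ReMr ImMr; lra.
Qed.

Lemma ccont_cabs phi : ccont phi -> rcont (fun t => cabs (phi t)).
Proof.
move=> /ccontP cphi t t01; apply/cvgrPdist_lt => e e0.
have /cont_cabsP/(_ e e0) := cphi t t01.
apply: filterS => s; apply: le_lt_trans.
rewrite ler_norml; apply/andP; split.
  by rewrite lerNl opprB cabs_le_subD.
by rewrite cabsB cabs_le_subD.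
Qed.

Lemma ccont_Re phi : ccont phi -> rcont (fun t => complex.Re (phi t)).
Proof.
move=> /ccontP cphi t t01; apply/cvgrPdist_lt => e e0.
have /cont_cabsP/(_ e e0) := cphi t t01.
apply: filterS => s; apply: le_lt_trans.
by rewrite -ReB cabsB cabs_Re.
Qed.

Lemma ccont_Im phi : ccont phi -> rcont (fun t => complex.Im (phi t)).
Proof.
move=> /ccontP cphi t t01; apply/cvgrPdist_lt => e e0.
have /cont_cabsP/(_ e e0) := cphi t t01.
apply: filterS => s; apply: le_lt_trans.
by rewrite -ImB cabsB cabs_Im.
Qed.

Lemma ccont_cst c : ccont (fun=> c).
Proof. by apply/ccontP => t _; exact: cst_continuous. Qed.

Lemma ccont_id : ccont (fun t => t%:C).
Proof.
apply/ccontP => t _; apply/cont_cabsP => e e0; near=> s.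
rewrite (_ : _ - _ = (s - t)%:C); last by rewrite rmorphB.
rewrite cabsR distrC; near: s.
by apply: cvgr_dist_lt.
Unshelve. all: by end_near. Qed.

Lemma ccontD phi psi : ccont phi -> ccont psi ->
  ccont (fun t => phi t + psi t).
Proof.
move=> /ccontP c1 /ccontP c2; apply/ccontP => t t01.
by apply: continuousD; [exact: c1|exact: c2].
Qed.

Lemma ccontB phi psi : ccont phi -> ccont psi ->
  ccont (fun t => phi t - psi t).
Proof.
move=> /ccontP c1 /ccontP c2; apply/ccontP => t t01.
by apply: continuousB; [exact: c1|exact: c2].
Qed.

Lemma ccontM phi psi : ccont phi -> ccont psi ->
  ccont (fun t => phi t * psi t).
Proof.
move=> /ccontP c1 /ccontP c2; apply/ccontP => t t01.
by apply: (@continuousM C); [exact: c1|exact: c2].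
Qed.

Lemma ccontV phi : (forall t : R, 0 <= t <= 1 -> phi t != 0) -> ccont phi ->
  ccont (fun t => (phi t)^-1).
Proof.
move=> n0 /ccontP c1; apply/ccontP => t t01.
by apply: (@continuousV C); [exact: n0|exact: c1].
Qed.

Lemma ccont_comp (f : C -> C) phi : ccont phi ->
  (forall t : R, 0 <= t <= 1 -> {for (phi t), continuous (f : C^o -> C^o)}) ->
  ccont (fun t => f (phi t)).
Proof.
move=> /ccontP c1 cf; apply/ccontP => t t01.
apply: (@continuous_comp R C^o C^o phi f); first exact: c1.
exact: cf.
Qed.

Lemma ccont_affine phi (a b : R) :
  (forall t : R, 0 <= t <= 1 -> 0 <= a * t + b <= 1) -> ccont phi ->
  ccont (fun t => phi (a * t + b)).
Proof.
move=> ab /ccontP c1; apply/ccontP => t t01.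
apply: (@continuous_comp R R C^o (fun t => a * t + b) phi).
  by apply: continuousD; [apply: continuousM; [exact: cst_continuous|exact: cvg_id]
                         |exact: cst_continuous].
by apply: c1; exact: ab.
Qed.

Lemma cint_FTC phi psi : ccont psi ->
  (forall t : R, 0 <= t <= 1 -> rderiv phi t (psi t)) ->
  cint psi = phi 1 - phi 0.
Proof.
move=> c1 D; apply/eqP; rewrite eq_complex /= ReB ImB; apply/andP; split; apply/eqP.
  apply: (@rint_FTC (fun s => complex.Re (phi s)) _ (ccont_Re c1)) => t t01.
  by have /rderivP [] := D t t01.
apply: (@rint_FTC (fun s => complex.Im (phi s)) _ (ccont_Im c1)) => t t01.
by have /rderivP [] := D t t01.
Qed.

(** Linearity, splitting and reversal of [cint] are all read off from a primitive through
    [cint_FTC], which avoids any change of variables. *)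
Lemma cprim psi : ccont psi ->
  exists phi, forall t : R, 0 <= t <= 1 -> rderiv phi t (psi t).
Proof.
move=> c1; have [F HF] := rprim (ccont_Re c1).
have [G HG] := rprim (ccont_Im c1).
exists (fun t => Complex (F t) (G t)) => t t01; apply/rderivP; split.
  exact: HF.
exact: HG.
Qed.

Lemma rderivD phi psi t d d' : rderiv phi t d -> rderiv psi t d' ->
  rderiv (fun s => phi s + psi s) t (d + d').
Proof.
move=> D1 D2 e e0; have e20 : 0 < e / 2 by rewrite divr_gt0.
have [d1 d10 H1] := D1 _ e20.
have [d2 d20 H2] := D2 _ e20.
exists (Num.min d1 d2); first by rewrite lt_min d10.
move=> y; rewrite lt_min => /andP[/H1 h1 /H2 h2].
rewrite (_ : _ - _ - _ = (phi (t + y) - phi t - d * y%:C) +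
  (psi (t + y) - psi t - d' * y%:C)); last by ring.
by apply: le_trans (cabs_le_normD _ _) _; lra.
Qed.

Lemma rderivMl phi t d c : rderiv phi t d -> rderiv (fun s => c * phi s) t (c * d).
Proof.
move=> D1 e e0; have p : 0 < cabs c + 1 by rewrite ltr_wpDl // cabs_ge0.
have [d1 d10 H1] := D1 _ (divr_gt0 e0 p).
exists d1 => // y /H1 h1.
rewrite (_ : _ - _ - _ = c * (phi (t + y) - phi t - d * y%:C)); last by ring.
rewrite cabsM; apply: (@le_trans _ _ ((cabs c + 1) * (e / (cabs c + 1) * `|y|))).
  by apply: ler_pM => //; rewrite ?cabs_ge0 // lerDl.
by rewrite le_eqVlt; apply/orP; left; apply/eqP; field; rewrite gt_eqF.
Qed.

Lemma rderiv_affine phi (a b t : R) d : rderiv phi (a * t + b) d ->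
  rderiv (fun s => phi (a * s + b)) t (a%:C * d).
Proof.
move=> D1 e e0; have p : 0 < `|a| + 1 by rewrite ltr_wpDl.
have [d1 d10 H1] := D1 _ (divr_gt0 e0 p).
exists (d1 / (`|a| + 1)); first by rewrite divr_gt0.
move=> y; rewrite ltr_pdivlMr // => yd.
have ay : `|a * y| <= (`|a| + 1) * `|y|.
  by rewrite normrM ler_wpM2r // lerDl.
have /H1 : `|a * y| < d1 by apply: le_lt_trans ay _; rewrite mulrC.
rewrite (_ : a * t + b + a * y = a * (t + y) + b); last by ring.
rewrite (_ : d * (a * y)%:C = a%:C * d * y%:C); last by rewrite rmorphM /=; ring.
move=> h; apply: le_trans h _.
apply: (@le_trans _ _ (e / (`|a| + 1) * ((`|a| + 1) * `|y|))).
  by apply: ler_wpM2l => //; rewrite divr_ge0 // ltW.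
by rewrite le_eqVlt; apply/orP; left; apply/eqP; field; rewrite gt_eqF.
Qed.

Lemma cdiff_rderiv (f : C -> C) a v (t : R) d : cdiff f (a + t%:C * v) d ->
  rderiv (fun s => f (a + s%:C * v)) t (d * v).
Proof.
move=> D e e0; have p : 0 < cabs v + 1 by rewrite ltr_wpDl // cabs_ge0.
have [d1 d10 H1] := D _ (divr_gt0 e0 p).
exists (d1 / (cabs v + 1)); first by rewrite divr_gt0.
move=> y; rewrite ltr_pdivlMr // => yd.
have ay : cabs (y%:C * v) <= (cabs v + 1) * `|y|.
  by rewrite cabsM cabsR mulrC ler_wpM2r // lerDl.
have /H1 : cabs (y%:C * v) < d1 by apply: le_lt_trans ay _; rewrite mulrC.
rewrite (_ : a + t%:C * v + y%:C * v = a + (t + y)%:C * v); last first.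
  by rewrite rmorphD /=; ring.
rewrite (_ : d * (y%:C * v) = d * v * y%:C); last by ring.
move=> h; apply: le_trans h _.
apply: (@le_trans _ _ (e / (cabs v + 1) * ((cabs v + 1) * `|y|))).
  by apply: ler_wpM2l => //; rewrite divr_ge0 // ltW.
by rewrite le_eqVlt; apply/orP; left; apply/eqP; field; rewrite gt_eqF.
Qed.

Lemma eq_rint (f g : R -> R) :
  (forall t : R, 0 <= t <= 1 -> f t = g t) -> rint f = rint g.
Proof.
by move=> fg; apply: eq_Rintegral => t; rewrite inE /= in_itv /= => /fg.
Qed.

Lemma eq_cint phi psi :
  (forall t : R, 0 <= t <= 1 -> phi t = psi t) -> cint phi = cint psi.
Proof.
by move=> fg; congr Complex; apply: eq_rint => t /fg ->.
Qed.

Lemma cintD phi psi : ccont phi -> ccont psi ->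
  cint (fun t => phi t + psi t) = cint phi + cint psi.
Proof.
move=> c1 c2; have [F HF] := cprim c1; have [G HG] := cprim c2.
rewrite (cint_FTC c1 HF) (cint_FTC c2 HG).
rewrite (@cint_FTC (fun t => F t + G t)); first by ring.
  exact: ccontD.
by move=> t t01; apply: rderivD; [exact: HF|exact: HG].
Qed.

Lemma cintMl phi c : ccont phi -> cint (fun t => c * phi t) = c * cint phi.
Proof.
move=> c1; have [F HF] := cprim c1.
rewrite (cint_FTC c1 HF) (@cint_FTC (fun t => c * F t)); first by ring.
  by apply: ccontM c1; exact: ccont_cst.
by move=> t t01; apply: rderivMl; exact: HF.
Qed.

Lemma cintB phi psi : ccont phi -> ccont psi ->
  cint (fun t => phi t - psi t) = cint phi - cint psi.
Proof.
move=> c1 c2.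
have c3 : ccont (fun t => -1 * psi t) by apply: ccontM c2; exact: ccont_cst.
have -> : cint phi - cint psi = cint phi + -1 * cint psi by ring.
rewrite -(cintMl _ c2) -(cintD c1 c3).
by apply: eq_cint => t _; ring.
Qed.

Lemma cint_split phi : ccont phi ->
  cint phi = 2^-1 * cint (fun t => phi (2^-1 * t + 0)) +
             2^-1 * cint (fun t => phi (2^-1 * t + 2^-1)).
Proof.
move=> c1; have [F HF] := cprim c1.
have h1 (t : R) : 0 <= t <= 1 -> 0 <= 2^-1 * t + 0 <= 1 by move=> ?; lra.
have h2 (t : R) : 0 <= t <= 1 -> 0 <= 2^-1 * t + 2^-1 <= 1 by move=> ?; lra.
have e2 : (2^-1 : R)%:C = 2^-1 :> C by rewrite fmorphV rmorph_nat.
rewrite (cint_FTC c1 HF).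
rewrite -(@cintMl (fun t => phi (2^-1 * t + 0))); last exact: ccont_affine.
rewrite -(@cintMl (fun t => phi (2^-1 * t + 2^-1))); last exact: ccont_affine.
rewrite (@cint_FTC (fun t => F (2^-1 * t + 0))).
- rewrite (@cint_FTC (fun t => F (2^-1 * t + 2^-1))).
  + rewrite mulr1 mulr0 !add0r addr0 (_ : 2^-1 + 2^-1 = 1 :> R) //; last by field.
    by ring.
  + by apply: ccontM; [exact: ccont_cst|exact: ccont_affine].
  + by move=> t t01; rewrite -e2; apply: rderiv_affine; apply: HF; exact: h2.
- by apply: ccontM; [exact: ccont_cst|exact: ccont_affine].
- by move=> t t01; rewrite -e2; apply: rderiv_affine; apply: HF; exact: h1.
Qed.

Lemma cint_rev phi : ccont phi -> cint (fun t => phi (-1 * t + 1)) = cint phi.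
Proof.
move=> c1; have [F HF] := cprim c1.
have h1 (t : R) : 0 <= t <= 1 -> 0 <= -1 * t + 1 <= 1 by move=> ?; lra.
have e1 : (-1 : R)%:C = -1 :> C by rewrite rmorphN rmorph1.
apply: oppr_inj; rewrite -[LHS]mulN1r -cintMl; last exact: ccont_affine.
rewrite (@cint_FTC (fun t => F (-1 * t + 1))).
- rewrite (cint_FTC c1 HF) mulr0 mulr1 addNr add0r; ring.
- by apply: ccontM; [exact: ccont_cst|exact: ccont_affine].
- by move=> t t01; rewrite -e1; apply: rderiv_affine; apply: HF; exact: h1.
Qed.

(** Real and imaginary parts are bounded separately; the resulting factor 2 is absorbed by later
    constants. *)
Lemma cint_le phi : ccont phi ->
  cabs (cint phi) <= 2 * rint (fun t => cabs (phi t)).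
Proof.
move=> c1; apply: le_trans (cabs_le_ReIm _) _ => /=.
have i1 := rcont_integrable (ccont_Re c1).
have i2 := rcont_integrable (ccont_Im c1).
have i3 := rcont_integrable (ccont_cabs c1).
rewrite mulr2n mulrDl mul1r; apply: lerD.
  apply: le_trans (le_normr_Rintegral _ i1) _ => //.
  apply: le_Rintegral => //; first exact: (integrable_abse i1).
  by move=> t _ ; exact: cabs_Re.
apply: le_trans (le_normr_Rintegral _ i2) _ => //.
apply: le_Rintegral => //; first exact: (integrable_abse i2).
by move=> t _ ; exact: cabs_Im.
Qed.

Lemma cint_bound phi (M : R) : ccont phi ->
  (forall t : R, 0 <= t <= 1 -> cabs (phi t) <= M) -> cabs (cint phi) <= 2 * M.
Proof.
move=> c1 h; apply: le_trans (cint_le c1) _; rewrite ler_pM2l //.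
rewrite -[leRHS]rint_cst; apply: rcont_rint_le => //; first exact: ccont_cabs.
by move=> t _; exact: cst_continuous.
Qed.

End Integral01.

(** * Goursat's theorem, Cauchy's formula and estimates *)

Section UltraLimit.
Context {R : realType}.
Local Notation C := R[i].

(** Limits along such an ultrafilter replace the extraction of convergent
    subsequences, in Goursat's bisection and in Montel's theorem. *)
Lemma ultra_nat : exists2 U : set_system nat, UltraFilter U &
  forall N, U [set k | (N <= k)%N].
Proof.
have [U [UU sU]] := @ultraFilterLemma nat \oo _.
by exists U => // N; apply: sU; exact: nbhs_infty_ge.
Qed.

(** The image of [U] under [u] is an ultrafilter containing a compact interval, hence converges; its
    maximality is checked through complements of preimages. *)
Lemma ulimR (U : set_system nat) (UU : UltraFilter U) (u : nat -> R) (M : R) :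
  (forall k, `|u k| <= M) ->
  exists l : R, forall e : R, 0 < e -> U [set k | `|u k - l| < e].
Proof.
move=> uM; have cK : compact (`[- M, M] : set R) by exact: segment_compact.
have UF : ProperFilter U by exact: ultra_proper.
have ultrau : UltraFilter (u @ U).
  split; first exact: fmap_proper_filter.
  move=> G GF sG; rewrite predeqE => A; split; last exact: sG.
  move=> GA; apply: contrapT => nA.
  have UC : U (~` (u @^-1` A)).
    have [//|//] := in_ultra_setVsetC (u @^-1` A) UU.
  have : G (~` A) by apply: sG; exact: UC.
  move=> GC; have : G (A `&` ~` A) by exact: filterI.
  by rewrite setICr; exact: filter_not_empty.
move: cK; rewrite compact_ultra => /(_ _ ultrau) [].
  suff H : U (u @^-1` `[- M, M]%classic) by exact: H.
  apply: (filterS _ (@filterT _ U _)) => k _ /=.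
  by rewrite in_itv /= -ler_norml; exact: uM.
move=> l [_ /= cul]; exists l => e e0.
have : U (u @^-1` ball l e) by exact: cul (ball l e) (nbhsx_ballx _ _ e0).
by apply: filterS => k /=; rewrite -ball_normE /= distrC.
Qed.

Lemma ulimC (U : set_system nat) (UU : UltraFilter U) (u : nat -> C) (M : R) :
  (forall k, cabs (u k) <= M) ->
  exists2 l : C, cabs l <= M &
    forall e : R, 0 < e -> U [set k | cabs (u k - l) < e].
Proof.
move=> uM; have UF : ProperFilter U by exact: ultra_proper.
have [a Ha] := @ulimR U UU (fun k => complex.Re (u k)) M
  (fun k => le_trans (cabs_Re _) (uM k)).
have [b Hb] := @ulimR U UU (fun k => complex.Im (u k)) M
  (fun k => le_trans (cabs_Im _) (uM k)).
have H (e : R) : 0 < e -> U [set k | cabs (u k - Complex a b) < e].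
  move=> e0; have e20 : 0 < e / 2 by rewrite divr_gt0.
  apply: filterS (filterI (Ha _ e20) (Hb _ e20)) => k /= [h1 h2].
  by apply: le_lt_trans (cabs_le_ReIm _) _; rewrite ReB ImB /=; lra.
move: H; move: (Complex a b) => w H.
exists w => //; apply/ler_addgt0Pr => e e0.
have [k /= Hk] := filter_ex (H e e0).
have := cabs_le_normD (u k) (- (u k - w)); rewrite normcN.
rewrite (_ : u k + _ = w); last by ring.
have := uM k; lra.
Qed.

End UltraLimit.

Section Goursat.
Context {R : realType}.
Local Notation C := R[i].
Implicit Types (f g F : C -> C) (a b c d z w h : C).

Definition seg f a b : C := (b - a) * cint (fun t => f (a + t%:C * (b - a))).

Definition segcont f a b := ccont (fun t => f (a + t%:C * (b - a))).

Lemma cabs_segment a b (r t : R) : 0 <= t <= 1 -> cabs a <= r -> cabs b <= r ->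
  cabs (a + t%:C * (b - a)) <= r.
Proof.
move=> t01 ar br.
rewrite (_ : a + _ = (1 - t)%:C * a + t%:C * b); last first.
  by rewrite rmorphB rmorph1 /=; ring.
apply: le_trans (cabs_le_normD _ _) _; rewrite !cabsM !cabsR.
have /andP[t0 t1] := t01; rewrite !ger0_norm ?subr_ge0 //.
apply: (@le_trans _ _ ((1 - t) * r + t * r)); last by lra.
by apply: lerD; apply: ler_wpM2l => //; lra.
Qed.

Lemma disc_segment a b (t : R) : 0 <= t <= 1 -> disc a -> disc b ->
  disc (a + t%:C * (b - a)).
Proof.
move=> t01 da db; rewrite /disc /=.
apply: (@le_lt_trans _ _ (Num.max (cabs a) (cabs b))).
  by apply: cabs_segment => //; rewrite le_max lexx ?orbT.
by rewrite gt_max; apply/andP.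
Qed.

Lemma ccont_line a v : ccont (fun t : R => a + t%:C * v).
Proof.
by apply: ccontD; [exact: ccont_cst|apply: ccontM; [exact: ccont_id|exact: ccont_cst]].
Qed.

Lemma analytic_cdiff f z : analytic f -> disc z -> cdiff f z (cderiv f z).
Proof. by move=> af dz; apply: derivable_cdiff; exact: af. Qed.

Lemma analytic_segcont f a b : analytic f -> disc a -> disc b -> segcont f a b.
Proof.
move=> af da db; apply: ccont_comp; first exact: ccont_line.
move=> t t01; apply: cdiff_cont; apply: analytic_cdiff => //.
exact: disc_segment.
Qed.

Lemma analytic_cdiffP f : (forall z, disc z -> exists d, cdiff f z d) -> analytic f.
Proof. by move=> H z /H [d] /cdiff_derivable []. Qed.

Lemma seg_rev f a b : segcont f a b -> seg f b a = - seg f a b.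
Proof.
move=> c1; rewrite /seg -(cint_rev c1) -mulNr opprB; congr (_ * _).
apply: eq_cint => t _; congr f.
by rewrite rmorphD rmorphM rmorphN !rmorph1 /=; ring.
Qed.

Lemma seg_split f a b : segcont f a b ->
  seg f a b = seg f a ((a + b) / 2) + seg f ((a + b) / 2) b.
Proof.
move=> c1; rewrite /seg (cint_split c1).
have e2 : (2^-1 : R)%:C = 2^-1 :> C by rewrite fmorphV rmorph_nat.
rewrite (_ : (a + b) / 2 - a = (b - a) / 2); last by field.
rewrite (_ : b - (a + b) / 2 = (b - a) / 2); last by field.
rewrite mulrDr !mulrA; congr (_ * _ + _ * _); apply: eq_cint => t _; congr f.
  by rewrite !rmorphD !rmorphM /= e2 rmorph0; field.
by rewrite !rmorphD !rmorphM /= e2; field.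
Qed.

Lemma seg_FTC F f a b : segcont f a b ->
  (forall t : R, 0 <= t <= 1 ->
     cdiff F (a + t%:C * (b - a)) (f (a + t%:C * (b - a)))) ->
  seg f a b = F b - F a.
Proof.
move=> c1 D; rewrite /seg -(cintMl _ c1).
rewrite (@cint_FTC R (fun t => F (a + t%:C * (b - a)))).
- rewrite (_ : a + 1%:C * (b - a) = b); last by rewrite rmorph1; ring.
  by rewrite (_ : a + 0%:C * (b - a) = a) // rmorph0; ring.
- by apply: ccontM c1; exact: ccont_cst.
- by move=> t t01; rewrite mulrC; apply: cdiff_rderiv; exact: D.
Qed.

Lemma segB f g a b : segcont f a b -> segcont g a b ->
  seg (fun w => f w - g w) a b = seg f a b - seg g a b.
Proof. by move=> c1 c2; rewrite /seg (cintB c1 c2) mulrBr. Qed.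

Lemma seg_bound f a b (M : R) : segcont f a b ->
  (forall t : R, 0 <= t <= 1 -> cabs (f (a + t%:C * (b - a))) <= M) ->
  cabs (seg f a b) <= 2 * M * cabs (b - a).
Proof.
move=> c1 H; rewrite /seg cabsM mulrC; apply: ler_wpM2r; first exact: cabs_ge0.
exact: cint_bound.
Qed.

Lemma cdiff_quad a b z : cdiff (fun w => a * w + b / 2 * (w * w)) z (a + b * z).
Proof.
have D1 : cdiff (fun w => a * w) z (0 * z + a * 1).
  by apply: cdiffM; [exact: cdiff_cst|exact: cdiff_id].
have D2 : cdiff (fun w => w * w) z (1 * z + z * 1).
  by apply: cdiffM; exact: cdiff_id.
have D3 : cdiff (fun w => b / 2 * (w * w)) z (0 * (z * z) + b / 2 * (1 * z + z * 1)).
  by apply: cdiffM; first exact: cdiff_cst.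
have := cdiffD D1 D3; rewrite (_ : _ + _ = a + b * z) //; by field.
Qed.

Lemma affine_segcont c d a b : segcont (fun w => c + d * w) a b.
Proof.
apply: ccontD; first exact: ccont_cst.
by apply: ccontM; [exact: ccont_cst|exact: ccont_line].
Qed.

Lemma seg_affine c d a b :
  seg (fun w => c + d * w) a b =
  (c * b + d / 2 * (b * b)) - (c * a + d / 2 * (a * a)).
Proof.
apply: (@seg_FTC (fun w => c * w + d / 2 * (w * w))); first exact: affine_segcont.
by move=> t _; exact: cdiff_quad.
Qed.

Definition tri f a b c := seg f a b + seg f b c + seg f c a.

(** Invariant of the bisection: [rho], taken below 1, keeps all vertices in one closed disc where f
    is analytic, while [dm] is halved and [K] is divided by 4 at each step. *)
Let good (rho dm K : R) f a b c :=
  [/\ [/\ cabs a <= rho, cabs b <= rho & cabs c <= rho],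
      [/\ cabs (b - a) <= dm, cabs (c - b) <= dm & cabs (a - c) <= dm]
    & K <= cabs (tri f a b c)].

Lemma cabs_mid a b (r : R) : cabs a <= r -> cabs b <= r -> cabs ((a + b) / 2) <= r.
Proof.
move=> ar br; rewrite cabsM (_ : 2^-1 = (2^-1 : R)%:C); last first.
  by rewrite fmorphV rmorph_nat.
rewrite cabsR gtr0_norm //; have := cabs_le_normD a b; lra.
Qed.

Lemma cabs_half a (r : R) : cabs a <= r -> cabs (a / 2) <= r / 2.
Proof.
move=> ar; rewrite cabsM (_ : 2^-1 = (2^-1 : R)%:C); last first.
  by rewrite fmorphV rmorph_nat.
by rewrite cabsR gtr0_norm //; lra.
Qed.

(** The midpoints cut the triangle into four whose inner edges cancel, so one of them carries a
    quarter of the integral. The bound on a' - a makes the successive first vertices a Cauchy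
    sequence. *)
Lemma tri_step f (rho dm K : R) a b c : analytic f -> rho < 1 ->
  good rho dm K f a b c ->
  exists a' b' c', good rho (dm / 2) (K / 4) f a' b' c' /\ cabs (a' - a) <= dm.
Proof.
move=> af r1 [[ha hb hc] [hab hbc hca] hK].
have D z : cabs z <= rho -> disc z by move=> ?; exact: le_lt_trans r1.
set m1 := (a + b) / 2; set m2 := (b + c) / 2; set m3 := (c + a) / 2.
have [h1 h2 h3] : [/\ cabs m1 <= rho, cabs m2 <= rho & cabs m3 <= rho].
  by split; exact: cabs_mid.
have sc x y : cabs x <= rho -> cabs y <= rho -> segcont f x y.
  by move=> hx hy; apply: analytic_segcont => //; exact: D.
have E : tri f a b c = tri f a m1 m3 + tri f m1 b m2 + tri f m2 c m3 + tri f m1 m2 m3.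
  rewrite /tri (seg_split (sc _ _ ha hb)) (seg_split (sc _ _ hb hc)).
  rewrite (seg_split (sc _ _ hc ha)) -/m1 -/m2 -/m3.
  rewrite (seg_rev (sc _ _ h1 h2)) (seg_rev (sc _ _ h2 h3)) (seg_rev (sc _ _ h3 h1)).
  by ring.
have d1 : cabs ((b - a) / 2) <= dm / 2 by exact: cabs_half.
have d2 : cabs ((c - b) / 2) <= dm / 2 by exact: cabs_half.
have d3 : cabs ((a - c) / 2) <= dm / 2 by exact: cabs_half.
have [d1' d2' d3'] : [/\ cabs ((a - b) / 2) <= dm / 2, cabs ((b - c) / 2) <= dm / 2 &
    cabs ((c - a) / 2) <= dm / 2].
  by split; rewrite -normcN -mulNr opprB.
have dm0 : 0 <= dm by apply: le_trans hab; exact: cabs_ge0.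
have [k1|k1] := leP (K / 4) (cabs (tri f a m1 m3)).
  exists a, m1, m3; split; last by rewrite subrr cabs0.
  split => //; split.
  - by rewrite (_ : m1 - a = (b - a) / 2) // /m1; field.
  - by rewrite (_ : m3 - m1 = (c - b) / 2) // /m1 /m3; field.
  - by rewrite (_ : a - m3 = (a - c) / 2) // /m3; field.
have [k2|k2] := leP (K / 4) (cabs (tri f m1 b m2)).
  exists m1, b, m2; split; last first.
    rewrite (_ : m1 - a = (b - a) / 2); last by rewrite /m1; field.
    by apply: le_trans d1 _; lra.
  split => //; split.
  - by rewrite (_ : b - m1 = (b - a) / 2) // /m1; field.
  - by rewrite (_ : m2 - b = (c - b) / 2) // /m2; field.
  - by rewrite (_ : m1 - m2 = (a - c) / 2) // /m1 /m2; field.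
have m2a : cabs (m2 - a) <= dm.
  rewrite (_ : m2 - a = (b - a) / 2 + (c - a) / 2); last by rewrite /m2; field.
  by apply: le_trans (cabs_le_normD _ _) _; lra.
have [k3|k3] := leP (K / 4) (cabs (tri f m2 c m3)).
  exists m2, c, m3; split => //.
  split => //; split.
  - by rewrite (_ : c - m2 = (c - b) / 2) // /m2; field.
  - by rewrite (_ : m3 - c = (a - c) / 2) // /m3; field.
  - by rewrite (_ : m2 - m3 = (b - a) / 2) // /m2 /m3; field.
have [k4|k4] := leP (K / 4) (cabs (tri f m1 m2 m3)).
  exists m1, m2, m3; split; last first.
    rewrite (_ : m1 - a = (b - a) / 2); last by rewrite /m1; field.
    by apply: le_trans d1 _; lra.
  split => //; split.
  - by rewrite (_ : m2 - m1 = (c - a) / 2) // /m1 /m2; field.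
  - by rewrite (_ : m3 - m2 = (a - b) / 2) // /m2 /m3; field.
  - by rewrite (_ : m1 - m3 = (b - c) / 2) // /m1 /m3; field.
exfalso; move: hK; rewrite E => hK.
have := cabs_le_normD (tri f a m1 m3 + tri f m1 b m2 + tri f m2 c m3) (tri f m1 m2 m3).
have := cabs_le_normD (tri f a m1 m3 + tri f m1 b m2) (tri f m2 c m3).
have := cabs_le_normD (tri f a m1 m3) (tri f m1 b m2).
lra.
Qed.

Lemma cabs_tri f a b c (M d : R) :
  segcont f a b -> segcont f b c -> segcont f c a ->
  [/\ cabs (b - a) <= d, cabs (c - b) <= d & cabs (a - c) <= d] ->
  (forall t : R, 0 <= t <= 1 -> [/\ cabs (f (a + t%:C * (b - a))) <= M,
    cabs (f (b + t%:C * (c - b))) <= M & cabs (f (c + t%:C * (a - c))) <= M]) ->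
  cabs (tri f a b c) <= 6 * M * d.
Proof.
move=> c1 c2 c3 [d1 d2 d3] H; have M0 : 0 <= M.
  have [|+ _ _] := H 0; first by rewrite lexx ler01.
  by apply: le_trans; exact: cabs_ge0.
have step x y : segcont f x y -> cabs (y - x) <= d ->
    (forall t : R, 0 <= t <= 1 -> cabs (f (x + t%:C * (y - x))) <= M) ->
    cabs (seg f x y) <= 2 * M * d.
  move=> cxy dxy Hxy; apply: le_trans (seg_bound cxy Hxy) _.
  by apply: ler_wpM2l => //; rewrite mulr_ge0.
have s1 := step _ _ c1 d1 (fun t t01 => let: And3 h _ _ := H t t01 in h).
have s2 := step _ _ c2 d2 (fun t t01 => let: And3 _ h _ := H t t01 in h).
have s3 := step _ _ c3 d3 (fun t t01 => let: And3 _ _ h := H t t01 in h).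
rewrite /tri.
have := cabs_le_normD (seg f a b + seg f b c) (seg f c a).
have := cabs_le_normD (seg f a b) (seg f b c).
lra.
Qed.

Theorem Goursat f a b c : analytic f -> disc a -> disc b -> disc c ->
  tri f a b c = 0.
Proof.
move=> af da db dc; apply/eqP; rewrite -cabs_eq0; apply/negPn/negP => K0.
set K := cabs (tri f a b c) in K0.
have {}K0 : 0 < K by rewrite lt_neqAle eq_sym K0 cabs_ge0.
pose rho : R := Num.max (cabs a) (Num.max (cabs b) (cabs c)).
have rho1 : rho < 1 by rewrite !gt_max; apply/and3P; split; [exact: da|exact: db|exact: dc].
pose d : R := cabs (b - a) + cabs (c - b) + cabs (a - c).
have g0 : good rho d K f a b c.
  split => //; first by rewrite !le_max !lexx !orbT.
  have := cabs_ge0 (b - a); have := cabs_ge0 (c - b); have := cabs_ge0 (a - c).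
  by rewrite /d => ? ? ?; split; lra.
have d0 : 0 <= d by rewrite !addr_ge0 ?cabs_ge0.
pose P n (T : C * C * C) := good rho (d / 2 ^+ n) (K / 4 ^+ n) f T.1.1 T.1.2 T.2.
(* The implication makes the bisection step total, so that choice yields a function, iterated below
   from the initial triangle. *)
have /choice [st Hst] : forall x : nat * (C * C * C), exists T', P x.1 x.2 ->
    P x.1.+1 T' /\ cabs (T'.1.1 - x.2.1.1) <= d / 2 ^+ x.1.
  move=> [n T]; have [/= PT|nP] := pselect (P n T); last by exists T.
  have [a' [b' [c' [g' h']]]] := tri_step af rho1 PT.
  exists (a', b', c') => _; split => //=.
  rewrite /P /= !exprS.
  rewrite (_ : d / (2 * 2 ^+ n) = d / 2 ^+ n / 2); last first.
    by field; rewrite expf_neq0.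
  rewrite (_ : K / (4 * 4 ^+ n) = K / 4 ^+ n / 4) //.
  by field; rewrite expf_neq0.
pose T := fix T n := if n is m.+1 then st (m, T m) else (a, b, c).
have PT n : P n (T n).
  elim: n => [|n IH]; first by rewrite /P /= !expr0 !divr1.
  by have [] := Hst (n, T n) IH.
pose u n := (T n).1.1.
have ustep n : cabs (u n.+1 - u n) <= d / 2 ^+ n.
  by have [] := Hst (n, T n) (PT n).
have uu n j : cabs (u (n + j)%N - u n) <= d / 2 ^+ n * (2 - 2 / 2 ^+ j).
  elim: j => [|j IH]; first by rewrite addn0 subrr cabs0 expr0 divr1 subrr mulr0.
  rewrite addnS (_ : _ - _ = (u (n + j).+1 - u (n + j)%N) + (u (n + j)%N - u n)); last by ring.
  apply: le_trans (cabs_le_normD _ _) _; apply: le_trans (lerD (ustep _) IH) _.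
  rewrite exprD exprS le_eqVlt; apply/orP; left; apply/eqP.
  by field; rewrite !expf_neq0.
have [U UU UN] := ultra_nat.
have UF : ProperFilter U by exact: ultra_proper.
have ub n : cabs (u n) <= rho by have [[]] := PT n.
have [l lrho ul] := ulimC UU ub.
have lu n : cabs (l - u n) <= 2 * (d / 2 ^+ n).
  apply/ler_addgt0Pr => e e0.
  have [k /= [k1 k2]] := filter_ex (filterI (ul e e0) (UN n)).
  have := uu n (k - n)%N; rewrite subnKC // => k3.
  have := cabs_le_normD (- (u k - l)) (u k - u n); rewrite normcN.
  rewrite (_ : _ + _ = l - u n); last by ring.
  have : d / 2 ^+ n * (2 - 2 / 2 ^+ (k - n)) <= d / 2 ^+ n * 2.
    apply: ler_wpM2l; first by rewrite divr_ge0 // exprn_ge0.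
    by rewrite gerBl divr_ge0 // exprn_ge0.
  lra.
have D := analytic_cdiff af (le_lt_trans lrho rho1).
set D1 := cderiv f l in D.
(* The last estimate bounds the n-th integral by 18 e d^2 / 4^n, which this e keeps below K / 4^n;
   the + 1 covers d = 0. *)
pose e : R := K / (36 * (d ^+ 2 + 1)).
have dp : 0 < d ^+ 2 + 1 by rewrite ltr_wpDl // sqr_ge0.
have e0 : 0 < e by rewrite divr_gt0 // mulr_gt0.
have [de de0 H] := D e e0.
(* Points of the n-th triangle are within d / 2^n of its first vertex, and that vertex is within 2 d
   / 2^n of l. *)
have [n Hn] : exists n, 3 * (d / 2 ^+ n) < de.
  have := @cvg_geometric R (3 * d) 2^-1.
  rewrite gtr0_norm ?invr_gt0 // => /(_ _)/cvgrPdist_lt.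
  move=> /(_ _ de de0) [|N _ HN]; first by rewrite invf_lt1 // ltr1n.
  exists N; have := HN N (leqnn N); rewrite /= /geometric /= sub0r normrN ger0_norm.
    by rewrite exprVn mulrA.
  by rewrite !mulr_ge0 // exprn_ge0.
have [[ha hb hc] [hab hbc hca] hK] := PT n.
move: ha hb hc hab hbc hca hK; rewrite -/(u n).
move: (T n).1.2 (T n).2 => b' c' ha hb hc hab hbc hca hK.
have sc x y : cabs x <= rho -> cabs y <= rho -> segcont f x y.
  by move=> hx hy; apply: analytic_segcont => //; exact: le_lt_trans rho1.
have Dc z : cabs z <= rho -> disc z by move=> ?; exact: le_lt_trans rho1.
(* The tangent map at l is affine, so its integral over the closed triangle vanishes and only the
   first-order remainder of f counts. *)
pose g w := (f l - D1 * l) + D1 * w.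
have Eg x y : cabs x <= rho -> cabs y <= rho ->
    seg (fun w => f w - g w) x y = seg f x y - seg g x y.
  by move=> hx hy; apply: segB; [exact: sc|exact: affine_segcont].
have tE : tri f (u n) b' c' = tri (fun w => f w - g w) (u n) b' c'.
  by rewrite /tri !Eg // !seg_affine; ring.
have sc' x y : cabs x <= rho -> cabs y <= rho -> segcont (fun w => f w - g w) x y.
  by move=> hx hy; apply: ccontB; [exact: sc|exact: affine_segcont].
pose q := d / 2 ^+ n.
have close w : cabs (w - u n) <= q -> cabs (f w - g w) <= e * (3 * q).
  move=> hw; have wl : cabs (w - l) <= 3 * q.
    rewrite (_ : w - l = (w - u n) - (l - u n)); last by ring.
    have := cabs_le_normD (w - u n) (- (l - u n)); rewrite normcN.
    have := lu n; rewrite -/q; lra.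
  have := H (w - l) (le_lt_trans wl Hn).
  rewrite (_ : f (l + (w - l)) - f l - D1 * (w - l) = f w - g w); last first.
    by rewrite [l + _]addrC subrK /g; ring.
  move=> h; apply: le_trans h _; apply: ler_wpM2l => //; exact: ltW.
have near1 x y (t : R) : 0 <= t <= 1 -> cabs (x - u n) <= q -> cabs (y - u n) <= q ->
    cabs (x + t%:C * (y - x) - u n) <= q.
  move=> t01 hx hy.
  rewrite (_ : _ - _ = (x - u n) + t%:C * ((y - u n) - (x - u n))); last by ring.
  exact: cabs_segment.
have q0 : 0 <= q by rewrite divr_ge0 // exprn_ge0.
have : cabs (tri f (u n) b' c') <= 6 * (e * (3 * q)) * q.
  rewrite tE; apply: cabs_tri; try exact: sc'.
    by split.
  move=> t t01; split; apply: close; apply: near1 => //; rewrite ?subrr ?cabs0 //.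
  - by rewrite cabsB.
  - by rewrite cabsB.
move=> Hle; have := le_trans hK Hle.
have -> : 6 * (e * (3 * q)) * q = 18 * e * d ^+ 2 / 4 ^+ n.
  have -> : 4 ^+ n = 2 ^+ n * 2 ^+ n :> R.
    by rewrite -exprMn; congr (_ ^+ _); ring.
  by rewrite /q; field; rewrite expf_neq0.
rewrite ler_pM2r ?invr_gt0 ?exprn_gt0 // /e => Hf.
have : 18 * (K / (36 * (d ^+ 2 + 1))) * d ^+ 2 < K.
  rewrite (_ : _ * _ * _ = K * (d ^+ 2 / (2 * (d ^+ 2 + 1)))); last first.
    by field; rewrite gt_eqF.
  rewrite gtr_pMr // ltr_pdivrMr ?mulr_gt0 //; have := sqr_ge0 d; lra.
lra.
Qed.

Lemma path_integralE f z : path_integral f z = seg f 0 z.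
Proof.
rewrite /path_integral /seg subr0; congr (_ * _).
by apply: eq_cint => t _; rewrite add0r.
Qed.

Lemma disc0 : disc (0 : C).
Proof. by rewrite /disc /mkset cabs0 ltr01. Qed.

Lemma disc_ball z w : disc z -> cabs w < 1 - cabs z -> disc (z + w).
Proof.
rewrite /disc /= => dz dw; apply: le_lt_trans (cabs_le_normD _ _) _; lra.
Qed.

Lemma segcont_cst c a b : segcont (fun=> c) a b.
Proof. exact: ccont_cst. Qed.

Lemma seg_cst c a b : seg (fun=> c) a b = c * (b - a).
Proof.
rewrite (@seg_FTC (fun w => c * w)); first by ring.
  exact: segcont_cst.
move=> t _; have := cdiffM (cdiff_cst c (a + t%:C * (b - a))) (cdiff_id (a + t%:C * (b - a))).
by rewrite mul0r add0r mulr1.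
Qed.

(** Goursat's theorem on the triangle 0, z, z + h turns the increment of the primitive into the
    integral over [z, z + h], which continuity of f compares with f(z) h. *)
Lemma cdiff_path_integral f z : analytic f -> disc z ->
  cdiff (path_integral f) z (f z).
Proof.
move=> af dz e e0.
have e40 : 0 < e / 4 by rewrite divr_gt0.
have [de de0 H] := cdiff_small (analytic_cdiff af dz) e40.
have z1 : 0 < 1 - cabs z by rewrite subr_gt0.
exists (Num.min de (1 - cabs z)); first by rewrite lt_min de0.
move=> h; rewrite lt_min => /andP[h1 h2].
have dzh := disc_ball dz h2.
rewrite !path_integralE.
have sc x y : disc x -> disc y -> segcont f x y by move=> ? ?; exact: analytic_segcont.
have E : seg f 0 (z + h) - seg f 0 z - f z * h = seg (fun w => f w - f z) z (z + h).
  rewrite segB ?seg_cst; [|exact: sc|exact: segcont_cst].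
  have := Goursat af disc0 dz dzh; rewrite /tri.
  rewrite (seg_rev (sc _ _ disc0 dzh)) => /eqP; rewrite subr_eq0 => /eqP <-.
  by rewrite [z + h - z]addrC addKr; ring.
rewrite E.
have -> : e * cabs h = 2 * (e / 2) * cabs (z + h - z).
  by rewrite [z + h - z]addrC addKr; field.
apply: seg_bound; first by apply: ccontB; [exact: sc|exact: segcont_cst].
move=> t t01; rewrite [z + h - z]addrC addKr.
have /ltW : cabs (f (z + t%:C * h) - f z) < e / 4.
  apply: H; rewrite cabsM cabsR; apply: le_lt_trans h1.
  have /andP[t0 t1] := t01; by rewrite ger0_norm // ler_piMl // cabs_ge0.
by move=> ?; lra.
Qed.

Lemma analytic_path_integral f : analytic f -> analytic (path_integral f).
Proof.
by move=> af; apply: analytic_cdiffP => z dz; exists (f z); exact: cdiff_path_integral.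
Qed.

Lemma path_integral0 f : path_integral f 0 = 0.
Proof. by rewrite /path_integral mul0r. Qed.

End Goursat.

(** * Cauchy's formula and estimates on squares *)

Section Cauchy.
Context {R : realType}.
Local Notation C := R[i].
Implicit Types (f g F psi : C -> C) (a b c d z w h : C).

Lemma segMl f a b c : segcont f a b -> seg (fun w => c * f w) a b = c * seg f a b.
Proof. by move=> c1; rewrite /seg (cintMl _ c1); ring. Qed.

Lemma eq_seg f g a b : (forall t : R, 0 <= t <= 1 ->
   f (a + t%:C * (b - a)) = g (a + t%:C * (b - a))) -> seg f a b = seg g a b.
Proof. by move=> fg; congr (_ * _); exact: eq_cint. Qed.

(** [sqpt c s j] parametrizes the [j]-th side of the square of centre [c] and half side [s]. *)
Definition side (t : R) : C := Complex 1 (2 * t - 1).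

Definition sqpt c (s : R) (j : nat) (t : R) : C := c + s%:C * ('i%C ^+ j * side t).

Lemma side_ge1 t : 1 <= cabs (side t).
Proof. by apply: le_trans (cabs_Re _); rewrite normr1. Qed.

Lemma side_neq0 t : side t != 0.
Proof. by rewrite -cabs_gt0; apply: lt_le_trans (side_ge1 t). Qed.

Lemma side_le2 t : 0 <= t <= 1 -> cabs (side t) <= 2.
Proof.
move=> /andP[t0 t1]; apply: le_trans (cabs_le_ReIm _) _ => /=.
by rewrite normr1 [leRHS]mulr2n lerD2l ler_norml; apply/andP; split; lra.
Qed.

Lemma sqpt_seg c s j t :
  sqpt c s j 0 + t%:C * (sqpt c s j.+1 0 - sqpt c s j 0) = sqpt c s j t.
Proof.
rewrite /sqpt exprS.
have -> : side t = side 0 + t%:C * ('i%C * side 0 - side 0).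
  by apply/eqP; rewrite eq_complex /=; apply/andP; split; apply/eqP; ring.
by ring.
Qed.

Lemma cabs_i : cabs ('i%C : C) = 1.
Proof. by rewrite /= expr0n expr1n add0r sqrtr1. Qed.

Lemma sqptB c (s : R) j : sqpt c s j.+1 0 - sqpt c s j 0 = s%:C * ('i%C ^+ j * (2 * 'i%C)).
Proof.
rewrite /sqpt exprS.
have -> : 2 * 'i%C = 'i%C * side 0 - side 0 :> C.
  by apply/eqP; rewrite eq_complex /=; apply/andP; split; apply/eqP; ring.
by ring.
Qed.

Lemma sqpt4 c s : sqpt c s 4 0 = sqpt c s 0 0.
Proof.
rewrite /sqpt (_ : 'i%C ^+ 4 = 1) ?expr0 // (_ : 4 = 2 * 2)%N // exprM sqr_i.
by rewrite sqrrN expr1n.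
Qed.

Lemma cabs_sqptB c (s : R) j : 0 < s -> cabs (sqpt c s j.+1 0 - sqpt c s j 0) = 2 * s.
Proof.
move=> s0; rewrite sqptB !cabsM cabsX cabs_i expr1n mul1r mulr1 cabsR gtr0_norm //.
by rewrite (_ : 2 = 2%:R%:C :> C) ?cabsR ?gtr0_norm //; [ring|rewrite rmorph_nat].
Qed.

Lemma cabs_sqpt c (s : R) j t : 0 < s -> cabs (sqpt c s j t - c) = s * cabs (side t).
Proof.
move=> s0; rewrite /sqpt [c + _]addrC addrK !cabsM cabsX cabs_i expr1n mul1r.
by rewrite cabsR gtr0_norm.
Qed.

Lemma sqpt_disc c (s : R) j t : 0 < s -> cabs c + 2 * s < 1 -> 0 <= t <= 1 ->
  disc (sqpt c s j t).
Proof.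
move=> s0 cs t01; rewrite /disc /mkset.
have := cabs_le_normD c (sqpt c s j t - c); rewrite addrC subrK cabs_sqpt //.
have : s * cabs (side t) <= s * 2 by apply: ler_wpM2l; [exact: ltW|exact: side_le2].
lra.
Qed.

Lemma sqpt_dist c (s : R) j t z : 0 < s -> cabs (z - c) <= s / 2 ->
  s / 2 <= cabs (sqpt c s j t - z).
Proof.
move=> s0 zc; rewrite (_ : _ - z = (sqpt c s j t - c) - (z - c)); last by ring.
have := cabs_le_subD (sqpt c s j t - c) (z - c); rewrite cabs_sqpt //.
have : s * 1 <= s * cabs (side t) by apply: ler_wpM2l; [exact: ltW|exact: side_ge1].
lra.
Qed.

Lemma sqpt_neq c (s : R) j t z : 0 < s -> cabs (z - c) <= s / 2 ->
  sqpt c s j t - z != 0.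
Proof.
move=> s0 zc; rewrite -cabs_gt0; apply: lt_le_trans (sqpt_dist _ _ s0 zc).
by rewrite divr_gt0.
Qed.

Lemma cabs_sum n (a : 'I_n -> C) : cabs (\sum_(j < n) a j) <= \sum_(j < n) cabs (a j).
Proof.
elim/big_ind2 : _ => [|x1 x2 y1 y2 h1 h2|//]; first by rewrite cabs0.
by apply: le_trans (cabs_le_normD _ _) _; exact: lerD.
Qed.

Definition oint f c (s : R) : C :=
  \sum_(j < 4) seg f (sqpt c s j 0) (sqpt c s j.+1 0).

Definition ointcont f c (s : R) := forall j, ccont (fun t => f (sqpt c s j t)).

Lemma ointcont_seg f c s j : ointcont f c s ->
  segcont f (sqpt c s j 0) (sqpt c s j.+1 0).
Proof.
move=> /(_ j); rewrite /segcont; congr ccont; apply/funext => t.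
by rewrite sqpt_seg.
Qed.

Lemma eq_oint f g c s :
  (forall j (t : R), 0 <= t <= 1 -> f (sqpt c s j t) = g (sqpt c s j t)) ->
  oint f c s = oint g c s.
Proof.
move=> fg; apply: eq_bigr => j _; apply: eq_seg => t t01.
by rewrite sqpt_seg; exact: fg.
Qed.

Lemma ointMl f c s a : ointcont f c s -> oint (fun w => a * f w) c s = a * oint f c s.
Proof.
move=> cf; rewrite /oint mulr_sumr; apply: eq_bigr => j _; apply: segMl.
exact: ointcont_seg.
Qed.

Lemma ointB f g c s : ointcont f c s -> ointcont g c s ->
  oint (fun w => f w - g w) c s = oint f c s - oint g c s.
Proof.
move=> cf cg; rewrite /oint -sumrB; apply: eq_bigr => j _; apply: segB.
  exact: ointcont_seg.
exact: ointcont_seg.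
Qed.

Lemma oint_bound f c (s M : R) : 0 < s -> ointcont f c s ->
  (forall j t, 0 <= t <= 1 -> cabs (f (sqpt c s j t)) <= M) ->
  cabs (oint f c s) <= 16 * (M * s).
Proof.
move=> s0 cf H.
have step j : cabs (seg f (sqpt c s j 0) (sqpt c s j.+1 0)) <= 4 * (M * s).
  have -> : 4 * (M * s) = 2 * M * cabs (sqpt c s j.+1 0 - sqpt c s j 0).
    by rewrite cabs_sqptB //; ring.
  apply: seg_bound; first exact: ointcont_seg.
  by move=> t t01; rewrite sqpt_seg; exact: H.
apply: le_trans (cabs_sum _) _.
rewrite (_ : 16 * _ = \sum_(j < 4) 4 * (M * s)); last first.
  by rewrite sumr_const card_ord; ring.
by apply: ler_sum => j _; exact: step.
Qed.

Lemma oint_FTC F f c s : ointcont f c s ->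
  (forall j t, 0 <= t <= 1 -> cdiff F (sqpt c s j t) (f (sqpt c s j t))) ->
  oint f c s = 0.
Proof.
move=> cf D; rewrite /oint.
under eq_bigr => j _.
  rewrite (@seg_FTC _ F); last first.
    by move=> t t01; rewrite sqpt_seg; exact: D.
    exact: ointcont_seg.
  over.
rewrite -(big_mkord xpredT (fun j => F (sqpt c s j.+1 0) - F (sqpt c s j 0))).
by rewrite telescope_sumr // sqpt4 subrr.
Qed.

Lemma analytic_ointcont f c s : analytic f -> 0 < s -> cabs c + 2 * s < 1 ->
  ointcont f c s.
Proof.
move=> af s0 cs j; apply: ccont_comp.
  move: (ccont_line (sqpt c s j 0) (sqpt c s j.+1 0 - sqpt c s j 0)).
  by congr ccont; apply/funext => t; rewrite sqpt_seg.
move=> t t01; apply: cdiff_cont; apply: analytic_cdiff => //.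
exact: sqpt_disc.
Qed.

Lemma oint_analytic f c s : analytic f -> 0 < s -> cabs c + 2 * s < 1 ->
  oint f c s = 0.
Proof.
move=> af s0 cs; apply: (@oint_FTC (path_integral f)).
  exact: analytic_ointcont.
by move=> j t t01; apply: cdiff_path_integral => //; exact: sqpt_disc.
Qed.

Lemma ointcont_inv c s z : 0 < s -> cabs (z - c) <= s / 2 ->
  ointcont (fun w => (w - z)^-1) c s.
Proof.
move=> s0 zc j; apply: ccontV.
  by move=> t _; exact: sqpt_neq.
apply: ccontB; last exact: ccont_cst.
move: (ccont_line (sqpt c s j 0) (sqpt c s j.+1 0 - sqpt c s j 0)).
by congr ccont; apply/funext => t; rewrite sqpt_seg.
Qed.

Lemma ointcontM f g c s : ointcont f c s -> ointcont g c s ->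
  ointcont (fun w => f w * g w) c s.
Proof. by move=> cf cg j; exact: ccontM. Qed.

Lemma ointcontX f c s n : ointcont f c s -> ointcont (fun w => f w ^+ n) c s.
Proof.
move=> cf; elim: n => [|n IH] j.
  exact: ccont_cst.
rewrite (_ : (fun _ => _) = fun t => f (sqpt c s j t) * f (sqpt c s j t) ^+ n).
  by apply: ccontM; [exact: cf|exact: IH].
by apply/funext => t; rewrite exprS.
Qed.

(** Cauchy-type integral of [psi] with kernel (w - z)^-n. Only the values of [psi] on the contour
    matter, so it can be differentiated in z without analyticity of [psi]. *)
Definition qn psi c s n z : C := oint (fun w => psi w * (w - z)^-1 ^+ n) c s.

Lemma ointcont_qn psi c s n z : ointcont psi c s -> 0 < s -> cabs (z - c) <= s / 2 ->
  ointcont (fun w => psi w * (w - z)^-1 ^+ n) c s.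
Proof.
move=> cp s0 zc.
have ci := @ointcontX (fun w => (w - z)^-1) c s n (ointcont_inv s0 zc).
exact: (@ointcontM psi (fun w => (w - z)^-1 ^+ n) c s cp ci).
Qed.

(** Differentiation under the integral sign needs only a quadratic remainder of the kernel, uniform
    along the contour. The distance s / 2 is available because z stays within s / 2 of c, while the
    contour stays at distance at least s from c. *)
Lemma cdiff_qn psi c (s M : R) n z : 0 < s -> ointcont psi c s ->
  (forall j t, 0 <= t <= 1 -> cabs (psi (sqpt c s j t)) <= M) ->
  cabs (z - c) < s / 2 -> 
  (exists B : R, forall a h : C, s / 2 <= cabs a -> s / 2 <= cabs (a - h) ->
    cabs a <= 3 * s -> cabs h <= s ->
    cabs ((a - h)^-1 ^+ n - a^-1 ^+ n - n%:R * a^-1 ^+ n.+1 * h) <= B * cabs h ^+ 2) ->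
  cdiff (qn psi c s n) z (n%:R * qn psi c s n.+1 z).
Proof.
move=> s0 cp HM zc [B HB] e e0.
(* Read off from the instance a = 2 s, h = s of the hypothesis. *)
have B0 : 0 <= B.
  have := HB s%:C 0; rewrite subr0 cabsR gtr0_norm // cabs0 => H.
  have {H} := HB (2 * s)%:C s%:C.
  rewrite -rmorphB !cabsR !gtr0_norm ?mulr_gt0 //; last by lra.
  move=> /(_ _ _ _ _)/(le_trans (cabs_ge0 _)); rewrite pmulr_lge0 ?exprn_gt0 //.
  by apply; lra.
have M0 : 0 <= M.
  by apply: le_trans (HM 0%N 0 _); [exact: cabs_ge0|rewrite lexx ler01].
have Q0 : 0 < 16 * (M * B * s) + 1.
  by rewrite ltr_wpDl // !mulr_ge0 // ltW.
exists (Num.min (Num.min (s / 2 - cabs (z - c)) s) (e / (16 * (M * B * s) + 1))).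
  by rewrite !lt_min s0 subr_gt0 zc divr_gt0.
move=> h; rewrite !lt_min => /andP[/andP[h1 h2] h3].
have zhc : cabs (z + h - c) <= s / 2.
  have := cabs_le_normD (z - c) h; rewrite (_ : z - c + h = z + h - c); last by ring.
  lra.
have c0 := ointcont_qn n cp s0 (ltW zc).
have c2 := ointcont_qn n cp s0 zhc.
have c3 := ointcont_qn n.+1 cp s0 (ltW zc).
have c4 : ointcont (fun w => n%:R * h * (psi w * (w - z)^-1 ^+ n.+1)) c s.
  apply: (@ointcontM (fun=> n%:R * h) (fun w => psi w * (w - z)^-1 ^+ n.+1) c s _ c3).
  by move=> j; exact: ccont_cst.
have c5 : ointcont (fun w => psi w * (w - (z + h))^-1 ^+ n - psi w * (w - z)^-1 ^+ n) c s.
  by move=> j; exact: (ccontB (c2 j) (c0 j)).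
have -> : qn psi c s n (z + h) - qn psi c s n z - n%:R * qn psi c s n.+1 z * h =
   oint (fun w => psi w * (w - (z + h))^-1 ^+ n - psi w * (w - z)^-1 ^+ n
      - n%:R * h * (psi w * (w - z)^-1 ^+ n.+1)) c s.
  rewrite (ointB c5 c4) (ointB c2 c0) (ointMl _ c3) /qn.
  move: (oint _ c s) (oint _ c s) (oint _ c s) => A1 A2 A3.
  by rewrite mulrAC.
apply: (@le_trans _ _ (16 * (M * (B * cabs h ^+ 2) * s))).
  apply: (oint_bound s0 (fun j => ccontB (c5 j) (c4 j))) => j t t01.
  set w := sqpt c s j t.
  rewrite (_ : _ - _ - _ = psi w * ((w - z - h)^-1 ^+ n - (w - z)^-1 ^+ n -
     n%:R * (w - z)^-1 ^+ n.+1 * h)); last first.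
    by rewrite (_ : w - (z + h) = w - z - h); ring.
  rewrite cabsM; apply: ler_pM; rewrite ?cabs_ge0 //; first exact: HM.
  apply: HB.
  - by apply: sqpt_dist => //; exact: ltW.
  - by rewrite (_ : w - z - h = w - (z + h)); [exact: sqpt_dist|ring].
  - rewrite (_ : w - z = (w - c) - (z - c)); last by ring.
    apply: le_trans (cabs_le_normD _ _) _; rewrite normcN cabs_sqpt //.
    have : s * cabs (side t) <= s * 2 by apply: ler_wpM2l; [exact: ltW|exact: side_le2].
    lra.
  - by lra.
rewrite (_ : 16 * _ = 16 * (M * B * s) * cabs h * cabs h); last by ring.
apply: ler_wpM2r; first exact: cabs_ge0.
move: h3; rewrite ltr_pdivlMr // mulrDr mulr1 => h3.
have := cabs_ge0 h; lra.
Qed.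

Lemma cabs_inv_le a (s : R) : 0 < s -> s / 2 <= cabs a -> cabs a^-1 <= 2 / s.
Proof.
move=> s0 h; rewrite cabsV -[2 / s]invrK lef_pV2 ?posrE ?invr_gt0 ?divr_gt0 //.
  by rewrite invf_div.
by apply: lt_le_trans h; rewrite divr_gt0.
Qed.

Lemma cabs_inv_pow a (s : R) n : 0 < s -> s / 2 <= cabs a ->
  cabs a^-1 ^+ n <= (2 / s) ^+ n.
Proof.
move=> s0 h; apply: lerXn2r; rewrite ?nnegrE ?cabs_ge0 //.
  by rewrite divr_ge0 // ltW.
exact: cabs_inv_le.
Qed.

Lemma cabs_kernel (s P : R) p a h n m : 0 < s -> s / 2 <= cabs a ->
  s / 2 <= cabs (a - h) -> cabs p <= P ->
  cabs (h ^+ 2 * p * (a^-1 ^+ n * (a - h)^-1 ^+ m)) <= P * ((2 / s) ^+ n * (2 / s) ^+ m) * cabs h ^+ 2.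
Proof.
move=> s0 ha hah hp; rewrite cabsM [cabs (h ^+ 2 * p)]cabsM [cabs (_ * (a - h)^-1 ^+ m)]cabsM !cabsX.
rewrite [leRHS]mulrC -[leLHS]mulrA.
apply: ler_wpM2l; first by rewrite exprn_ge0 // cabs_ge0.
apply: ler_pM; rewrite ?mulr_ge0 ?exprn_ge0 ?cabs_ge0 //.
by apply: ler_pM; rewrite ?exprn_ge0 ?cabs_ge0 // cabs_inv_pow.
Qed.

Lemma cabs_nat n : cabs (n%:R : C) = n%:R.
Proof. by rewrite -(rmorph_nat (real_complex R)) cabsR ger0_norm // ler0n. Qed.

(** The remainder equals h^2 P / (a^(n+1) (a - h)^n) with P = 1, 3 a - 2 h or 6 a^2 - 8 a h + 3 h^2
    for n = 1, 2, 3. With |a| <= 3 s and |h| <= s, |P| is at most 1, 11 s or 81 s^2. *)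
Lemma kernel_taylor (s : R) n : 0 < s -> (0 < n <= 3)%N ->
  exists B : R, forall a h : C, s / 2 <= cabs a -> s / 2 <= cabs (a - h) ->
    cabs a <= 3 * s -> cabs h <= s ->
    cabs ((a - h)^-1 ^+ n - a^-1 ^+ n - n%:R * a^-1 ^+ n.+1 * h) <= B * cabs h ^+ 2.
Proof.
move=> s0; have nz x : s / 2 <= cabs x -> x != 0.
  by move=> hx; rewrite -cabs_gt0; apply: lt_le_trans hx; rewrite divr_gt0.
case: n => [//|[|[|[|//]]]] _.
- exists (1 * ((2 / s) ^+ 2 * (2 / s) ^+ 1)) => a h ha hah h3 hs.
  have := @cabs_kernel s 1 1 a h 2 1 s0 ha hah; rewrite cabs1 => /(_ (lexx _)).
  congr (cabs _ <= _); field; by rewrite !nz.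
- exists (11 * s * ((2 / s) ^+ 3 * (2 / s) ^+ 2)) => a h ha hah h3 hs.
  have := @cabs_kernel s (11 * s) (3%:R * a - 2%:R * h) a h 3 2 s0 ha hah.
  have -> : h ^+ 2 * (3%:R * a - 2%:R * h) * (a^-1 ^+ 3 * (a - h)^-1 ^+ 2) =
    (a - h)^-1 ^+ 2 - a^-1 ^+ 2 - 2%:R * a^-1 ^+ 3 * h by field; rewrite !nz.
  apply; apply: le_trans (cabs_le_normD _ _) _.
  by rewrite normcN !cabsM !cabs_nat; lra.
- exists (81 * s ^+ 2 * ((2 / s) ^+ 4 * (2 / s) ^+ 3)) => a h ha hah h3 hs.
  have := @cabs_kernel s (81 * s ^+ 2) (6%:R * a ^+ 2 - 8%:R * (a * h) + 3%:R * h ^+ 2) a h 4 3 s0 ha hah.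
  have -> : h ^+ 2 * (6%:R * a ^+ 2 - 8%:R * (a * h) + 3%:R * h ^+ 2) * (a^-1 ^+ 4 * (a - h)^-1 ^+ 3) =
    (a - h)^-1 ^+ 3 - a^-1 ^+ 3 - 3%:R * a^-1 ^+ 4 * h by field; rewrite !nz.
  apply; apply: le_trans (cabs_le_normD _ _) _.
  have := cabs_le_normD (6%:R * a ^+ 2) (- (8%:R * (a * h))).
  have -> : cabs (3%:R * h ^+ 2) = 3 * cabs h ^+ 2 by rewrite cabsM cabsX cabs_nat.
  have -> : cabs (6%:R * a ^+ 2) = 6 * cabs a ^+ 2 by rewrite cabsM cabsX cabs_nat.
  have -> : cabs (- (8%:R * (a * h))) = 8 * (cabs a * cabs h).
    by rewrite normcN !cabsM cabs_nat.
  move=> H.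
  have a0 := cabs_ge0 a; have h0 := cabs_ge0 h.
  have A1 : cabs a ^+ 2 <= 9 * s ^+ 2.
    by rewrite (_ : 9 * s ^+ 2 = (3 * s) ^+ 2); [rewrite lerXn2r // nnegrE // mulr_ge0 // ltW|ring].
  have A2 : cabs h ^+ 2 <= s ^+ 2 by rewrite lerXn2r // nnegrE // ltW.
  have A3 : cabs a * cabs h <= 3 * s * s by exact: ler_pM.
  lra.
Qed.

Lemma cdiff_qn3 psi c (s M : R) n z : 0 < s -> ointcont psi c s ->
  (forall j t, 0 <= t <= 1 -> cabs (psi (sqpt c s j t)) <= M) ->
  cabs (z - c) < s / 2 -> (0 < n <= 3)%N ->
  cdiff (qn psi c s n) z (n%:R * qn psi c s n.+1 z).
Proof. by move=> s0 cp HM zc n3; apply: cdiff_qn HM zc _ => //; exact: kernel_taylor. Qed.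

(** The integral of 1 / (w - c) over the square, that is 2 pi i, the normalizing constant of
    Cauchy's formula. It is never evaluated: its invariance under moving the pole and a lower bound
    are enough. *)
Definition wind c (s : R) : C := qn (fun=> 1) c s 1 c.

Lemma ointcont_cst c s a : ointcont (fun=> a) c s.
Proof. by move=> j; exact: ccont_cst. Qed.

(** The derivative in z is the integral of (w - z)^-2, which vanishes because this kernel has the
    single-valued primitive -1 / (w - z); hence the integral is constant along the segment from c to
    z. *)
Lemma wind_const c (s : R) z : 0 < s -> cabs (z - c) < s / 2 ->
  qn (fun=> 1) c s 1 z = wind c s.
Proof.
move=> s0 zc.
have D x : cabs (x - c) < s / 2 -> cdiff (qn (fun=> 1) c s 1) x 0.
  move=> xc; have := @cdiff_qn3 (fun=> 1) c s 1 1 x s0 (@ointcont_cst c s 1) _ xc isT.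
  rewrite [X in _ * X](_ : _ = 0) ?mulr0; first by apply => j t _; rewrite cabs1.
  apply: (@oint_FTC (fun w => - (w - x)^-1)).
    by apply: ointcont_qn => //; [exact: ointcont_cst|exact: ltW].
  move=> j t t01; have nz := @sqpt_neq c s j t x s0 (ltW xc).
  have D1 := cdiffB (cdiff_id (sqpt c s j t)) (cdiff_cst x (sqpt c s j t)).
  have := cdiffN (@cdiffV R (fun w => w - x) _ _ nz D1); congr cdiff.
  by field.
have cc : cabs (c - c) < s / 2 by rewrite subrr cabs0 divr_gt0.
have : seg (fun=> 0) c z = qn (fun=> 1) c s 1 z - qn (fun=> 1) c s 1 c.
  apply: seg_FTC; first exact: ccont_cst.
  move=> t /andP[t0 t1]; apply: D.
  rewrite [c + _]addrC addrK cabsM cabsR ger0_norm //.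
  by apply: le_lt_trans zc; rewrite ler_piMl // cabs_ge0.
rewrite seg_cst mul0r => /esym/eqP; rewrite subr_eq0 => /eqP ->.
by [].
Qed.

Lemma ccont_side : ccont side.
Proof.
have -> : side = fun t => Complex 1 (-1) + t%:C * (2 * 'i%C).
  by apply/funext => t; apply/eqP; rewrite eq_complex /=; apply/andP; split; apply/eqP; ring.
exact: ccont_line.
Qed.

Lemma seg_sqpt f c (s : R) j : ointcont f c s ->
  seg f (sqpt c s j 0) (sqpt c s j.+1 0) =
  cint (fun t => (s%:C * ('i%C ^+ j * (2 * 'i%C))) * f (sqpt c s j t)).
Proof.
move=> cf; rewrite (cintMl _ (cf j)) -(sqptB c) /seg; congr (_ * _).
by apply: eq_cint => t t01; rewrite sqpt_seg.
Qed.

Lemma i_neq0 : 'i%C != 0 :> C.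
Proof. by rewrite -cabs_gt0 cabs_i ltr01. Qed.

Lemma realC_neq0 (s : R) : 0 < s -> s%:C != 0 :> C.
Proof. by move=> s0; rewrite -cabs_gt0 cabsR normr_gt0 gt_eqF. Qed.

Lemma side_kernel c (s : R) j t a : 0 < s ->
  s%:C * ('i%C ^+ j * (2 * 'i%C)) * (a * (sqpt c s j t - c)^-1) =
  2 * 'i%C * (a * (side t)^-1).
Proof.
move=> s0; rewrite /sqpt [c + _]addrC addrK.
by field; rewrite side_neq0 expf_neq0 ?i_neq0 // realC_neq0.
Qed.

(** The four sides contribute equally, each 2 i times the integral of 1 / (1 + i (2 t - 1)), whose
    real part 1 / (1 + (2 t - 1)^2) is at least 1/2. *)
Lemma wind_ge4 c (s : R) : 0 < s -> 4 <= cabs (wind c s).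
Proof.
move=> s0; have cc : cabs (c - c) <= s / 2 by rewrite subrr cabs0 divr_ge0 // ltW.
have ci : ccont (fun t => (side t)^-1).
  by apply: ccontV; [move=> t _; exact: side_neq0|exact: ccont_side].
have E : wind c s = 4 * (2 * 'i%C * cint (fun t => (side t)^-1)).
  rewrite /wind /qn /oint.
  under eq_bigr => j _.
    rewrite seg_sqpt; last exact: (ointcont_qn 1 (@ointcont_cst c s 1) s0 cc).
    rewrite (@eq_cint _ _ (fun t => 2 * 'i%C * (side t)^-1)); last first.
      by move=> t _; rewrite expr1 side_kernel // mul1r.
    rewrite (cintMl _ ci); over.
  by rewrite sumr_const card_ord; move: (cint _) => ?; ring.
rewrite E !cabsM !cabs_nat cabs_i.
have : 2^-1 <= cabs (cint (fun t => (side t)^-1)).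
  apply: le_trans (le_trans (ler_norm _) (cabs_Re _)) => /=.
  rewrite -[leLHS](@rint_cst R); apply: rcont_rint_le.
  - by move=> t _; exact: cst_continuous.
  - exact: (ccont_Re ci).
  - move=> t /andP[t0 t1] /=; rewrite expr1n div1r lef_pV2 ?posrE //.
      rewrite (_ : (2 * t - 1) ^+ 2 = 1 - 4 * (t * (1 - t))); last by ring.
      by have : 0 <= t * (1 - t); [rewrite mulr_ge0 // subr_ge0|lra].
    by rewrite ltr_pwDl // sqr_ge0.
lra.
Qed.

Lemma wind_neq0 c (s : R) : 0 < s -> wind c s != 0.
Proof. by move=> s0; rewrite -cabs_gt0; apply: lt_le_trans (wind_ge4 c s0). Qed.

(** Away from z this is the quotient rule. At z the quotient is the mean of f over [z, z + h], so
    its derivative there is f'(z) / 2. Having f analytic is essential: that the derivative of an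
    analytic function is again analytic is not yet available. *)
Lemma dq_analytic F f z : (forall w, disc w -> cdiff F w (f w)) -> analytic f ->
  disc z -> analytic (fun w => if w == z then f z else (F w - F z) / (w - z)).
Proof.
move=> D af dz; apply: analytic_cdiffP => w dw.
have [->|wz] := eqVneq w z.
- exists (cderiv f z / 2) => e e0.
  have e20 : 0 < e / 2 by rewrite divr_gt0.
  have [de de0 H] := analytic_cdiff af dz e20.
  exists (Num.min de (1 - cabs z)); first by rewrite lt_min de0 subr_gt0.
  move=> h; rewrite lt_min => /andP[h1 h2].
  have [->|h0] := eqVneq h 0.
    by rewrite addr0 eqxx subrr mulr0 subrr cabs0 mulr0.
  rewrite eqxx (_ : (z + h == z) = false); last first.
    by apply/negbTE; rewrite -subr_eq0 [z + h]addrC addrK.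
  have dzh := disc_ball dz h2.
  have sc := analytic_segcont af dz dzh.
  have hE : z + h - z = h by ring.
  have cf : ccont (fun t => f (z + t%:C * h)).
    by move: sc; rewrite /segcont hE.
  have cg : ccont (fun t => f z + cderiv f z * h * t%:C).
    apply: ccontD; first exact: ccont_cst.
    by apply: ccontM; [exact: ccont_cst|exact: ccont_id].
  have <- : seg f z (z + h) = F (z + h) - F z.
    by apply: seg_FTC => // t t01; apply: D; exact: disc_segment.
  have E2 : cint (fun t => f z + cderiv f z * h * t%:C) = f z + cderiv f z / 2 * h.
    have := @seg_affine R (f z) (cderiv f z * h) 0 1.
    rewrite /seg subr0 mul1r => E.
    rewrite (@eq_cint _ _ (fun t => f z + cderiv f z * h * (0 + t%:C * 1))).
      by rewrite E; field.
    by move=> t _; rewrite add0r mulr1.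
  rewrite /seg hE mulrAC divff // mul1r.
  rewrite (_ : cint _ - f z - _ = cint (fun t => f (z + t%:C * h)) -
    cint (fun t => f z + cderiv f z * h * t%:C)); last first.
    by rewrite E2; move: (cint _) => X; ring.
  rewrite -(cintB cf cg).
  have -> : e * cabs h = 2 * (e / 2 * cabs h) by field.
  apply: cint_bound; first exact: ccontB.
  move=> t /andP[t0 t1].
  have th : cabs (t%:C * h) <= cabs h.
    by rewrite cabsM cabsR ger0_norm // ler_piMl // cabs_ge0.
  have := H _ (le_lt_trans th h1).
  rewrite (_ : _ - _ - _ = f (z + t%:C * h) - (f z + cderiv f z * h * t%:C)); last by ring.
  move=> H2; apply: le_trans H2 _; apply: ler_wpM2l => //; exact: ltW.
- have wz0 : w - z != 0 by rewrite subr_eq0.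
  have D1 := cdiffB (D w dw) (cdiff_cst (F z) w).
  have D2 := cdiffB (cdiff_id w) (cdiff_cst z w).
  have D3 := cdiffM D1 (@cdiffV R (fun w => w - z) _ _ wz0 D2).
  have r0 : 0 < cabs (w - z) by rewrite cabs_gt0.
  eexists; apply: (cdiff_ext r0 _ D3) => h hw /=; rewrite (_ : (w + h == z) = false) //.
  apply/negbTE/eqP => E; move: hw; rewrite -E (_ : w - (w + h) = - h); last by ring.
  by rewrite normcN ltxx.
Qed.

Lemma disc_near c (s : R) z : 0 < s -> cabs c + 2 * s < 1 -> cabs (z - c) < s / 2 -> disc z.
Proof.
move=> s0 cs zc; rewrite /disc /mkset.
have := cabs_le_normD c (z - c); rewrite addrC subrK; lra.
Qed.

(** The difference quotient of F at z is analytic, so its integral over the square vanishes, which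
    is Cauchy's formula. F comes with an analytic derivative because [dq_analytic] asks for one;
    [analytic_cderiv] lifts this restriction. *)
Lemma Cauchy_prim F f c (s : R) z : (forall w, disc w -> cdiff F w (f w)) ->
  analytic f -> 0 < s -> cabs c + 2 * s < 1 -> cabs (z - c) < s / 2 ->
  F z = (wind c s)^-1 * qn F c s 1 z.
Proof.
move=> D af s0 cs zc.
have dz := disc_near s0 cs zc.
have aG := dq_analytic D af dz.
have aF : analytic F by apply: analytic_cdiffP => w dw; exists (f w); exact: D.
have cF := analytic_ointcont aF s0 cs.
have := oint_analytic aG s0 cs.
rewrite (@eq_oint _ (fun w => F w * (w - z)^-1 ^+ 1 - F z * (1 * (w - z)^-1 ^+ 1))).
  have c1 := ointcont_qn 1 cF s0 (ltW zc).
  have c2 := ointcont_qn 1 (@ointcont_cst c s 1) s0 (ltW zc).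
  have c3 : ointcont (fun w => F z * (1 * (w - z)^-1 ^+ 1)) c s.
    exact: (@ointcontM (fun=> F z) (fun w => 1 * (w - z)^-1 ^+ 1) c s (@ointcont_cst c s _) c2).
  rewrite (ointB c1 c3) (ointMl _ c2) -/(qn F c s 1 z) -/(qn (fun=> 1) c s 1 z).
  rewrite (wind_const s0 zc) => /eqP; rewrite subr_eq0 => /eqP ->.
  by rewrite mulrC mulfK // wind_neq0.
move=> j t t01; have nz := @sqpt_neq c s j t z s0 (ltW zc).
rewrite -subr_eq0 (negbTE nz) expr1 mul1r mulrBl //.
Qed.

Lemma oint_sup f c (s : R) : ointcont f c s -> exists M : R,
  forall j (t : R), 0 <= t <= 1 -> cabs (f (sqpt c s j t)) <= M.
Proof.
move=> cf.
have step j : exists M : R, forall t : R, 0 <= t <= 1 -> cabs (f (sqpt c s j t)) <= M.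
  have [|x _ Hx] := @EVT_max R (fun t => cabs (f (sqpt c s j t))) 0 1 ler01.
    exact: (rcont_within (ccont_cabs (cf j))).
  by exists (cabs (f (sqpt c s j x))) => t t01; apply: Hx; rewrite in_itv.
have [M0 H0] := step 0%N; have [M1 H1] := step 1%N.
have [M2 H2] := step 2; have [M3 H3] := step 3.
exists (Num.max (Num.max M0 M1) (Num.max M2 M3)) => j t t01.
have -> : sqpt c s j t = sqpt c s (j %% 4)%N t.
  rewrite /sqpt {1}(divn_eq j 4) exprD mulnC exprM (_ : 'i%C ^+ 4 = 1) ?expr1n ?mul1r //.
  by rewrite (_ : 4 = 2 * 2)%N // exprM sqr_i sqrrN expr1n.
have := ltn_pmod j (isT : 0 < 4)%N.
case: (j %% 4)%N => [|[|[|[|//]]]] _; rewrite !le_max.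
- by rewrite H0.
- by rewrite H1 ?orbT.
- by rewrite H2 ?orbT.
- by rewrite H3 ?orbT.
Qed.

Lemma Cauchy_radius c : disc c -> exists2 s : R, 0 < s & cabs c + 2 * s < 1.
Proof.
rewrite /disc /mkset => dc; exists ((1 - cabs c) / 4); first by rewrite divr_gt0 // subr_gt0.
lra.
Qed.

(** Cauchy's formula holds for a primitive F of f. Differentiating it three times under the integral
    sign gives f, then f', then a derivative of f'; this is why kernel exponents up to 3 suffice. *)
Theorem analytic_cderiv f : analytic f -> analytic (cderiv f).
Proof.
move=> af; apply: analytic_cdiffP => c dc.
have [s s0 cs] := Cauchy_radius dc.
pose F := path_integral f.
have D w : disc w -> cdiff F w (f w) by exact: cdiff_path_integral.
have aF : analytic F by exact: analytic_path_integral.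
have cF := analytic_ointcont aF s0 cs.
have [M HM] := oint_sup cF.
have C1 z : cabs (z - c) < s / 2 -> F z = (wind c s)^-1 * qn F c s 1 z.
  by move=> zc; exact: (Cauchy_prim D af s0 cs zc).
pose k := (wind c s)^-1.
have loc z h : cabs (z - c) < s / 2 -> cabs h < s / 2 - cabs (z - c) ->
    cabs (z + h - c) < s / 2.
  move=> h1 h2; rewrite (_ : z + h - c = (z - c) + h); last by ring.
  apply: le_lt_trans (cabs_le_normD _ _) _; lra.
have dz z : cabs (z - c) < s / 2 -> disc z by exact: disc_near.
have C2 z : cabs (z - c) < s / 2 -> f z = k * qn F c s 2 z.
  move=> zc; apply: (cdiff_uniq (D z (dz _ zc))).
  have D1 := cdiffM (cdiff_cst k z) (cdiff_qn3 s0 cF HM zc (isT : (0 < 1 <= 3)%N)).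
  rewrite mul0r add0r mul1r in D1.
  have r0 : 0 < s / 2 - cabs (z - c) by rewrite subr_gt0.
  apply: (cdiff_ext r0 _ D1) => h hh; rewrite C1 //; exact: loc.
have C3 z : cabs (z - c) < s / 2 -> cderiv f z = k * (2%:R * qn F c s 3 z).
  move=> zc; apply: (cdiff_uniq (analytic_cdiff af (dz _ zc))).
  have D1 := cdiffM (cdiff_cst k z) (cdiff_qn3 s0 cF HM zc (isT : (0 < 2 <= 3)%N)).
  rewrite mul0r add0r in D1.
  have r0 : 0 < s / 2 - cabs (z - c) by rewrite subr_gt0.
  apply: (cdiff_ext r0 _ D1) => h hh; rewrite C2 //; exact: loc.
have cc : cabs (c - c) < s / 2 by rewrite subrr cabs0 divr_gt0.
have D1 := cdiffM (cdiff_cst k c) (cdiffM (cdiff_cst 2%:R c)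
  (cdiff_qn3 s0 cF HM cc (isT : (0 < 3 <= 3)%N))).
have r0 : 0 < s / 2 - cabs (c - c) by rewrite subr_gt0.
eexists; apply: (cdiff_ext r0 _ D1) => h hh; rewrite C3 //; exact: loc.
Qed.

Lemma Cauchy f c (s : R) z : analytic f -> 0 < s -> cabs c + 2 * s < 1 ->
  cabs (z - c) < s / 2 -> f z = (wind c s)^-1 * qn f c s 1 z.
Proof.
move=> af; apply: (@Cauchy_prim _ (cderiv f)); last exact: analytic_cderiv.
by move=> w dw; exact: analytic_cdiff.
Qed.

Lemma Cauchy_deriv f c (s : R) : analytic f -> 0 < s -> cabs c + 2 * s < 1 ->
  cderiv f c = (wind c s)^-1 * qn f c s 2 c.
Proof.
move=> af s0 cs; have cc : cabs (c - c) < s / 2 by rewrite subrr cabs0 divr_gt0.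
have dc := disc_near s0 cs cc.
have cf := analytic_ointcont af s0 cs; have [M HM] := oint_sup cf.
apply: (cdiff_uniq (analytic_cdiff af dc)).
have D1 := cdiffM (cdiff_cst (wind c s)^-1 c) (cdiff_qn3 s0 cf HM cc (isT : (0 < 1 <= 3)%N)).
rewrite mul0r add0r mul1r in D1.
have r0 : 0 < s / 2 - cabs (c - c) by rewrite subr_gt0.
apply: (cdiff_ext r0 _ D1) => h hh; rewrite -Cauchy //.
by rewrite [c + h]addrC addrK; move: hh; rewrite subrr cabs0 subr0.
Qed.

Lemma cabs_wind_inv c (s : R) : 0 < s -> cabs (wind c s)^-1 <= 4^-1.
Proof.
move=> s0; rewrite cabsV lef_pV2 ?posrE ?wind_ge4 //.
by apply: lt_le_trans (wind_ge4 c s0).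
Qed.

Lemma Cauchy_estimate_deriv f c (s M : R) : analytic f -> 0 < s -> cabs c + 2 * s < 1 ->
  (forall w, cabs (w - c) <= 2 * s -> cabs (f w) <= M) ->
  cabs (cderiv f c) <= 16 * M / s.
Proof.
move=> af s0 cs HM; rewrite (Cauchy_deriv af s0 cs) cabsM.
have cc : cabs (c - c) <= s / 2 by rewrite subrr cabs0 divr_ge0 // ltW.
have M0 : 0 <= M.
  by apply: le_trans (HM c _); rewrite ?cabs_ge0 // subrr cabs0 mulr_ge0 // ltW.
have c1 := ointcont_qn 2 (analytic_ointcont af s0 cs) s0 cc.
have /(_ (M * (2 / s) ^+ 2)) := oint_bound s0 c1 => H.
have {}H : cabs (qn f c s 2 c) <= 16 * (M * (2 / s) ^+ 2 * s).
  apply: H => j t t01; rewrite cabsM cabsX; apply: ler_pM; rewrite ?cabs_ge0 ?exprn_ge0 ?cabs_ge0 //.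
    apply: HM; rewrite cabs_sqpt // mulrC; apply: ler_wpM2r; [exact: ltW|exact: side_le2].
  by apply: cabs_inv_pow => //; exact: sqpt_dist.
apply: (@le_trans _ _ (4^-1 * (16 * (M * (2 / s) ^+ 2 * s)))).
  by apply: ler_pM; rewrite ?cabs_ge0 // cabs_wind_inv.
by rewrite le_eqVlt; apply/orP; left; apply/eqP; field; rewrite gt_eqF.
Qed.

(** The remainder depends on f only through the bound M, which lets it pass to pointwise limits in
    [ulim_analytic]. *)
Lemma Cauchy_estimate_taylor f c (s M : R) h : analytic f -> 0 < s -> cabs c + 2 * s < 1 ->
  (forall w, cabs (w - c) <= 2 * s -> cabs (f w) <= M) -> cabs h < s / 2 ->
  cabs (f (c + h) - f c - cderiv f c * h) <= 32 * M / s ^+ 2 * cabs h ^+ 2.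
Proof.
move=> af s0 cs HM hs.
have cc : cabs (c - c) < s / 2 by rewrite subrr cabs0 divr_gt0.
have hc : cabs (c + h - c) < s / 2 by rewrite [c + h]addrC addrK.
have M0 : 0 <= M.
  by apply: le_trans (HM c _); rewrite ?cabs_ge0 // subrr cabs0 mulr_ge0 // ltW.
have cf := analytic_ointcont af s0 cs.
have c1 := ointcont_qn 1 cf s0 (ltW hc).
have c2 := ointcont_qn 1 cf s0 (ltW cc).
have c3 := ointcont_qn 2 cf s0 (ltW cc).
have c4 : ointcont (fun w => h * (f w * (w - c)^-1 ^+ 2)) c s.
  exact: (@ointcontM (fun=> h) (fun w => f w * (w - c)^-1 ^+ 2) c s (@ointcont_cst c s _) c3).
have c5 : ointcont (fun w => f w * (w - (c + h))^-1 ^+ 1 - f w * (w - c)^-1 ^+ 1) c s.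
  by move=> j; exact: (ccontB (c1 j) (c2 j)).
rewrite (Cauchy_deriv af s0 cs) (Cauchy af s0 cs hc) (Cauchy af s0 cs cc).
have -> : (wind c s)^-1 * qn f c s 1 (c + h) - (wind c s)^-1 * qn f c s 1 c -
   (wind c s)^-1 * qn f c s 2 c * h = (wind c s)^-1 *
   oint (fun w => f w * (w - (c + h))^-1 ^+ 1 - f w * (w - c)^-1 ^+ 1 -
      h * (f w * (w - c)^-1 ^+ 2)) c s.
  rewrite (ointB c5 c4) (ointB c1 c2) (ointMl _ c3).
  rewrite -/(qn f c s 1 (c + h)) -/(qn f c s 1 c) -/(qn f c s 2 c).
  move: (qn f c s 1 (c + h)) (qn f c s 1 c) (qn f c s 2 c) (wind c s) => A1 A2 A3 A4.
  by ring.
rewrite cabsM.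
apply: (@le_trans _ _ (4^-1 * (16 * (M * (1 * ((2 / s) ^+ 2 * (2 / s) ^+ 1) * cabs h ^+ 2) * s)))).
  apply: ler_pM; rewrite ?cabs_ge0 // ?cabs_wind_inv //.
  apply: (oint_bound s0 (fun j => ccontB (c5 j) (c4 j))) => j t t01; set w := sqpt c s j t.
  have nz1 : w - c != 0 by exact: (sqpt_neq _ _ s0 (ltW cc)).
  have nz2 : w - c - h != 0.
    rewrite (_ : w - c - h = w - (c + h)); last by ring.
    exact: (sqpt_neq _ _ s0 (ltW hc)).
  rewrite (_ : _ - _ - _ = f w * (h ^+ 2 * 1 * ((w - c)^-1 ^+ 2 * (w - c - h)^-1 ^+ 1))); last first.
    rewrite (_ : w - (c + h) = w - c - h); last by ring.
    by field; rewrite nz1 nz2.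
  rewrite cabsM; apply: ler_pM; rewrite ?cabs_ge0 //.
    apply: HM; rewrite cabs_sqpt // mulrC; apply: ler_wpM2r; [exact: ltW|exact: side_le2].
  apply: cabs_kernel => //; last by rewrite cabs1.
    exact: (sqpt_dist _ _ s0 (ltW cc)).
  rewrite (_ : w - c - h = w - (c + h)); last by ring.
  exact: (sqpt_dist _ _ s0 (ltW hc)).
by rewrite le_eqVlt; apply/orP; left; apply/eqP; field; rewrite gt_eqF.
Qed.

(** The constant in front of the sum is 1: the factor 1/4 from [wind_ge4] absorbs |2 i| and the
    factor 2 lost in [cint_le], while 1 / |side t| is at most 1. *)
Lemma Cauchy_mean f c (s : R) : analytic f -> 0 < s -> cabs c + 2 * s < 1 ->
  cabs (f c) <= \sum_(j < 4) rint (fun t => cabs (f (sqpt c s j t))).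
Proof.
move=> af s0 cs; have cc : cabs (c - c) < s / 2 by rewrite subrr cabs0 divr_gt0.
have cf := analytic_ointcont af s0 cs.
have c1 := ointcont_qn 1 cf s0 (ltW cc).
rewrite (Cauchy af s0 cs cc) cabsM.
apply: (@le_trans _ _ (4^-1 * cabs (qn f c s 1 c))).
  by apply: ler_wpM2r; rewrite ?cabs_ge0 ?cabs_wind_inv.
rewrite ler_pdivrMl // /qn /oint; apply: le_trans (cabs_sum _) _.
rewrite mulr_sumr; apply: ler_sum => j _.
rewrite (seg_sqpt j c1).
have ci : ccont (fun t => f (sqpt c s j t) * (side t)^-1).
  apply: ccontM; first exact: cf.
  by apply: ccontV; [move=> t _; exact: side_neq0|exact: ccont_side].
rewrite (@eq_cint _ _ (fun t => 2 * 'i%C * (f (sqpt c s j t) * (side t)^-1))); last first.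
  by move=> t _; rewrite expr1 side_kernel.
rewrite (cintMl _ ci) !cabsM cabs_nat cabs_i mulr1.
rewrite (_ : 4 = 2 * 2); last by ring.
rewrite -mulrA; apply: ler_wpM2l => //.
apply: le_trans (cint_le ci) _; apply: ler_wpM2l => //.
apply: rcont_rint_le; [exact: ccont_cabs|exact: (ccont_cabs (cf j))|].
move=> t t01; rewrite cabsM cabsV ler_piMr ?cabs_ge0 // invf_le1 ?side_ge1 //.
by apply: lt_le_trans (side_ge1 t).
Qed.

End Cauchy.

(** * Integration in the plane *)

Section PlaneMeasure.
Context {R : realType}.
Local Notation C := R[i].
Local Notation leb := (@lebesgue_measure R).
Local Notation TR := (measurableTypeR R).
Local Notation T2 := (TR * TR)%type.

Definition pt (u : T2) : C := Complex u.1 u.2.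

Definition box_open (G : set T2) := forall u, G u -> exists2 de : R, 0 < de &
  forall v : T2, `|v.1 - u.1| < de -> `|v.2 - u.2| < de -> G v.

(** Around each of its points such a set contains a box with rational corners, so it is a countable
    union of boxes and belongs to the product sigma-algebra. *)
Lemma box_open_measurable (G : set T2) : box_open G -> measurable G.
Proof.
move=> oG.
pose box (q : rat * rat * rat * rat) : set T2 :=
  (`]ratr q.1.1.1, ratr q.1.1.2[ `*` `]ratr q.1.2, ratr q.2[)%classic.
pose F q : set T2 := if `[< box q `<=` G >] then box q else set0.
have -> : G = \bigcup_q F q.
  apply/seteqP; split => [u /oG [de de0 H]|u [q _]]; last first.
    by rewrite /F; case: asboolP => // + /=; exact.
  have [a1] := @rat_in_itvoo R (u.1 - de) u.1 (ltac:(rewrite gtrBl; exact: de0)).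
  have [b1] := @rat_in_itvoo R u.1 (u.1 + de) (ltac:(rewrite ltrDl; exact: de0)).
  have [a2] := @rat_in_itvoo R (u.2 - de) u.2 (ltac:(rewrite gtrBl; exact: de0)).
  have [b2] := @rat_in_itvoo R u.2 (u.2 + de) (ltac:(rewrite ltrDl; exact: de0)).
  rewrite !in_itv /= => /andP[B1 B2] /andP[A1 A2] /andP[B3 B4] /andP[A3 A4].
  exists (a1, b1, a2, b2) => //; rewrite /F.
  case: asboolP => [_|nb]; first by split; rewrite /= in_itv /= ?A4 ?A2 ?B3 ?B1.
  exfalso; apply: nb => v [/=]; rewrite !in_itv /= => /andP[v1 v2] /andP[v3 v4].
  by apply: H; rewrite ltr_norml; apply/andP; split; lra.
apply: countable_bigcupT_measurable; first exact: countableP.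
move=> q; rewrite /F; case: asboolP => _; last exact: measurable0.
by apply: measurableX; exact: measurable_itv.
Qed.

Lemma box_cont_measurable (D : set T2) (phi : T2 -> R) : box_open D ->
  (forall u, D u -> forall e : R, 0 < e -> exists2 de : R, 0 < de &
    forall v : T2, D v -> `|v.1 - u.1| < de -> `|v.2 - u.2| < de ->
      `|phi v - phi u| < e) ->
  measurable_fun D phi.
Proof.
move=> oD cphi; apply: (measurability _ (RGenOInfty.measurableE R)).
move=> /= _ [_ [a ->]] <-; apply: box_open_measurable => u [Du].
rewrite /= in_itv /= andbT => au.
have [d1 d10 H1] := oD u Du.
have e0 : 0 < phi u - a by rewrite subr_gt0.
have [d2 d20 H2] := cphi u Du _ e0.
exists (Num.min d1 d2); first by rewrite lt_min d10.
move=> v; rewrite !lt_min => /andP[v1 v2] /andP[v3 v4].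
have Dv := H1 v v1 v3; split => //=; rewrite in_itv /= andbT.
have := H2 v Dv v2 v4; rewrite ltr_norml => /andP[+ _]; lra.
Qed.

Lemma ptB u v : pt u - pt v = Complex (u.1 - v.1) (u.2 - v.2).
Proof. by []. Qed.

Lemma cabs_ptB u v (de : R) : `|v.1 - u.1| < de / 2 -> `|v.2 - u.2| < de / 2 ->
  cabs (pt v - pt u) < de.
Proof.
move=> h1 h2; rewrite ptB; apply: le_lt_trans (cabs_le_ReIm _) _ => /=; lra.
Qed.

Lemma box_open_setT : box_open setT.
Proof. by move=> u _; exists 1. Qed.

Definition Disc : set T2 := pt @^-1` disc.

Lemma box_open_Disc : box_open Disc.
Proof.
move=> u Du; have d0 : 0 < 1 - cabs (pt u) by rewrite subr_gt0; exact: Du.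
exists ((1 - cabs (pt u)) / 2); first by rewrite divr_gt0.
move=> v v1 v2; rewrite /Disc /preimage /mkset.
have -> : pt v = pt u + (pt v - pt u) by rewrite addrC subrK.
apply: (disc_ball Du); exact: cabs_ptB.
Qed.

Lemma measurable_Disc : measurable Disc.
Proof. exact: box_open_measurable box_open_Disc. Qed.

Lemma measurable_cabs_pt : measurable_fun setT (fun u : T2 => cabs (pt u)).
Proof.
apply: box_cont_measurable; first exact: box_open_setT.
move=> u _ e e0; exists (e / 2); first by rewrite divr_gt0.
move=> v _ v1 v2; have H := cabs_ptB v1 v2.
rewrite ltr_norml; apply/andP; split.
  by have := cabs_le_subD (pt u) (pt v); rewrite cabsB; lra.
by have := cabs_le_subD (pt v) (pt u); lra.
Qed.

Lemma measurable_analytic (f : C -> C) : analytic f ->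
  measurable_fun Disc (fun u : T2 => cabs (f (pt u))).
Proof.
move=> af; apply: box_cont_measurable; first exact: box_open_Disc.
move=> u Du e e0.
have [de de0 H] := cdiff_small (analytic_cdiff af Du) e0.
exists (de / 2); first by rewrite divr_gt0.
move=> v Dv v1 v2; have := H _ (cabs_ptB v1 v2).
rewrite [pt u + _]addrC subrK => {}H.
rewrite ltr_norml; apply/andP; split.
  by have := cabs_le_subD (f (pt u)) (f (pt v)); rewrite cabsB; lra.
by have := cabs_le_subD (f (pt v)) (f (pt u)); lra.
Qed.

Lemma affine_preimage_neg (a b c d : R) : a < 0 ->
  (fun x => a * x + b) @^-1` `]c, d]%classic = `[((d - b) / a), ((c - b) / a)[%classic.
Proof.
move=> a0; apply/seteqP; split => x /=; rewrite !in_itv /= => /andP[h1 h2].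
  rewrite ler_ndivrMr // ltr_ndivlMr //; apply/andP; split; lra.
move: h1 h2; rewrite ler_ndivrMr // ltr_ndivlMr // => h1 h2.
by apply/andP; split; lra.
Qed.

Lemma affine_preimage_pos (a b c d : R) : 0 < a ->
  (fun x => a * x + b) @^-1` `]c, d]%classic = `]((c - b) / a), ((d - b) / a)]%classic.
Proof.
move=> a0; apply/seteqP; split => x /=; rewrite !in_itv /= => /andP[h1 h2].
  rewrite ler_pdivlMr // ltr_pdivrMr //; apply/andP; split; lra.
move: h1 h2; rewrite ler_pdivlMr // ltr_pdivrMr // => h1 h2.
by apply/andP; split; lra.
Qed.

Local Open Scope ereal_scope.

(** By uniqueness of Lebesgue measure: |a| times the image measure under the affine map has the
    right value on half-open intervals. For a < 0 the preimage is closed on the other side, with the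
    same length. *)
Lemma leb_affine (phi : R -> \bar R) (a b : R) : a != 0%R ->
  measurable_fun setT phi -> (forall x, 0 <= phi x) ->
  \int[leb]_x phi (a * x + b)%R = (`|a|^-1)%:E * \int[leb]_x phi x.
Proof.
move=> a0 mphi phi0.
have na0 : (0 < `|a|)%R by rewrite normr_gt0.
pose T : TR -> TR := fun x => (a * x + b)%R.
have mT : measurable_fun setT T.
  apply: measurable_funD; last exact: measurable_cst.
  by apply: measurable_funM; [exact: measurable_cst|exact: measurable_id].
pose nu := mscale (NngNum (ltW na0)) (pushforward leb T).
have nuE (A : set TR) : measurable A -> leb A = nu mT A.
  move=> mA; apply: lebesgue_measure_unique => //= _ [[c d] /= cd <-].
  rewrite /nu /mscale /pushforward /=.
  move: a0; rewrite neq_lt => /orP[a0|a0].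
    rewrite /pushforward /T affine_preimage_neg //.
    rewrite !lebesgue_measure_itv /= !lte_fin ltr_nM2r ?invr_lt0 //.
    rewrite ltrD2r; case: ifPn => _; last by rewrite mule0.
    rewrite -EFinM ltr0_norm //; congr EFin; field; by rewrite lt_eqF.
  rewrite /pushforward /T affine_preimage_pos //.
  rewrite !lebesgue_measure_itv /= !lte_fin ltr_pM2r ?invr_gt0 //.
  rewrite ltrD2r; case: ifPn => _; last by rewrite mule0.
  rewrite -EFinM gtr0_norm //; congr EFin; field; by rewrite gt_eqF.
have -> : \int[leb]_x phi x = `|a|%:E * \int[leb]_x phi (a * x + b)%R.
  transitivity (\int[nu mT]_x phi x).
    by apply: eq_measure_integral => A mA _; exact: nuE.
  rewrite ge0_integral_mscale //=; congr (_ * _).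
  by rewrite ge0_integral_pushforward.
by rewrite muleA -EFinM mulVf ?gt_eqF // mul1e.
Qed.

Local Notation L2 := (leb \x leb).

Lemma plane_dilate (H : T2 -> \bar R) (t : R) : (0 < t)%R ->
  measurable_fun setT H -> (forall x, 0 <= H x) ->
  \int[L2]_u H (t * u.1, t * u.2)%R = (t^-1 ^+ 2)%:E * \int[L2]_u H u.
Proof.
move=> t0 mH H0.
have mT : measurable_fun setT (fun u : T2 => ((t * u.1)%R : TR, (t * u.2)%R : TR)).
  by apply: measurable_fun_pair; apply: measurable_funM => //; exact: measurable_cst.
have mH2 : measurable_fun setT (fun u : T2 => H (t * u.1, t * u.2)%R).
  exact: (measurableT_comp mH mT).
have mF : measurable_fun setT (fun x : TR => \int[leb]_y H (x, y)).
  exact: (measurable_fun_fubini_tonelli_F (m2 := leb) H mH H0).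
have mFx (x : TR) : measurable_fun setT (fun y => H (x, y)).
  by apply: measurable_fun_pair2.
have F0 (x : TR) : 0 <= \int[leb]_y H (x, y) by apply: integral_ge0 => y _; exact: H0.
rewrite (fubini_tonelli1 _ mH2) //= (fubini_tonelli1 _ mH) //= /fubini_F.
have E (x : R) : \int[leb]_y H ((t * x)%R, (t * y)%R) =
    (t^-1)%:E * \int[leb]_y H ((t * x)%R, y).
  have := @leb_affine (fun y => H ((t * x)%R, y)) t 0 (lt0r_neq0 t0) (mFx _) (fun y => H0 _).
  rewrite gtr0_norm // => <-; apply: eq_integral => y _; by rewrite addr0.
under eq_integral do rewrite /= E.
rewrite ge0_integralZl_EFin //; last 2 first.
- apply: (measurableT_comp mF).
  by apply: measurable_funM => //; exact: measurable_cst.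
- by rewrite invr_ge0 ltW.
have := @leb_affine (fun x => \int[leb]_y H (x, y)) t 0 (lt0r_neq0 t0) mF F0.
rewrite gtr0_norm // => E2.
under eq_integral => x _ do rewrite -[(t * x)%R]addr0.
by rewrite E2 muleA -EFinM expr2.
Qed.

Lemma FTC_Icc (F f : R -> R) (a b : R) : (a < b)%R ->
  (forall t, (a <= t <= b)%R -> {for t, continuous f}) ->
  (forall t, (a <= t <= b)%R -> is_derive t (1%R : R) F (f t)) ->
  \int[leb]_(t in `[a, b]) (f t)%:E = (F b - F a)%:E.
Proof.
move=> ab cf dF.
have dc t : (a <= t <= b)%R -> {for t, continuous F}.
  move=> /dF [D _]; apply: differentiable_continuous; exact/derivable1_diffP.
rewrite (@continuous_FTC2 R f F a b) //.
- apply: continuous_in_subspaceT => x.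
  by rewrite inE /= in_itv /=; exact: cf.
- split.
  + move=> x; rewrite in_itv /= => /andP[x0 x1].
    by have [] := dF x _; rewrite ?ltW.
  + by apply: cvg_at_right_filter; apply: dc; rewrite lexx ltW.
  + by apply: cvg_at_left_filter; apply: dc; rewrite lexx ltW.
- move=> x; rewrite in_itv /= => /andP[x0 x1].
  by rewrite derive1E; have [] := dF x _; rewrite ?ltW.
Qed.

Lemma is_derive_powR_shift (a e t : R) : (a < t)%R ->
  is_derive t (1%R : R) (fun x => (x - a) `^ e)%R (e * (t - a) `^ (e - 1))%R.
Proof.
move=> at1; have ta : (0 < t - a)%R by rewrite subr_gt0.
have D := is_derive1_powR e ta.
have D2 : is_derive t (1%R : R) (fun x : R => x - a)%R 1%R.
  have := is_deriveB (is_derive_id t (1%R : R)) (is_derive_cst a t (1%R : R)).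
  by rewrite subr0.
have := @is_derive1_comp R (fun x => x `^ e)%R (fun x => x - a)%R t _ _ D D2.
by rewrite mulr1.
Qed.

(** For e < 0 the integrand is singular at a, so ]a, 1] is exhausted by the intervals [c i, 1], on
    which the fundamental theorem applies, and monotone convergence concludes. The denominators i +
    2 keep c i strictly below 1. *)
Lemma integral_powR_le (a e : R) : (a < 1)%R -> (-1 < e)%R ->
  \int[leb]_(t in `]a, 1%R]) ((t - a) `^ e)%:E <= ((1 - a) `^ (e + 1) / (e + 1))%:E.
Proof.
move=> a1 e1; have e10 : (0 < e + 1)%R by lra.
have a10 : (0 < 1 - a)%R by lra.
pose c (i : nat) : R := (a + (1 - a) / i.+2%:R)%R.
have ci i : (a < c i < 1)%R.
  rewrite /c ltrDl divr_gt0 ?ltr0n //= -ltrBrDl ltr_pdivrMr ?ltr0n //.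
  by rewrite ltr_pMr // ltr1n.
pose F (i : nat) : set TR := `[c i, 1%R]%classic.
have FE : `]a, 1%R]%classic = \bigcup_i F i.
  apply/seteqP; split => t /=; rewrite in_itv /=.
    move=> /andP[at1 t1].
    have p : (0 < (t - a) / (1 - a))%R by rewrite divr_gt0 // subr_gt0.
    have [k] := ltr_add_invr p; rewrite add0r ltr_pdivlMr // => kH.
    exists k => //; rewrite /F /= in_itv /= t1 andbT /c -lerBrDl.
    apply: le_trans (ltW kH); rewrite mulrC; apply: ler_wpM2r; first exact: ltW.
    by rewrite lef_pV2 ?posrE ?ltr0n // ler_nat.
  move=> [k _]; rewrite /F /= in_itv /= => /andP[h1 ->]; rewrite andbT.
  by have /andP[h2 _] := ci k; exact: lt_le_trans h1.
have ndF : {homo F : n m / (n <= m)%N >-> (n <= m)%O}.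
  move=> n m nm; apply/subsetPset => t; rewrite /F /= !in_itv /= => /andP[h ->].
  rewrite andbT; apply: le_trans h; rewrite /c lerD2l ler_wpM2l //; first exact: ltW.
  by rewrite lef_pV2 ?posrE ?ltr0n // ler_nat.
have mFi i : measurable (F i) by exact: measurable_itv.
have mf (D : set TR) : measurable_fun D (fun t : TR => ((t - a) `^ e)%:E).
  apply/measurable_EFinP; apply: measurable_funTS.
  apply: (measurableT_comp (measurable_powR e)).
  by apply: measurable_funB => //; exact: measurable_cst.
rewrite FE.
have cv := @ge0_nondecreasing_set_cvg_integral _ TR R F (fun t => ((t - a) `^ e)%:E) leb ndF
   mFi (fun i => mf _) (fun i x _ => powR_ge0 _ _).
rewrite -(cvg_lim _ cv) //; apply: lime_le; first by apply/cvg_ex; eexists; exact: cv.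
apply: nearW => i; have /andP[ci1 ci2] := ci i.
have -> : \int[leb]_(t in F i) ((t - a) `^ e)%:E =
    ((1 - a) `^ (e + 1) / (e + 1) - (c i - a) `^ (e + 1) / (e + 1))%:E; last first.
  by rewrite lee_fin lerBlDr lerDl divr_ge0 ?powR_ge0 // ltW.
apply: (@FTC_Icc (fun t => (t - a) `^ (e + 1) / (e + 1))%R).
- exact: ci2.
- move=> t /andP[h1 h2]; have := is_derive_powR_shift e (lt_le_trans ci1 h1).
  by case=> D _; apply: differentiable_continuous; exact/derivable1_diffP.
- move=> t /andP[h1 h2]; have := is_derive_powR_shift (e + 1) (lt_le_trans ci1 h1).
  move=> D; have := is_deriveM D (is_derive_cst (e + 1)^-1%R t (1%R : R)).
  rewrite /GRing.scale /= mulr0 add0r addrK mulrA mulVf ?gt_eqF // mul1r.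
  exact.
Qed.

Lemma integral_atan_le (x0 t : R) : (0 < t)%R ->
  \int[leb]_(x in `[(-1)%R, 1%R]) ((t ^+ 2 + (x - x0) ^+ 2)^-1)%:E <= (pi / t)%:E.
Proof.
move=> t0; have t20 : (0 < t ^+ 2)%R by rewrite exprn_gt0.
have pos x : (0 < t ^+ 2 + (x - x0) ^+ 2)%R by rewrite ltr_pwDl // sqr_ge0.
have -> : \int[leb]_(x in `[(-1)%R, 1%R]) ((t ^+ 2 + (x - x0) ^+ 2)^-1)%:E =
    (atan ((1 - x0) / t) / t - atan ((-1 - x0) / t) / t)%:E; last first.
  rewrite lee_fin -mulrBl ler_pM2r ?invr_gt0 //.
  have := atan_ltpi2 ((1 - x0) / t); have := atan_gtNpi2 ((-1 - x0) / t).
  lra.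
apply: (@FTC_Icc (fun x => atan ((x - x0) / t) / t)%R).
- by lra.
- move=> x _; apply: continuousV; first by rewrite gt_eqF.
  apply: continuousD; first exact: cst_continuous.
  apply: (@continuous_comp R R R (fun y => y - x0)%R (fun y => y ^+ 2)%R).
    by apply: continuousB; [exact: cvg_id|exact: cst_continuous].
  exact: exprn_continuous.
- move=> x _.
  have D2 : is_derive x (1%R : R) (fun x : R => (x - x0) / t)%R t^-1%R.
    have D := is_deriveB (is_derive_id x (1%R : R)) (is_derive_cst x0 x (1%R : R)).
    have := is_deriveM D (is_derive_cst t^-1%R x (1%R : R)).
    by rewrite /GRing.scale /= subr0 mulr0 add0r mulr1.
  have D := @is_derive1_comp R atan (fun x => (x - x0) / t)%R x _ _ (is_derive1_atan _) D2.
  have := is_deriveM D (is_derive_cst t^-1%R x (1%R : R)).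
  rewrite /GRing.scale /= mulr0 add0r; congr is_derive.
  field; rewrite gt_eqF // ?gt_eqF //=.
Qed.

End PlaneMeasure.

(** * Convexity of powers and weighted Jensen inequality *)

Section PowerIneq.
Context {R : realType}.

(** The graph of x^q lies above its tangent at l. Young's inequality for the exponents q and q / (q
    - 1), applied to x and l^(q - 1), gives this without derivatives. *)
Lemma powR_tangent (q x l : R) : 1 <= q -> 0 <= x -> 0 <= l ->
  q * l `^ (q - 1) * x <= x `^ q + (q - 1) * l `^ q.
Proof.
move=> q1 x0 l0; have [->|qn1] := eqVneq q 1.
  by rewrite subrr powRr0 mul0r addr0 powRr1 // !mul1r.
have {qn1} q1' : 1 < q by rewrite lt_neqAle eq_sym qn1.
have q0 : 0 < q by lra.
have q2 : 0 < q / (q - 1) by rewrite divr_gt0 // subr_gt0.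
have nz1 : q != 0 by rewrite gt_eqF.
have nz2 : q - 1 != 0 by rewrite subr_eq0 gt_eqF.
have h1 : q^-1 + (q / (q - 1))^-1 = 1.
  by field; rewrite ?nz1 ?nz2.
have := conjugate_powR x0 (powR_ge0 l (q - 1)) q0 q2 h1.
rewrite -powRrM (_ : (q - 1) * (q / (q - 1)) = q); last first.
  by field; rewrite ?nz2.
rewrite -(ler_pM2l q0) mulrDr => h.
rewrite mulrC mulrCA.
apply: le_trans h _.
rewrite le_eqVlt; apply/orP; left; apply/eqP.
by field; rewrite ?nz1 ?nz2.
Qed.

Lemma powRDp (x a b : R) : 0 < x -> x `^ (a + b) = x `^ a * x `^ b.
Proof. by move=> x0; rewrite powRD //; apply/implyP => _; rewrite gt_eqF. Qed.

End PowerIneq.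

Section Jensen.
Local Open Scope ereal_scope.
Context d (T : measurableType d) {R : realType}.
Context (mu : {measure set T -> \bar R}).

(** Hoelder's inequality with a weight, obtained by integrating w times the tangent inequality at
    phi / w. Only a lower bound A of the integral of phi enters, so that integral may be
    infinite. *)
Lemma Jensen_weighted (D : set T) (phi w : T -> R) (W A q : R) :
  measurable D -> measurable_fun D phi -> measurable_fun D w ->
  (forall x, D x -> (0 <= phi x)%R) -> (forall x, D x -> (0 < w x)%R) ->
  (1 <= q)%R -> (0 < W)%R -> (0 <= A)%R ->
  \int[mu]_(x in D) (w x)%:E <= W%:E -> A%:E <= \int[mu]_(x in D) (phi x)%:E ->
  (A `^ q)%:E <= (W `^ (q - 1))%:E * \int[mu]_(x in D) (phi x `^ q * w x `^ (1 - q))%:E.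
Proof.
move=> mD mphi mw phi0 w0 q1 W0 A0 hW hA.
(* The tangent is taken at the ratio of the two bounds, the value that phi / w has in the case of
   equality. *)
pose l := (A / W)%R; have l0 : (0 <= l)%R by rewrite divr_ge0 // ltW.
set X := \int[mu]_(x in D) (phi x `^ q * w x `^ (1 - q))%:E.
have X0 : 0 <= X by apply: integral_ge0 => x _; rewrite lee_fin mulr_ge0 ?powR_ge0.
have mX : measurable_fun D (fun x => (phi x `^ q * w x `^ (1 - q))%R).
  apply: measurable_funM.
    exact: (measurableT_comp (measurable_powR q) mphi).
  exact: (measurableT_comp (measurable_powR (1 - q)) mw).
have k1 : (0 <= q * l `^ (q - 1))%R by rewrite mulr_ge0 ?powR_ge0 //; lra.
have k2 : (0 <= (q - 1) * l `^ q)%R by rewrite mulr_ge0 ?powR_ge0 // subr_ge0.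
have pw x : D x -> (q * l `^ (q - 1) * phi x <=
    phi x `^ q * w x `^ (1 - q) + (q - 1) * l `^ q * w x)%R.
  move=> Dx; have wx := w0 x Dx.
  have := @powR_tangent R q (phi x / w x) l q1 (divr_ge0 (phi0 x Dx) (ltW wx)) l0.
  rewrite -(ler_pM2l wx); congr (_ <= _)%R; first by field; rewrite gt_eqF.
  rewrite powRM ?invr_ge0 ?(ltW wx) ?phi0 // -powR_inv1 ?(ltW wx) // -powRrM mulN1r.
  rewrite (powRDp _ _ wx) powRr1 ?(ltW wx) //.
  by ring.
have main : (q * l `^ (q - 1))%:E * A%:E <= X + ((q - 1) * l `^ q)%:E * W%:E.
  apply: (@le_trans _ _ ((q * l `^ (q - 1))%:E * \int[mu]_(x in D) (phi x)%:E)).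
    by apply: lee_wpmul2l => //; rewrite lee_fin.
  rewrite -ge0_integralZl_EFin //; last exact/measurable_EFinP.
  apply: (@le_trans _ _ (\int[mu]_(x in D) ((phi x `^ q * w x `^ (1 - q))%:E +
      (((q - 1) * l `^ q)%:E * (w x)%:E)))).
    apply: ge0_le_integral => //.
    - by move=> x Dx; rewrite -EFinM lee_fin mulr_ge0 // phi0.
    - apply/measurable_EFinP; apply: measurable_funM => //; exact: measurable_cst.
    - apply: emeasurable_funD; first exact/measurable_EFinP.
      apply/measurable_EFinP; apply: measurable_funM => //; exact: measurable_cst.
  rewrite ge0_integralD //; last 4 first.
  - by move=> x Dx; rewrite lee_fin mulr_ge0 ?powR_ge0.
  - exact/measurable_EFinP.
  - by move=> x Dx; rewrite -EFinM lee_fin mulr_ge0 // ltW // w0.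
  - by apply/measurable_EFinP; apply: measurable_funM => //; exact: measurable_cst.
  apply: leeD => //; rewrite ge0_integralZl_EFin //.
  - by apply: lee_wpmul2l => //; rewrite lee_fin.
  - by move=> x Dx; rewrite lee_fin ltW // w0.
  - exact/measurable_EFinP.
have lW : (l * W = A)%R by rewrite /l mulfVK // gt_eqF.
have lq : (l `^ q * W = l `^ (q - 1) * A)%R.
  by rewrite -(mulr_powRB1 l0 (lt_le_trans ltr01 q1)) -lW; ring.
have {main} : (l `^ (q - 1) * A)%:E <= X.
  move: main; case: X X0 => [x x0|_ _|//]; last by rewrite leey.
  rewrite -!EFinM -EFinD !lee_fin => h.
  have : (q * l `^ (q - 1) * A <= x + (q - 1) * (l `^ q * W))%R.
    by rewrite mulrA.
  rewrite lq; lra.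
move=> h; have W1 : (0 < W `^ (q - 1))%R by exact: powR_gt0.
apply: (@le_trans _ _ ((W `^ (q - 1))%:E * (l `^ (q - 1) * A)%:E)); last first.
  by apply: lee_wpmul2l => //; rewrite lee_fin ltW.
rewrite -EFinM lee_fin mulrA -powRM ?(ltW W0) // [(W * l)%R]mulrC lW.
by rewrite [(_ * A)%R]mulrC mulr_powRB1 // (lt_le_trans ltr01 q1).
Qed.

Lemma ge0_integralDT (f g : T -> \bar R) : (forall x, 0 <= f x) -> (forall x, 0 <= g x) ->
  measurable_fun setT f -> measurable_fun setT g ->
  \int[mu]_x (f x + g x) = \int[mu]_x f x + \int[mu]_x g x.
Proof. by move=> f0 g0 mf mg; apply: ge0_integralD. Qed.

Lemma measurable_le_set (D : set T) (f g : T -> R) : measurable D -> measurable_fun D f -> measurable_fun D g ->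
  measurable (D `&` [set x | (f x <= g x)%R]).
Proof.
move=> mD mf mg.
rewrite (_ : D `&` _ = D `&` (fun x => (g x - f x)%R) @^-1` `[0%R, +oo[%classic).
  by apply: (measurable_funB mg mf mD); exact: measurable_itv.
by apply/seteqP; split=> x [Dx] /=; rewrite in_itv /= andbT subr_ge0.
Qed.

Lemma measurable_lt_set (D : set T) (f g : T -> R) : measurable D -> measurable_fun D f -> measurable_fun D g ->
  measurable (D `&` [set x | (f x < g x)%R]).
Proof.
move=> mD mf mg.
rewrite (_ : D `&` _ = D `&` (fun x => (g x - f x)%R) @^-1` `]0%R, +oo[%classic).
  by apply: (measurable_funB mg mf mD); exact: measurable_itv.
by apply/seteqP; split=> x [Dx] /=; rewrite in_itv /= andbT subr_gt0.
Qed.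

End Jensen.

(** * The mean value inequality for |f|^p *)

Section MeanValue.
Context {R : realType}.
Local Notation C := R[i].
Local Notation leb := (@lebesgue_measure R).
Local Notation TR := (measurableTypeR R).
Local Notation T2 := (TR * TR)%type.
Local Notation L2 := (leb \x leb)%E.

Lemma pt_eta (c : C) : pt (complex.Re c, complex.Im c) = c.
Proof. by case: c. Qed.

Lemma measurable_cabs_ptB d (T : measurableType d) (a b : T -> T2) :
  measurable_fun setT a -> measurable_fun setT b ->
  measurable_fun setT (fun x => cabs (pt (a x) - pt (b x))).
Proof.
move=> ma mb.
have m1 := measurableT_comp measurable_fst ma; have m2 := measurableT_comp measurable_snd ma.
have m3 := measurableT_comp measurable_fst mb; have m4 := measurableT_comp measurable_snd mb.
have m : measurable_fun setT (fun x => (((a x).1 - (b x).1)%R : TR, ((a x).2 - (b x).2)%R : TR)).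
  by apply: measurable_fun_pair; exact: measurable_funB.
exact: (measurableT_comp (@measurable_cabs_pt R) m).
Qed.

Lemma measurable_cabs_sub (c : C) : measurable_fun setT (fun u : T2 => cabs (pt u - c)).
Proof.
rewrite -(pt_eta c); apply: measurable_cabs_ptB => //.
Qed.

Definition cball (c : C) (r : R) : set T2 := [set u | cabs (pt u - c) <= r].

Lemma measurable_cball c r : measurable (cball c r).
Proof.
rewrite -[cball c r]setTI; apply: measurable_le_set => //; exact: measurable_cabs_sub.
Qed.

Lemma cball_Disc c (r : R) : cabs c + r < 1 -> cball c r `<=` Disc.
Proof.
move=> cr u; rewrite /cball /= => h; rewrite /Disc /preimage /disc /mkset.
have := cabs_le_normD c (pt u - c); rewrite addrC subrK; lra.
Qed.

Lemma measurable_analytic_powR (f : C -> C) (p : R) (D : set T2) : analytic f -> measurable D ->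
  D `<=` Disc -> measurable_fun D (fun u : T2 => cabs (f (pt u)) `^ p).
Proof.
move=> af mD DD; apply: (measurableT_comp (measurable_powR p)).
apply: (measurable_funS _ DD); first exact: measurable_Disc.
exact: measurable_analytic.
Qed.

Lemma measurable_erestrict d (T : measurableType d) (D : set T) (h : T -> \bar R) :
  measurable D -> measurable_fun D h -> measurable_fun setT (h \_ D).
Proof. by move=> mD; exact: (measurable_restrictT _ mD).1. Qed.

Lemma pt_sqpt c (s t : R) :
  [/\ sqpt c s 0 t = pt (complex.Re c + s, 2 * s * t + (complex.Im c - s)),
      sqpt c s 1 t = pt (- (2 * s) * t + (complex.Re c + s), complex.Im c + s),
      sqpt c s 2 t = pt (complex.Re c - s, - (2 * s) * t + (complex.Im c + s)) &
      sqpt c s 3 t = pt (2 * s * t + (complex.Re c - s), complex.Im c - s)].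
Proof.
rewrite /sqpt /side /pt; case: c => c1 c2; split; apply/eqP; rewrite eq_complex /=;
  apply/andP; split; apply/eqP; ring.
Qed.

Local Open Scope ereal_scope.

Lemma rint_le_integral (phi : R -> R) (Phi : R -> \bar R) (p : R) : (1 <= p)%R ->
  rcont phi -> (forall t, (0 <= phi t)%R) -> measurable_fun [set: TR] Phi ->
  (forall t, 0 <= Phi t) ->
  (forall t, (0 <= t <= 1)%R -> (phi t `^ p)%:E = Phi t) ->
  (rint phi `^ p)%:E <= \int[leb]_t Phi t.
Proof.
move=> p1 cphi phi0 mPhi Phi0 E.
have iphi := rcont_integrable cphi.
have mphi : measurable_fun (`[0%R, 1%R]%classic : set TR) phi.
  by apply/measurable_EFinP; exact: (measurable_int leb iphi).
apply: (@le_trans _ _ (\int[leb]_(t in `[0%R, 1%R]) (phi t `^ p * 1 `^ (1 - p))%:E)).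
  have := @Jensen_weighted _ TR R leb `[0%R, 1%R]%classic phi (fun=> 1%R) 1 (rint phi) p.
  rewrite powR1 mul1e; apply=> //.
  - by apply: Rintegral_ge0 => t _; exact: phi0.
  - by rewrite integral_cst //= lebesgue_measure_itv /= lte_fin ltr01 oppr0 adde0 mule1.
  - rewrite /rint /Rintegral fineK //.
    by apply: integrable_fin_num.
rewrite (@eq_integral _ TR R leb _ Phi); last first.
  by move=> t; rewrite inE /= in_itv /= => t01; rewrite powR1 mulr1 E.
by apply: ge0_subset_integral => //.
Qed.

(** Jensen's inequality on [0, 1] moves the power inside; the affine change of variable then
    replaces the side, of length 2 s >= rho, by the whole line that contains it. *)
Lemma side_le_slice (f : C -> C) (p rho s : R) c j (Phi : R -> \bar R) (a b : R) :
  (1 <= p)%R -> analytic f -> (0 < s)%R -> (rho / 2 <= s)%R -> (0 < rho)%R ->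
  (cabs c + 2 * s < 1)%R -> `|a|%R = (2 * s)%R ->
  measurable_fun [set: TR] Phi -> (forall t, 0 <= Phi t) ->
  (forall t, (0 <= t <= 1)%R -> (cabs (f (sqpt c s j t)) `^ p)%:E = Phi (a * t + b)%R) ->
  (rint (fun t => cabs (f (sqpt c s j t))) `^ p)%:E <= (rho^-1)%:E * \int[leb]_t Phi t.
Proof.
move=> p1 af s0 rs rho0 cs ha mPhi Phi0 E.
have a0 : (a != 0)%R by rewrite -normr_gt0 ha mulr_gt0.
have mab : measurable_fun [set: TR] (fun t : TR => (a * t + b)%R : TR).
  by apply: measurable_funD => //; apply: measurable_funM => //; exact: measurable_cst.
apply: (@le_trans _ _ (\int[leb]_t Phi (a * t + b)%R)).
  apply: rint_le_integral => //.
  - exact: (ccont_cabs (analytic_ointcont af s0 cs j)).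
  - by move=> t; exact: cabs_ge0.
  - exact: (measurableT_comp mPhi mab).
rewrite (leb_affine b a0 mPhi Phi0) ha; apply: lee_wpmul2r.
  by apply: integral_ge0 => t _.
rewrite lee_fin lef_pV2 ?posrE ?mulr_gt0 //; lra.
Qed.

Lemma le_sum4 (a b c d : \bar R) : 0 <= a -> 0 <= b -> 0 <= c -> 0 <= d ->
  [/\ a <= a + b + c + d, b <= a + b + c + d, c <= a + b + c + d & d <= a + b + c + d].
Proof.
move=> a0 b0 c0 d0; split.
- by apply: le_trans (leeDl _ d0); apply: le_trans (leeDl _ c0); exact: leeDl.
- by apply: le_trans (leeDl _ d0); apply: le_trans (leeDl _ c0); exact: leeDr.
- by apply: le_trans (leeDl _ d0); apply: leeDr; exact: adde_ge0.
- by apply: leeDr; apply: adde_ge0 => //; exact: adde_ge0.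
Qed.

(** The Cauchy formula is averaged over the squares of half side between [rho / 2] and [rho]. *)
Lemma mean_value_powR (f : C -> C) (p rho : R) c : (1 <= p)%R -> analytic f ->
  (0 < rho)%R -> (cabs c + 2 * rho < 1)%R ->
  (cabs (f c) `^ p)%:E <= (8 * 4 `^ p / rho ^+ 2)%:E *
    \int[L2]_(u in cball c (2 * rho)) (cabs (f (pt u)) `^ p)%:E.
Proof.
move=> p1 af rho0 crho.
set B := cball c (2 * rho).
have mB : measurable B by exact: measurable_cball.
have BD : B `<=` Disc by exact: cball_Disc.
pose Psi := (fun u : T2 => (cabs (f (pt u)) `^ p)%:E) \_ B.
have mPsi : measurable_fun setT Psi.
  apply: measurable_erestrict => //; apply/measurable_EFinP.
  exact: measurable_analytic_powR.
have Psi0 u : 0 <= Psi u.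
  by rewrite /Psi patchE; case: ifP => _ //; rewrite lee_fin powR_ge0.
pose G (x : TR) := \int[leb]_y Psi (x, y).
pose H (y : TR) := \int[leb]_x Psi (x, y).
have mG : measurable_fun setT G.
  exact: (measurable_fun_fubini_tonelli_F (m2 := leb) Psi mPsi Psi0).
have mH : measurable_fun setT H.
  exact: (measurable_fun_fubini_tonelli_G (m1 := leb) Psi mPsi Psi0).
have G0 x : 0 <= G x by apply: integral_ge0 => y _.
have H0 x : 0 <= H x by apply: integral_ge0 => y _.
rewrite integral_mkcond -/Psi; set I := \int[L2]_u Psi u.
have IG : \int[leb]_x G x = I by rewrite /I (fubini_tonelli1 _ mPsi).
have IH : \int[leb]_x H x = I by rewrite /I (fubini_tonelli2 _ mPsi).
have mslice1 (x : TR) : measurable_fun setT (fun y : TR => Psi (x, y)).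
  exact: (measurable_fun_pair2 x mPsi).
have mslice2 (y : TR) : measurable_fun setT (fun x : TR => Psi (x, y)).
  exact: (measurable_fun_pair1 y mPsi).
have GE x : G x = \int[leb]_y Psi (x, y); first exact: erefl.
have HE y : H y = \int[leb]_x Psi (x, y); first exact: erefl.
have I0 : 0 <= I by apply: integral_ge0 => u _.
clearbody G H I.
set c1 := complex.Re c; set c2 := complex.Im c.
(* Sum of the integrals of [Psi] over the four lines carrying the sides of the square of half side
   s. As s varies, each of the four lines sweeps the plane, whence the total 4 I. *)
pose K (s : R) := G (1 * s + c1)%R + G (-1 * s + c1)%R + H (1 * s + c2)%R + H (-1 * s + c2)%R.
have K0 s : 0 <= K s.
  by apply: adde_ge0 => //; apply: adde_ge0 => //; exact: adde_ge0.
have key s : (rho / 2 <= s <= rho)%R ->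
    (cabs (f c) `^ p)%:E <= (4 `^ p / rho)%:E * K s.
  move=> /andP[s1 s2]; have s0 : (0 < s)%R by apply: lt_le_trans s1; rewrite divr_gt0.
  have cs : (cabs c + 2 * s < 1)%R by lra.
  have PE j (t : R) : (0 <= t <= 1)%R -> forall u : T2, sqpt c s j t = pt u ->
      (cabs (f (sqpt c s j t)) `^ p)%:E = Psi u.
    move=> t01 u E; rewrite /Psi patchE mem_set ?E //.
    rewrite /B /cball /= -/(pt u) -E cabs_sqpt //.
    have := side_le2 t01; have := side_ge1 t => h1 h2.
    apply: (@le_trans _ _ (s * 2)%R); first by apply: ler_wpM2l => //; exact: ltW.
    lra.
  (* One of the four sides carries at least a quarter of |f(c)|; this is the origin of 4^p. *)
  have [j j4 Hr] : exists2 j, (j < 4)%N &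
      (cabs (f c) <= 4 * rint (fun t => cabs (f (sqpt c s j t))))%R.
    apply: contrapT => nj.
    have {}nj j : (j < 4)%N -> (rint (fun t => cabs (f (sqpt c s j t))) < cabs (f c) / 4)%R.
      move=> j4; rewrite ltNge; apply/negP => h; apply: nj; exists j => //.
      by move: h; rewrite ler_pdivrMr // mulrC.
    pose r j := rint (fun t => cabs (f (sqpt c s j t))).
    have {}nj j : (j < 4)%N -> (r j < cabs (f c) / 4)%R by exact: nj.
    have h : (cabs (f c) <= r 0%N + (r 1%N + (r 2%N + r 3%N)))%R.
      by have := Cauchy_mean af s0 cs; rewrite !big_ord_recl big_ord0 addr0.
    have := nj 0%N isT; have := nj 1%N isT; have := nj 2%N isT; have := nj 3%N isT.
    by move: h; move: (r 0%N) (r 1%N) (r 2%N) (r 3%N) => r0 r1 r2 r3; lra.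
  have Hj A : (rint (fun t => cabs (f (sqpt c s j t))) `^ p)%:E <= (rho^-1)%:E * A ->
      A <= K s -> (cabs (f c) `^ p)%:E <= (4 `^ p / rho)%:E * K s.
    move=> h1 h2.
    apply: (@le_trans _ _ ((4 `^ p)%:E * (rint (fun t => cabs (f (sqpt c s j t))) `^ p)%:E)).
      have r0 : (0 <= rint (fun t => cabs (f (sqpt c s j t))))%R.
        by apply: Rintegral_ge0 => t _; exact: cabs_ge0.
      rewrite -EFinM lee_fin -powRM // ge0_ler_powR // ?nnegrE ?cabs_ge0 ?mulr_ge0 //.
      by apply: le_trans p1.
    rewrite EFinM -muleA; apply: lee_wpmul2l; first by rewrite lee_fin powR_ge0.
    apply: le_trans h1 _; apply: lee_wpmul2l => //.
    by rewrite lee_fin invr_ge0 ltW.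
  have n2s : `|2 * s|%R = (2 * s)%R by rewrite gtr0_norm // mulr_gt0.
  have n2s' : `|- (2 * s)|%R = (2 * s)%R by rewrite normrN.
  have st := @side_le_slice f p rho s c j _ _ _ p1 af s0 s1 rho0 cs.
  have [P0 P1 P2 P3] : [/\ G (1 * s + c1)%R <= K s, G (-1 * s + c1)%R <= K s,
      H (1 * s + c2)%R <= K s & H (-1 * s + c2)%R <= K s].
    exact: le_sum4.
  case: j st Hj j4 PE Hr => [|[|[|[|//]]]] st Hj _ PE _.
  - apply: Hj P0; rewrite GE; apply: st n2s (mslice1 _) (fun t => Psi0 _) _ => t t01.
    apply: PE => //; have [-> _ _ _] := pt_sqpt c s t.
    by congr pt; congr pair; rewrite mul1r addrC.
  - apply: Hj P2; rewrite HE; apply: st n2s' (mslice2 _) (fun t => Psi0 _) _ => t t01.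
    apply: PE => //; have [_ -> _ _] := pt_sqpt c s t.
    by congr pt; congr pair; rewrite mul1r addrC.
  - apply: Hj P1; rewrite GE; apply: st n2s' (mslice1 _) (fun t => Psi0 _) _ => t t01.
    apply: PE => //; have [_ _ -> _] := pt_sqpt c s t.
    by congr pt; congr pair; rewrite mulN1r addrC.
  - apply: Hj P3; rewrite HE; apply: st n2s (mslice2 _) (fun t => Psi0 _) _ => t t01.
    apply: PE => //; have [_ _ _ ->] := pt_sqpt c s t.
    by congr pt; congr pair; rewrite mulN1r addrC.
have K3 s : 0 <= G (1 * s + c1)%R + G (-1 * s + c1)%R + H (1 * s + c2)%R /\
    0 <= G (1 * s + c1)%R + G (-1 * s + c1)%R.
  have h : 0 <= G (1 * s + c1)%R + G (-1 * s + c1)%R by exact: adde_ge0.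
  by split => //; exact: adde_ge0.
have maff (a b : R) (P : TR -> \bar R) : measurable_fun setT P ->
    measurable_fun setT (fun s : TR => P (a * s + b)%R).
  move=> mP; apply: (measurableT_comp mP).
  by apply: measurable_funD => //; apply: measurable_funM => //; exact: measurable_cst.
have mK : measurable_fun [set: TR] K.
  by apply: emeasurable_funD; [apply: emeasurable_funD; [apply: emeasurable_funD|]|]; exact: maff.
have intK : \int[leb]_s K s = 4%:E * I.
  have m1 := maff 1%R c1 G mG; have m2 := maff (-1)%R c1 G mG.
  have m3 := maff 1%R c2 H mH; have m4 := maff (-1)%R c2 H mH.
  rewrite /K ge0_integralDT; [|by move=> s; have [] := K3 s|by []|by apply: emeasurable_funD => //; exact: emeasurable_funD|by []].
  rewrite ge0_integralDT; [|by move=> s; have [] := K3 s|by []|exact: emeasurable_funD|by []].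
  rewrite ge0_integralDT //.
  have n1 : (-1 != 0 :> R)%R by rewrite oppr_eq0 oner_eq0.
  rewrite (leb_affine c1 (oner_neq0 _) mG G0) (leb_affine c1 n1 mG G0).
  rewrite (leb_affine c2 (oner_neq0 _) mH H0) (leb_affine c2 n1 mH H0).
  rewrite normrN normr1 invr1 !mul1e IG IH.
  rewrite (_ : 4 = 1 + 1 + 1 + 1)%R; last by ring.
  by rewrite !EFinD !ge0_muleDl ?mul1e // ?lee_fin // ?addr_ge0.
(* [key] is integrated over [rho / 2, rho], of length rho / 2; on the right the range of s is then
   enlarged to the whole line. *)
have h : (rho / 2)%:E * (cabs (f c) `^ p)%:E <= (4 `^ p / rho)%:E * (4%:E * I).
  have -> : (rho / 2)%:E * (cabs (f c) `^ p)%:E =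
      \int[leb]_(s in `[(rho / 2)%R, rho]) (cabs (f c) `^ p)%:E.
    rewrite integral_cst //= lebesgue_measure_itv /= lte_fin.
    rewrite ifT; last by lra.
    by rewrite muleC -EFinD; congr (_ * _%:E); field.
  rewrite -intK -ge0_integralZl_EFin //; last first.
    by rewrite divr_ge0 ?powR_ge0 // ltW.
  have mcK : measurable_fun [set: TR] (fun s : TR => (4 `^ p / rho)%:E * K s).
    by apply: measurable_funeM.
  apply: (@le_trans _ _ (\int[leb]_(s in `[(rho / 2)%R, rho]) ((4 `^ p / rho)%:E * K s))).
    apply: ge0_le_integral => //.
    - by move=> s _; rewrite lee_fin powR_ge0.
    - exact: (measurable_funS measurableT (@subsetT _ _) mcK).
  apply: ge0_subset_integral => //.
  by move=> s _; rewrite mule_ge0 // lee_fin divr_ge0 ?powR_ge0 // ltW.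
have r2 : (0 < rho / 2)%R by rewrite divr_gt0.
rewrite -(@lee_pmul2l _ (rho / 2)%:E) ?lte_fin //.
apply: le_trans h _.
rewrite !muleA -!EFinM; apply: lee_wpmul2r => //.
by rewrite lee_fin le_eqVlt; apply/orP; left; apply/eqP; field; rewrite gt_eqF.
Qed.

End MeanValue.

(** * The weight 1 - |z| and dilations *)

Section Bergman.
Context {R : realType}.
Local Notation C := R[i].
Local Notation leb := (@lebesgue_measure R).
Local Notation TR := (measurableTypeR R).
Local Notation T2 := (TR * TR)%type.
Local Notation L2 := (leb \x leb)%E.
Implicit Types (f g F : C -> C) (u v : T2).

Lemma sigma_finite_L2 : sigma_finite [set: T2] L2.
Proof.
have /sigma_finiteP[F [TF ndF Foo]] := @sigma_finiteT _ _ _ leb.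
exists (fun n => F n `*` F n).
  rewrite -setXTT TF predeqE => -[x y]; split.
    move=> [/= [n _ Fnx] [k _ Gky]]; exists (maxn n k) => //; split.
    - by move: x Fnx; exact/subsetPset/ndF/leq_maxl.
    - by move: y Gky; exact/subsetPset/ndF/leq_maxr.
  by move=> [n _ []/= ? ?]; split; exists n.
move=> k; have [mF Fk] := Foo k.
split; first exact: measurableX.
by rewrite product_measure1E// lte_mul_pinfty// ge0_fin_numE.
Qed.

(** The sigma-finite structure of the product is not found by inference. *)
Definition L2s : {sigma_finite_measure set T2 -> \bar R} :=
  HB.pack_for (SigmaFiniteMeasure.type T2 R) L2 (Measure_isSigmaFinite.Build _ T2 R L2 sigma_finite_L2).

Definition om u : R := 1 - cabs (pt u).

Lemma om_gt0 u : Disc u -> 0 < om u.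
Proof. by move=> Du; rewrite subr_gt0; exact: Du. Qed.

Lemma om_le1 u : om u <= 1.
Proof. by rewrite gerBl cabs_ge0. Qed.

Lemma measurable_om : measurable_fun setT om.
Proof. by apply: measurable_funB; [exact: measurable_cst|exact: measurable_cabs_pt]. Qed.

Lemma measurable_om_powR e : measurable_fun setT (fun u => om u `^ e).
Proof. exact: (measurableT_comp (measurable_powR e) measurable_om). Qed.

Lemma powR_le2 (a b q : R) : 0 <= a -> 0 <= b -> 0 <= q ->
  (a + b) `^ q <= 2 `^ q * (a `^ q + b `^ q).
Proof.
move=> a0 b0 q0.
have h (x y : R) : 0 <= x -> 0 <= y -> x <= y -> (x + y) `^ q <= 2 `^ q * (x `^ q + y `^ q).
  move=> x0 y0 xy; apply: (@le_trans _ _ ((2 * y) `^ q)).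
    by apply: ge0_ler_powR; rewrite ?nnegrE ?addr_ge0 ?mulr_ge0 //; lra.
  by rewrite powRM // ler_wpM2l ?powR_ge0 // lerDr powR_ge0.
have [ab|/ltW ba] := leP a b; first exact: h.
by rewrite addrC [_ `^ q + _]addrC; exact: h.
Qed.

(** Valid for both signs of e, so a power of 1 - |z| can be treated as a constant on discs whose
    radius is a small multiple of 1 - |z|. *)
Lemma powR_lip (x y e : R) : 0 < x -> 0 < y -> x <= 2 * y -> y <= 2 * x ->
  x `^ e <= 2 `^ `|e| * y `^ e.
Proof.
move=> x0 y0 xy yx; have [e0|e0] := leP 0 e.
  rewrite ger0_norm // -powRM ?(ltW y0) //.
  by apply: ge0_ler_powR => //; rewrite nnegrE ltW ?mulr_gt0.
have ne : 0 <= - e by rewrite oppr_ge0 ltW.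
have h : y `^ (- e) <= 2 `^ (- e) * x `^ (- e).
  rewrite -powRM ?(ltW x0) //; apply: ge0_ler_powR => //.
  - by rewrite nnegrE ltW.
  - by rewrite nnegrE mulr_ge0 // ltW.
rewrite (powRN y e) (powRN x e) -[leLHS]div1r ler_pdivrMr ?powR_gt0 // in h.
by move: h; rewrite mulrAC ler_pdivlMr ?powR_gt0 // mul1r ltr0_norm.
Qed.

Local Open Scope ereal_scope.

Lemma area_cball_le (c : C) (r : R) : (0 <= r)%R -> L2 (cball c r) <= ((2 * r) ^+ 2)%:E.
Proof.
move=> r0.
have -> : ((2 * r) ^+ 2)%:E = L2 (`[(complex.Re c - r)%R, (complex.Re c + r)%R] `*`
    `[(complex.Im c - r)%R, (complex.Im c + r)%R])%classic.
  have E (x : R) : leb `[(x - r)%R, (x + r)%R] = (2 * r)%:E.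
    rewrite lebesgue_measure_itv /= lte_fin; case: ifPn => h.
      by rewrite -EFinD; congr EFin; ring.
    by have -> : r = 0%R; [lra|rewrite mulr0].
  by rewrite product_measure1E //= !E -EFinM expr2.
apply: le_measure; rewrite ?inE.
- exact: measurable_cball.
- by apply: measurableX; exact: measurable_itv.
- move=> u; rewrite /cball /= => h; split => /=; rewrite in_itv /=.
    have := le_trans (cabs_Re _) h; rewrite ReB /= ler_norml; lra.
  have := le_trans (cabs_Im _) h; rewrite ImB /= ler_norml; lra.
Qed.

Lemma area_Disc : L2 Disc <= 4%:E.
Proof.
apply: (@le_trans _ _ (L2 (cball (0 : C) (1 : R))%R)).
  apply: le_measure; rewrite ?inE; [exact: measurable_Disc|exact: measurable_cball|].
  by move=> u Du; rewrite /cball /mkset subr0; exact: ltW.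
have h := @area_cball_le (0 : C)%R 1%R ler01.
by apply: (le_trans h); rewrite lee_fin mulr1 expr2; lra.
Qed.

Lemma ge0_le_integralT d (T : measurableType d) (mu : {measure set T -> \bar R})
  (f g : T -> \bar R) : (forall x, 0 <= f x) -> measurable_fun setT f ->
  measurable_fun setT g -> (forall x, f x <= g x) ->
  \int[mu]_x f x <= \int[mu]_x g x.
Proof. by move=> f0 mf mg fg; apply: ge0_le_integral. Qed.

Lemma integralZT d (T : measurableType d) (mu : {measure set T -> \bar R})
  (f : T -> \bar R) (k : R) : (forall x, 0 <= f x) -> measurable_fun setT f ->
  (0 <= k)%R -> \int[mu]_x (k%:E * f x) = k%:E * \int[mu]_x f x.
Proof. by move=> f0 mf k0; apply: ge0_integralZl_EFin. Qed.

Definition sc (t : R) u : T2 := ((t * u.1)%R, (t * u.2)%R).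

Lemma pt_sc t u : pt (sc t u) = (t%:C * pt u)%R.
Proof. by apply/eqP; rewrite eq_complex /= !mul0r subr0 addr0 !eqxx. Qed.

Lemma cabs_sc t u : (0 <= t)%R -> cabs (pt (sc t u)) = (t * cabs (pt u))%R.
Proof. by move=> t0; rewrite pt_sc cabsM cabsR ger0_norm. Qed.

Lemma measurable_sc2 : measurable_fun setT (fun x : TR * T2 => sc x.1 x.2).
Proof.
apply: measurable_fun_pair; apply: measurable_funM => //.
  by apply: measurableT_comp => //; exact: measurable_snd.
by apply: measurableT_comp => //; exact: measurable_snd.
Qed.

Lemma measurable_sc t : measurable_fun setT (sc t).
Proof.
by apply: measurable_fun_pair; apply: measurable_funM => //; exact: measurable_cst.
Qed.

(** A Hardy-type exchange that raises the exponent by one. For fixed t put w = t u: since t - |w| =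
    t (1 - |u|), the weight becomes (t - |w|)^e up to 2^|e|, and the Jacobian t^-2 is at most 4. For
    fixed w, the integral of (t - |w|)^e over |w| < t <= 1 is at most (1 - |w|)^(e + 1) / (e +
    1). *)
Lemma dilate_Tonelli (e : R) (G : T2 -> \bar R) : (-1 < e)%R ->
  measurable_fun setT G -> (forall u, 0 <= G u) ->
  \int[leb]_(t in `[2^-1%R, 1%R]) \int[L2]_(u in Disc) (G (sc t u) * (om u `^ e)%:E)
  <= (4 * 2 `^ `|e| / (e + 1))%:E * \int[L2]_(u in Disc) (G u * (om u `^ (e + 1))%:E).
Proof.
move=> e1 mG G0; have e10 : (0 < e + 1)%R by lra.
pose S : set (TR * T2) := ((`[2^-1%R, 1%R]%classic `*` setT) `&`
  [set x | (cabs (pt x.2) < x.1)%R])%classic.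
have mS : measurable S.
  apply: measurable_lt_set.
  - by apply: measurableX => //; exact: measurable_itv.
  - apply: measurable_funTS; apply: (measurableT_comp (@measurable_cabs_pt R)).
    exact: measurable_snd.
  - by apply: measurable_funTS; exact: measurable_fst.
pose K : TR * T2 -> \bar R :=
  (fun x => G x.2 * ((x.1 - cabs (pt x.2)) `^ e)%:E) \_ S.
have mK : measurable_fun setT K.
  apply: measurable_erestrict => //; apply: measurable_funTS.
  apply: emeasurable_funM; first exact: (measurableT_comp mG measurable_snd).
  apply/measurable_EFinP; apply: (measurableT_comp (measurable_powR e)).
  apply: measurable_funB; first exact: measurable_fst.
  exact: (measurableT_comp (@measurable_cabs_pt R) measurable_snd).
have K0 x : 0 <= K x.
  by rewrite /K patchE; case: ifP => // _; rewrite mule_ge0 // lee_fin powR_ge0.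
have mKt (t : TR) : measurable_fun setT (fun u => K (t, u)).
  exact: (measurable_fun_pair2 t mK).
have mKw (w : T2) : measurable_fun setT (fun t => K (t, w)).
  exact: (measurable_fun_pair1 w mK).
have mGD : measurable_fun setT
    (fun x : TR * T2 => ((fun u => G (sc x.1 u) * (om u `^ e)%:E) \_ Disc) x.2).
  pose D' : set (TR * T2) := (setT `*` Disc)%classic.
  have mD' : measurable D' by apply: measurableX => //; exact: measurable_Disc.
  have -> : (fun x : TR * T2 => ((fun u => G (sc x.1 u) * (om u `^ e)%:E) \_ Disc) x.2)
      = (fun x => G (sc x.1 x.2) * (om x.2 `^ e)%:E) \_ D'.
    apply/funext => x; rewrite !patchE.
    suff -> : (x \in D') = (x.2 \in (Disc : set T2)) by [].
    apply/idP/idP; rewrite !inE; first by case.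
    by move=> Dx; split.
  apply: measurable_erestrict => //; apply: measurable_funTS.
  apply: emeasurable_funM; first exact: (measurableT_comp mG measurable_sc2).
  by apply/measurable_EFinP; exact: (measurableT_comp (measurable_om_powR e) measurable_snd).
have GD0 (x : TR * T2) : 0 <= ((fun u => G (sc x.1 u) * (om u `^ e)%:E) \_ Disc) x.2.
  by rewrite patchE; case: ifP => // _; rewrite mule_ge0 // lee_fin powR_ge0.
have c0 : (0 <= 4 * 2 `^ `|e|)%R by rewrite mulr_ge0 ?powR_ge0.
have step1 (t : R) : (2^-1 <= t <= 1)%R ->
    \int[L2]_(u in Disc) (G (sc t u) * (om u `^ e)%:E) <=
    (4 * 2 `^ `|e|)%:E * \int[L2]_w K (t, w).
  move=> /andP[t2 t1]; have t0 : (0 < t)%R by apply: lt_le_trans t2.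
  apply: (@le_trans _ _ (\int[L2]_u ((2 `^ `|e|)%:E * K (t, sc t u)))).
    rewrite integral_mkcond; apply: ge0_le_integralT.
    - by move=> u; exact: (GD0 (t, u)).
    - exact: (measurable_fun_pair2 t mGD).
    - apply: measurable_funeM; exact: (measurableT_comp (mKt t) (measurable_sc t)).
    - move=> u; rewrite patchE; case: ifPn => [|_]; last by rewrite mule_ge0 ?lee_fin ?powR_ge0.
      rewrite inE => Du; have ou := om_gt0 Du.
      have cE : cabs (pt (sc t u)) = (t * cabs (pt u))%R := cabs_sc u (ltW t0).
      have Su : S (t, sc t u).
        split; first by split => //; change (t \in `[2^-1%R, 1%R]); rewrite in_itv /= t2 t1.
        change (cabs (pt (sc t u)) < t)%R; rewrite cE gtr_pMr //.
      rewrite /K patchE mem_set //.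
      change (G (sc t u) * (om u `^ e)%:E <= (2 `^ `|e|)%:E *
        (G (sc t u) * ((t - cabs (pt (sc t u))) `^ e)%:E)); rewrite cE.
      rewrite muleCA; apply: lee_wpmul2l => //; rewrite -EFinM lee_fin.
      rewrite (_ : (t - t * cabs (pt u) = t * om u)%R); last by rewrite /om; ring.
      apply: powR_lip => //; first by rewrite mulr_gt0.
        by rewrite mulrA ler_peMl ?(ltW ou) //; lra.
      by apply: ler_pM => //; [exact: ltW|exact: ltW|lra].
  have mKs : measurable_fun setT (fun u => K (t, sc t u)).
    exact: (measurableT_comp (mKt t) (measurable_sc t)).
  rewrite (integralZT L2 (fun u => K0 (t, sc t u)) mKs (powR_ge0 _ _)).
  have -> := @plane_dilate R (fun w => K (t, w)) t t0 (mKt t) (fun w => K0 _).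
  rewrite muleA -EFinM; apply: lee_wpmul2r; first by apply: integral_ge0.
  rewrite lee_fin mulrC; apply: ler_wpM2r; first exact: powR_ge0.
  rewrite (_ : 4 = 2 ^+ 2)%R; last by ring.
  rewrite lerXn2r ?nnegrE ?invr_ge0 ?(ltW t0) //.
  by rewrite -[leRHS]invrK lef_pV2 ?posrE.
move: c0 step1; set c := (4 * 2 `^ `|e|)%R => c0 step1; clearbody c.
apply: (@le_trans _ _ (\int[leb]_t (c%:E * \int[L2]_w K (t, w)))).
  rewrite integral_mkcond; apply: ge0_le_integralT.
  - move=> t; rewrite patchE; case: ifP => // _; apply: integral_ge0 => u _.
    by rewrite mule_ge0 // lee_fin powR_ge0.
  - apply: measurable_erestrict; first exact: measurable_itv.
    apply: measurable_funTS.
    have mFG := measurable_fun_fubini_tonelli_F (m2 := L2s) _ mGD GD0.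
    by apply: (eq_measurable_fun _ _ mFG) => t _; rewrite /fubini_F [RHS]integral_mkcond.
  - apply: measurable_funeM.
    exact: (measurable_fun_fubini_tonelli_F (m2 := L2s) _ mK K0).
  - move=> t; rewrite patchE; case: ifPn => [|_].
      by rewrite inE /= in_itv /= => /step1.
    by rewrite mule_ge0 ?lee_fin //; apply: integral_ge0.
have mFK := measurable_fun_fubini_tonelli_F (m2 := L2s) _ mK K0.
rewrite (integralZT leb (fun t => integral_ge0 _ (fun w _ => K0 (t, w))) mFK c0).
rewrite (fubini_tonelli (m2 := L2s) _ mK K0).
rewrite [(c / _)%:E]EFinM -[leRHS]muleA.
apply: lee_wpmul2l => //.
have mGe : measurable_fun setT (fun u => G u * (om u `^ (e + 1))%:E).
  apply: emeasurable_funM => //; apply/measurable_EFinP; exact: measurable_om_powR.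
rewrite -ge0_integralZl_EFin //; last 4 first.
- exact: measurable_Disc.
- by move=> u _; rewrite mule_ge0 // lee_fin powR_ge0.
- exact: measurable_funTS.
- by rewrite invr_ge0 ltW.
rewrite [leRHS]integral_mkcond; apply: ge0_le_integralT.
- by move=> w; apply: integral_ge0.
- exact: (measurable_fun_fubini_tonelli_G (m1 := leb) _ mK K0).
- apply: measurable_erestrict; first exact: measurable_Disc.
  by apply: measurable_funTS; exact: measurable_funeM.
- move=> w; rewrite patchE; case: ifPn => [|nDw].
    rewrite inE => Dw; have w1 : (cabs (pt w) < 1)%R by exact: Dw.
    have mp : measurable_fun setT (fun t : TR => ((t - cabs (pt w)) `^ e)%:E).
      apply/measurable_EFinP; apply: (measurableT_comp (measurable_powR e)).
      by apply: measurable_funB => //; exact: measurable_cst.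
    apply: (@le_trans _ _ (G w * \int[leb]_(t in `]cabs (pt w), 1%R]) ((t - cabs (pt w)) `^ e)%:E)).
      rewrite -ge0_integralZl //; last 2 first.
      - exact: measurable_funTS.
      - by move=> t _; rewrite lee_fin powR_ge0.
      rewrite [leRHS]integral_mkcond; apply: ge0_le_integralT.
      - by move=> t; exact: K0.
      - exact: mKw.
      - apply: measurable_erestrict; first exact: measurable_itv.
        by apply: measurable_funTS; exact: measurable_funeM.
      - move=> t; rewrite /K !patchE; case: ifPn => [|_]; last first.
          by case: ifP => // _; rewrite mule_ge0 // lee_fin powR_ge0.
        rewrite inE => -[[/= + _] /= tw]; rewrite in_itv /= => /andP[_ t1].
        by rewrite mem_set //= in_itv /= tw t1.
    rewrite muleCA -EFinM; apply: lee_wpmul2l => //.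
    by apply: le_trans (integral_powR_le w1 e1) _; rewrite lee_fin mulrC.
  rewrite (_ : \int[leb]_t K (t, w) = 0) // integral0_eq // => t _.
  rewrite /K patchE memNset // => -[[/= + _] /= tw]; rewrite in_itv /= => /andP[_ t1].
  by move: nDw; rewrite notin_setE; apply; exact: lt_le_trans tw t1.
Qed.

(** Polar coordinates are avoided: [dilate_Tonelli] with G = 1 reduces to the exponent e + 1 > 0,
    where the integrand is at most 1 on a set of area at most 4. *)
Lemma integral_om_powR_le (e : R) : (-1 < e)%R ->
  exists2 M : R, (0 < M)%R & \int[L2]_(u in Disc) (om u `^ e)%:E <= M%:E.
Proof.
move=> e1; have e10 : (0 < e + 1)%R by lra.
have L : leb `[2^-1%R, 1%R] = (2^-1)%:E.
  rewrite lebesgue_measure_itv /= lte_fin ifT; last by lra.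
  by rewrite -EFinD; congr EFin; lra.
have c0 : (0 < 4 * 2 `^ `|e| / (e + 1))%R by rewrite divr_gt0 ?mulr_gt0 ?powR_gt0.
have h0 := dilate_Tonelli e1 (@measurable_cst _ _ T2 (\bar R) setT 1) (fun=> lee01).
move: c0 h0; set c := (4 * _ / _)%R => c0 h0; clearbody c.
set I := \int[L2]_(u in Disc) (om u `^ e)%:E.
set J := \int[L2]_(u in Disc) (om u `^ (e + 1))%:E.
have I0 : 0 <= I by apply: integral_ge0 => u _; rewrite lee_fin powR_ge0.
have h : \int[leb]_(t in `[2^-1%R, 1%R]) I <= c%:E * J.
  have -> : \int[leb]_(t in `[2^-1%R, 1%R]) I = \int[leb]_(t in `[2^-1%R, 1%R])
      \int[L2]_(u in Disc) (cst 1 (sc t u) * (om u `^ e)%:E).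
    by apply: eq_integral => t _; apply: eq_integral => u _; rewrite mul1e.
  have -> : J = \int[L2]_(u in Disc) (cst 1 u * (om u `^ (e + 1))%:E).
    by apply: eq_integral => u _; rewrite mul1e.
  exact: h0.
have J4 : J <= 4%:E.
  apply: le_trans area_Disc; rewrite -[leRHS]mul1e -integral_cst; last exact: measurable_Disc.
  apply: ge0_le_integral.
  - exact: measurable_Disc.
  - by move=> u _; rewrite lee_fin powR_ge0.
  - by apply/measurable_EFinP; apply: measurable_funTS; exact: measurable_om_powR.
  - exact: measurable_cst.
  - move=> u Du; have E1 : (1 `^ (e + 1) = 1 :> R)%R by rewrite powR1.
    rewrite lee_fin -[leRHS]E1.
    apply: ge0_ler_powR; rewrite ?nnegrE; [lra|exact/ltW/om_gt0|lra|exact: om_le1].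
clearbody I J; move: h; rewrite integral_cst; last exact: measurable_itv.
move=> h; exists (2 * (c * 4))%R; first by rewrite !mulr_gt0.
have h2 : I * (2^-1)%:E <= (c * 4)%:E.
  rewrite -L; apply: le_trans h _; rewrite EFinM; apply: lee_wpmul2l => //.
  by rewrite lee_fin ltW.
by move: h2; rewrite lee_pdivrMr // -EFinM [(_ * 2)%R]mulrC.
Qed.

End Bergman.

(** * Littlewood-Paley inequalities *)

Section LittlewoodPaley.
Context {R : realType}.
Local Notation C := R[i].
Local Notation leb := (@lebesgue_measure R).
Local Notation TR := (measurableTypeR R).
Local Notation T2 := (TR * TR)%type.
Local Notation L2 := (leb \x leb)%E.
Implicit Types (f g F : C -> C) (u v : T2).

Local Open Scope ereal_scope.

Section TonelliSet.
Context d1 d2 (T1 : measurableType d1) (T2 : measurableType d2).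
Context (m1 : {sigma_finite_measure set T1 -> \bar R}).
Context (m2 : {sigma_finite_measure set T2 -> \bar R}).
Context (D1 : set T1) (D2 : set T2) (f : T1 * T2 -> \bar R).
Context (mD1 : measurable D1) (mD2 : measurable D2).
Context (mf : measurable_fun setT f) (f0 : forall x, 0 <= f x).

Let h := f \_ (D1 `*` D2).

Let mh : measurable_fun setT h.
Proof. by apply: measurable_erestrict; [exact: measurableX|exact: measurable_funTS]. Qed.

Let h0 x : 0 <= h x.
Proof. by rewrite /h patchE; case: ifP. Qed.

Let sliceF x : \int[m2]_y h (x, y) = ((fun x => \int[m2]_(y in D2) f (x, y)) \_ D1) x.
Proof.
rewrite patchE; case: ifPn => xD.
  rewrite [RHS]integral_mkcond; apply: eq_integral => y _; rewrite /h !patchE in_setX /=.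
  by rewrite xD.
by apply: integral0_eq => y _; rewrite /h patchE in_setX /= (negbTE xD).
Qed.

Let sliceG y : \int[m1]_x h (x, y) = ((fun y => \int[m1]_(x in D1) f (x, y)) \_ D2) y.
Proof.
rewrite patchE; case: ifPn => yD.
  rewrite [RHS]integral_mkcond; apply: eq_integral => x _; rewrite /h !patchE in_setX /=.
  by rewrite yD andbT.
by apply: integral0_eq => x _; rewrite /h patchE in_setX /= (negbTE yD) andbF.
Qed.

Lemma Tonelli_set : \int[m1]_(x in D1) \int[m2]_(y in D2) f (x, y) =
  \int[m2]_(y in D2) \int[m1]_(x in D1) f (x, y).
Proof.
have := fubini_tonelli (m1 := m1) (m2 := m2) h mh h0.
under eq_integral do rewrite sliceF; rewrite -integral_mkcond => ->.
by under eq_integral do rewrite sliceG; rewrite -integral_mkcond.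
Qed.

Lemma measurable_Tonelli_G : measurable_fun setT (fun y => \int[m1]_(x in D1) f (x, y)).
Proof.
have m : measurable_fun setT (f \_ (D1 `*` setT)).
  by apply: measurable_erestrict; [exact: measurableX|exact: measurable_funTS].
have k0 x : 0 <= (f \_ (D1 `*` setT)) x by rewrite patchE; case: ifP.
apply: (eq_measurable_fun _ _ (measurable_fun_fubini_tonelli_G (m1 := m1) _ m k0)).
move=> y _; rewrite /fubini_G [RHS]integral_mkcond; apply: eq_integral => x _.
by rewrite !patchE in_setX in_setT andbT.
Qed.

End TonelliSet.

Lemma integralZD d (T : measurableType d) (mu : {measure set T -> \bar R}) D
  (f : T -> \bar R) (k : R) : measurable D -> (forall x, D x -> 0 <= f x) ->
  measurable_fun D f -> (0 <= k)%R ->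
  \int[mu]_(x in D) (k%:E * f x) = k%:E * \int[mu]_(x in D) f x.
Proof. by move=> mD f0 mf k0; apply: ge0_integralZl_EFin. Qed.

(** Up to constants, the [p]-th power of the norm of [A^p_e]: the weight is a power
    of [1 - |z|] instead of [1 - |z|^2]. *)
Definition Nrm (p e : R) f : \bar R :=
  \int[L2]_(u in Disc) (cabs (f (pt u)) `^ p * om u `^ e)%:E.

Lemma Nrm_ge0 p e f : 0 <= Nrm p e f.
Proof. by apply: integral_ge0 => u _; rewrite lee_fin mulr_ge0 ?powR_ge0. Qed.

Lemma measurable_Nrm p e f : analytic f ->
  measurable_fun Disc (fun u => (cabs (f (pt u)) `^ p * om u `^ e)%:E).
Proof.
move=> af; apply/measurable_EFinP; apply: measurable_funM.
  by apply: measurable_analytic_powR => //; exact: measurable_Disc.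
by apply: measurable_funTS; exact: measurable_om_powR.
Qed.

(** The relation between u and the points of its disc is almost symmetric: u lies in the disc of
    doubled parameter about v. This is what the exchange of integrals in [average_Tonelli] rests
    on. *)
Lemma om_ball u v (k : R) : Disc u -> (0 < k)%R -> (k <= 2^-1)%R ->
  cball (pt u) (k * om u) v ->
  [/\ Disc v, (om u <= 2 * om v)%R, (om v <= 2 * om u)%R & (cabs (pt u - pt v) <= 2 * k * om v)%R].
Proof.
move=> Du k0 k2 uv; have ou := om_gt0 Du.
have kou : (k * om u <= 2^-1 * om u)%R by rewrite ler_pM2r.
have d1 : (cabs (pt v - pt u) <= k * om u)%R by exact: uv.
have d2 := cabs_le_subD (pt v) (pt u); have d3 := cabs_le_subD (pt u) (pt v).
rewrite cabsB in d3.
have h1 : (om u <= 2 * om v)%R by move: d2 d3 d1 kou; rewrite /om; lra.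
split => //.
- by change (cabs (pt v) < 1)%R; move: h1 ou; rewrite /om; lra.
- by move: d2 d3 d1 kou; rewrite /om; lra.
- rewrite cabsB; apply: le_trans d1 _; rewrite [(2 * k)%R]mulrC -mulrA.
  by rewrite ler_pM2l.
Qed.

Lemma mean_value_om (p k : R) : (1 <= p)%R -> (0 < k)%R -> (k <= 2^-1)%R ->
  exists2 c : R, (0 < c)%R & forall f u, analytic f -> Disc u ->
  (cabs (f (pt u)) `^ p)%:E <= (c / om u ^+ 2)%:E *
    \int[L2]_(v in cball (pt u) (k * om u)) (cabs (f (pt v)) `^ p)%:E.
Proof.
move=> p1 k0 k2; exists (8 * 4 `^ p / (k / 2) ^+ 2)%R.
  by rewrite divr_gt0 ?mulr_gt0 ?powR_gt0 ?exprn_gt0 ?divr_gt0.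
move=> f u af Du; have ou := om_gt0 Du.
have r0 : (0 < k * om u / 2)%R by rewrite divr_gt0 ?mulr_gt0.
have h : (cabs (pt u) + 2 * (k * om u / 2) < 1)%R.
  have : (k * om u <= 2^-1 * om u)%R by rewrite ler_pM2r.
  by move: ou; rewrite /om; lra.
have := mean_value_powR p1 af r0 h.
rewrite (_ : (2 * (k * om u / 2) = k * om u)%R); last by field.
rewrite (_ : (8 * 4 `^ p / (k * om u / 2) ^+ 2 = 8 * 4 `^ p / (k / 2) ^+ 2 / om u ^+ 2)%R) //.
by move: ou r0 => ? ?; field; rewrite !gt_eqF.
Qed.

(** Mean value inequality on the disc of radius (1 - |z|) / 2, where the weight is comparable with
    its value at the centre; the area contributes 2 to the exponent and the weight contributes e. *)
Lemma point_bound (p e : R) : (1 <= p)%R ->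
  exists2 c : R, (0 < c)%R & forall f u, analytic f -> Disc u ->
  (cabs (f (pt u)) `^ p)%:E <= (c * om u `^ (- (2 + e)))%:E * Nrm p e f.
Proof.
move=> p1; have h0 : (0 < 2^-1 :> R)%R by rewrite invr_gt0.
have [c c0 H] := mean_value_om p1 h0 (lexx _).
exists (c * 2 `^ `|e|)%R; first by rewrite mulr_gt0 ?powR_gt0.
move=> f u af Du; have ou := om_gt0 Du.
have sB : cball (pt u) (2^-1 * om u) `<=` (Disc : set T2).
  by move=> v /(om_ball Du h0 (lexx _)) -[].
apply: le_trans (H f u af Du) _.
rewrite (_ : (c * 2 `^ `|e| * om u `^ (- (2 + e)))%:E =
   (c / om u ^+ 2)%:E * (2 `^ `|e| * om u `^ (- e))%:E); last first.
  rewrite -EFinM; congr EFin; rewrite opprD powRDp // (powRN _ 2) powR_mulrn ?(ltW ou) //.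
  by ring.
rewrite -muleA; apply: lee_wpmul2l.
  by rewrite lee_fin divr_ge0 ?ltW // exprn_gt0.
rewrite /Nrm -ge0_integralZl_EFin; last 4 first.
- exact: measurable_Disc.
- by move=> v _; rewrite lee_fin mulr_ge0 ?powR_ge0.
- exact: measurable_Nrm.
- by rewrite mulr_ge0 ?powR_ge0.
apply: (@le_trans _ _ (\int[L2]_(v in cball (pt u) (2^-1 * om u)%R)
   ((2 `^ `|e| * om u `^ (- e))%:E * (cabs (f (pt v)) `^ p * om v `^ e)%:E))).
  apply: ge0_le_integral.
  - exact: measurable_cball.
  - by move=> v _; rewrite lee_fin powR_ge0.
  - apply/measurable_EFinP; apply: measurable_analytic_powR => //; exact: measurable_cball.
  - apply: measurable_funeM; apply: measurable_funS (measurable_Nrm p e af) => //.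
    exact: measurable_Disc.
  - move=> v vB; have [Dv h1 h2 _] := om_ball Du h0 (lexx _) vB.
    have ov := om_gt0 Dv; rewrite -EFinM lee_fin.
    rewrite mulrCA ler_peMr ?powR_ge0 // powRN mulrAC ler_pdivlMr ?powR_gt0 // mul1r.
    exact: powR_lip.
apply: ge0_subset_integral => //.
- exact: measurable_cball.
- exact: measurable_Disc.
- by apply: measurable_funeM; exact: measurable_Nrm.
- by move=> v _; rewrite mule_ge0 // lee_fin mulr_ge0 ?powR_ge0.
Qed.

Lemma measurable_ray f u : analytic f -> Disc u ->
  measurable_fun (`[2^-1%R, 1%R]%classic : set TR) (fun t : TR => cabs (f (pt (sc t u)))).
Proof.
move=> af Du; apply: (measurable_comp (F := Disc)) (measurable_analytic af) _.
- exact: measurable_Disc.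
- move=> v [t /=]; rewrite in_itv /= => /andP[t2 t1] <-.
  change (cabs (pt (sc t u)) < 1)%R; rewrite cabs_sc; last by lra.
  apply: le_lt_trans (_ : cabs (pt u) < 1)%R; last exact: Du.
  by apply: ler_piMl => //; exact: cabs_ge0.
- by apply: measurable_funTS; apply: measurable_fun_pair; apply: measurable_funM => //; exact: measurable_cst.
Qed.

Lemma Disc_sc t u : Disc u -> (0 <= t <= 1)%R -> Disc (sc t u).
Proof.
move=> Du /andP[t0 t1]; change (cabs (pt (sc t u)) < 1)%R; rewrite cabs_sc //.
by apply: le_lt_trans (Du : (cabs (pt u) < 1)%R); apply: ler_piMl => //; exact: cabs_ge0.
Qed.

(** The radius is entered at z / 2 rather than at 0, so that the dilation factors stay in [1/2, 1],
    where their Jacobians are bounded. The factor 2 comes from reparametrizing [0, 1] by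
    [1/2, 1]. *)
Lemma radial_FTC F u : analytic F -> Disc u ->
  (cabs (F (pt u) - F (pt (sc 2^-1 u))))%:E <=
  2%:E * \int[leb]_(t in `[2^-1%R, 1%R]) (cabs (cderiv F (pt (sc t u))))%:E.
Proof.
move=> aF Du; set a := pt (sc _ u); set z := pt u; pose f := cderiv F.
have af : analytic f by exact: analytic_cderiv.
have da : disc a by apply: Disc_sc => //; lra.
have dz : disc z by exact: Du.
have aE : a = ((2^-1)%:C * z)%R by exact: pt_sc.
have e2 : ((2^-1)%:C = 2^-1 :> C)%R by rewrite fmorphV rmorph_nat.
have zaE : (z - a = (2^-1)%:C * z)%R by rewrite aE e2; field.
have lineE (s : R) : (a + s%:C * (z - a) = (2^-1 * s + 2^-1)%:C * z)%R.
  by rewrite zaE aE rmorphD rmorphM /=; ring.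
have c1 := analytic_segcont af da dz.
have <- : seg f a z = (F z - F a)%R.
  apply: (seg_FTC c1) => t t01; apply: analytic_cdiff => //.
  exact: disc_segment.
pose phi s : R := cabs (f (a + s%:C * (z - a)))%R.
have cphi : rcont phi by exact: (ccont_cabs c1).
have h1 : (cabs (seg f a z) <= rint phi)%R.
  rewrite /seg cabsM; apply: (@le_trans _ _ (2^-1 * (2 * rint phi))%R); last first.
    by rewrite mulrA mulVf // mul1r.
  apply: ler_pM; [exact: cabs_ge0|exact: cabs_ge0| |exact: (cint_le c1)].
  rewrite zaE cabsM cabsR ger0_norm ?invr_ge0 //; apply: ler_piMr; first by rewrite invr_ge0.
  exact: ltW.
apply: (@le_trans _ _ (rint phi)%:E); first by rewrite lee_fin.
pose psi : R -> \bar R := (fun t => (cabs (f (pt (sc t u))))%:E) \_ `[2^-1%R, 1%R].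
have mpsi : measurable_fun [set: TR] psi.
  apply: measurable_erestrict; first exact: measurable_itv.
  by apply/measurable_EFinP; exact: measurable_ray.
have psi0 t : 0 <= psi t.
  by rewrite /psi patchE; case: ifP => // _; rewrite lee_fin cabs_ge0.
have h20 : (2^-1 != 0 :> R)%R by rewrite invr_eq0.
have maff : measurable_fun [set: TR] (fun t : TR => (2^-1 * t + 2^-1)%R : TR).
  apply: measurable_funD; last exact: measurable_cst.
  by apply: measurable_funM => //; exact: measurable_cst.
have rr0 : (rint phi `^ 1 = rint phi)%R.
  apply: powRr1; apply: le_trans h1; exact: cabs_ge0.
rewrite -rr0.
apply: le_trans (rint_le_integral (lexx 1%R) cphi (fun t => cabs_ge0 _)
   (measurableT_comp mpsi maff) (fun t => psi0 _) _) _.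
  move=> t /andP[t0 t1]; rewrite powRr1 ?cabs_ge0 //.
  change ((phi t)%:E = psi (2^-1 * t + 2^-1)%R); rewrite /psi patchE mem_set; last first.
    by rewrite /= in_itv /=; lra.
  by rewrite /phi pt_sc lineE.
rewrite (leb_affine 2^-1%R h20 mpsi psi0) normrV ?unitfE // invrK ger0_norm //.
by rewrite /psi -integral_mkcond.
Qed.

Lemma is_derive_powR_rev (b e t : R) : (t < b)%R ->
  is_derive t (1%R : R) (fun x => (b - x) `^ e)%R (- (e * (b - t) `^ (e - 1)))%R.
Proof.
move=> at1; have ta : (0 < b - t)%R by rewrite subr_gt0.
have D := is_derive1_powR e ta.
have D2 : is_derive t (1%R : R) (fun x : R => b - x)%R (-1)%R.
  have := is_deriveB (is_derive_cst b t (1%R : R)) (is_derive_id t (1%R : R)).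
  by rewrite sub0r.
have := @is_derive1_comp R (fun x => x `^ e)%R (fun x => b - x)%R t _ _ D D2.
by rewrite mulrN1.
Qed.

Lemma continuous_powR_rev (b e t : R) : (t < b)%R ->
  {for t, continuous (fun x => (b - x) `^ e)%R}.
Proof.
move=> tb; have [D _] := is_derive_powR_rev e tb.
by apply: differentiable_continuous; apply/derivable1_diffP.
Qed.

Lemma integral_weight_le (o dl : R) : (0 < o)%R -> (0 < dl)%R ->
  \int[leb]_(t in `[2^-1%R, 1%R]) ((o + 1 - t) `^ (- (1 + dl)))%:E <= (o `^ (- dl) / dl)%:E.
Proof.
move=> o0 d0; have h21 : (2^-1 < 1 :> R)%R by lra.
have dn0 : dl != 0%R by rewrite gt_eqF.
pose G (t : R) := (dl^-1 * (o + 1 - t) `^ (- dl))%R.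
have -> : \int[leb]_(t in `[2^-1%R, 1%R]) ((o + 1 - t) `^ (- (1 + dl)))%:E =
   (G 1 - G 2^-1)%:E; last first.
  rewrite lee_fin /G addrK mulrC gerBl mulr_ge0 ?powR_ge0 // invr_ge0 ltW //.
apply: FTC_Icc => // t /andP[t2 t1]; first by apply: continuous_powR_rev; lra.
have tb : (t < o + 1)%R by lra.
have D := is_deriveZ (dl^-1)%R (is_derive_powR_rev (- dl) tb).
have -> : ((o + 1 - t) `^ (- (1 + dl)) = dl^-1 *: - (- dl * (o + 1 - t) `^ (- dl - 1)))%R.
  rewrite /GRing.scale /= opprD [(- 1 - dl)%R]addrC.
  by move: ((o + 1 - t) `^ _)%R => x; field.
exact: D.
Qed.

(** Hoelder's inequality along the radius, with the weight
    [(2 - |z| - t)^-(1 + dl)], which is comparable to [(1 - t |z|)^-(1 + dl)]. *)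
Lemma radial_Jensen (q dl : R) : (1 <= q)%R -> (0 < dl)%R ->
  exists2 c : R, (0 < c)%R & forall F u, analytic F -> Disc u ->
  (cabs (F (pt u) - F (pt (sc 2^-1 u))) `^ q)%:E <= (c * om u `^ (- (dl * (q - 1))))%:E *
  \int[leb]_(t in `[2^-1%R, 1%R])
    (cabs (cderiv F (pt (sc t u))) `^ q * om (sc t u) `^ ((1 + dl) * (q - 1)))%:E.
Proof.
move=> q1 d0; exists (2 `^ q * dl^-1 `^ (q - 1) * 2 `^ ((1 + dl) * (q - 1)))%R.
  by rewrite !mulr_gt0 ?powR_gt0 ?invr_gt0.
move=> F u aF Du; have o0 := om_gt0 Du; set o := om u in o0 *.
set A := cabs (F _ - F _)%R; have A0 : (0 <= A)%R by exact: cabs_ge0.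
pose f := cderiv F; have af : analytic f by exact: analytic_cderiv.
pose I : set TR := `[2^-1%R, 1%R]%classic.
have mI : measurable I by exact: measurable_itv.
pose phi (t : TR) : R := cabs (f (pt (sc t u))).
pose w (t : TR) : R := ((o + 1 - t) `^ (- (1 + dl)))%R.
have mphi : measurable_fun I phi by exact: measurable_ray.
have mb : measurable_fun setT (fun t : TR => (o + 1 - t)%R : TR).
  by apply: measurable_funB => //; exact: measurable_cst.
have mw : measurable_fun I w.
  by apply: measurable_funTS; exact: (measurableT_comp (measurable_powR _) mb).
have wp t : I t -> (0 < w t)%R.
  by rewrite /I /= in_itv /= => t1; apply: powR_gt0; lra.
have H : (A / 2)%:E <= \int[leb]_(t in I) (phi t)%:E.
  have := radial_FTC aF Du; rewrite -/A -lee_pdivrMl // => h.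
  by apply: le_trans h; rewrite -EFinM lee_fin mulrC.
have W0 : (0 < o `^ (- dl) / dl)%R by rewrite divr_gt0 ?powR_gt0.
have := Jensen_weighted mI mphi mw (fun t _ => cabs_ge0 _) wp q1 W0
  (divr_ge0 A0 (ler0n _ 2)) (integral_weight_le o0 d0) H.
move=> h.
have -> : (A `^ q)%:E = (2 `^ q)%:E * ((A / 2) `^ q)%:E.
  by rewrite -EFinM -powRM ?divr_ge0 // mulrC divfK.
rewrite -!mulrA EFinM -muleA; apply: lee_wpmul2l; first by rewrite lee_fin powR_ge0.
apply: (le_trans h).
have -> : ((o `^ (- dl) / dl) `^ (q - 1) = dl^-1 `^ (q - 1) * o `^ (- (dl * (q - 1))))%R.
  by rewrite powRM ?powR_ge0 ?invr_ge0 ?ltW // -powRrM mulNr mulrC.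
rewrite [X in _ <= X%:E * _](_ : _ = dl^-1 `^ (q - 1) * o `^ (- (dl * (q - 1))) *
  2 `^ ((1 + dl) * (q - 1)))%R; last by ring.
rewrite [X in _ <= X * _]EFinM -[leRHS]muleA; apply: lee_wpmul2l.
  by rewrite lee_fin mulr_ge0 ?powR_ge0.
have mos : measurable_fun setT (fun t : TR => om (sc t u)).
  apply: (measurableT_comp measurable_om).
  by apply: measurable_fun_pair; apply: measurable_funM => //; exact: measurable_cst.
have mR : measurable_fun I (fun t =>
    (cabs (f (pt (sc t u))) `^ q * om (sc t u) `^ ((1 + dl) * (q - 1)))%:E).
  apply/measurable_EFinP; apply: measurable_funM.
    exact: (measurableT_comp (measurable_powR q) mphi).
  by apply: measurable_funTS; exact: (measurableT_comp (measurable_powR _) mos).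
rewrite -ge0_integralZl_EFin //; last first.
  by move=> t _; rewrite lee_fin mulr_ge0 ?powR_ge0.
apply: ge0_le_integral => //.
- by move=> t _; rewrite lee_fin mulr_ge0 ?powR_ge0.
- apply/measurable_EFinP; apply: measurable_funM.
    exact: (measurableT_comp (measurable_powR q) mphi).
  exact: (measurableT_comp (measurable_powR _) mw).
- by apply: measurable_funeM.
- move=> t It; move: (It); rewrite /I /= in_itv /= => /andP[t2 t1].
  rewrite -EFinM lee_fin mulrCA; apply: ler_wpM2l; first exact: powR_ge0.
  have Ds : Disc (sc t u) by apply: Disc_sc => //; lra.
  have os := om_gt0 Ds.
  rewrite -powRM ?(ltW os) // /w -powRrM (_ : (- (1 + dl) * (1 - q) = (1 + dl) * (q - 1))%R); last by ring.
  apply: ge0_ler_powR; rewrite ?nnegrE.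
  + by rewrite mulr_ge0 // ?subr_ge0 // ltW // addr_gt0.
  + by lra.
  + by rewrite mulr_ge0 // ltW.
  (* With x = |z|, the claim 2 - x - t <= 2 (1 - t x) amounts to (1 - t) x + t (1 - x) >= 0. *)
  + rewrite /om cabs_sc; last by lra.
    have := cabs_ge0 (pt u); have := Du : (cabs (pt u) < 1)%R.
    rewrite /o /om; move: (cabs (pt u)) => x x1 x0.
    have : (0 <= (1 - t) * x)%R by rewrite mulr_ge0 // subr_ge0.
    have : (0 <= t * (1 - x))%R by rewrite mulr_ge0 // ?subr_ge0 ?(ltW x1) //; lra.
    nra.
Qed.

Lemma Nrm_scale p e f : analytic f -> forall c : R, (0 <= c)%R ->
  \int[L2]_(u in Disc) (c * (cabs (f (pt u)) `^ p * om u `^ e))%:E = c%:E * Nrm p e f.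
Proof.
move=> af c c0; rewrite /Nrm -ge0_integralZl_EFin //.
- exact: measurable_Disc.
- by move=> u _; rewrite lee_fin mulr_ge0 ?powR_ge0.
- exact: measurable_Nrm.
Qed.

Lemma powR_le_root (a y q : R) : (0 <= a -> 0 < q -> a `^ q <= y -> a <= y `^ q^-1)%R.
Proof.
move=> a0 q0 h; rewrite -[leLHS](powRr1 a0) -(mulfV (lt0r_neq0 q0)) powRrM.
apply: ge0_ler_powR; rewrite ?nnegrE ?invr_ge0 ?powR_ge0 ?(ltW q0) //.
by apply: le_trans h; exact: powR_ge0.
Qed.

Lemma powR_neg_anti (x y e : R) : (0 < x -> x <= y -> 0 <= e -> y `^ (- e) <= x `^ (- e))%R.
Proof.
move=> x0 xy e0; have y0 := lt_le_trans x0 xy.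
rewrite !(powRN _ e) lef_pV2 ?posrE ?powR_gt0 //.
by apply: ge0_ler_powR; rewrite ?nnegrE ?(ltW x0) ?(ltW y0).
Qed.

(** On |z| <= 1/2 the weight is bounded below, so [point_bound] for F' gives a uniform bound M
    there; integrating from 0 to w with |w| <= 1/2 gives |F(w)| <= M, the factor 2 of [seg_bound]
    being compensated by |w|. *)
Lemma half_radius_le_deriv (q b : R) : (1 <= q)%R -> (-1 < b)%R ->
  exists2 c : R, (0 < c)%R & forall F u, analytic F -> F 0%R = 0%R -> Disc u ->
  (cabs (F (pt (sc 2^-1 u))) `^ q)%:E <= c%:E * Nrm q (b + q) (cderiv F).
Proof.
move=> q1 b1; have q0 : (0 < q)%R by lra.
have [c c0 H] := point_bound (b + q) q1; have e0 : (0 < 2 + (b + q))%R by lra.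
exists (c * 2 `^ (2 + (b + q)))%R; first by rewrite mulr_gt0 ?powR_gt0.
move=> F u aF F0 Du; set k := (c * _)%R.
have k0 : (0 < k)%R by rewrite mulr_gt0 ?powR_gt0.
have := Nrm_ge0 q (b + q) (cderiv F).
case E : (Nrm q (b + q) (cderiv F)) => [x||] //; last first.
  by move=> _; rewrite gt0_muley ?leey // lte_fin.
rewrite lee_fin => x0; rewrite -EFinM lee_fin.
have af : analytic (cderiv F) by exact: analytic_cderiv.
pose M := ((k * x) `^ q^-1)%R.
have kx0 : (0 <= k * x)%R by rewrite mulr_ge0 // ltW.
have Mq : (M `^ q = k * x)%R by rewrite -powRrM mulVf ?gt_eqF // powRr1.
have bd z : (cabs z <= 2^-1)%R -> (cabs (cderiv F z) <= M)%R.
  move=> z2; pose v : T2 := (complex.Re z, complex.Im z).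
  have vz : pt v = z by rewrite /pt /v /=; case: (z).
  have ov : (2^-1 <= om v)%R by rewrite /om vz; lra.
  have Dv : Disc v by change (cabs (pt v) < 1)%R; rewrite vz; lra.
  have := H _ v af Dv; rewrite E vz -EFinM lee_fin => h.
  apply: powR_le_root; [exact: cabs_ge0|exact: q0|].
  apply: le_trans h _; apply: ler_wpM2r => //; apply: ler_wpM2l; first exact: ltW.
  apply: le_trans (powR_neg_anti (_ : 0 < 2^-1)%R ov (ltW e0)) _; first by rewrite invr_gt0.
  by rewrite -powR_inv1 // -powRrM mulN1r opprK.
set w := pt _; have w2 : (cabs w <= 2^-1)%R.
  rewrite /w cabs_sc ?invr_ge0 //; apply: ler_piMr; first by rewrite invr_ge0.
  exact: ltW.
have dw : disc w by change (cabs w < 1)%R; lra.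
have c1 := analytic_segcont af (@disc0 R) dw.
have FE : seg (cderiv F) 0%R w = F w.
  rewrite (seg_FTC c1 (F := F)) ?F0 ?subr0 // => t t01; apply: analytic_cdiff => //.
  by have := disc_segment t01 (@disc0 R) dw; rewrite subr0.
have FM : (cabs (F w) <= M)%R.
  rewrite -FE; apply: le_trans (seg_bound c1 (M := M) _) _.
    move=> t t01; apply: bd; apply: cabs_segment => //.
    by rewrite cabs0 invr_ge0.
  rewrite subr0 mulrAC; apply: ler_piMl; first exact: powR_ge0.
  by rewrite mulrC -ler_pdivlMr // mul1r.
rewrite -Mq; apply: ge0_ler_powR; rewrite ?nnegrE ?cabs_ge0 ?powR_ge0 // ltW //.
Qed.

(** F(z) is split into F(z) - F(z / 2), controlled by radial averages of |F'|^q, and F(z / 2), which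
    only sees a fixed compact disc. *)
Lemma Nrm_le_deriv (q b : R) : (1 <= q)%R -> (-1 < b)%R ->
  exists2 c : R, (0 < c)%R & forall F, analytic F -> F 0%R = 0%R ->
  Nrm q b F <= c%:E * Nrm q (b + q) (cderiv F).
Proof.
move=> q1 b1; have q0 : (0 < q)%R by lra.
(* Small enough that e = b - dl (q - 1) stays above -1, as the exchange of integrals requires; the
   exponents then add up to (1 + dl) (q - 1) + e + 1 = b + q. *)
pose dl : R := ((b + 1) / (2 * q))%R.
have d0 : (0 < dl)%R by rewrite divr_gt0 ?mulr_gt0 //; lra.
have dlq : (dl * (q - 1) < b + 1)%R.
  rewrite /dl mulrAC ltr_pdivrMr ?mulr_gt0 // ltr_pM2l; lra.
pose e : R := (b - dl * (q - 1))%R.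
have e1 : (-1 < e)%R by rewrite /e; lra.
have [c1 c10 H1] := radial_Jensen q1 d0.
have [c2 c20 H2] := half_radius_le_deriv q1 b1.
have [M M0 HM] := integral_om_powR_le b1.
pose c3 : R := (4 * 2 `^ `|e| / (e + 1))%R.
have c30 : (0 < c3)%R by rewrite divr_gt0 ?mulr_gt0 ?powR_gt0 //; lra.
exists (2 `^ q * (c1 * c3) + 2 `^ q * (c2 * M))%R.
  by rewrite addr_gt0 // mulr_gt0 ?powR_gt0 // mulr_gt0.
move=> F aF F0; pose f := cderiv F; have af : analytic f by exact: analytic_cderiv.
set N := Nrm q (b + q) f; have N0 : 0 <= N by exact: Nrm_ge0.
pose kp : R := ((1 + dl) * (q - 1))%R.
pose G : T2 -> \bar R := (fun v => (cabs (f (pt v)) `^ q * om v `^ kp)%:E) \_ Disc.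
have mG : measurable_fun setT G.
  by apply: measurable_erestrict; [exact: measurable_Disc|exact: measurable_Nrm].
have G0 v : 0 <= G v.
  by rewrite /G patchE; case: ifP => // _; rewrite lee_fin mulr_ge0 ?powR_ge0.
pose K (x : TR * T2) := G (sc x.1 x.2) * (om x.2 `^ e)%:E.
have mK : measurable_fun setT K.
  apply: emeasurable_funM; first exact: (measurableT_comp mG (@measurable_sc2 R)).
  apply/measurable_EFinP; exact: (measurableT_comp (measurable_om_powR e) measurable_snd).
have K0 x : 0 <= K x by rewrite mule_ge0 // lee_fin powR_ge0.
pose I : set TR := `[2^-1%R, 1%R]%classic.
have mI : measurable I by exact: measurable_itv.
pose T u := \int[leb]_(t in I) K (t, u).
have mT : measurable_fun setT T by exact: (measurable_Tonelli_G leb mI mK K0).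
have T0 u : 0 <= T u by apply: integral_ge0 => t _; exact: K0.
have intT : \int[L2]_(u in Disc) T u <= c3%:E * N.
  have -> : \int[L2]_(u in Disc) T u = \int[leb]_(t in I) \int[L2]_(u in Disc) K (t, u).
    exact: (esym (Tonelli_set leb L2s mI (@measurable_Disc R) mK K0)).
  apply: le_trans (dilate_Tonelli e1 mG G0) _.
  apply: lee_wpmul2l; first by rewrite lee_fin ltW.
  suff -> : \int[L2]_(u in Disc) (G u * (om u `^ (e + 1))%:E) = N by exact: lexx.
  apply: eq_integral => u uD; have Du : Disc u by rewrite inE in uD.
  rewrite /G patchE uD -EFinM -mulrA -powRDp ?om_gt0 //; congr (_ * _ `^ _)%:E.
  by rewrite /kp /e; ring.
have step u : Disc u -> (cabs (F (pt u)) `^ q * om u `^ b)%:E <=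
    (2 `^ q * c1)%:E * T u + (2 `^ q * c2)%:E * N * (om u `^ b)%:E.
  move=> Du; have ou := om_gt0 Du.
  pose A := cabs (F (pt u) - F (pt (sc 2^-1 u)))%R.
  pose B := cabs (F (pt (sc 2^-1 u))).
  have AB : (cabs (F (pt u)) `^ q <= 2 `^ q * (A `^ q + B `^ q))%R.
    apply: le_trans (powR_le2 (cabs_ge0 _) (cabs_ge0 _) (ltW q0)).
    apply: ge0_ler_powR; rewrite ?nnegrE ?addr_ge0 ?cabs_ge0 ?(ltW q0) //.
    by apply: le_trans (cabs_le_normD _ _); rewrite subrK.
  apply: (@le_trans _ _ ((2 `^ q)%:E * ((A `^ q)%:E * (om u `^ b)%:E) +
                         (2 `^ q)%:E * ((B `^ q)%:E * (om u `^ b)%:E))).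
    rewrite -!EFinM -EFinD lee_fin -mulrDr -mulrDl mulrA.
    by apply: ler_wpM2r => //; exact: powR_ge0.
  apply: leeD; rewrite EFinM -!muleA; apply: lee_wpmul2l; rewrite ?lee_fin ?powR_ge0 //.
    have -> : T u = (om u `^ e)%:E * \int[leb]_(t in I)
        (cabs (f (pt (sc t u))) `^ q * om (sc t u) `^ kp)%:E.
      rewrite -ge0_integralZl_EFin ?powR_ge0 //; last 2 first.
      - by move=> t _; rewrite lee_fin mulr_ge0 ?powR_ge0.
      - have mm : measurable_fun I (fun t => G (sc t u)).
          apply: measurable_funTS; apply: (measurableT_comp mG).
          by apply: measurable_fun_pair; apply: measurable_funM => //; exact: measurable_cst.
        apply: (eq_measurable_fun _ _ mm) => t; rewrite inE /I /= in_itv /= => t2.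
        by rewrite /G patchE mem_set //; apply: Disc_sc => //; lra.
      apply: eq_integral => t; rewrite inE /I /= in_itv /= => t2.
      have Ds : Disc (sc t u) by apply: Disc_sc => //; lra.
      by rewrite [RHS]muleC /K /G patchE mem_set.
    have -> : (om u `^ b)%:E = (om u `^ e)%:E * (om u `^ (dl * (q - 1)))%:E.
      by rewrite -EFinM -powRDp // /e subrK.
    rewrite [X in _ <= X]muleCA [X in X <= _]muleCA; apply: lee_wpmul2l.
      by rewrite lee_fin powR_ge0.
    apply: le_trans (lee_wpmul2r _ (H1 F u aF Du)) _; first by rewrite lee_fin powR_ge0.
    rewrite muleAC -EFinM -mulrA -powRDp // addNr powRr0 mulr1.
    exact: lexx.
  rewrite muleA; apply: lee_wpmul2r; first by rewrite lee_fin powR_ge0.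
  exact: H2.
have mN : measurable_fun Disc (fun u => (2 `^ q * c2)%:E * N * (om u `^ b)%:E).
  apply: emeasurable_funM; first exact: measurable_cst.
  by apply/measurable_EFinP; apply: measurable_funTS; exact: measurable_om_powR.
have mT2 : measurable_fun Disc (fun u => (2 `^ q * c1)%:E * T u).
  by apply: measurable_funeM; exact: measurable_funTS.
have k1 : (0 <= 2 `^ q * c1)%R by rewrite mulr_ge0 ?powR_ge0 // ltW.
have k2 : (0 <= 2 `^ q * c2)%R by rewrite mulr_ge0 ?powR_ge0 // ltW.
apply: (@le_trans _ _ (\int[L2]_(u in Disc)
   ((2 `^ q * c1)%:E * T u + (2 `^ q * c2)%:E * N * (om u `^ b)%:E))).
  apply: ge0_le_integral.
  - exact: measurable_Disc.
  - by move=> u _; rewrite lee_fin mulr_ge0 ?powR_ge0.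
  - exact: measurable_Nrm.
  - exact: emeasurable_funD.
  - exact: step.
rewrite ge0_integralD; last 5 first.
- exact: measurable_Disc.
- by move=> u _; rewrite mule_ge0.
- exact: mT2.
- by move=> u _; rewrite mule_ge0 ?mule_ge0 // lee_fin powR_ge0.
- exact: mN.
have k3 : (0 <= 2 `^ q * (c1 * c3))%R by rewrite mulrA mulr_ge0 // ltW.
have k4 : (0 <= 2 `^ q * (c2 * M))%R by rewrite mulrA mulr_ge0 // ltW.
rewrite EFinD ge0_muleDl ?lee_fin //.
apply: leeD.
  rewrite (integralZD L2 (@measurable_Disc R) (fun u _ => T0 u) (measurable_funTS mT) k1).
  by rewrite mulrA [(2 `^ q * c1 * c3)%:E]EFinM -[leRHS]muleA; apply: lee_wpmul2l.
rewrite ge0_integralZl; last 4 first.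
- exact: measurable_Disc.
- by apply/measurable_EFinP; apply: measurable_funTS; exact: measurable_om_powR.
- by move=> u _; rewrite lee_fin powR_ge0.
- by rewrite mule_ge0.
rewrite mulrA [(2 `^ q * c2 * M)%:E]EFinM [leRHS]muleAC.
by apply: lee_wpmul2l => //; rewrite mule_ge0.
Qed.

End LittlewoodPaley.

(** * Averages over discs: derivatives, dilations and Carleson measures *)

Section Averages.
Context {R : realType}.
Local Notation C := R[i].
Local Notation leb := (@lebesgue_measure R).
Local Notation TR := (measurableTypeR R).
Local Notation T2 := (TR * TR)%type.
Local Notation L2 := (leb \x leb)%E.
Implicit Types (f g h F : C -> C) (u v : T2).

Lemma analyticD f g : analytic f -> analytic g -> analytic (fun z => f z + g z).
Proof.
move=> af ag; apply: analytic_cdiffP => z dz; exists (cderiv f z + cderiv g z).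
by apply: cdiffD; exact: analytic_cdiff.
Qed.

Lemma analyticB f g : analytic f -> analytic g -> analytic (fun z => f z - g z).
Proof.
move=> af ag; apply: analytic_cdiffP => z dz; exists (cderiv f z - cderiv g z).
by apply: cdiffB; exact: analytic_cdiff.
Qed.

Lemma analyticM f g : analytic f -> analytic g -> analytic (fun z => f z * g z).
Proof.
move=> af ag; apply: analytic_cdiffP => z dz; eexists.
by apply: cdiffM; exact: analytic_cdiff.
Qed.

Lemma analytic_cst (c : C) : analytic (fun=> c).
Proof. by apply: analytic_cdiffP => z dz; exists 0; exact: cdiff_cst. Qed.

Lemma cderivE f z d : cdiff f z d -> cderiv f z = d.
Proof. by case/cdiff_derivable. Qed.

Lemma disc_dilate (rho : R) (z : C) : 0 <= rho <= 1 -> disc z -> disc (rho%:C * z).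
Proof.
move=> /andP[r0 r1] dz; change (cabs (rho%:C * z) < 1).
rewrite cabsM cabsR ger0_norm //.
by apply: le_lt_trans (dz : cabs z < 1); apply: ler_piMl => //; exact: cabs_ge0.
Qed.

Lemma cdiff_dilate f (rho : R) (z : C) : 0 <= rho <= 1 -> analytic f -> disc z ->
  cdiff (fun w => f (rho%:C * w)) z (rho%:C * cderiv f (rho%:C * z)).
Proof.
move=> r01 af dz.
have D : cdiff f (rho%:C * z + 0) (cderiv f (rho%:C * z)).
  by rewrite addr0; apply: analytic_cdiff => //; exact: disc_dilate.
by apply: (cdiff_ext ltr01 _ (cdiff_affine D)) => k _ /=; rewrite addr0.
Qed.

Lemma analytic_dilate f (rho : R) : 0 <= rho <= 1 -> analytic f ->
  analytic (fun w => f (rho%:C * w)).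
Proof.
by move=> r01 af; apply: analytic_cdiffP => z dz; eexists; exact: cdiff_dilate.
Qed.

Local Open Scope ereal_scope.

Lemma eq_Nrm p e f g : (forall z, disc z -> f z = g z) -> Nrm p e f = Nrm p e g.
Proof.
move=> fg; apply: eq_integral => u; rewrite inE => Du.
by rewrite (fg _ (Du : disc (pt u))).
Qed.

Lemma Nrm_cmul p e f (c : C) : (0 < p)%R -> analytic f ->
  Nrm p e (fun z => c * f z)%R = (cabs c `^ p)%:E * Nrm p e f.
Proof.
move=> p0 af; rewrite -Nrm_scale ?powR_ge0 //; apply: eq_integral => u _.
by rewrite cabsM powRM ?cabs_ge0 // mulrA.
Qed.

Lemma NrmD p e f g : (0 < p)%R -> analytic f -> analytic g ->
  Nrm p e (fun z => f z + g z)%R <= (2 `^ p)%:E * (Nrm p e f + Nrm p e g).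
Proof.
move=> p0 af ag.
have h0 F u : 0 <= (cabs (F (pt u)) `^ p * om u `^ e)%:E.
  by rewrite lee_fin mulr_ge0 ?powR_ge0.
rewrite /Nrm -ge0_integralD //; last 3 first.
- exact: measurable_Disc.
- exact: measurable_Nrm.
- exact: measurable_Nrm.
have m2 : measurable_fun Disc (fun u => (cabs (f (pt u)) `^ p * om u `^ e)%:E +
    (cabs (g (pt u)) `^ p * om u `^ e)%:E).
  by apply: emeasurable_funD; exact: measurable_Nrm.
rewrite -(integralZD L2 (@measurable_Disc R) (fun u _ => adde_ge0 (h0 f u) (h0 g u)) m2 (powR_ge0 _ _)).
apply: ge0_le_integral.
- exact: measurable_Disc.
- by move=> u _; exact: (h0 (fun z => f z + g z)%R).
- exact: (measurable_Nrm p e (analyticD af ag)).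
- exact: measurable_funeM.
- move=> u _; rewrite -EFinD -EFinM lee_fin -mulrDl mulrA; apply: ler_wpM2r; first exact: powR_ge0.
  apply: le_trans (powR_le2 (cabs_ge0 _) (cabs_ge0 _) (ltW p0)).
  apply: ge0_ler_powR; rewrite ?nnegrE ?addr_ge0 ?cabs_ge0 ?(ltW p0) //.
  exact: cabs_le_normD.
Qed.

Lemma Nrm_bounded p e f (M I : R) : (0 < p)%R -> analytic f -> (0 <= M)%R ->
  (forall z, disc z -> (cabs (f z) <= M)%R) ->
  \int[L2]_(u in Disc) (om u `^ e)%:E <= I%:E -> Nrm p e f <= (M `^ p * I)%:E.
Proof.
move=> p0 af M0 fM HI.
apply: (@le_trans _ _ (\int[L2]_(u in Disc) ((M `^ p)%:E * (om u `^ e)%:E))).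
  apply: ge0_le_integral.
  - exact: measurable_Disc.
  - by move=> u _; rewrite lee_fin mulr_ge0 ?powR_ge0.
  - exact: measurable_Nrm.
  - apply: measurable_funeM; apply/measurable_EFinP; apply: measurable_funTS.
    exact: measurable_om_powR.
  - move=> u Du; rewrite -EFinM lee_fin; apply: ler_wpM2r; first exact: powR_ge0.
    by apply: ge0_ler_powR; rewrite ?nnegrE ?cabs_ge0 ?(ltW p0) //; exact: fM.
rewrite integralZD ?powR_ge0 //; last 3 first.
- exact: measurable_Disc.
- by move=> u _; rewrite lee_fin powR_ge0.
- by apply/measurable_EFinP; apply: measurable_funTS; exact: measurable_om_powR.
by rewrite EFinM; apply: lee_wpmul2l => //; rewrite lee_fin powR_ge0.
Qed.

(** After the exchange each v collects the m-mass of those u whose disc contains it. By [om_ball]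
    these u lie in the disc of radius 2 k (1 - |v|) about v, the only place where the mass of m has
    to be known. *)
Lemma average_Tonelli (k : R) (m psi B : T2 -> \bar R) : (0 < k)%R -> (k <= 2^-1)%R ->
  measurable_fun setT m -> measurable_fun setT psi -> measurable_fun setT B ->
  (forall u, 0 <= m u) -> (forall u, 0 <= psi u) -> (forall v, 0 <= B v) ->
  (forall v, Disc v -> \int[L2]_(u in Disc `&` cball (pt v) (2 * k * om v)) m u <= B v) ->
  \int[L2]_(u in Disc) (m u * \int[L2]_(v in cball (pt u) (k * om u)) psi v) <=
  \int[L2]_(v in Disc) (psi v * B v).
Proof.
move=> k0 k2 mm mpsi mB m0 psi0 B0 HB.
pose S : set (T2 * T2) := ((Disc `*` setT) `&`
  [set x | (cabs (pt x.2 - pt x.1) <= k * om x.1)%R])%classic.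
have mS : measurable S.
  apply: measurable_le_set.
  - by apply: measurableX => //; exact: measurable_Disc.
  - by apply: measurable_funTS; apply: measurable_cabs_ptB; [exact: measurable_snd|exact: measurable_fst].
  - apply: measurable_funTS; apply: measurable_funM; first exact: measurable_cst.
    by apply: (measurableT_comp measurable_om); exact: measurable_fst.
pose K : T2 * T2 -> \bar R := (fun x => m x.1 * psi x.2) \_ S.
have mK : measurable_fun setT K.
  apply: measurable_erestrict => //; apply: measurable_funTS.
  apply: emeasurable_funM.
    exact: (measurableT_comp mm measurable_fst).
  exact: (measurableT_comp mpsi measurable_snd).
have K0 x : 0 <= K x by rewrite /K patchE; case: ifP => // _; rewrite mule_ge0.
have -> : \int[L2]_(u in Disc) (m u * \int[L2]_(v in cball (pt u) (k * om u)) psi v) =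
    \int[L2]_u \int[L2]_v K (u, v).
  rewrite integral_mkcond; apply: eq_integral => u _; rewrite patchE; case: ifPn => uD.
    rewrite -ge0_integralZl //; last 2 first.
    - exact: measurable_cball.
    - exact: measurable_funTS.
    rewrite integral_mkcond; apply: eq_integral => v _; rewrite /K !patchE.
    suff -> : ((u, v) \in S) = (v \in cball (pt u) (k * om u)) by [].
    apply/idP/idP; rewrite !inE; first by case.
    by move=> h; split; [split => //; rewrite inE in uD|].
  apply/esym/integral0_eq => v _; rewrite /K patchE memNset // => -[[/= h _] _].
  by move: uD; rewrite notin_setE; apply.
have -> : \int[L2]_u \int[L2]_v K (u, v) = \int[L2]_v \int[L2]_u K (u, v).
  exact: (@fubini_tonelli _ _ _ _ _ (@L2s R) (@L2s R) K mK K0).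
rewrite [leRHS]integral_mkcond; apply: ge0_le_integralT.
- by move=> v; apply: integral_ge0.
- exact: (@measurable_fun_fubini_tonelli_G _ _ _ _ _ (@L2s R) K mK K0).
- apply: measurable_erestrict; first exact: measurable_Disc.
  by apply: measurable_funTS; exact: emeasurable_funM.
- move=> v; rewrite patchE; case: ifPn => vD; last first.
    rewrite integral0_eq // => u _; rewrite /K patchE memNset // => -[[/= Du _] /= h].
    by have [Dv _ _ _] := om_ball Du k0 k2 h; move: vD; rewrite notin_setE; apply.
  rewrite inE in vD; pose W : set T2 := (Disc `&` cball (pt v) (2 * k * om v))%classic.
  have mW : measurable W.
    by apply: measurableI; [exact: measurable_Disc|exact: measurable_cball].
  apply: (@le_trans _ _ (psi v * \int[L2]_(u in W) m u)); last first.
    by apply: lee_wpmul2l => //; exact: HB.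
  rewrite -ge0_integralZl //; last exact: measurable_funTS.
  rewrite [leRHS]integral_mkcond; apply: ge0_le_integralT.
  + by move=> u; exact: K0.
  + exact: (measurable_fun_pair1 v mK).
  + apply: measurable_erestrict => //; apply: measurable_funeM; exact: measurable_funTS.
  + move=> u; rewrite /K !patchE; case: ifPn => [|_]; last by case: ifP => // _; rewrite mule_ge0.
    rewrite inE => -[[/= Du _] /= h]; rewrite mem_set ?(muleC (psi v)) //.
    by have [_ _ _ h2] := om_ball Du k0 k2 h; split.
Qed.

Lemma cball_area_le v (k : R) : Disc v -> (0 <= k)%R ->
  L2 (cball (pt v) (k * om v)) <= ((2 * k) ^+ 2 * om v ^+ 2)%:E.
Proof.
move=> Dv k0; have ov := om_gt0 Dv.
apply: le_trans (area_cball_le _ _) _; first by rewrite mulr_ge0 // ltW.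
by rewrite lee_fin mulrA exprMn.
Qed.

Lemma measurable_ball_integral (k : R) (psi : T2 -> \bar R) :
  measurable_fun setT psi -> (forall u, 0 <= psi u) ->
  measurable_fun setT (fun u => \int[L2]_(v in cball (pt u) (k * om u)) psi v).
Proof.
move=> mpsi psi0.
pose S : set (T2 * T2) := (setT `&`
  [set x | (cabs (pt x.2 - pt x.1) <= k * om x.1)%R])%classic.
have mS : measurable S.
  apply: measurable_le_set => //.
  - by apply: measurable_cabs_ptB; [exact: measurable_snd|exact: measurable_fst].
  - apply: measurable_funM; first exact: measurable_cst.
    by apply: (measurableT_comp (@measurable_om R)); exact: measurable_fst.
pose K : T2 * T2 -> \bar R := (fun x => psi x.2) \_ S.
have mK : measurable_fun setT K.
  apply: measurable_erestrict => //; apply: measurable_funTS.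
  exact: (measurableT_comp mpsi measurable_snd).
have K0 x : 0 <= K x by rewrite /K patchE; case: ifP.
have mF := @measurable_fun_fubini_tonelli_F _ _ _ _ _ (@L2s R) K mK K0.
apply: (eq_measurable_fun _ _ mF) => u _; rewrite /fubini_F [RHS]integral_mkcond.
apply: eq_integral => v _; rewrite /K !patchE.
suff -> : ((u, v) \in S) = (v \in cball (pt u) (k * om u)) by [].
by apply/idP/idP; rewrite !inE; [case|move=> h; split].
Qed.

(** Cauchy's estimate on the square of half side om u / 32 asks for |f| within om u / 16 of u. At
    such a point w the value is bounded by a mean over the disc of radius om w / 8, and all these
    discs stay inside the disc of radius om u / 4 about u. *)
Lemma deriv_bound (p : R) : (1 <= p)%R ->
  exists2 c : R, (0 < c)%R & forall f u, analytic f -> Disc u ->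
  (cabs (cderiv f (pt u)) `^ p)%:E <= (c * om u `^ (- (2 + p)))%:E *
    \int[L2]_(v in cball (pt u) (4^-1 * om u)) (cabs (f (pt v)) `^ p)%:E.
Proof.
move=> p1; have p0 : (0 < p)%R by lra.
have k0 : (0 < 8^-1 :> R)%R by rewrite invr_gt0.
have k2 : (8^-1 <= 2^-1 :> R)%R by lra.
have [c c0 H] := mean_value_om p1 k0 k2.
exists ((16 * 32) `^ p * (2 * c))%R.
  by apply: mulr_gt0; [apply: powR_gt0; exact: mulr_gt0|exact: mulr_gt0].
move=> f u af Du; have ou := om_gt0 Du.
set X := \int[L2]_(v in _) _.
have X0 : 0 <= X by apply: integral_ge0 => v _; rewrite lee_fin powR_ge0.
have cp : (0 < (16 * 32) `^ p * (2 * c) * om u `^ (- (2 + p)))%R.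
  apply: mulr_gt0; last exact: powR_gt0.
  by apply: mulr_gt0; [apply: powR_gt0; exact: mulr_gt0|exact: mulr_gt0].
have sB : cball (pt u) (4^-1 * om u) `<=` (Disc : set T2).
  by apply: cball_Disc; move: ou; rewrite /om; lra.
case E : X X0 => [x||] // x0; last by rewrite gt0_muley ?leey // lte_fin.
rewrite lee_fin in x0; rewrite -EFinM lee_fin.
have bd w : (cabs (w - pt u) <= 2 * (om u / 32))%R ->
    (cabs (f w) `^ p <= 2 * c * om u `^ (- 2) * x)%R.
  move=> hw; pose v : T2 := (complex.Re w, complex.Im w).
  have vw : pt v = w by rewrite /pt /v /=; case: (w).
  have h1 := cabs_le_subD w (pt u); have h2 := cabs_le_subD (pt u) w.
  rewrite cabsB in h2.
  have ov1 : (15 / 16 * om u <= om v)%R by move: h1 hw; rewrite /om vw; lra.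
  have ov2 : (om v <= 17 / 16 * om u)%R by move: h2 hw; rewrite /om vw; lra.
  have ov : (0 < om v)%R by lra.
  have Dv : Disc v by change (cabs (pt v) < 1)%R; move: ov; rewrite /om; lra.
  have := H f v af Dv; rewrite vw => h.
  rewrite -lee_fin; apply: le_trans h _.
  have -> : (2 * c * om u `^ (- 2) * x)%:E = (c * (2 * om u `^ (- 2)))%:E * x%:E.
    by rewrite -EFinM; congr EFin; ring.
  apply: lee_pmul.
  - by rewrite lee_fin divr_ge0 ?exprn_ge0 ?ltW.
  - by apply: integral_ge0 => y _; rewrite lee_fin powR_ge0.
  - rewrite lee_fin ler_pM2l // powRN powR_mulrn ?(ltW ou) // -[leLHS]mul1r.
    rewrite ler_pdivrMr ?exprn_gt0 // mulrAC ler_pdivlMr ?exprn_gt0 // mul1r.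
    by rewrite -ler_pdivrMl // ; nra.
  - rewrite -E /X -vw; apply: ge0_subset_integral.
    + exact: measurable_cball.
    + exact: measurable_cball.
    + by apply/measurable_EFinP; apply: measurable_analytic_powR => //; exact: measurable_cball.
    + by move=> y _; rewrite lee_fin powR_ge0.
    + move=> y; rewrite /cball /mkset vw => hy.
      have := cabs_le_normD (pt y - w)%R (w - pt u)%R; rewrite subrKA.
      by move: hy hw ov2; lra.
pose M := ((2 * c * om u `^ (- 2) * x) `^ p^-1)%R.
have M0 : (0 <= M)%R by exact: powR_ge0.
have s0 : (0 < om u / 32)%R by rewrite divr_gt0.
have cs : (cabs (pt u) + 2 * (om u / 32) < 1)%R by move: ou; rewrite /om; lra.
have := Cauchy_estimate_deriv af s0 cs (M := M) (fun w hw => powR_le_root (cabs_ge0 _) p0 (bd w hw)).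
rewrite (_ : (16 * M / (om u / 32) = 16 * 32 * M / om u)%R); last by field; rewrite gt_eqF.
move=> h.
apply: le_trans (_ : ((16 * 32 * M / om u) `^ p <= _)%R).
  by apply: ge0_ler_powR; rewrite ?nnegrE ?cabs_ge0 ?(ltW p0) // ?divr_ge0 ?mulr_ge0 // ltW.
rewrite powRM ?invr_ge0 ?mulr_ge0 ?(ltW ou) // powRM // /M -powRrM mulVf ?gt_eqF // powRr1; last first.
  by rewrite mulr_ge0 ?mulr_ge0 ?powR_ge0 ?(ltW c0).
have E2 : (om u `^ (- (2 + p)) = om u `^ (- 2) * om u `^ (- p))%R.
  by rewrite -powRDp // opprD.
rewrite E2 -powR_inv1 ?(ltW ou) // -powRrM mulN1r.
by rewrite le_eqVlt; apply/orP; left; apply/eqP; ring.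
Qed.

(** [deriv_bound] is integrated against the weight and the integrals are exchanged: the points u
    near v contribute om^(e - 2) times an area of order om^2, which restores the weight om^e. *)
Lemma Nrm_deriv_le (p e : R) : (1 <= p)%R -> (-1 < e)%R ->
  exists2 c : R, (0 < c)%R & forall f, analytic f ->
  Nrm p (e + p) (cderiv f) <= c%:E * Nrm p e f.
Proof.
move=> p1 e1; have p0 : (0 < p)%R by lra.
have [c c0 H] := deriv_bound p1.
pose c2 : R := (c * (2 `^ `|e - 2|))%R.
have c20 : (0 < c2)%R by rewrite mulr_gt0 ?powR_gt0.
exists c2 => // f af.
have k0 : (0 < 4^-1 :> R)%R by rewrite invr_gt0.
have k2 : (4^-1 <= 2^-1 :> R)%R by lra.
have h0 : (0 < 2^-1 :> R)%R by rewrite invr_gt0.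
pose m u : \bar R := (c * om u `^ (e - 2))%:E.
pose psi : T2 -> \bar R := (fun v => (cabs (f (pt v)) `^ p)%:E) \_ Disc.
pose B v : \bar R := (c2 * om v `^ (e - 2) * (1 ^+ 2 * om v ^+ 2))%:E.
have mm : measurable_fun setT m.
  apply/measurable_EFinP; apply: measurable_funM; first exact: measurable_cst.
  exact: measurable_om_powR.
have mpsi : measurable_fun setT psi.
  apply: measurable_erestrict; first exact: measurable_Disc.
  by apply/measurable_EFinP; apply: measurable_analytic_powR => //; exact: measurable_Disc.
have mB : measurable_fun setT B.
  apply/measurable_EFinP; apply: measurable_funM.
    by apply: measurable_funM; [exact: measurable_cst|exact: measurable_om_powR].
  apply: measurable_funM; first exact: measurable_cst.
  exact: measurable_funX (@measurable_om R).
have m0 u : 0 <= m u by rewrite lee_fin mulr_ge0 ?powR_ge0 // ltW.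
have psi0 u : 0 <= psi u by rewrite /psi patchE; case: ifP => // _; rewrite lee_fin powR_ge0.
have B0 v : 0 <= B v.
  by rewrite lee_fin; apply: mulr_ge0; apply: mulr_ge0; rewrite ?powR_ge0 ?sqr_ge0 // ltW.
have HB v : Disc v -> \int[L2]_(u in Disc `&` cball (pt v) (2 * 4^-1 * om v)) m u <= B v.
  move=> Dv; have ov := om_gt0 Dv.
  have -> : (2 * 4^-1 = 2^-1 :> R)%R by lra.
  pose W : set T2 := (Disc `&` cball (pt v) (2^-1 * om v))%classic.
  have mW : measurable W.
    by apply: measurableI; [exact: measurable_Disc|exact: measurable_cball].
  apply: (@le_trans _ _ (\int[L2]_(u in W) (cst (c2 * om v `^ (e - 2))%:E u))).
    apply: ge0_le_integral.
    - exact: mW.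
    - by move=> u _.
    - exact: measurable_funTS.
    - exact: measurable_cst.
    - move=> u [Du uv]; have [_ h1 h2 _] := om_ball Dv h0 (lexx _) uv.
      rewrite lee_fin -mulrA ler_pM2l //; apply: powR_lip => //; exact: om_gt0.
  rewrite integral_cst // /B [leRHS]EFinM; apply: lee_wpmul2l.
    by rewrite lee_fin mulr_ge0 ?powR_ge0 // ltW.
  have -> : (1 = 2 * 2^-1 :> R)%R by lra.
  apply: le_trans (_ : L2 (cball (pt v) (2^-1 * om v)) <= _); last first.
    by apply: cball_area_le => //; exact: ltW.
  apply: le_measure; rewrite ?inE //; first exact: measurable_cball.
  by move=> ? [].
have AT := average_Tonelli k0 k2 mm mpsi mB m0 psi0 B0 HB.
apply: (@le_trans _ _ (\int[L2]_(u in Disc) (m u * \int[L2]_(v in cball (pt u) (4^-1 * om u)) psi v))).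
  apply: ge0_le_integral.
  - exact: measurable_Disc.
  - by move=> u _; rewrite lee_fin mulr_ge0 ?powR_ge0.
  - by apply: measurable_Nrm; exact: analytic_cderiv.
  - apply: measurable_funTS; apply: emeasurable_funM => //.
    exact: measurable_ball_integral.
  - move=> u Du; have ou := om_gt0 Du; rewrite EFinM.
    apply: le_trans (lee_wpmul2r _ (H f u af Du)) _; first by rewrite lee_fin powR_ge0.
    rewrite muleAC -EFinM -mulrA -powRDp // /m (_ : (- (2 + p) + (e + p) = e - 2)%R); last by ring.
    apply: lee_wpmul2l; first by rewrite lee_fin mulr_ge0 ?powR_ge0 // ltW.
    rewrite le_eqVlt; apply/orP; left; apply/eqP; apply: eq_integral => v; rewrite inE => hv.
    by have [Dv _ _ _] := om_ball Du k0 k2 hv; rewrite /psi patchE mem_set.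
apply: le_trans AT _.
rewrite -integralZD; last 4 first.
- exact: measurable_Disc.
- by move=> u _; rewrite lee_fin mulr_ge0 ?powR_ge0.
- exact: measurable_Nrm.
- exact: ltW.
rewrite le_eqVlt; apply/orP; left; apply/eqP; apply: eq_integral => v vD.
have Dv : Disc v by rewrite inE in vD.
have ov := om_gt0 Dv; rewrite /psi patchE vD /B -!EFinM; congr EFin.
rewrite (_ : (om v `^ e = om v `^ (e - 2) * om v ^+ 2)%R); first by rewrite expr1n; ring.
by rewrite -powR_mulrn ?(ltW ov) // -powRDp // subrK.
Qed.

(** Since e + p >= 0, the weight at u is at most the weight at rho u, so the dilation only costs its
    Jacobian rho^-2 <= 4. *)
Lemma Nrm_deriv_dilate (p e rho : R) f : (1 <= p)%R -> (-1 < e)%R ->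
  (2^-1 <= rho <= 1)%R -> analytic f ->
  \int[L2]_(u in Disc)
    (cabs (rho%:C * cderiv f (rho%:C * pt u))%R `^ p * om u `^ (e + p))%:E
  <= 4%:E * Nrm p (e + p) (cderiv f).
Proof.
move=> p1 e1 /andP[r2 r1] af; have p0 : (0 < p)%R by lra.
have ep : (0 <= e + p)%R by lra.
have rho0 : (0 < rho)%R by lra.
have r01 : (0 <= rho <= 1)%R by lra.
have af' := analytic_cderiv af.
pose G : T2 -> \bar R := (fun v => (cabs (cderiv f (pt v)) `^ p * om v `^ (e + p))%:E) \_ Disc.
have mG : measurable_fun setT G.
  by apply: measurable_erestrict; [exact: measurable_Disc|exact: measurable_Nrm].
have G0 v : 0 <= G v.
  by rewrite /G patchE; case: ifP => // _; rewrite lee_fin mulr_ge0 ?powR_ge0.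
apply: (@le_trans _ _ (\int[L2]_u G (sc rho u))).
  rewrite integral_mkcond; apply: ge0_le_integralT.
  - by move=> u; rewrite patchE; case: ifP => // _; rewrite lee_fin mulr_ge0 ?powR_ge0.
  - apply: measurable_erestrict; first exact: measurable_Disc.
    have ad : analytic (fun z => rho%:C * cderiv f (rho%:C * z))%R.
      by apply: analyticM; [exact: analytic_cst|exact: analytic_dilate].
    exact: (measurable_Nrm p (e + p) ad).
  - exact: (measurableT_comp mG (measurable_sc rho)).
  - move=> u; rewrite patchE; case: ifPn => // uD; rewrite inE in uD.
    have ou := om_gt0 uD; have Ds : Disc (sc rho u) by exact: Disc_sc.
    rewrite /G patchE mem_set // lee_fin pt_sc; apply: ler_pM; rewrite ?powR_ge0 //.
      apply: ge0_ler_powR; rewrite ?nnegrE ?cabs_ge0 ?(ltW p0) //.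
      by rewrite cabsM cabsR gtr0_norm //; apply: ler_piMl => //; exact: cabs_ge0.
    apply: ge0_ler_powR; rewrite ?nnegrE ?(ltW ou) ?(ltW (om_gt0 Ds)) //.
    rewrite /om cabs_sc ?(ltW rho0) // lerD2l lerN2.
    by apply: ler_piMl => //; exact: cabs_ge0.
rewrite (plane_dilate rho0 mG G0) /Nrm [X in _ * X <= _](_ : _ = Nrm p (e + p) (cderiv f)); last first.
  by rewrite /Nrm [RHS]integral_mkcond.
apply: lee_wpmul2r; first exact: Nrm_ge0.
rewrite lee_fin -[leRHS](_ : 2 ^+ 2 = 4)%R; last by ring.
rewrite lerXn2r ?nnegrE ?invr_ge0 ?(ltW rho0) //.
by rewrite -[leRHS]invrK lef_pV2 ?posrE // invr_gt0.
Qed.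

(** For [e < 0] the weight is not monotone under dilations; passing to the
    derivative replaces [e] by [e + p >= 0]. *)
Lemma Nrm_dilate (p e : R) : (1 <= p)%R -> (-1 < e)%R ->
  exists2 c : R, (0 < c)%R & forall f rho, analytic f -> (2^-1 <= rho <= 1)%R ->
  Nrm p e (fun z => f (rho%:C * z)%R) <= c%:E * Nrm p e f.
Proof.
move=> p1 e1; have p0 : (0 < p)%R by lra.
have [c1 c10 H1] := Nrm_le_deriv p1 e1; have [c2 c20 H2] := Nrm_deriv_le p1 e1.
have [c3 c30 H3] := point_bound e p1.
have [I I0 HI] := integral_om_powR_le e1.
exists (2 `^ p * (c1 * 4 * c2 + c3 * I))%R.
  by apply: mulr_gt0; [exact: powR_gt0|apply: addr_gt0; rewrite !mulr_gt0].
move=> f rho af r12; have r01 : (0 <= rho <= 1)%R by lra.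
set N := Nrm p e f; have N0 : 0 <= N by exact: Nrm_ge0.
pose g z : C := (f (rho%:C * z) - f 0)%R.
have ag : analytic g by apply: analyticB; [exact: analytic_dilate|exact: analytic_cst].
have g0 : g 0%R = 0%R by rewrite /g mulr0 subrr.
have Dg z : disc z -> cderiv g z = (rho%:C * cderiv f (rho%:C * z))%R.
  move=> dz; apply: cderivE.
  rewrite -[X in cdiff _ _ X]subr0; apply: cdiffB; last exact: cdiff_cst.
  exact: cdiff_dilate.
have Ng : Nrm p e g <= (c1 * 4 * c2)%:E * N.
  apply: le_trans (H1 g ag g0) _; rewrite -mulrA EFinM -muleA.
  apply: lee_wpmul2l; first by rewrite lee_fin ltW.
  rewrite (eq_Nrm p (e + p) Dg); apply: le_trans (Nrm_deriv_dilate p1 e1 r12 af) _.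
  by rewrite EFinM -muleA; apply: lee_wpmul2l => //; exact: H2.
have Nc : Nrm p e (fun=> f 0%R) <= (c3 * I)%:E * N.
  have h := Nrm_bounded p0 (@analytic_cst (f 0%R)) (cabs_ge0 (f 0%R)) (fun z _ => lexx _) HI.
  apply: (le_trans h).
  rewrite EFinM [(c3 * I)%:E]EFinM muleAC; apply: lee_wpmul2r; first by rewrite lee_fin ltW.
  pose o : T2 := (0%R, 0%R); have o0 : pt o = 0%R by [].
  have oo : om o = 1%R by rewrite /om o0 cabs0 subr0.
  have Do : Disc o by change (cabs (pt o) < 1)%R; rewrite o0 cabs0.
  by have := H3 f o af Do; rewrite o0 oo powR1 mulr1.
rewrite (eq_Nrm p e (g := fun z => g z + f 0%R)%R); last by move=> z _; rewrite /g subrK.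
apply: le_trans (NrmD e p0 ag (@analytic_cst _)) _.
rewrite EFinM -muleA; apply: lee_wpmul2l; first by rewrite lee_fin powR_ge0.
rewrite EFinD ge0_muleDl ?lee_fin; first exact: leeD.
  by rewrite !mulr_ge0 // ltW.
by rewrite mulr_ge0 // ltW.
Qed.

(** [|h|^q = |h|^p |h|^(q-p)]: the first factor is averaged over a disc, the
    second one is bounded pointwise by [point_bound]. *)
Lemma Carleson (p q a r : R) : (1 <= p)%R -> (p <= q)%R -> (-1 < a)%R ->
  (0 < r)%R -> (r < 1)%R ->
  exists2 c : R, (0 < c)%R & forall (m : T2 -> \bar R) (l de x : R) h,
  measurable_fun setT m -> (forall u, 0 <= m u) -> (0 <= l)%R -> (0 < de)%R ->
  (forall v, Disc v -> (om v < de)%R ->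
    \int[L2]_(u in Disc `&` [set u | (cabs (pt u - pt v) < r * om v)%R]) m u
      <= (l * om v `^ (q * (2 + a) / p))%:E) ->
  analytic h -> Nrm p a h = x%:E ->
  \int[L2]_(u in Disc `&` [set u | (om u < de / 2)%R]) (m u * (cabs (h (pt u)) `^ q)%:E)
    <= (c * l * x `^ (q / p))%:E.
Proof.
move=> p1 pq a1 r0 r1; have p0 : (0 < p)%R by lra.
have qp0 : (0 <= q - p)%R by lra.
have qp0' : (0 <= (q - p) / p)%R by rewrite divr_ge0 // ltW.
(* The exchange doubles the parameter of the discs; r / 4 keeps the result inside the disc of
   parameter r, where the mass of m is controlled. *)
pose k : R := (r / 4)%R; have k0 : (0 < k)%R by rewrite divr_gt0.
have k2 : (k <= 2^-1)%R by rewrite /k; lra.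
have kk0 : (0 < 2 * k)%R by rewrite mulr_gt0.
have kk2 : (2 * k <= 2^-1)%R by rewrite /k; lra.
have kr : (2 * k < r)%R by rewrite /k; lra.
have [c1 c10 H1] := point_bound a p1.
have [c2 c20 H2] := mean_value_om p1 k0 k2.
(* The first term comes from [point_bound] raised to the power (q - p) / p, the -2 from the area in
   the mean value inequality. By [EA] the growth of the mass of m on discs restores exactly the
   weight exponent a. *)
pose E : R := (- (2 + a) * ((q - p) / p) - 2)%R.
have EA : (E + q * (2 + a) / p = a)%R by rewrite /E; field; rewrite gt_eqF.
pose c3 : R := (c1 `^ ((q - p) / p) * c2 * 2 `^ `|E|)%R.
have c30 : (0 < c3)%R by rewrite !mulr_gt0 ?powR_gt0.
exists c3 => // m l de x h mm m0 l0 de0 Hm ah Nx.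
have x0 : (0 <= x)%R by rewrite -lee_fin -Nx Nrm_ge0.
pose S : set T2 := (Disc `&` [set u | (om u < de / 2)%R])%classic.
have mS : measurable S.
  apply: measurable_lt_set; first exact: measurable_Disc.
    exact: measurable_funTS (@measurable_om R).
  exact: measurable_cst.
pose cx : R := (c1 `^ ((q - p) / p) * x `^ ((q - p) / p) * c2)%R.
have cx0 : (0 <= cx)%R by rewrite !mulr_ge0 ?powR_ge0 // ltW.
pose m1 : T2 -> \bar R := (fun u => m u * (cx * om u `^ E)%:E) \_ S.
pose psi : T2 -> \bar R := (fun v => (cabs (h (pt v)) `^ p)%:E) \_ Disc.
pose B v : \bar R := (cx * 2 `^ `|E| * l * om v `^ a)%:E.
have mm1 : measurable_fun setT m1.
  apply: measurable_erestrict => //; apply: measurable_funTS; apply: emeasurable_funM => //.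
  apply/measurable_EFinP; apply: measurable_funM; first exact: measurable_cst.
  exact: measurable_om_powR.
have mpsi : measurable_fun setT psi.
  apply: measurable_erestrict; first exact: measurable_Disc.
  by apply/measurable_EFinP; apply: measurable_analytic_powR => //; exact: measurable_Disc.
have mB : measurable_fun setT B.
  apply/measurable_EFinP; apply: measurable_funM; first exact: measurable_cst.
  exact: measurable_om_powR.
have m10 u : 0 <= m1 u.
  by rewrite /m1 patchE; case: ifP => // _; rewrite mule_ge0 // lee_fin mulr_ge0 ?powR_ge0.
have psi0 u : 0 <= psi u by rewrite /psi patchE; case: ifP => // _; rewrite lee_fin powR_ge0.
have cE0 : (0 <= cx * 2 `^ `|E|)%R by apply: mulr_ge0 => //; exact: powR_ge0.
have cl0 : (0 <= cx * 2 `^ `|E| * l)%R by apply: mulr_ge0.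
have cv0 v : (0 <= cx * 2 `^ `|E| * om v `^ E)%R by apply: mulr_ge0 => //; exact: powR_ge0.
have B0 v : 0 <= B v by rewrite lee_fin mulr_ge0 ?powR_ge0.
have HB v : Disc v -> \int[L2]_(u in Disc `&` cball (pt v) (2 * k * om v)) m1 u <= B v.
  move=> Dv; have ov := om_gt0 Dv.
  pose W : set T2 := (Disc `&` cball (pt v) (2 * k * om v))%classic.
  have mW : measurable W.
    by apply: measurableI; [exact: measurable_Disc|exact: measurable_cball].
  (* If 1 - |v| >= de, every u of the disc has 1 - |u| >= de / 2 and lies outside S; this is why the
     region of integration stops at de / 2. *)
  have [vde|vde] := ltP (om v) de; last first.
    rewrite integral0_eq // => u [Du uv]; have [_ h1 _ _] := om_ball Dv kk0 kk2 uv.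
    rewrite /m1 patchE memNset // => -[_ /= h3]; move: h3 h1 vde; lra.
  pose V : set T2 := (Disc `&` [set u | (cabs (pt u - pt v) < r * om v)%R])%classic.
  have mV : measurable V.
    apply: measurable_lt_set; first exact: measurable_Disc.
      exact: measurable_funTS (@measurable_cabs_sub R (pt v)).
    exact: measurable_cst.
  apply: (@le_trans _ _ (\int[L2]_(u in W) ((cx * 2 `^ `|E| * om v `^ E)%:E * m u))).
    apply: ge0_le_integral.
    - exact: mW.
    - by move=> u _.
    - exact: measurable_funTS.
    - by apply: measurable_funeM; exact: measurable_funTS.
    - move=> u [Du uv]; have [_ h1 h2 _] := om_ball Dv kk0 kk2 uv.
      rewrite /m1 patchE; case: ifPn => _; last first.
        by rewrite mule_ge0 // lee_fin.
      rewrite muleC; apply: lee_wpmul2r => //; rewrite lee_fin -mulrA.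
      by apply: ler_wpM2l => //; apply: powR_lip => //; exact: om_gt0.
  apply: (@le_trans _ _ (\int[L2]_(u in V) ((cx * 2 `^ `|E| * om v `^ E)%:E * m u))).
    apply: ge0_subset_integral => //.
    - by apply: measurable_funeM; exact: measurable_funTS.
    - by move=> u _; rewrite mule_ge0 // lee_fin.
    - move=> u [Du uv]; split => //.
      by apply: (le_lt_trans (uv : (cabs (pt u - pt v) <= 2 * k * om v)%R)); rewrite ltr_pM2r.
  rewrite (integralZD L2 mV (fun u _ => m0 u) (measurable_funTS mm) (cv0 v)).
  apply: le_trans (lee_wpmul2l _ (Hm v Dv vde)) _; first by rewrite lee_fin.
  rewrite -EFinM /B lee_fin le_eqVlt; apply/orP; left; apply/eqP.
  by rewrite -[in RHS]EA powRDp //; ring.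
have AT := average_Tonelli k0 k2 mm1 mpsi mB m10 psi0 B0 HB.
have step u : S u -> (cabs (h (pt u)) `^ q)%:E <=
    (cx * om u `^ E)%:E * \int[L2]_(v in cball (pt u) (k * om u)) psi v.
  move=> [Du _]; have ou := om_gt0 Du.
  have -> : \int[L2]_(v in cball (pt u) (k * om u)) psi v =
      \int[L2]_(v in cball (pt u) (k * om u)) (cabs (h (pt v)) `^ p)%:E.
    apply: eq_integral => v; rewrite inE => hv.
    by have [Dv _ _ _] := om_ball Du k0 k2 hv; rewrite /psi patchE mem_set.
  have h1 := H1 h u ah Du; rewrite Nx -EFinM lee_fin in h1.
  have h2 := H2 h u ah Du.
  have hq : (cabs (h (pt u)) `^ q <= cabs (h (pt u)) `^ p *
      (c1 * om u `^ (- (2 + a)) * x) `^ ((q - p) / p))%R.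
    have [->|hn] := eqVneq (cabs (h (pt u))) 0%R.
      by rewrite powR0 ?mulr_ge0 ?powR_ge0 // gt_eqF //; lra.
    have hp : (0 < cabs (h (pt u)))%R by rewrite lt_def hn cabs_ge0.
    rewrite [X in (_ `^ X <= _)%R](_ : q = p + p * ((q - p) / p))%R; last by field; rewrite gt_eqF.
    rewrite powRDp // powRrM; apply: ler_wpM2l; first exact: powR_ge0.
    by apply: ge0_ler_powR; rewrite ?nnegrE ?powR_ge0 // !mulr_ge0 ?powR_ge0 // ltW.
  apply: (@le_trans _ _ ((cabs (h (pt u)) `^ p)%:E *
      ((c1 * om u `^ (- (2 + a)) * x) `^ ((q - p) / p))%:E)).
    by rewrite -EFinM lee_fin.
  apply: le_trans (lee_wpmul2r _ h2) _; first by rewrite lee_fin powR_ge0.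
  rewrite muleAC; apply: lee_wpmul2r.
    by apply: integral_ge0 => v _; rewrite lee_fin powR_ge0.
  rewrite -EFinM lee_fin powRM ?mulr_ge0 ?powR_ge0 ?(ltW c10) // powRM ?powR_ge0 ?(ltW c10) //.
  rewrite -powRrM /cx /E powRDp // powRN powR_mulrn ?(ltW ou) //.
  by rewrite le_eqVlt; apply/orP; left; apply/eqP; ring.
apply: (@le_trans _ _ (\int[L2]_(u in Disc) (m1 u * \int[L2]_(v in cball (pt u) (k * om u)) psi v))).
  rewrite [leRHS](_ : _ = \int[L2]_(u in S) (m1 u * \int[L2]_(v in cball (pt u) (k * om u)) psi v)); last first.
    rewrite [LHS]integral_mkcond [RHS]integral_mkcond; apply: eq_integral => u _; rewrite !patchE.
    case: ifPn => uD; case: ifPn => uS //.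
      by rewrite /m1 patchE (negbTE uS) mul0e.
    by move: uS; rewrite inE => -[h1 _]; move: uD; rewrite mem_set.
  apply: ge0_le_integral.
  - exact: mS.
  - by move=> u _; rewrite mule_ge0 // lee_fin powR_ge0.
  - apply: emeasurable_funM; first exact: measurable_funTS.
    by apply/measurable_EFinP; apply: measurable_analytic_powR => // ? [].
  - apply: measurable_funTS; apply: emeasurable_funM => //.
    exact: measurable_ball_integral.
  - move=> u Su; rewrite /m1 patchE mem_set // -muleA; apply: lee_wpmul2l => //.
    exact: step.
apply: le_trans AT _.
have -> : \int[L2]_(v in Disc) (psi v * B v) = (cx * 2 `^ `|E| * l)%:E * Nrm p a h.
  rewrite -Nrm_scale //; apply: eq_integral => v vD; rewrite /psi patchE vD /B -EFinM.
  by congr EFin; ring.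
rewrite Nx -EFinM lee_fin le_eqVlt; apply/orP; left; apply/eqP.
rewrite /cx /c3 (_ : q / p = (q - p) / p + 1)%R; last by field; rewrite gt_eqF.
have [->|xn] := eqVneq x 0%R.
  rewrite mulr0 [X in (_ * X)%R]powR0 ?mulr0 // gt_eqF //; lra.
rewrite powRDp ?lt_def ?xn // powRr1 //; ring.
Qed.

End Averages.

(** * Montel's theorem and test functions *)

Section Montel.
Context {R : realType}.
Local Notation C := R[i].
Implicit Types (h : C -> C).

Lemma analytic_lipschitz f (s M : R) (z w : C) : analytic f -> 0 <= s < 1 ->
  (forall x, cabs x <= (1 + s) / 2 -> cabs (f x) <= M) ->
  cabs z <= s -> cabs w <= s ->
  cabs (f w - f z) <= 2 * (16 * M / ((1 - s) / 4)) * cabs (w - z).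
Proof.
move=> af /andP[s0 s1] fM zs ws.
have s40 : 0 < (1 - s) / 4 by rewrite divr_gt0 //; lra.
have dz : disc z by rewrite /disc /=; lra.
have dw : disc w by rewrite /disc /=; lra.
have c1 := analytic_segcont (analytic_cderiv af) dz dw.
rewrite -(seg_FTC c1 (F := f)); last first.
  by move=> t t01; apply: analytic_cdiff => //; exact: disc_segment.
apply: seg_bound c1 _ => t t01.
have := cabs_segment t01 zs ws; move: (_ + _) => x xs.
apply: Cauchy_estimate_deriv => //; first by lra.
move=> y yx; apply: fM; have := cabs_le_subD y x; lra.
Qed.

Section LocallyBounded.
Context (f : nat -> C -> C) (af : forall k, analytic (f k)).
Context (fb : forall s : R, 0 <= s < 1 ->
  exists2 M : R, 0 < M & forall k z, cabs z <= s -> cabs (f k z) <= M).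
Context (U : set_system nat) (UU : UltraFilter U).

Lemma ulim_exists : exists h : C -> C, forall z, disc z -> forall e : R, 0 < e ->
  U [set k | cabs (f k z - h z) < e].
Proof.
suff H z : exists l : C, disc z -> forall e : R, 0 < e -> U [set k | cabs (f k z - l) < e].
  by have [h hP] := choice H; exists h.
have [dz|ndz] := pselect (disc z); last by exists 0 => /ndz.
have zs : 0 <= cabs z < 1 by rewrite cabs_ge0 /=; exact: dz.
have [M M0 HM] := fb zs.
have [l _ Hl] := ulimC UU (fun k => HM k z (lexx _)).
by exists l.
Qed.

Context (h : C -> C) (hlim : forall z, disc z -> forall e : R, 0 < e ->
  U [set k | cabs (f k z - h z) < e]).

(** The candidate for h'(c) is the limit of the f_k'(c), which Cauchy's estimate keeps bounded; the
    Taylor remainder, uniform in k, passes to the pointwise limit. *)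
Lemma ulim_analytic : analytic h.
Proof.
have UF : ProperFilter U by exact: ultra_proper.
apply: analytic_cdiffP => c dc; have c1 : cabs c < 1 by exact: dc.
have c0 := cabs_ge0 c.
pose s : R := (1 - cabs c) / 4; have s0 : 0 < s by rewrite divr_gt0 //; lra.
have cs : cabs c + 2 * s < 1 by rewrite /s; lra.
have cs2 : 0 <= cabs c + 2 * s < 1 by rewrite /s; lra.
have [M M0 HM] := fb cs2.
have bd k w : cabs (w - c) <= 2 * s -> cabs (f k w) <= M.
  by move=> wc; apply: HM; have := cabs_le_subD w c; lra.
have [d _ Hd] := ulimC UU (fun k => Cauchy_estimate_deriv (@af k) s0 cs (bd k)).
exists d => e e0; pose K : R := 32 * M / s ^+ 2.
have K0 : 0 < K by rewrite divr_gt0 ?exprn_gt0 // mulr_gt0.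
exists (Num.min (s / 2) (e / K)); first by rewrite lt_min (divr_gt0 e0 K0) (divr_gt0 s0).
move=> y; rewrite lt_min => /andP[y1 y2].
apply: (@le_trans _ _ (K * cabs y ^+ 2)); last first.
  rewrite expr2 mulrA; apply: ler_wpM2r; first exact: cabs_ge0.
  by rewrite mulrC -ler_pdivlMr // ltW.
apply/ler_addgt0Pr => x x0; have x40 : 0 < x / 4 by rewrite divr_gt0.
have dy : disc (c + y).
  by rewrite /disc /=; have := cabs_le_normD c y; move: cs y1; lra.
have y01 : cabs y <= 1 by move: y1; rewrite /s; lra.
have [k /= [k1 [k2 k3]]] :=
  filter_ex (filterI (hlim dc x40) (filterI (hlim dy x40) (Hd _ x40))).
have T := Cauchy_estimate_taylor (@af k) s0 cs (bd k) y1.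
have -> : h (c + y) - h c - d * y = (f k (c + y) - f k c - cderiv (f k) c * y)
   - (f k (c + y) - h (c + y)) + (f k c - h c) + (cderiv (f k) c - d) * y by ring.
have t1 := cabs_le_normD ((f k (c + y) - f k c - cderiv (f k) c * y)
   - (f k (c + y) - h (c + y)) + (f k c - h c)) ((cderiv (f k) c - d) * y).
have t2 := cabs_le_normD ((f k (c + y) - f k c - cderiv (f k) c * y)
   - (f k (c + y) - h (c + y))) (f k c - h c).
have t3 := cabs_le_normD (f k (c + y) - f k c - cderiv (f k) c * y)
   (- (f k (c + y) - h (c + y))).
rewrite normcN in t3; rewrite [cabs (_ * y)]cabsM in t1.
have t4 : cabs (cderiv (f k) c - d) * cabs y <= x / 4.
  rewrite -[leRHS]mulr1; apply: ler_pM; rewrite ?cabs_ge0 // ltW //.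
move: T t1 t2 t3 t4 k1 k2; rewrite -/K; lra.
Qed.

(** Otherwise [U] contains the set of bad indices. Bad points have a limit x along [U], and the
    common Lipschitz bound of the f_k and of h then contradicts convergence at x. *)
Lemma ulim_uniform (s e : R) : 0 <= s < 1 -> 0 < e ->
  U [set k | forall z, cabs z <= s -> cabs (f k z - h z) <= e].
Proof.
move=> s01 e0; have UF : ProperFilter U by exact: ultra_proper.
have s21 : 0 <= (1 + s) / 2 < 1 by lra.
have [M M0 HM] := fb s21.
pose L : R := 2 * (16 * M / ((1 - s) / 4)).
have L0 : 0 < L.
  apply: mulr_gt0 => //; apply: divr_gt0; first exact: mulr_gt0.
  by apply: divr_gt0 => //; lra.
have lipf k z w : cabs z <= s -> cabs w <= s -> cabs (f k w - f k z) <= L * cabs (w - z).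
  by move=> zs ws; exact: (analytic_lipschitz (@af k) s01 (HM k) zs ws).
clearbody L.
have ds z : cabs z <= s -> disc z by rewrite /disc /=; lra.
have liph z w : cabs z <= s -> cabs w <= s -> cabs (h w - h z) <= L * cabs (w - z).
  move=> zs ws; apply/ler_addgt0Pr => x x0; have x40 : 0 < x / 4 by rewrite divr_gt0.
  have [k /= [k1 k2]] := filter_ex (filterI (hlim (ds _ zs) x40) (hlim (ds _ ws) x40)).
  have -> : h w - h z = (f k w - f k z) - (f k w - h w) + (f k z - h z) by ring.
  have t1 := cabs_le_normD ((f k w - f k z) - (f k w - h w)) (f k z - h z).
  have t2 := cabs_le_normD (f k w - f k z) (- (f k w - h w)); rewrite normcN in t2.
  have := lipf k z w zs ws; move: t1 t2 k1 k2; lra.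
set W := [set k | _]; have [//|nW] := in_ultra_setVsetC W UU.
have bad k : exists z : C, cabs z <= s /\ (~ W k -> e < cabs (f k z - h z)).
  have [Wk|Wk] := pselect (W k); first by exists 0; rewrite cabs0; split => //; lra.
  have /existsNP[z /not_implyP[zs zk]] := Wk.
  by exists z; split => // _; rewrite ltNge; apply/negP.
have [u uP] := choice bad.
have [x xs Hx] := ulimC UU (fun k => (uP k).1).
have L40 : 0 < 4 * L by exact: mulr_gt0.
have eL : 0 < e / (4 * L) by exact: divr_gt0.
have e40 : 0 < e / 4 by rewrite divr_gt0.
have [k /= [k1 [k2 k3]]] := filter_ex (filterI nW (filterI (Hx _ eL) (hlim (ds _ xs) e40))).
have [us ub] := uP k; have := ub k1.
have h1 := lipf k x (u k) xs us; have h2 := liph (u k) x us xs.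
have h3 : L * cabs (u k - x) <= e / 4.
  rewrite mulrC -ler_pdivlMr // (_ : e / 4 / L = e / (4 * L)); first exact: ltW.
  by rewrite invfM mulrA.
rewrite cabsB in h2; rewrite (cabsB x) in h2.
have t1 := cabs_le_normD ((f k (u k) - f k x) + (f k x - h x)) (h x - h (u k)).
have t2 := cabs_le_normD (f k (u k) - f k x) (f k x - h x).
rewrite (_ : _ + _ + _ = f k (u k) - h (u k)) in t1; last by ring.
rewrite (cabsB (h x)) in t1; move: h1 h2 h3 t1 t2 k3; lra.
Qed.

End LocallyBounded.

(** One ultrafilter serves all compact discs at once. The j-th index is picked with tolerance 1 / (j
    + 1) on the disc of radius 1 - 1 / (j + 1) and beyond the previous index, which is possible
    because [U] contains all tails. *)
Lemma Montel (f : nat -> C -> C) : (forall k, analytic (f k)) ->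
  (forall s : R, 0 <= s < 1 ->
     exists2 M : R, 0 < M & forall k z, cabs z <= s -> cabs (f k z) <= M) ->
  exists (phi : nat -> nat) (h : C -> C), [/\ {homo phi : i j / (i < j)%N}, analytic h &
    forall s e : R, 0 <= s < 1 -> 0 < e -> exists K : nat, forall k, (K <= k)%N ->
      forall z, cabs z <= s -> cabs (f (phi k) z - h z) <= e].
Proof.
move=> af fb; have [U UU Uc] := ultra_nat.
have UF : ProperFilter U by exact: ultra_proper.
have [h hlim] := ulim_exists fb UU.
have ah := ulim_analytic af fb UU hlim.
have Hu := ulim_uniform af fb UU hlim.
pose s_ (j : nat) : R := 1 - j.+1%:R^-1; pose e_ (j : nat) : R := j.+1%:R^-1.
have e_0 j : 0 < e_ j by rewrite invr_gt0.
have s_1 j : 0 <= s_ j < 1.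
  rewrite /s_ subr_ge0 ltrBlDr ltrDl e_0 andbT.
  by rewrite invf_le1 // ler1n.
have pk (x : nat * nat) : exists k, (x.2 <= k)%N /\
    forall z, cabs z <= s_ x.1 -> cabs (f k z - h z) <= e_ x.1.
  have [k /= [k1 k2]] := filter_ex (filterI (Uc x.2) (Hu _ _ (s_1 x.1) (e_0 x.1))).
  by exists k.
have [pick pickP] := choice pk.
pose phi := fix phi j := if j is i.+1 then pick (j, (phi i).+1) else pick (0%N, 0%N).
have phiS i : phi i.+1 = pick (i.+1, (phi i).+1) by [].
have phiP i z : cabs z <= s_ i -> cabs (f (phi i) z - h z) <= e_ i.
  case: i => [|i]; first by have [_ H] := pickP (0%N, 0%N); exact: H.
  by have [_ H] := pickP (i.+1, (phi i).+1); rewrite phiS; exact: H.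
exists phi, h; split => //.
  apply: homo_ltn => [y x z|i]; first exact: ltn_trans.
  by rewrite phiS; have [H _] := pickP (i.+1, (phi i).+1).
move=> s e s01 e0.
pose d : R := Num.min (1 - s) e; have d0 : 0 < d by rewrite lt_min e0 andbT; lra.
have [K HK] : exists K : nat, K.+1%:R^-1 <= d.
  exists (Num.bound d^-1); rewrite -[leRHS]invrK lef_pV2 ?posrE ?invr_gt0 //.
  apply: ltW; apply: (lt_trans (archi_boundP _)); first by rewrite invr_ge0 ltW.
  by rewrite ltr_nat.
exists K => k Kk z zs.
have ek : e_ k <= d.
  by apply: le_trans HK; rewrite /e_ lef_pV2 ?posrE // ler_nat ltnS.
have h1 : cabs z <= s_ k.
  apply: le_trans zs _; have : d <= 1 - s by rewrite /d ge_min lexx.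
  by clearbody d; move: ek; rewrite /s_ /e_; move: (_^-1) => y; lra.
apply: le_trans (phiP k z h1) _; apply: le_trans ek _.
by rewrite /d ge_min lexx orbT.
Qed.

End Montel.

(** * Powers of the kernel 1 / (1 - conj a z) *)

Section Kernel.
Context {R : realType}.
Local Notation C := R[i].
Local Notation leb := (@lebesgue_measure R).
Local Notation TR := (measurableTypeR R).
Local Notation T2 := (TR * TR)%type.
Local Notation L2 := (leb \x leb)%E.
Implicit Types (a z : C) (m : nat).

Definition kden a z : C := 1 - a^* * z.
Definition kpow m a z : C := (kden a z)^-1 ^+ m.

Lemma cabs_kden_ge a z : cabs a <= 1 -> cabs z <= 1 ->
  1 - cabs a <= cabs (kden a z) /\ 1 - cabs z <= cabs (kden a z).
Proof.
move=> a1 z1; have := cabs_le_subD 1 (a^* * z); rewrite cabs1 cabsM cabs_conj -/(kden a z).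
have h1 : cabs a * cabs z <= cabs a by apply: ler_piMr => //; exact: cabs_ge0.
have h2 : cabs a * cabs z <= cabs z by apply: ler_piMl => //; exact: cabs_ge0.
by split; lra.
Qed.

Lemma kden_neq0 a z : cabs a < 1 -> disc z -> kden a z != 0.
Proof.
move=> a1 dz; rewrite -cabs_gt0; have [h _] := cabs_kden_ge (ltW a1) (ltW (dz : cabs z < 1)).
by apply: lt_le_trans h; rewrite subr_gt0.
Qed.

Lemma cdiff_kden_inv a z : kden a z != 0 ->
  cdiff (fun w => (kden a w)^-1) z (a^* * (kden a z)^-1 ^+ 2).
Proof.
move=> n0.
have D : cdiff (kden a) z (0 - (0 * z + a^* * 1)).
  apply: cdiffB; first exact: cdiff_cst.
  by apply: cdiffM; [exact: cdiff_cst|exact: cdiff_id].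
have -> : a^* * (kden a z)^-1 ^+ 2 = - (0 - (0 * z + a^* * 1)) / (kden a z ^+ 2).
  by rewrite exprVn; ring.
exact: (cdiffV n0 D).
Qed.

Lemma cdiff_kpow m a z : kden a z != 0 ->
  cdiff (kpow m a) z (m%:R * a^* * (kden a z)^-1 ^+ m.+1).
Proof.
move=> n0; elim: m => [|m IH].
  by rewrite !mul0r; exact: (cdiff_cst 1).
have := cdiffM (cdiff_kden_inv n0) IH.
rewrite (_ : _ + _ = m.+1%:R * a^* * (kden a z)^-1 ^+ m.+2); last first.
  by rewrite /kpow -natr1 !exprS expr0; ring.
apply: (cdiff_ext ltr01) => h _ /=.
by rewrite /kpow exprS.
Qed.

Lemma analytic_kpow m a : cabs a < 1 -> analytic (kpow m a).
Proof.
by move=> a1; apply: analytic_cdiffP => z dz; eexists; apply: cdiff_kpow; exact: kden_neq0.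
Qed.

Lemma cabs_kpow m a z : cabs (kpow m a z) = (cabs (kden a z))^-1 ^+ m.
Proof. by rewrite /kpow cabsX cabsV. Qed.

(** With b the reflection of a in the circle, 1 - conj a z = conj a (b - z); hence |z - b| <= 2 D
    because |a| >= 1/2, while d <= D. Each factor is thus at most 5 D^2, and the two real variables
    are separated. *)
Lemma kden_quadratic a (d x y : R) : d = 1 - cabs a -> 2^-1 <= cabs a < 1 ->
  cabs (x +i* y) < 1 ->
  (d ^+ 2 + (x - complex.Re (a^*)^-1) ^+ 2) * (d ^+ 2 + (y - complex.Im (a^*)^-1) ^+ 2)
    <= 25 * cabs (kden a (x +i* y)) ^+ 4.
Proof.
move=> dE /andP[a2 a1] z1; set D := cabs (kden _ _); set b := (a^*)^-1.
have D0 : 0 <= D by exact: cabs_ge0.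
have an0 : a^* != 0 by rewrite -cabs_gt0 cabs_conj; lra.
have zb : cabs (x +i* y - b) <= 2 * D.
  have E : kden a (x +i* y) = a^* * (b - x +i* y) by rewrite /kden mulrBr /b mulfV.
  rewrite /D E cabsM cabs_conj (cabsB b) mulrA; apply: ler_peMl; first exact: cabs_ge0.
  lra.
have [dD _] := cabs_kden_ge (ltW a1) (ltW z1); rewrite -dE -/D in dD.
have d0 : 0 <= d by rewrite dE; lra.
have hd : d ^+ 2 <= D ^+ 2 by rewrite lerXn2r ?nnegrE.
have hx : (x - complex.Re b) ^+ 2 <= 4 * D ^+ 2.
  rewrite -[leLHS]real_normK ?num_real // (_ : 4 * D ^+ 2 = (2 * D) ^+ 2); last by ring.
  rewrite lerXn2r ?nnegrE ?mulr_ge0 //; apply: le_trans zb.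
  by have := cabs_Re (x +i* y - b); rewrite ReB.
have hy : (y - complex.Im b) ^+ 2 <= 4 * D ^+ 2.
  rewrite -[leLHS]real_normK ?num_real // (_ : 4 * D ^+ 2 = (2 * D) ^+ 2); last by ring.
  rewrite lerXn2r ?nnegrE ?mulr_ge0 //; apply: le_trans zb.
  by have := cabs_Im (x +i* y - b); rewrite ImB.
rewrite (_ : 25 * D ^+ 4 = (5 * D ^+ 2) * (5 * D ^+ 2)); last by ring.
apply: ler_pM; rewrite ?addr_ge0 ?sqr_ge0 //; lra.
Qed.

Local Open Scope ereal_scope.

Lemma product_integral (D : set TR) (G H : TR -> \bar R) (J : R) :
  measurable D -> measurable_fun setT G -> measurable_fun setT H ->
  (forall x, 0 <= G x) -> (forall x, 0 <= H x) ->
  \int[leb]_(x in D) G x <= J%:E -> \int[leb]_(x in D) H x <= J%:E ->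
  \int[L2]_(u in (D `*` D)%classic) (G u.1 * H u.2) <= (J ^+ 2)%:E.
Proof.
move=> mD mG mH G0 H0 GJ HJ.
have mf : measurable_fun setT (fun u : T2 => G u.1 * H u.2).
  apply: emeasurable_funM.
    exact: (measurableT_comp mG measurable_fst).
  exact: (measurableT_comp mH measurable_snd).
pose f := (fun u : T2 => G u.1 * H u.2) \_ (D `*` D)%classic.
have mf2 : measurable_fun setT f.
  by apply: measurable_erestrict; [exact: measurableX|exact: measurable_funTS].
have f0 u : 0 <= f u by rewrite /f patchE; case: ifP => // _; rewrite mule_ge0.
have HI : 0 <= \int[leb]_(x in D) H x by apply: integral_ge0.
rewrite integral_mkcond -/f (fubini_tonelli1 (m1 := leb) (m2 := leb) f mf2 f0).
have -> : \int[leb]_x fubini_F leb f x = \int[leb]_(x in D) (G x * \int[leb]_(y in D) H y).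
  rewrite [RHS]integral_mkcond; apply: eq_integral => x _; rewrite patchE /fubini_F.
  case: ifPn => xD.
    rewrite -ge0_integralZl //; last exact: measurable_funTS.
    rewrite [RHS]integral_mkcond; apply: eq_integral => y _.
    by rewrite /f !patchE in_setX /= xD.
  by apply: integral0_eq => y _; rewrite /f patchE in_setX /= (negbTE xD).
rewrite ge0_integralZr //; last exact: measurable_funTS.
by rewrite expr2 EFinM; apply: lee_pmul => //; apply: integral_ge0.
Qed.

Lemma kernel_integral a : (2^-1 <= cabs a < 1)%R ->
  \int[L2]_(u in Disc) (((cabs (kden a (pt u)))^-1 ^+ 4)%:E)
    <= (25 * (pi / (1 - cabs a)) ^+ 2)%:E.
Proof.
move=> a12; have /andP[a2 a1] := a12; pose d : R := (1 - cabs a)%R.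
have d0 : (0 < d)%R by rewrite /d; lra.
pose I : set TR := `[(-1)%R, 1%R]%classic.
have mI : measurable I by exact: measurable_itv.
pose G (b x : R) : \bar R := ((d ^+ 2 + (x - b) ^+ 2)^-1)%:E.
have mG b : measurable_fun [set: TR] (G b).
  apply/measurable_EFinP.
  have mq : measurable_fun [set: TR] (fun x : TR => (d ^+ 2 + (x - b) ^+ 2)%R : TR).
    apply: measurable_funD; first exact: measurable_cst.
    by apply: measurable_funX; apply: measurable_funB => //; exact: measurable_cst.
  apply: (eq_measurable_fun _ _ (measurableT_comp (measurable_powR (-1)%R) mq)) => x _.
  by rewrite /= powR_inv1 // addr_ge0 ?sqr_ge0.
have G0 b x : 0 <= G b x by rewrite lee_fin invr_ge0 addr_ge0 ?sqr_ge0.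
have GI b : \int[leb]_(x in I) G b x <= (pi / d)%:E by exact: integral_atan_le.
pose b1 := complex.Re (a^*)^-1%R; pose b2 := complex.Im (a^*)^-1%R.
have := product_integral mI (mG b1) (mG b2) (G0 b1) (G0 b2) (GI b1) (GI b2) => H.
have mGG : measurable_fun setT (fun u : T2 => G b1 u.1 * G b2 u.2).
  apply: emeasurable_funM.
    exact: (measurableT_comp (mG b1) measurable_fst).
  exact: (measurableT_comp (mG b2) measurable_snd).
rewrite EFinM; apply: le_trans (lee_wpmul2l _ H) => //.
rewrite -integralZD //; last 3 first.
- exact: measurableX.
- by move=> u _; rewrite mule_ge0.
- exact: measurable_funTS.
rewrite [leLHS]integral_mkcond [leRHS]integral_mkcond; apply: ge0_le_integralT.
- by move=> u; rewrite patchE; case: ifP => // _; rewrite lee_fin exprn_ge0 ?invr_ge0 ?cabs_ge0.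
- apply: measurable_erestrict; first exact: measurable_Disc.
  have := measurable_analytic_powR 1%R (@analytic_kpow 4 a a1) (@measurable_Disc R) (fun _ h => h).
  move=> mk; apply/measurable_EFinP; apply: (eq_measurable_fun _ _ mk) => u _.
  by rewrite powRr1 ?cabs_ge0 // cabs_kpow.
- apply: measurable_erestrict; first exact: measurableX.
  by apply: measurable_funTS; exact: measurable_funeM.
- move=> u; rewrite !patchE; case: ifPn => uD; last first.
    by case: ifP => // _; rewrite mule_ge0 ?mule_ge0.
  rewrite inE in uD; have u1 : (cabs (pt u) < 1)%R by exact: uD.
  rewrite mem_set; last first.
    have h1 := cabs_Re (pt u); have h2 := cabs_Im (pt u).
    move: h1 h2; rewrite !ler_norml => /andP[h1 h2] /andP[h3 h4].
    split; rewrite /I /= in_itv /=; apply/andP; split; move: h1 h2 h3 h4 u1 => /=; lra.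
  rewrite /G -!EFinM lee_fin.
  have k0 : (0 < cabs (kden a (pt u)))%R by rewrite cabs_gt0; exact: kden_neq0.
  have q1 : (0 < d ^+ 2 + (u.1 - b1) ^+ 2)%R by rewrite ltr_pwDl ?exprn_gt0 ?sqr_ge0.
  have q2 : (0 < d ^+ 2 + (u.2 - b2) ^+ 2)%R by rewrite ltr_pwDl ?exprn_gt0 ?sqr_ge0.
  rewrite -invfM exprVn ler_pdivlMr ?mulr_gt0 // mulrC ler_pdivrMr ?exprn_gt0 //.
  exact: (kden_quadratic (erefl d) a12 u1).
Qed.

(** One derivative makes the exponent of [1 - |z|] nonnegative, so that it is
    absorbed by [|1 - conj a z|]; what remains is dominated by a product of two
    arctangent integrals. *)
Lemma kpow_Nrm (p e : R) m : (1 <= p)%R -> (-1 < e)%R -> (6 + e <= m%:R)%R ->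
  exists2 c : R, (0 < c)%R & forall a, (2^-1 <= cabs a < 1)%R ->
  Nrm p e (kpow m a) <= (c * (1 - cabs a) `^ (2 + e - m%:R * p))%:E.
Proof.
move=> p1 e1 m6; have p0 : (0 < p)%R by lra.
have mp : (6 + e <= m%:R * p)%R.
  by apply: (le_trans m6); apply: ler_peMr.
have m0 : (0 <= m%:R :> R)%R by exact: ler0n.
have [c1 c10 H1] := Nrm_le_deriv p1 e1.
have [I I0 HI] := integral_om_powR_le e1.
pose P : R := (25 * pi ^+ 2)%R.
have P0 : (0 < P)%R by apply: mulr_gt0 => //; rewrite exprn_gt0 // pi_gt0.
pose c2 : R := (c1 * (m%:R `^ p * P))%R.
have c20 : (0 <= c2)%R.
  by apply: mulr_ge0; [exact: ltW|apply: mulr_ge0; [exact: powR_ge0|exact: ltW]].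
exists (2 `^ p * (c2 + I))%R.
  by rewrite mulr_gt0 ?powR_gt0 // ltr_wpDl.
move=> a a12; have /andP[a2 a1] := a12; pose d : R := (1 - cabs a)%R.
have d0 : (0 < d)%R by rewrite /d; lra.
have ak : analytic (kpow m a) by exact: analytic_kpow.
pose F z : C := (kpow m a z - 1)%R.
have aF : analytic F := analyticB ak (@analytic_cst R 1%R).
have F0 : F 0%R = 0%R by rewrite /F /kpow /kden mulr0 subr0 invr1 expr1n subrr.
have DF z : disc z -> cderiv F z = (m%:R * a^* * (kden a z)^-1 ^+ m.+1)%R.
  move=> dz; apply: cderivE; rewrite -[X in cdiff _ _ X]subr0.
  by apply: cdiffB; [apply: cdiff_kpow; exact: kden_neq0|exact: cdiff_cst].
have pointwise u : Disc u -> ((cabs (cderiv F (pt u)) `^ p * om u `^ (e + p))%:E <=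
    (m%:R `^ p * d `^ (4 - (m%:R * p - e)))%:E * ((cabs (kden a (pt u)))^-1 ^+ 4)%:E).
  move=> Du; have dz : disc (pt u) by exact: Du.
  have ou := om_gt0 Du.
  set D := cabs (kden a (pt u)).
  have D0 : (0 < D)%R by rewrite /D cabs_gt0; exact: kden_neq0.
  have [dD oD] := cabs_kden_ge (ltW a1) (ltW (dz : cabs (pt u) < 1)%R).
  rewrite -/D -/d in dD; rewrite -/D -/(om u) in oD.
  rewrite -EFinM lee_fin (DF _ dz) !cabsM cabs_conj cabsX cabsV -/D.
  have cm : cabs (m%:R : C) = m%:R.
    by rewrite (_ : m%:R = (m%:R : R)%:C) ?cabsR ?ger0_norm // rmorph_nat.
  rewrite cm.
  have h1 : ((m%:R * cabs a * D^-1 ^+ m.+1) `^ p <= m%:R `^ p * D `^ (- (m%:R + 1) * p))%R.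
    have -> : (D `^ (- (m%:R + 1) * p) = (D^-1 ^+ m.+1) `^ p)%R.
      by rewrite powRrM powRN natr1 powR_mulrn ?(ltW D0) // exprVn.
    have hD : (0 <= D^-1 ^+ m.+1)%R by rewrite exprn_ge0 // invr_ge0 ltW.
    rewrite -powRM //; apply: ge0_ler_powR; rewrite ?nnegrE ?(ltW p0) ?mulr_ge0 ?cabs_ge0 //.
    by apply: ler_wpM2r => //; apply: ler_piMr => //; exact: ltW.
  have h2 : (om u `^ (e + p) <= D `^ (e + p))%R.
    by apply: ge0_ler_powR; rewrite ?nnegrE ?(ltW ou) ?(ltW D0) //; lra.
  apply: le_trans (ler_pM (powR_ge0 _ _) (powR_ge0 _ _) h1 h2) _.
  rewrite -!mulrA; apply: ler_wpM2l; first exact: powR_ge0.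
  (* The power of D splits as D^(4 - (m p - e)) D^-4. The first exponent is negative since m is
     large, so D >= d turns it into a power of d; the second factor is left for
     [kernel_integral]. *)
  rewrite -powRDp // (_ : (- (m%:R + 1) * p + (e + p) = (4 - (m%:R * p - e)) - 4)%R); last by ring.
  rewrite powRDp // (powRN _ 4) powR_mulrn ?(ltW D0) // exprVn; apply: ler_wpM2r.
    by rewrite invr_ge0 exprn_ge0 // ltW.
  rewrite -[(4 - _)%R]opprK; apply: powR_neg_anti => //; lra.
have NF : Nrm p e F <= (c2 * d `^ (2 + e - m%:R * p))%:E.
  apply: le_trans (H1 F aF F0) _.
  rewrite /c2 -mulrA EFinM; apply: lee_wpmul2l; first by rewrite lee_fin ltW.
  have mk : measurable_fun Disc (fun u : T2 => ((cabs (kden a (pt u)))^-1 ^+ 4)%:E).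
    have mk := measurable_analytic_powR 1%R (@analytic_kpow 4 a a1) (@measurable_Disc R) (fun _ h => h).
    apply/measurable_EFinP; apply: (eq_measurable_fun _ _ mk) => u _.
    by rewrite powRr1 ?cabs_ge0 // cabs_kpow.
  have k0 (u : T2) : Disc u -> 0 <= ((cabs (kden a (pt u)))^-1 ^+ 4)%:E.
    by move=> _; rewrite lee_fin exprn_ge0 // invr_ge0 cabs_ge0.
  have c0 : (0 <= m%:R `^ p * d `^ (4 - (m%:R * p - e)))%R by rewrite mulr_ge0 ?powR_ge0.
  apply: (@le_trans _ _ (\int[L2]_(u in Disc)
    ((m%:R `^ p * d `^ (4 - (m%:R * p - e)))%:E * ((cabs (kden a (pt u)))^-1 ^+ 4)%:E))).
    apply: ge0_le_integral.
    - exact: measurable_Disc.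
    - by move=> u _; rewrite lee_fin mulr_ge0 ?powR_ge0.
    - by apply: measurable_Nrm; exact: analytic_cderiv.
    - exact: measurable_funeM.
    - exact: pointwise.
  rewrite (integralZD L2 (@measurable_Disc R) k0 mk c0).
  apply: le_trans (lee_wpmul2l _ (kernel_integral a12)) _; first by rewrite lee_fin.
  rewrite -EFinM lee_fin -/d -[leRHS]mulrA -[leLHS]mulrA; apply: ler_wpM2l; first exact: powR_ge0.
  rewrite (_ : (2 + e - m%:R * p = (4 - (m%:R * p - e)) - 2)%R); last by ring.
  rewrite [X in (_ <= _ * X)%R]powRDp // (powRN _ 2) powR_mulrn ?(ltW d0) // /P exprMn exprVn.
  by rewrite le_eqVlt; apply/orP; left; apply/eqP; ring.
rewrite (eq_Nrm p e (g := fun z => F z + 1)%R); last by move=> z _; rewrite /F subrK.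
apply: le_trans (NrmD e p0 aF (@analytic_cst R 1%R)) _.
rewrite -mulrA EFinM; apply: lee_wpmul2l; first by rewrite lee_fin powR_ge0.
rewrite mulrDl EFinD; apply: leeD; first exact: NF.
have h := Nrm_bounded p0 (@analytic_cst R 1%R) ler01 (fun z _ => (_ : cabs 1 <= 1)%R) HI.
apply: le_trans (h _) _; first by rewrite cabs1.
rewrite lee_fin powR1 mul1r; apply: ler_peMr; first exact: ltW.
have E1 : (1 `^ (- (m%:R * p - 2 - e)) = 1 :> R)%R by rewrite powR1.
rewrite -[leLHS]E1 (_ : (2 + e - m%:R * p = - (m%:R * p - 2 - e))%R); last by ring.
by apply: powR_neg_anti => //; rewrite ?gerBl ?cabs_ge0 //; lra.
Qed.

End Kernel.

(** * The essential norm *)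

Section Volterra.
Context {R : realType}.
Local Notation C := R[i].
Local Notation leb := (@lebesgue_measure R).
Local Notation TR := (measurableTypeR R).
Local Notation T2 := (TR * TR)%type.
Local Notation L2 := (leb \x leb)%E.
Implicit Types (f g h F : C -> C) (u v : T2).

(** [Tgn g n f] is [volt n] of the product f g'; treating the product as one function makes
    induction on n possible. *)
Definition volt n F := iter n path_integral F.

Lemma analytic_volt n F : analytic F -> analytic (volt n F).
Proof.
move=> aF; elim: n => [|n IH]; first exact: aF.
exact: (analytic_path_integral IH).
Qed.

Lemma cderiv_volt n F z : analytic F -> disc z -> cderiv (volt n.+1 F) z = volt n F z.
Proof.
by move=> aF dz; exact: (cderivE (cdiff_path_integral (@analytic_volt n F aF) dz)).
Qed.

Lemma volt0 n F : volt n.+1 F 0 = 0.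
Proof. exact: path_integral0. Qed.

Local Open Scope ereal_scope.

(** Induction with b generalized: each integration produces a function vanishing at 0, as
    [Nrm_le_deriv] requires, and moves the exponent to b + q, still above -1. *)
Lemma volt_Nrm_le n (q b : R) : (1 <= q)%R -> (-1 < b)%R ->
  exists2 c : R, (0 < c)%R & forall F, analytic F ->
  Nrm q b (volt n F) <= c%:E * Nrm q (b + n%:R * q) F.
Proof.
move=> q1; elim: n b => [|n IH] b b1.
  by exists 1%R => // F aF; rewrite mul0r addr0 mul1e.
have bq : (-1 < b + q)%R by lra.
have [c1 c10 H1] := Nrm_le_deriv q1 b1; have [c2 c20 H2] := IH _ bq.
exists (c1 * c2)%R; first exact: mulr_gt0.
move=> F aF; have h1 := H1 _ (@analytic_volt n.+1 F aF) (volt0 n F).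
apply: (le_trans h1).
rewrite (eq_Nrm q (b + q) (g := volt n F)); last by move=> z dz; exact: cderiv_volt.
rewrite EFinM -muleA; apply: lee_wpmul2l; first by rewrite lee_fin ltW.
apply: le_trans (H2 F aF) _.
by rewrite (_ : b + q + n%:R * q = b + n.+1%:R * q)%R // -natr1; ring.
Qed.

Lemma volt_Nrm_ge n (q b : R) : (1 <= q)%R -> (-1 < b)%R ->
  exists2 c : R, (0 < c)%R & forall F, analytic F ->
  Nrm q (b + n%:R * q) F <= c%:E * Nrm q b (volt n F).
Proof.
move=> q1; elim: n b => [|n IH] b b1.
  by exists 1%R => // F aF; rewrite mul0r addr0 mul1e.
have bq : (-1 < b + q)%R by lra.
have [c1 c10 H1] := Nrm_deriv_le q1 b1; have [c2 c20 H2] := IH _ bq.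
exists (c2 * c1)%R; first exact: mulr_gt0.
move=> F aF.
rewrite (_ : b + n.+1%:R * q = b + q + n%:R * q)%R; last by rewrite -natr1; ring.
apply: le_trans (H2 F aF) _.
rewrite EFinM -muleA; apply: lee_wpmul2l; first by rewrite lee_fin ltW.
have h1 := H1 _ (@analytic_volt n.+1 F aF); apply: le_trans h1.
rewrite (eq_Nrm q (b + q) (f := cderiv (volt n.+1 F)) (g := volt n F)); first exact: lexx.
by move=> z dz; exact: cderiv_volt.
Qed.

Lemma om_sqr u : (1 - cabs (pt u) ^+ 2 = om u * (1 + cabs (pt u)))%R.
Proof. by rewrite /om; ring. Qed.

Lemma om_sqr_powR (e : R) u : Disc u ->
  ((1 - cabs (pt u) ^+ 2) `^ e <= 2 `^ `|e| * om u `^ e /\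
   om u `^ e <= 2 `^ `|e| * (1 - cabs (pt u) ^+ 2) `^ e)%R.
Proof.
move=> Du; have ou := om_gt0 Du; have z1 : (cabs (pt u) < 1)%R by exact: Du.
have z0 := cabs_ge0 (pt u).
have h1 : (om u <= 1 - cabs (pt u) ^+ 2)%R.
  by rewrite om_sqr ler_peMr ?(ltW ou) // lerDl.
have h2 : (1 - cabs (pt u) ^+ 2 <= 2 * om u)%R.
  by rewrite om_sqr mulrC ler_pM2r //; lra.
have h0 : (0 < 1 - cabs (pt u) ^+ 2)%R by exact: lt_le_trans h1.
by split; apply: powR_lip => //; lra.
Qed.

Lemma weight_equiv (e : R) (D : set T2) (phi : T2 -> R) : measurable D -> D `<=` Disc ->
  measurable_fun D phi -> (forall u, (0 <= phi u)%R) ->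
  \int[L2]_(u in D) (phi u * (1 - cabs (pt u) ^+ 2) `^ e)%:E
    <= (2 `^ `|e|)%:E * \int[L2]_(u in D) (phi u * om u `^ e)%:E /\
  \int[L2]_(u in D) (phi u * om u `^ e)%:E
    <= (2 `^ `|e|)%:E * \int[L2]_(u in D) (phi u * (1 - cabs (pt u) ^+ 2) `^ e)%:E.
Proof.
move=> mD sD mphi phi0.
have m1 : measurable_fun D (fun u => (phi u * om u `^ e)%:E).
  apply/measurable_EFinP; apply: measurable_funM => //; apply: measurable_funTS.
  exact: measurable_om_powR.
have m2 : measurable_fun D (fun u => (phi u * (1 - cabs (pt u) ^+ 2) `^ e)%:E).
  apply/measurable_EFinP; apply: measurable_funM => //; apply: measurable_funTS.
  apply: (measurableT_comp (measurable_powR e)); apply: measurable_funB; first exact: measurable_cst.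
  by apply: measurable_funX; exact: measurable_cabs_pt.
have p1 u : D u -> 0 <= (phi u * om u `^ e)%:E.
  by move=> _; rewrite lee_fin mulr_ge0 ?powR_ge0.
have p2 u : D u -> 0 <= (phi u * (1 - cabs (pt u) ^+ 2) `^ e)%:E.
  by move=> _; rewrite lee_fin mulr_ge0 ?powR_ge0.
rewrite -(integralZD L2 mD p1 m1 (powR_ge0 _ _)) -(integralZD L2 mD p2 m2 (powR_ge0 _ _)).
split; apply: ge0_le_integral => //.
- exact: measurable_funeM.
- move=> u Du; rewrite -EFinM lee_fin mulrCA; apply: ler_wpM2l => //.
  by have [] := om_sqr_powR e (sD _ Du).
- exact: measurable_funeM.
- move=> u Du; rewrite -EFinM lee_fin mulrCA; apply: ler_wpM2l => //.
  by have [] := om_sqr_powR e (sD _ Du).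
Qed.

Lemma area_integral_Nrm (p a : R) : (-1 < a)%R ->
  exists2 c : R, (0 < c)%R & forall f, analytic f ->
  area_integral disc (fun z => cabs (f z) `^ p * ((a + 1) * (1 - cabs z ^+ 2) `^ a))%R
    <= c%:E * Nrm p a f /\
  Nrm p a f <= c%:E *
  area_integral disc (fun z => cabs (f z) `^ p * ((a + 1) * (1 - cabs z ^+ 2) `^ a))%R.
Proof.
move=> a1; have a10 : (0 < a + 1)%R by lra.
have pi0 : (0 < pi :> R)%R by exact: pi_gt0.
have t0 : (0 < 2 `^ `|a| :> R)%R by exact: powR_gt0.
pose k : R := (pi^-1 * (a + 1))%R.
have k0 : (0 < k)%R by rewrite mulr_gt0 ?invr_gt0.
exists (2 `^ `|a| * k + 2 `^ `|a| * k^-1)%R; first by rewrite addr_gt0 // mulr_gt0 ?invr_gt0.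
move=> f af; set A := area_integral _ _.
pose phi (u : T2) : R := (cabs (f (pt u)) `^ p)%R.
have phi0 u : (0 <= phi u)%R by exact: powR_ge0.
have mphi : measurable_fun Disc phi.
  by apply: measurable_analytic_powR => //; exact: measurable_Disc.
have [] := weight_equiv a (@measurable_Disc R) (@subset_refl _ _) mphi phi0.
set I := \int[L2]_(u in Disc) (phi u * (1 - cabs (pt u) ^+ 2) `^ a)%:E => h1 h2.
have I0 : 0 <= I by apply: integral_ge0 => u _; rewrite lee_fin mulr_ge0 ?powR_ge0.
have AE : A = k%:E * I.
  rewrite /A /area_integral /k EFinM -muleA; congr (_ * _).
  rewrite -[LHS]/(\int[L2]_(u in Disc) (phi u * ((a + 1) * (1 - cabs (pt u) ^+ 2) `^ a))%:E).
  have m2 : measurable_fun Disc (fun u => (phi u * (1 - cabs (pt u) ^+ 2) `^ a)%:E).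
    apply/measurable_EFinP; apply: measurable_funM => //; apply: measurable_funTS.
    apply: (measurableT_comp (measurable_powR a)); apply: measurable_funB; first exact: measurable_cst.
    by apply: measurable_funX; exact: measurable_cabs_pt.
  have p2 u : Disc u -> 0 <= (phi u * (1 - cabs (pt u) ^+ 2) `^ a)%:E.
    by move=> _; rewrite lee_fin mulr_ge0 ?powR_ge0.
  rewrite -(integralZD L2 (@measurable_Disc R) p2 m2 (ltW a10)).
  by apply: eq_integral => u _; rewrite -EFinM mulrCA.
clearbody A; have kV : (k^-1 * k = 1)%R by rewrite mulVf // gt_eqF.
have N0 := Nrm_ge0 p a f.
split.
  apply: (@le_trans _ _ ((2 `^ `|a| * k)%:E * Nrm p a f)); last first.
    by apply: lee_wpmul2r => //; rewrite lee_fin lerDl ltW // mulr_gt0 ?invr_gt0.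
  rewrite AE [(2 `^ `|a| * k)%R]mulrC [(k * _)%:E]EFinM -[leRHS]muleA.
  apply: lee_wpmul2l; first by rewrite lee_fin ltW.
  exact: h1.
have A0 : 0 <= A.
  by rewrite AE; apply: mule_ge0; [rewrite lee_fin; exact: ltW|exact: I0].
apply: (@le_trans _ _ ((2 `^ `|a| * k^-1)%:E * A)); last first.
  by apply: lee_wpmul2r => //; rewrite lee_fin lerDr ltW // mulr_gt0.
rewrite AE muleA -EFinM -mulrA kV mulr1.
exact: h2.
Qed.

Lemma poweRK (x : \bar R) (p : R) : (0 < p)%R -> 0 <= x -> poweR (poweR x p^-1) p = x.
Proof. by move=> p0 x0; rewrite -poweRrM mulVf ?gt_eqF // poweRe1. Qed.

(** The dictionary between [bergman_norm], a root with values in the extended reals, and the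
    integral [Nrm]. Bounding by real numbers x and y keeps later estimates in [R]. *)
Lemma bergman_normP (p a : R) : (1 <= p)%R -> (-1 < a)%R ->
  exists2 c : R, (0 < c)%R & forall f, analytic f ->
  [/\ forall x : R, (0 <= x)%R -> bergman_norm p a f <= x%:E -> Nrm p a f <= (c * x `^ p)%:E,
      forall y : R, (0 <= y)%R -> Nrm p a f <= y%:E -> bergman_norm p a f <= ((c * y) `^ p^-1)%:E
    & bergman p a f <-> Nrm p a f < +oo].
Proof.
move=> p1 a1; have p0 : (0 < p)%R by lra.
have [c c0 H] := area_integral_Nrm p a1; exists c => // f af.
have [] := H f af; rewrite /bergman /bergman_norm; set A := area_integral _ _ => h1 h2.
have A0 : 0 <= A.
  apply: mule_ge0; first by rewrite lee_fin invr_ge0 pi_ge0.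
  by apply: integral_ge0 => u _; rewrite lee_fin mulr_ge0 ?mulr_ge0 ?powR_ge0 //; lra.
have ge0i (x : \bar R) : 0 <= x -> x \in `[0, +oo] by move=> x0; rewrite in_itv /= x0 leey.
split.
- move=> x x0 hx; apply: (le_trans h2); rewrite EFinM; apply: lee_wpmul2l.
    by rewrite lee_fin ltW.
  rewrite -(poweRK p0 A0) -poweR_EFin; apply: gt0_ler_poweR (ltW p0) _ _ _ _ hx.
    by apply: ge0i; exact: poweR_ge0.
  by apply: ge0i; rewrite lee_fin.
- move=> y y0 hy; rewrite -poweR_EFin; apply: gt0_ler_poweR.
  + by rewrite invr_ge0 ltW.
  + exact: ge0i.
  + by apply: ge0i; rewrite lee_fin mulr_ge0 // ltW.
  + by apply: (le_trans h1); rewrite EFinM; apply: lee_wpmul2l => //; rewrite lee_fin ltW.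
- split.
    move=> [_ hA]; apply: (le_lt_trans h2); apply: lte_mul_pinfty => //.
      by rewrite lee_fin ltW.
    by apply: lty_poweRy hA; rewrite gt_eqF // invr_gt0.
  move=> hN; split => //; apply: poweR_lty; apply: (le_lt_trans h1).
  by apply: lte_mul_pinfty => //; rewrite lee_fin ltW.
Qed.

End Volterra.

(** * The measure [mu_n] and its upper limit at the circle *)

Section Weight.
Context {R : realType}.
Local Notation C := R[i].
Local Notation leb := (@lebesgue_measure R).
Local Notation TR := (measurableTypeR R).
Local Notation T2 := (TR * TR)%type.
Local Notation L2 := (leb \x leb)%E.
Implicit Types (f g h F : C -> C) (u v : T2).

Local Open Scope ereal_scope.

(** For e = b + n q this is, up to constants, the density of [mu_n], with 1 - |z| in place of 1 -
    |z|^2. Extension by zero makes it measurable on the whole plane, as the averaging lemmas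
    require. *)
Definition weight g (q e : R) : T2 -> \bar R :=
  (fun u => (cabs (cderiv g (pt u)) `^ q * om u `^ e)%:E) \_ Disc.

Lemma weight_ge0 g q e u : 0 <= weight g q e u.
Proof. by rewrite /weight patchE; case: ifP => // _; rewrite lee_fin mulr_ge0 ?powR_ge0. Qed.

Lemma measurable_weight g q e : analytic g -> measurable_fun setT (weight g q e).
Proof.
move=> ag; apply: measurable_erestrict; first exact: measurable_Disc.
exact: (measurable_Nrm q e (analytic_cderiv ag)).
Qed.

Lemma measurable_powE f q (D : set T2) : analytic f -> measurable D -> D `<=` Disc ->
  measurable_fun D (fun u => (cabs (f (pt u)) `^ q)%:E).
Proof.
by move=> af mD sD; apply/measurable_EFinP; exact: measurable_analytic_powR.
Qed.

Lemma measurable_weight_powE f g q e (D : set T2) : analytic f -> analytic g ->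
  measurable D -> D `<=` Disc ->
  measurable_fun D (fun u => weight g q e u * (cabs (f (pt u)) `^ q)%:E).
Proof.
move=> af ag mD sD; apply: emeasurable_funM.
  by apply: measurable_funTS; exact: measurable_weight.
exact: measurable_powE.
Qed.

Lemma Nrm_weight g q e : Nrm q e (cderiv g) = \int[L2]_(u in Disc) weight g q e u.
Proof. by apply: eq_integral => u uD; rewrite /weight patchE uD. Qed.

Lemma NrmM_weight f g q e : (0 < q)%R ->
  Nrm q e (fun z => f z * cderiv g z)%R =
  \int[L2]_(u in Disc) (weight g q e u * (cabs (f (pt u)) `^ q)%:E).
Proof.
move=> q0; apply: eq_integral => u uD; rewrite /weight patchE uD -EFinM.
by rewrite cabsM powRM ?cabs_ge0 //; congr EFin; ring.
Qed.

Lemma NrmM_bounded f g q e (M : \bar R) (eta : R) : (0 < q)%R -> analytic f -> analytic g ->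
  (0 <= eta)%R -> Nrm q e (cderiv g) <= M -> (forall z, disc z -> (cabs (f z) <= eta)%R) ->
  Nrm q e (fun z => f z * cderiv g z)%R <= (eta `^ q)%:E * M.
Proof.
move=> q0 af ag eta0 gM fe; have ag' := analytic_cderiv ag.
apply: (@le_trans _ _ ((eta `^ q)%:E * Nrm q e (cderiv g))); last first.
  by apply: lee_wpmul2l => //; rewrite lee_fin powR_ge0.
rewrite -(Nrm_scale q e ag' (powR_ge0 _ _)); apply: ge0_le_integral.
- exact: measurable_Disc.
- by move=> u _; rewrite lee_fin mulr_ge0 ?powR_ge0.
- exact: (measurable_Nrm q e (analyticM af ag')).
- apply: (eq_measurable_fun _ _ (measurable_funeM (eta `^ q)%:E (measurable_Nrm q e ag'))).
  by move=> u _; rewrite EFinM.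
- move=> u Du; rewrite lee_fin mulrA; apply: ler_wpM2r; first exact: powR_ge0.
  rewrite cabsM powRM ?cabs_ge0 //; apply: ler_wpM2r; first exact: powR_ge0.
  by apply: ge0_ler_powR; rewrite ?nnegrE ?cabs_ge0 ?(ltW q0) //; exact: fe.
Qed.

(** The set [carleson_disc (pt v) r] in real coordinates. *)
Definition tent (r : R) v : set T2 :=
  (Disc `&` [set u | (cabs (pt u - pt v) < r * om v)%R])%classic.

Lemma measurable_tent r v : measurable (tent r v).
Proof.
apply: measurable_lt_set; first exact: measurable_Disc.
  exact: measurable_funTS (@measurable_cabs_sub R (pt v)).
exact: measurable_cst.
Qed.

(** The disc is cut at 1 - |z| = de / 2: near the circle [Carleson] applies, and inside the bound
    eta of |f| is paired with the total mass M. In the applications f is small on compact sets, so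
    eta can be taken small. *)
Lemma Carleson_compact (p q a r : R) : (1 <= p)%R -> (p <= q)%R -> (-1 < a)%R ->
  (0 < r)%R -> (r < 1)%R ->
  exists2 c : R, (0 < c)%R & forall g f (e l de X M eta : R),
  analytic g -> analytic f -> (0 <= l)%R -> (0 < de)%R -> (0 <= X)%R -> (0 <= eta)%R ->
  Nrm q e (cderiv g) <= M%:E ->
  (forall v, Disc v -> (om v < de)%R -> \int[L2]_(u in tent r v) weight g q e u
      <= (l * om v `^ (q * (2 + a) / p))%:E) ->
  Nrm p a f <= X%:E ->
  (forall u, Disc u -> (de / 2 <= om u)%R -> (cabs (f (pt u)) <= eta)%R) ->
  Nrm q e (fun z => f z * cderiv g z)%R <= (c * l * X `^ (q / p) + eta `^ q * M)%:E.
Proof.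
move=> p1 pq a1 r0 r1; have q0 : (0 < q)%R by lra.
have p0 : (0 < p)%R by lra.
have [c c0 H] := Carleson p1 pq a1 r0 r1; exists c => //.
move=> g f e l de X M eta ag af l0 de0 X0 eta0 gM gl fX feta.
have : Nrm p a f \is a fin_num.
  by rewrite ge0_fin_numE ?Nrm_ge0 //; apply: le_lt_trans fX _; rewrite ltry.
move=> /fineK; set x := fine _ => Nx.
have x0 : (0 <= x)%R by rewrite -lee_fin Nx Nrm_ge0.
have xX : (x <= X)%R by rewrite -lee_fin Nx.
pose m := weight g q e.
have m0 u : 0 <= m u by exact: weight_ge0.
have mm : measurable_fun setT m by exact: measurable_weight.
have := H m l de x f mm m0 l0 de0 gl af (esym Nx).
pose S : set T2 := (Disc `&` [set u | (om u < de / 2)%R])%classic => HS.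
have mS : measurable S.
  apply: measurable_lt_set; first exact: measurable_Disc.
    exact: measurable_funTS (@measurable_om R).
  exact: measurable_cst.
rewrite NrmM_weight //.
pose A u := m u * (cabs (f (pt u)) `^ q)%:E.
have A0 u : 0 <= A u by rewrite mule_ge0 // lee_fin powR_ge0.
have mA : measurable_fun Disc A.
  by apply: measurable_weight_powE => //; exact: measurable_Disc.
have mAS : measurable_fun setT (A \_ S).
  by apply: measurable_erestrict => //; apply: measurable_weight_powE => // ? [].
have AS0 u : 0 <= (A \_ S) u by rewrite patchE; case: ifP.
have me : measurable_fun setT (fun u => (eta `^ q)%:E * m u) by exact: measurable_funeM.
have e0 u : 0 <= (eta `^ q)%:E * m u by rewrite mule_ge0 // lee_fin powR_ge0.
apply: (@le_trans _ _ (\int[L2]_u ((A \_ S) u + (eta `^ q)%:E * m u))).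
  rewrite integral_mkcond; apply: ge0_le_integralT.
  - by move=> u; rewrite patchE; case: ifP => // _; exact: (A0 u).
  - by apply: measurable_erestrict => //; exact: measurable_Disc.
  - exact: emeasurable_funD.
  - move=> u; rewrite !patchE; case: ifPn => [uD|_]; last by rewrite adde_ge0 //; case: ifP.
    rewrite inE in uD; case: ifPn => uS; first by rewrite leeDl.
    rewrite add0e /A muleC; apply: lee_wpmul2r => //; rewrite lee_fin.
    apply: ge0_ler_powR; rewrite ?nnegrE ?cabs_ge0 ?(ltW q0) //.
    apply: feta => //; rewrite leNgt; apply/negP => h.
    by move: uS; rewrite notin_setE; apply.
rewrite ge0_integralDT // EFinD; apply: leeD.
  rewrite -integral_mkcond; apply: le_trans HS _; rewrite lee_fin.
  apply: ler_wpM2l; first by rewrite mulr_ge0 // ltW.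
  by apply: ge0_ler_powR; rewrite ?nnegrE // divr_ge0 // ltW.
rewrite (integralZT L2 m0 mm (powR_ge0 _ _)) EFinM; apply: lee_wpmul2l.
  by rewrite lee_fin powR_ge0.
apply: le_trans gM; rewrite Nrm_weight [leRHS]integral_mkcond.
apply: ge0_le_integralT => //.
  by apply: measurable_erestrict; [exact: measurable_Disc|exact: measurable_funTS].
by move=> u; rewrite /m /weight !patchE; case: ifP.
Qed.

(** The quotient whose upper limit at the circle is [limsup_mu]. *)
Definition quot g n (p q a b r : R) (z : C) : \bar R :=
  mu_n g n q b (carleson_disc z r) * ((1 - cabs z ^+ 2) `^ (q * (2 + a) / p))^-1%:E.

Lemma quot_ge0 g n p q a b r z : 0 <= quot g n p q a b r z.
Proof.
apply: mule_ge0; last by rewrite lee_fin invr_ge0 powR_ge0.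
apply: mule_ge0; first by rewrite lee_fin invr_ge0 pi_ge0.
by apply: integral_ge0 => u _; rewrite lee_fin mulr_ge0 ?powR_ge0.
Qed.

(** Replaces 1 - |z|^2 by 1 - |z| both in the density and in the normalizing power, and removes the
    factor 1 / pi of the area measure; c pi + c / pi serves both directions. *)
Lemma quot_tent n (p q a b r : R) : exists2 c : R, (0 < c)%R & forall g v,
  analytic g -> Disc v ->
  \int[L2]_(u in tent r v) weight g q (b + n%:R * q) u
    <= (c * om v `^ (q * (2 + a) / p))%:E * quot g n p q a b r (pt v) /\
  quot g n p q a b r (pt v) * (om v `^ (q * (2 + a) / p))%:E
    <= c%:E * \int[L2]_(u in tent r v) weight g q (b + n%:R * q) u.
Proof.
set k := (q * (2 + a) / p)%R; set e := (b + n%:R * q)%R.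
have pi0 : (0 < pi :> R)%R by exact: pi_gt0.
have ce0 : (0 < 2 `^ `|e| :> R)%R by exact: powR_gt0.
have ck0 : (0 < 2 `^ `|k| :> R)%R by exact: powR_gt0.
pose c : R := (2 `^ `|e| * 2 `^ `|k|)%R; have c0 : (0 < c)%R by exact: mulr_gt0.
exists (c * pi + c * pi^-1)%R; first by rewrite addr_gt0 // mulr_gt0 ?invr_gt0.
move=> g v ag Dv; have ag' := analytic_cderiv ag; have ov := om_gt0 Dv.
pose phi (u : T2) : R := (cabs (cderiv g (pt u)) `^ q)%R.
have phi0 u : (0 <= phi u)%R by exact: powR_ge0.
have sT : tent r v `<=` Disc by move=> ? [].
have mT := measurable_tent r v.
have mphi : measurable_fun (tent r v) phi by exact: measurable_analytic_powR.
have [] := weight_equiv e mT sT mphi phi0.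
have -> : \int[L2]_(u in tent r v) (phi u * om u `^ e)%:E =
    \int[L2]_(u in tent r v) weight g q e u.
  by apply: eq_integral => u; rewrite inE => -[Du _]; rewrite /weight patchE mem_set.
set J := \int[L2]_(u in _) weight g q e u.
set J' := \int[L2]_(u in _) _ => h1 h2.
have J0 : 0 <= J by apply: integral_ge0 => u _; exact: weight_ge0.
have J'0 : 0 <= J' by apply: integral_ge0 => u _; rewrite lee_fin mulr_ge0 ?powR_ge0.
set W := ((1 - cabs (pt v) ^+ 2) `^ k)%R.
have W0 : (0 < W)%R.
  apply: powR_gt0; rewrite om_sqr; apply: mulr_gt0 => //.
  by rewrite ltr_pwDl // cabs_ge0.
have -> : quot g n p q a b r (pt v) = (pi^-1 * W^-1)%:E * J'.
  by rewrite /quot /mu_n /area_integral muleAC -EFinM.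
have [k1 k2] := om_sqr_powR k Dv; rewrite -/W in k1 k2.
have cc : ((c * pi)%:E <= (c * pi + c * pi^-1)%:E) /\ ((c * pi^-1)%:E <= (c * pi + c * pi^-1)%:E).
  by rewrite !lee_fin lerDl lerDr !ltW // mulr_gt0 ?invr_gt0.
split.
  apply: (@le_trans _ _ ((c * pi * (om v `^ k * (pi^-1 * W^-1)))%:E * J')); last first.
    rewrite muleA -EFinM; apply: lee_wpmul2r => //; rewrite lee_fin -[leRHS]mulrA.
    apply: ler_wpM2r; last by move: cc.1; rewrite lee_fin.
    by rewrite !mulr_ge0 ?powR_ge0 ?invr_ge0 // ltW.
  apply: (le_trans h2); apply: lee_wpmul2r => //; rewrite lee_fin.
  have -> : (c * pi * (om v `^ k * (pi^-1 * W^-1)) = 2 `^ `|e| * (2 `^ `|k| * om v `^ k / W))%R.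
    have Wn : (W != 0)%R by rewrite gt_eqF.
    have pn : (pi != 0 :> R)%R by rewrite gt_eqF.
    rewrite /c; clearbody W; move: pn; move: (pi : R) => P pn.
    by field; apply/andP; split.
  apply: ler_peMr; first exact: ltW.
  by rewrite ler_pdivlMr // mul1r.
rewrite muleAC -EFinM.
apply: (@le_trans _ _ ((c * pi^-1)%:E * J)); last by apply: lee_wpmul2r => //; exact: cc.2.
apply: (@le_trans _ _ ((pi^-1 * W^-1 * om v `^ k * 2 `^ `|e|)%:E * J)).
  rewrite [in leRHS]EFinM -muleA; apply: lee_wpmul2l => //.
  by rewrite lee_fin !mulr_ge0 ?powR_ge0 ?invr_ge0 // ltW.
apply: lee_wpmul2r => //; rewrite lee_fin.
have -> : (c * pi^-1 = pi^-1 * 2 `^ `|k| * 2 `^ `|e|)%R by rewrite /c; ring.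
apply: ler_wpM2r; first exact: ltW.
rewrite -mulrA; apply: ler_wpM2l; first by rewrite invr_ge0 ltW.
by rewrite mulrC ler_pdivrMr.
Qed.

Section Limsup.
Context (g : C -> C) (n : nat) (p q a b r : R).

Lemma to_boundary_annulus (d : R) : (0 < d)%R ->
  (to_boundary : set_system (C^o)) [set z : C | (1 - d < cabs z < 1)%R].
Proof. by move=> d0; exists d. Qed.

Lemma limsup_mu_ge0 : 0 <= limsup_mu g n p q a b r.
Proof.
apply: limf_esup_ge0; last by move=> z; exact: quot_ge0.
(* The filter is shown not to contain the empty set: the real point 1 - min(d, 1) / 2 lies in the
   annulus of width d. *)
move=> [d d0 h]; suff /h : [set z : C | (1 - d < cabs z < 1)%R] (1 - Num.min d 1 / 2)%:C%R by [].
have m0 : (0 < Num.min d 1)%R by rewrite lt_min d0 ltr01.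
have m1 : (Num.min d 1 <= 1)%R by rewrite ge_min lexx orbT.
have md : (Num.min d 1 <= d)%R by rewrite ge_min lexx.
change (1 - d < cabs (1 - Num.min d 1 / 2 : R)%:C%C < 1)%R.
rewrite cabsR ger0_norm; last by move: m0 m1 md; lra.
by apply/andP; split; move: m0 m1 md; lra.
Qed.

Lemma limsup_mu_lt (l : R) : limsup_mu g n p q a b r < l%:E ->
  exists2 d : R, (0 < d)%R & forall v, Disc v -> (om v < d)%R ->
    quot g n p q a b r (pt v) <= l%:E.
Proof.
move=> /ereal_inf_lt[_ [V [d d0 dV] <-] Vl]; exists d => // v Dv ovd.
apply: le_trans (ltW Vl); apply: ereal_sup_ubound; exists (pt v) => //.
apply: dV; apply/andP; split; last exact: Dv.
by move: ovd; rewrite /om; lra.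
Qed.

Lemma limsup_mu_gt (l : R) : l%:E < limsup_mu g n p q a b r ->
  forall d : R, (0 < d)%R -> exists v, [/\ Disc v, (om v < d)%R &
    l%:E < quot g n p q a b r (pt v)].
Proof.
move=> h d d0.
have : l%:E < ereal_sup [set quot g n p q a b r z | z in [set z : C | (1 - d < cabs z < 1)%R]].
  apply: (lt_le_trans h); apply: ereal_inf_lbound.
  by exists [set z : C | (1 - d < cabs z < 1)%R] => //; exact: to_boundary_annulus.
move=> /ereal_sup_gt[_ [z /= /andP[z1 z2] <-] lz].
exists (complex.Re z, complex.Im z).
have E : pt (complex.Re z, complex.Im z) = z by case: (z).
split; last by rewrite E.
- by change (cabs (pt (complex.Re z, complex.Im z)) < 1)%R; rewrite E.
- by rewrite /om E; lra.
Qed.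

End Limsup.

End Weight.

(** * Dilated operators, the upper bound and the compactness criterion *)

Section Operators.
Context {R : realType}.
Local Notation C := R[i].
Local Notation leb := (@lebesgue_measure R).
Local Notation TR := (measurableTypeR R).
Local Notation T2 := (TR * TR)%type.
Local Notation L2 := (leb \x leb)%E.
Implicit Types (f g h F : C -> C) (u v : T2).

Local Open Scope ereal_scope.

Lemma pt_ReIm (z : C) : pt (complex.Re z, complex.Im z) = z.
Proof. by case: z. Qed.

Lemma sup_bound (p e : R) : (1 <= p)%R -> (-1 < e)%R ->
  exists2 c : R, (0 < c)%R & forall f (X s : R) z, analytic f -> Nrm p e f <= X%:E ->
  (0 <= s < 1)%R -> (cabs z <= s)%R ->
  (cabs (f z) <= (c * (1 - s) `^ (- (2 + e)) * X) `^ p^-1)%R.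
Proof.
move=> p1 e1; have p0 : (0 < p)%R by lra.
have [c c0 H] := point_bound e p1; exists c => // f X s z af fX /andP[s0 s1] zs.
have X0 : (0 <= X)%R by rewrite -lee_fin; apply: le_trans fX; exact: Nrm_ge0.
pose v : T2 := (complex.Re z, complex.Im z).
have vz : pt v = z := pt_ReIm z.
have Dv : Disc v by change (cabs (pt v) < 1)%R; rewrite vz; lra.
have os : (1 - s <= om v)%R by rewrite /om vz; lra.
apply: powR_le_root => //; first exact: cabs_ge0.
have := H f v af Dv; rewrite vz => h.
have c1 : (0 <= c * om v `^ (- (2 + e)))%R by rewrite mulr_ge0 ?powR_ge0 // ltW.
have := le_trans h (lee_wpmul2l (_ : 0 <= (c * om v `^ (- (2 + e)))%:E) fX).
rewrite lee_fin => /(_ c1); rewrite -EFinM lee_fin => h2; apply: (le_trans h2).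
apply: ler_wpM2r => //; apply: ler_wpM2l; first exact: ltW.
by apply: powR_neg_anti => //; lra.
Qed.

Lemma loc_bounded (p e X : R) (f : nat -> C -> C) : (1 <= p)%R -> (-1 < e)%R ->
  (forall k, analytic (f k)) -> (forall k, Nrm p e (f k) <= X%:E) ->
  forall s : R, (0 <= s < 1)%R ->
  exists2 M : R, (0 < M)%R & forall k z, (cabs z <= s)%R -> (cabs (f k z) <= M)%R.
Proof.
move=> p1 e1 af fX s s01; have [c c0 H] := sup_bound p1 e1.
exists ((c * (1 - s) `^ (- (2 + e)) * X) `^ p^-1 + 1)%R.
  by apply: ltr_wpDl; [exact: powR_ge0|exact: ltr01].
move=> k z zs; apply: le_trans (H _ _ _ _ (af k) (fX k) s01 zs) _.
by rewrite lerDl.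
Qed.

Lemma NrmB p e f h : (0 < p)%R -> analytic f -> analytic h ->
  Nrm p e (fun z => f z - h z)%R <= (2 `^ p)%:E * (Nrm p e f + Nrm p e h).
Proof.
move=> p0 af ah.
have an : analytic (fun z => -1 * h z)%R := analyticM (@analytic_cst R (-1)%R) ah.
have -> : Nrm p e (fun z => f z - h z)%R = Nrm p e (fun z => f z + -1 * h z)%R.
  by apply: eq_Nrm => z _; rewrite mulN1r.
apply: le_trans (NrmD e p0 af an) _.
by rewrite Nrm_cmul // normcN cabs1 powR1 mul1e.
Qed.

Lemma NrmB_le p e f h (X Y : R) : (0 < p)%R -> analytic f -> analytic h ->
  Nrm p e f <= X%:E -> Nrm p e h <= Y%:E ->
  Nrm p e (fun z => f z - h z)%R <= (2 `^ p * (X + Y))%:E.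
Proof.
move=> p0 af ah fX hY; apply: le_trans (NrmB e p0 af ah) _.
by rewrite EFinM EFinD; apply: lee_wpmul2l; [rewrite lee_fin powR_ge0|exact: leeD].
Qed.

Lemma bergman_bounded (p a M : R) f : (1 <= p)%R -> (-1 < a)%R -> analytic f ->
  (forall z, disc z -> (cabs (f z) <= M)%R) -> bergman p a f.
Proof.
move=> p1 a1 af fM; have p0 : (0 < p)%R by lra.
have [c c0 H] := bergman_normP p1 a1; have [_ _ [_ h]] := H f af; apply: h.
have M0 : (0 <= M)%R by apply: le_trans (fM 0%R (@disc0 R)); exact: cabs_ge0.
have [I I0 HI] := integral_om_powR_le a1.
by apply: le_lt_trans (Nrm_bounded p0 af M0 fM HI) _; rewrite ltry.
Qed.

Lemma bergmanB (p a : R) f h : (1 <= p)%R -> (-1 < a)%R ->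
  bergman p a f -> bergman p a h -> bergman p a (fun z => f z - h z)%R.
Proof.
move=> p1 a1 bf bh; have p0 : (0 < p)%R by lra.
have af : analytic f by case: bf.
have ah : analytic h by case: bh.
have [c c0 H] := bergman_normP p1 a1.
have [_ _ [fN _]] := H f af; have [_ _ [hN _]] := H h ah.
have [_ _ [_ iN]] := H _ (analyticB af ah); apply: iN.
apply: le_lt_trans (NrmB a p0 af ah) _; apply: lte_mul_pinfty => //.
by apply: lte_add_pinfty; [exact: fN|exact: hN].
Qed.

Lemma linear_opB (p a q b : R) (T : operator) f h : (1 <= p)%R -> (-1 < a)%R ->
  linear_operator p a q b T -> bergman p a f -> bergman p a h ->
  forall z, disc z -> T (fun w => f w - h w)%R z = (T f z - T h z)%R.
Proof.
move=> p1 a1 [_ _ lin] bf bh z dz.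
have -> : (fun w => f w - h w)%R = (fun w => -1 * h w + f w)%R.
  by apply/funext => w; rewrite mulN1r addrC.
by rewrite lin // mulN1r addrC.
Qed.

Lemma cvg_ereal0 (x : nat -> \bar R) : (forall k, 0 <= x k) ->
  (forall e : R, (0 < e)%R -> exists K : nat, forall k, (K <= k)%N -> x k <= e%:E) ->
  x @ \oo --> (0 : \bar R).
Proof.
move=> x0 H; apply/fine_cvgP; split.
  have [K HK] := H 1%R ltr01; exists K => // k /= Kk.
  by rewrite ge0_fin_numE //; apply: le_lt_trans (HK k Kk) _; rewrite ltry.
apply/cvgrPdist_le => e e0; have [K HK] := H e e0; exists K => // k /= Kk.
rewrite sub0r normrN ger0_norm ?fine_ge0 //.
have h := HK k Kk; rewrite -lee_fin fineK // ge0_fin_numE //.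
by apply: le_lt_trans h _; rewrite ltry.
Qed.

Lemma ereal0_cvg (x : nat -> \bar R) (e : R) : (forall k, 0 <= x k) ->
  x @ \oo --> (0 : \bar R) -> (0 < e)%R ->
  exists K : nat, forall k, (K <= k)%N -> x k <= e%:E.
Proof.
move=> x0 /fine_cvgP[[K1 _ f1] /cvgrPdist_le/(_ e)] + e0 => /(_ e0)[K2 _ f2].
exists (maxn K1 K2) => k; rewrite geq_max => /andP[h1 h2].
have fk : x k \is a fin_num by exact: f1.
have := f2 k h2; rewrite /= sub0r normrN ger0_norm ?fine_ge0 // => h.
by rewrite -(fineK fk) lee_fin.
Qed.

Lemma bergman_norm_ge0 p a f : 0 <= bergman_norm p a f.
Proof. exact: poweR_ge0. Qed.

Lemma bergman_norm_cvg0 (q b : R) (F : nat -> C -> C) : (1 <= q)%R -> (-1 < b)%R ->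
  (forall k, analytic (F k)) ->
  (forall y : R, (0 < y)%R -> exists K : nat, forall k, (K <= k)%N -> Nrm q b (F k) <= y%:E) ->
  (fun k => bergman_norm q b (F k)) @ \oo --> (0 : \bar R).
Proof.
move=> q1 b1 aF H; have q0 : (0 < q)%R by lra.
have [c c0 Hc] := bergman_normP q1 b1.
apply: cvg_ereal0 => [k|e e0]; first exact: bergman_norm_ge0.
have y0 : (0 < e `^ q / c)%R by rewrite divr_gt0 ?powR_gt0.
have [K HK] := H _ y0; exists K => k Kk.
have [_ h _] := Hc _ (aF k); apply: le_trans (h _ (ltW y0) (HK k Kk)) _.
by rewrite lee_fin mulrC divfK ?gt_eqF // -powRrM mulfV ?gt_eqF // powRr1 // ltW.
Qed.

Lemma analytic_Tgn g n f : analytic g -> analytic f -> analytic (Tgn g n f).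
Proof.
by move=> ag af; exact: (@analytic_volt R n _ (analyticM af (analytic_cderiv ag))).
Qed.

(** Testing on the constant 1, which lies in the space because a > -1, shows that [mu_n] has finite
    total mass. This mass depends on g and may only multiply small quantities. *)
Lemma Tgn_mass (n : nat) (p q a b : R) g : (1 <= p)%R -> (p <= q)%R -> (-1 < a)%R ->
  (-1 < b)%R -> analytic g -> linear_operator p a q b (Tgn g n) ->
  exists2 M : R, (0 <= M)%R & Nrm q (b + n%:R * q) (cderiv g) <= M%:E.
Proof.
move=> p1 pq a1 b1 ag [Tb _ _]; have q1 : (1 <= q)%R by lra.
have b1' : bergman p a (fun=> 1%R : C).
  apply: (bergman_bounded (M := 1%R) p1 a1 (@analytic_cst R 1%R)) => z _.
  by rewrite cabs1.
have [c c0 H] := volt_Nrm_ge n q1 b1; have [k k0 Hk] := bergman_normP q1 b1.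
have aT := @analytic_Tgn g n _ ag (@analytic_cst R 1%R).
have [_ _ [h _]] := Hk _ aT; have {}h := h (Tb _ b1').
have ag' := analytic_cderiv ag.
have := H _ (analyticM (@analytic_cst R 1%R) ag').
rewrite (eq_Nrm q _ (f := (fun z => 1 * cderiv g z)%R) (g := cderiv g)); last first.
  by move=> z _; rewrite mul1r.
move=> hg.
have fin : Nrm q (b + n%:R * q) (cderiv g) < +oo.
  by apply: (le_lt_trans hg); apply: lte_mul_pinfty => //; rewrite lee_fin ltW.
have N0 := Nrm_ge0 q (b + n%:R * q) (cderiv g).
exists (fine (Nrm q (b + n%:R * q) (cderiv g))); first exact: fine_ge0.
by rewrite fineK // ge0_fin_numE.
Qed.

Lemma bergman_dilate (p a rho : R) f : (1 <= p)%R -> (-1 < a)%R -> (2^-1 <= rho <= 1)%R ->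
  bergman p a f -> bergman p a (fun z => f (rho%:C * z))%R.
Proof.
move=> p1 a1 r12 bf; have af : analytic f by case: bf.
have r01 : (0 <= rho <= 1)%R by lra.
have [c c0 H] := bergman_normP p1 a1; have [d d0 Hd] := Nrm_dilate p1 a1.
have [_ _ [fN _]] := H f af; have [_ _ [_ h]] := H _ (analytic_dilate r01 af); apply: h.
apply: le_lt_trans (Hd f rho af r12) _; apply: lte_mul_pinfty; rewrite ?lee_fin ?(ltW d0) //.
exact: fN.
Qed.

Lemma Tgn_bounded_le (n : nat) (q b : R) : (1 <= q)%R -> (-1 < b)%R ->
  exists2 c : R, (0 < c)%R & forall g f (M eta : R), analytic g -> analytic f ->
  (0 <= eta)%R -> Nrm q (b + n%:R * q) (cderiv g) <= M%:E ->
  (forall z, disc z -> (cabs (f z) <= eta)%R) ->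
  Nrm q b (Tgn g n f) <= (c * (eta `^ q * M))%:E.
Proof.
move=> q1 b1; have q0 : (0 < q)%R by lra.
have [c c0 H] := volt_Nrm_le n q1 b1; exists c => // g f M eta ag af eta0 gM fe.
apply: le_trans (H _ (analyticM af (analytic_cderiv ag))) _.
rewrite EFinM; apply: lee_wpmul2l; first by rewrite lee_fin ltW.
rewrite EFinM; exact: NrmM_bounded.
Qed.

Lemma bergman_seq_bound (p a M : R) (f : nat -> C -> C) : (1 <= p)%R -> (-1 < a)%R ->
  (forall k, bergman p a (f k)) -> (forall k, bergman_norm p a (f k) <= M%:E) ->
  exists2 X : R, (0 <= X)%R & forall k, Nrm p a (f k) <= X%:E.
Proof.
move=> p1 a1 bf fM; have [c c0 H] := bergman_normP p1 a1.
have M0 : (0 <= M)%R.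
  by rewrite -lee_fin; apply: le_trans (fM 0%N); exact: bergman_norm_ge0.
exists (c * M `^ p)%R; first by rewrite mulr_ge0 ?powR_ge0 // ltW.
move=> k; have ak : analytic (f k) by case: (bf k).
by have [h _ _] := H _ ak; exact: h.
Qed.

Lemma exists_powR_small (q A y : R) : (1 <= q)%R -> (0 <= A)%R -> (0 < y)%R ->
  exists2 eta : R, (0 < eta)%R & (A * eta `^ q <= y)%R.
Proof.
move=> q1 A0 y0; have q0 : (0 < q)%R by lra.
have A10 : (0 < A + 1)%R by lra.
exists ((y / (A + 1)) `^ q^-1)%R; first by rewrite powR_gt0 // divr_gt0.
have yA : (0 <= y / (A + 1))%R by rewrite divr_ge0 // ltW.
rewrite -powRrM mulVf ?gt_eqF // powRr1 // mulrCA -[leRHS]mulr1.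
apply: ler_wpM2l; first exact: ltW.
by rewrite ler_pdivrMr // mul1r; lra.
Qed.

(** A locally uniform limit of the f_k becomes, after dilation by rho < 1, a uniform limit on the
    whole disc, with a bounded limit function; the finite mass of [mu_n] turns uniform convergence
    into convergence of the images. *)
Lemma Tgn_dilate_compact (n : nat) (p q a b rho : R) g : (1 <= p)%R -> (p <= q)%R ->
  (-1 < a)%R -> (-1 < b)%R -> (2^-1 <= rho < 1)%R -> analytic g ->
  linear_operator p a q b (Tgn g n) ->
  compact_operator p a q b (fun f => Tgn g n (fun z => f (rho%:C * z)%R)).
Proof.
move=> p1 pq a1 b1 r12 ag linT; have q1 : (1 <= q)%R by lra.
have q0 : (0 < q)%R by lra.
have r12' : (2^-1 <= rho <= 1)%R by lra.
have r01 : (0 <= rho <= 1)%R by lra.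
have r01' : (0 <= rho < 1)%R by lra.
have [Tb Text Tlin] := linT.
have rd z : disc z -> (cabs (rho%:C * z)%R <= rho)%R.
  move=> dz; rewrite cabsM cabsR ger0_norm; last by lra.
  by apply: ler_piMr; [lra|exact/ltW/dz].
have dr z : disc z -> disc (rho%:C * z)%R by exact: disc_dilate.
split.
  split.
  - by move=> f bf; apply: Tb; exact: bergman_dilate.
  - move=> f h bf bh fh z dz.
    exact: (Text _ _ (bergman_dilate p1 a1 r12' bf) (bergman_dilate p1 a1 r12' bh)
      (fun w dw => fh _ (dr w dw)) z dz).
  - move=> c f h bf bh z dz.
    exact: (Tlin c _ _ (bergman_dilate p1 a1 r12' bf) (bergman_dilate p1 a1 r12' bh) z dz).
move=> f M bf fM; have [X X0 fX] := bergman_seq_bound p1 a1 bf fM.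
have af k : analytic (f k) by case: (bf k).
have [phi [h [phiI ah Hh]]] := Montel af (loc_bounded p1 a1 af fX).
have [Ms Ms0 HMs] := loc_bounded p1 a1 af fX r01'.
have hb w : (cabs w <= rho)%R -> (cabs (h w) <= Ms + 1)%R.
  move=> wr; have [K HK] := Hh rho 1%R r01' ltr01.
  have := HK K (leqnn K) w wr; have := HMs (phi K) w wr.
  have := cabs_le_subD (h w) (f (phi K) w); rewrite [cabs (h w - _)%R]cabsB; lra.
pose S F z : C := F (rho%:C * z)%R.
have aS F : analytic F -> analytic (S F) by move=> aF; exact: analytic_dilate.
have bSh : bergman p a (S h).
  apply: (bergman_bounded (M := (Ms + 1)%R) p1 a1 (aS h ah)) => z dz.
  exact: (hb _ (rd z dz)).
exists phi, (Tgn g n (S h)); split; [exact: phiI|exact: (Tb _ bSh)|].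
have [m m0 gm] := Tgn_mass p1 pq a1 b1 ag linT.
have [c c0 Hc] := Tgn_bounded_le n q1 b1.
apply: (bergman_norm_cvg0 q1 b1) => [k|y y0].
  exact: (analyticB (@analytic_Tgn g n _ ag (aS _ (af _))) (@analytic_Tgn g n _ ag (aS _ ah))).
 have [eta eta0 heta] := exists_powR_small q1 (mulr_ge0 (ltW c0) m0) y0.
have [K HK] := Hh rho eta r01' eta0; exists K => k Kk.
have bSf : bergman p a (S (f (phi k))) := bergman_dilate p1 a1 r12' (bf _).
rewrite (eq_Nrm q b (g := Tgn g n (fun w => S (f (phi k)) w - S h w)%R)); last first.
  by move=> z dz; rewrite (linear_opB p1 a1 linT bSf bSh dz).
apply: le_trans (Hc g _ m eta ag (analyticB (aS _ (af _)) (aS _ ah)) (ltW eta0) gm _) _.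
  by move=> z dz; exact: (HK k Kk _ (rd z dz)).
by rewrite lee_fin [(eta `^ q * m)%R]mulrC mulrA.
Qed.

Lemma analytic_dilate_close f (s M rho : R) z : analytic f -> (0 <= s < 1)%R ->
  (forall x, (cabs x <= (1 + s) / 2)%R -> (cabs (f x) <= M)%R) ->
  (0 <= rho <= 1)%R -> (cabs z <= s)%R -> (0 <= M)%R ->
  (cabs (f z - f (rho%:C * z)) <= 2 * (16 * M / ((1 - s) / 4)) * (1 - rho))%R.
Proof.
move=> af s01 fM r01 zs M0.
have rz : (cabs (rho%:C * z) <= s)%R.
  rewrite cabsM cabsR ger0_norm; last by lra.
  by apply: le_trans zs; apply: ler_piMl; [exact: cabs_ge0|lra].
apply: le_trans (analytic_lipschitz af s01 fM rz zs) _.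
apply: ler_wpM2l.
  apply: mulr_ge0 => //; apply: divr_ge0; first exact: mulr_ge0.
  by apply: divr_ge0 => //; lra.
have -> : (z - rho%:C * z = (1 - rho)%:C * z)%R by rewrite rmorphB rmorph1 mulrBl mul1r.
rewrite cabsM cabsR ger0_norm; last by lra.
by apply: ler_piMr; lra.
Qed.

(** The estimate shared by the upper bound and the compactness criterion: a boundary term governed
    by l and an interior term governed by eta, with a constant free of g, of the annulus d and of
    the mass M. *)
Lemma Tgn_Carleson (n : nat) (p q a b r : R) : (1 <= p)%R -> (p <= q)%R ->
  (-1 < a)%R -> (-1 < b)%R -> (0 < r)%R -> (r < 1)%R ->
  exists2 c : R, (0 < c)%R & forall g f (l d X M eta : R),
  analytic g -> analytic f -> (0 <= l)%R -> (0 < d)%R -> (0 <= X)%R -> (0 <= eta)%R ->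
  Nrm q (b + n%:R * q) (cderiv g) <= M%:E ->
  (forall v, Disc v -> (om v < d)%R -> quot g n p q a b r (pt v) <= l%:E) ->
  Nrm p a f <= X%:E ->
  (forall u, Disc u -> (d / 2 <= om u)%R -> (cabs (f (pt u)) <= eta)%R) ->
  Nrm q b (Tgn g n f) <= (c * (l * X `^ (q / p) + M * eta `^ q))%:E.
Proof.
move=> p1 pq a1 b1 r0 r1; have q1 : (1 <= q)%R by lra.
have [c1 c10 H1] := volt_Nrm_le n q1 b1.
have [c2 c20 H2] := Carleson_compact p1 pq a1 r0 r1.
have [c3 c30 H3] := quot_tent n p q a b r.
pose k : R := (c2 * c3 + 1)%R; have k0 : (0 < k)%R by rewrite addr_gt0 // mulr_gt0.
exists (c1 * k)%R; first exact: mulr_gt0.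
move=> g f l d X M eta ag af l0 d0 X0 eta0 gM gl fX fe.
have ag' := analytic_cderiv ag.
have tl v : Disc v -> (om v < d)%R ->
    \int[L2]_(u in tent r v) weight g q (b + n%:R * q) u <= (c3 * l * om v `^ (q * (2 + a) / p))%:E.
  move=> Dv vd; have [h _] := H3 g v ag Dv; apply: (le_trans h).
  apply: le_trans (lee_wpmul2l _ (gl v Dv vd)) _.
    by rewrite lee_fin mulr_ge0 ?powR_ge0 // ltW.
  by rewrite -EFinM lee_fin mulrAC.
have cl0 : (0 <= c3 * l)%R by rewrite mulr_ge0 // ltW.
have h := H2 g f _ _ d X M eta ag af cl0 d0 X0 eta0 gM tl fX fe.
apply: le_trans (H1 _ (analyticM af ag')) _.
rewrite -mulrA EFinM; apply: lee_wpmul2l; first by rewrite lee_fin ltW.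
apply: (le_trans h); rewrite lee_fin mulrDr; apply: lerD.
  rewrite !mulrA -[leLHS]mulrA -[leRHS]mulrA; apply: ler_wpM2r; last first.
    by rewrite /k lerDl ler01.
  by rewrite mulr_ge0 ?powR_ge0.
rewrite [leLHS]mulrC; apply: ler_peMl.
  by rewrite mulr_ge0 ?powR_ge0 // -lee_fin; apply: le_trans gM; exact: Nrm_ge0.
by rewrite /k lerDr mulr_ge0 // ltW.
Qed.

Lemma bergman0 (p a : R) : (1 <= p)%R -> (-1 < a)%R ->
  bergman p a (fun=> 0%R : C) /\ bergman_norm p a (fun=> 0%R : C) <= 0.
Proof.
move=> p1 a1; have p0 : (0 < p)%R by lra.
have a0 := @analytic_cst R 0%R; split.
  by apply: (bergman_bounded (M := 0%R) p1 a1 a0) => z _; rewrite cabs0.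
have [c c0 H] := bergman_normP p1 a1; have [_ h _] := H _ a0.
have N0 : Nrm p a (fun=> 0%R : C) <= 0%:E.
  rewrite /Nrm integral0_eq // => u _; rewrite cabs0 powR0 ?gt_eqF // mul0r //.
apply: le_trans (h 0%R (lexx _) N0) _.
by rewrite mulr0 powR0 // invr_eq0 gt_eqF.
Qed.

Lemma operator_norm_ge0 (p a q b : R) (T : operator) : (1 <= p)%R -> (-1 < a)%R ->
  0 <= operator_norm p a q b T.
Proof.
move=> p1 a1; have [b0 n0] := bergman0 p1 a1.
apply: le_trans (bergman_norm_ge0 q b (T (fun=> 0%R))) _.
apply: ereal_sup_ubound; exists (fun=> 0%R) => //; split => //=.
by apply: (le_trans n0); rewrite lee_fin.
Qed.

Lemma essential_norm_ge0 (p a q b : R) (T : operator) : (1 <= p)%R -> (-1 < a)%R ->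
  0 <= essential_norm p a q b T.
Proof.
move=> p1 a1; apply: le_ereal_inf_tmp => _ [K _ <-]; exact: operator_norm_ge0.
Qed.

Lemma exists_boundary_radius (d : R) : (0 < d)%R ->
  exists2 s : R, (0 <= s < 1)%R & forall u, Disc u -> (d / 2 <= om u)%R -> (cabs (pt u) <= s)%R.
Proof.
move=> d0; have m0 : (0 < Num.min d 1)%R by rewrite lt_min d0 ltr01.
have m1 : (Num.min d 1 <= 1)%R by rewrite ge_min lexx orbT.
have md : (Num.min d 1 <= d)%R by rewrite ge_min lexx.
exists (1 - Num.min d 1 / 2)%R; first by move: m0 m1; lra.
by move=> u _; rewrite /om; move: md; lra.
Qed.

(** For f in the unit ball, f - f(rho .) has norm bounded independently of rho, which yields a
    multiple of l near the circle; on a compact disc it is at most eta once rho is close to 1, and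
    eta is chosen so that the mass term is at most l. *)
Lemma essential_norm_upper (n : nat) (p q a b r : R) : (1 <= p)%R -> (p <= q)%R ->
  (-1 < a)%R -> (-1 < b)%R -> (0 < r)%R -> (r < 1)%R ->
  exists2 c : R, (0 < c)%R & forall g (l : R), analytic g ->
  linear_operator p a q b (Tgn g n) -> (0 < l)%R ->
  limsup_mu g n p q a b r < l%:E ->
  poweR (essential_norm p a q b (Tgn g n)) q <= (c * l)%:E.
Proof.
move=> p1 pq a1 b1 r0 r1; have q1 : (1 <= q)%R by lra.
have p0 : (0 < p)%R by lra.
have q0 : (0 < q)%R by lra.
have [c1 c10 H1] := Tgn_Carleson n p1 pq a1 b1 r0 r1.
have [c2 c20 H2] := Nrm_dilate p1 a1.
have [c3 c30 H3] := bergman_normP p1 a1.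
have [c4 c40 H4] := bergman_normP q1 b1.
have [c5 c50 H5] := sup_bound p1 a1.
pose X : R := (2 `^ p * (c3 + c2 * c3))%R.
have X0 : (0 <= X)%R by rewrite mulr_ge0 ?powR_ge0 // addr_ge0 ?mulr_ge0 // ltW.
pose c : R := (c4 * (c1 * (X `^ (q / p) + 1)))%R.
have c0 : (0 < c)%R.
  by rewrite !mulr_gt0 // ltr_wpDl ?powR_ge0.
exists c => // g l ag linT l0 /limsup_mu_lt[d d0 gd].
have [M M0 gM] := Tgn_mass p1 pq a1 b1 ag linT.
have [s s01 ds] := exists_boundary_radius d0.
have s12 : (0 <= (1 + s) / 2 < 1)%R by lra.
pose Ms : R := ((c5 * (1 - (1 + s) / 2) `^ (- (2 + a)) * c3) `^ p^-1)%R.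
have Ms0 : (0 <= Ms)%R by exact: powR_ge0.
pose L : R := (2 * (16 * Ms / ((1 - s) / 4)))%R.
have L0 : (0 <= L)%R.
  apply: mulr_ge0 => //; apply: divr_ge0; first exact: mulr_ge0.
  by apply: divr_ge0 => //; lra.
have [eta eta0 etaM] := exists_powR_small q1 M0 l0.
have L1 : (0 < L + 1)%R by lra.
have e0 : (0 < eta / (L + 1))%R by rewrite divr_gt0.
(* L is a Lipschitz constant on |z| <= s valid for the whole unit ball, so L (1 - rho) <= eta; the +
   1 covers L = 0. Staying above 1/2 keeps the bound of [Nrm_dilate] uniform. *)
pose rho : R := (1 - Num.min (2^-1) (eta / (L + 1)))%R.
have m0 : (0 < Num.min 2^-1 (eta / (L + 1)))%R by rewrite lt_min invr_gt0 ltr0n.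
have m1 : (Num.min 2^-1 (eta / (L + 1)) <= 2^-1)%R by rewrite ge_min lexx.
have m2 : (Num.min 2^-1 (eta / (L + 1)) <= eta / (L + 1))%R by rewrite ge_min lexx orbT.
have r12 : (2^-1 <= rho < 1)%R by rewrite /rho; move: m0 m1; lra.
have r12' : (2^-1 <= rho <= 1)%R by move: r12; lra.
have r01 : (0 <= rho <= 1)%R by move: r12; lra.
have rL : (L * (1 - rho) <= eta)%R.
  rewrite /rho opprB addrCA subrr addr0; apply: le_trans (ler_wpM2l L0 m2) _.
  rewrite mulrCA; apply: ler_piMr; first exact: ltW.
  by rewrite ler_pdivrMr // mul1r lerDl.
clearbody rho.
have compK := Tgn_dilate_compact p1 pq a1 b1 r12 ag linT.
have ess : essential_norm p a q b (Tgn g n) <= ((c * l) `^ q^-1)%:E.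
  apply: (@le_trans _ _ (operator_norm p a q b
      (fun f => (Tgn g n f \- Tgn g n (fun z => f (rho%:C * z)))%R))).
    by apply: ereal_inf_lbound; exists (fun f => Tgn g n (fun z => f (rho%:C * z))%R).
  apply: ge_ereal_sup => _ [f [bf /= fn1] <-].
  have af : analytic f by case: bf.
  have [hf _ _] := H3 f af; have := hf 1%R ler01 fn1; rewrite powR1 mulr1 => fX.
  have afr := analytic_dilate r01 af.
  have frX : Nrm p a (fun z => f (rho%:C * z)%R) <= (c2 * c3)%:E.
    apply: le_trans (H2 f rho af r12') _.
    by rewrite EFinM; apply: lee_wpmul2l => //; rewrite lee_fin ltW.
  have hX := NrmB_le p0 af afr fX frX.
  have fM z : (cabs z <= (1 + s) / 2)%R -> (cabs (f z) <= Ms)%R.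
    by move=> zs; exact: (H5 f c3 _ z af fX s12 zs).
  have small u : Disc u -> (d / 2 <= om u)%R ->
      (cabs (f (pt u) - f (rho%:C * pt u)) <= eta)%R.
    move=> Du ou; apply: le_trans rL.
    exact: (analytic_dilate_close af s01 fM r01 (ds u Du ou) Ms0).
  have aB := analyticB af afr.
  have h := H1 g _ l d X M eta ag aB (ltW l0) d0 X0 (ltW eta0) gM gd hX small.
  have bfr := bergman_dilate p1 a1 r12' bf.
  have aT := analyticB (@analytic_Tgn g n _ ag af) (@analytic_Tgn g n _ ag afr).
  have [_ h2 _] := H4 _ aT.
  apply: le_trans (h2 (c1 * (X `^ (q / p) + 1) * l)%R _ _) _.
  - by rewrite !mulr_ge0 ?addr_ge0 ?powR_ge0 // ltW.
  - rewrite (eq_Nrm q b (g := Tgn g n (fun w => f w - f (rho%:C * w))%R)); last first.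
      by move=> z dz; rewrite (linear_opB p1 a1 linT bf bfr dz).
    apply: (le_trans h); rewrite lee_fin -mulrA; apply: ler_wpM2l; first exact: ltW.
    by rewrite mulrDl mul1r [(l * _)%R]mulrC; apply: lerD.
  - by rewrite lee_fin /c !mulrA.
have cl0 : (0 <= c * l)%R by rewrite mulr_ge0 // ltW.
have ge0i (x : \bar R) : 0 <= x -> x \in `[0, +oo] by move=> x0; rewrite in_itv /= x0 leey.
have := gt0_ler_poweR (ltW q0) (ge0i _ (essential_norm_ge0 q b (Tgn g n) p1 a1))
  (ge0i _ (_ : 0 <= ((c * l) `^ q^-1)%:E)) ess.
rewrite lee_fin powR_ge0 => /(_ isT) h; apply: (le_trans h).
by rewrite poweR_EFin -powRrM mulVf ?gt_eqF // powRr1.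
Qed.

(** A substitute for Fatou's lemma: on 1 - |z| >= 1 / (i + 1) a single f_k is within 1 of h, which
    gives the bound 2^p (X + I), the same for all i; monotone convergence in i concludes. *)
Lemma limit_Nrm_lty (p a X : R) (f : nat -> C -> C) h : (1 <= p)%R -> (-1 < a)%R ->
  (forall k, analytic (f k)) -> analytic h -> (forall k, Nrm p a (f k) <= X%:E) ->
  (forall s e : R, (0 <= s < 1)%R -> (0 < e)%R ->
     exists k, forall z, (cabs z <= s)%R -> (cabs (f k z - h z) <= e)%R) ->
  Nrm p a h < +oo.
Proof.
move=> p1 a1 af ah fX lim; have p0 : (0 < p)%R by lra.
have [I I0 HI] := integral_om_powR_le a1.
pose A u := (cabs (h (pt u)) `^ p * om u `^ a)%:E.
pose F (i : nat) : set T2 := (Disc `&` [set u | (i.+1%:R^-1 <= om u)%R])%classic.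
have mF i : measurable (F i).
  apply: measurable_le_set; first exact: measurable_Disc.
    exact: measurable_cst.
  exact: measurable_funTS (@measurable_om R).
have FE : Disc = \bigcup_i F i.
  apply/seteqP; split => u; last by case=> i _ [].
  move=> Du; have ou := om_gt0 Du; have [k] := ltr_add_invr ou; rewrite add0r => hk.
  by exists k => //; split => //; exact: ltW.
have ndF : {homo F : n m / (n <= m)%N >-> (n <= m)%O}.
  move=> n m nm; apply/subsetPset => u [Du h1]; split => //.
  by apply: le_trans h1; rewrite lef_pV2 ?posrE ?ltr0n // ler_nat.
have mA : measurable_fun Disc A by exact: measurable_Nrm.
have A0 u : 0 <= A u by rewrite lee_fin mulr_ge0 ?powR_ge0.
have mAi i : measurable_fun (F i) A.
  by apply: measurable_funS mA; [exact: measurable_Disc|move=> ? []].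
apply: (@le_lt_trans _ _ (2 `^ p * (X + I))%:E); last by rewrite ltry.
rewrite /Nrm -/A FE.
have cv := @ge0_nondecreasing_set_cvg_integral _ T2 R F A L2 ndF mF mAi (fun i x _ => A0 x).
rewrite -(cvg_lim _ cv) //; apply: lime_le; first by apply/cvg_ex; eexists; exact: cv.
apply: nearW => i.
have i01 : (0 <= (1 - i.+1%:R^-1 : R) < 1)%R.
  rewrite subr_ge0 invf_le1 ?ler1n ?ltr0n //= ltrBlDr ltrDl invr_gt0 ltr0n //.
have [k Hk] := lim _ 1%R i01 ltr01.
pose B u := (2 `^ p)%:E * ((cabs (f k (pt u)) `^ p * om u `^ a)%:E + (om u `^ a)%:E).
have mN := measurable_Nrm p a (af k).
have mO : measurable_fun Disc (fun u : T2 => (om u `^ a)%:E).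
  by apply/measurable_EFinP; apply: measurable_funTS; exact: measurable_om_powR.
have N0 u : Disc u -> 0 <= (cabs (f k (pt u)) `^ p * om u `^ a)%:E.
  by move=> _; rewrite lee_fin mulr_ge0 ?powR_ge0.
have O0 u : Disc u -> 0 <= (om u `^ a)%:E by move=> _; rewrite lee_fin powR_ge0.
have mS := emeasurable_funD mN mO.
have mB : measurable_fun Disc B by exact: measurable_funeM.
have B0 u : Disc u -> 0 <= B u.
  move=> Du; apply: mule_ge0; first by rewrite lee_fin powR_ge0.
  by apply: adde_ge0; [exact: N0|exact: O0].
apply: (@le_trans _ _ (\int[L2]_(u in F i) B u)).
  apply: ge0_le_integral.
  - exact: mF.
  - by move=> u _; exact: A0.
  - exact: mAi.
  - by apply: measurable_funS mB; [exact: measurable_Disc|move=> ? []].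
  - move=> u [Du iu]; rewrite /A /B -EFinD -EFinM lee_fin.
    rewrite -[X in (_ + X)%R]mul1r -mulrDl mulrA; apply: ler_wpM2r; first exact: powR_ge0.
    have hz : (cabs (f k (pt u) - h (pt u)) <= 1)%R.
      have iu1 : (i.+1%:R^-1 <= om u)%R := iu.
      by apply: Hk; move: iu1; rewrite /om; move: (_^-1)%R => t; lra.
    apply: (@le_trans _ _ ((cabs (f k (pt u)) + 1) `^ p)%R).
      apply: ge0_ler_powR; rewrite ?nnegrE ?addr_ge0 ?cabs_ge0 ?(ltW p0) //.
      by have := cabs_le_subD (h (pt u)) (f k (pt u)); rewrite [cabs (h _ - _)%R]cabsB; lra.
    by have := powR_le2 (cabs_ge0 (f k (pt u))) ler01 (ltW p0); rewrite powR1.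
apply: (@le_trans _ _ (\int[L2]_(u in Disc) B u)).
  by apply: ge0_subset_integral => //; [exact: measurable_Disc|move=> ? []].
rewrite (integralZD L2 (@measurable_Disc R) (fun u Du => adde_ge0 (N0 u Du) (O0 u Du)) mS (powR_ge0 _ _)).
rewrite EFinM; apply: lee_wpmul2l; first by rewrite lee_fin powR_ge0.
rewrite (ge0_integralD L2 (@measurable_Disc R) N0 mN O0 mO) EFinD.
by apply: leeD; [exact: fX|exact: HI].
Qed.

(** A zero essential norm would give compactness only through closedness of the compact operators in
    norm. Montel's theorem is applied to T itself instead: the limit h stays in the space by
    [limit_Nrm_lty], and the factor l in [Tgn_Carleson] can be taken as small as desired. *)
Lemma limsup0_compact (n : nat) (p q a b r : R) g : (1 <= p)%R -> (p <= q)%R ->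
  (-1 < a)%R -> (-1 < b)%R -> (0 < r)%R -> (r < 1)%R -> analytic g ->
  linear_operator p a q b (Tgn g n) -> limsup_mu g n p q a b r = 0 ->
  compact_operator p a q b (Tgn g n).
Proof.
move=> p1 pq a1 b1 r0 r1 ag linT L0; split => //.
have q1 : (1 <= q)%R by lra.
have p0 : (0 < p)%R by lra.
have [Tb _ _] := linT; move=> f M bf fM.
have [X X0 fX] := bergman_seq_bound p1 a1 bf fM.
have af k : analytic (f k) by case: (bf k).
have [phi [h [phiI ah Hh]]] := Montel af (loc_bounded p1 a1 af fX).
have hN : Nrm p a h < +oo.
  apply: (limit_Nrm_lty p1 a1 (fun k => af (phi k)) ah (fun k => fX (phi k))) => s e s01 e0.
  by have [K HK] := Hh s e s01 e0; exists K; exact: (HK K (leqnn K)).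
have [k k0 Hk] := bergman_normP p1 a1; have [_ _ [_ bh]] := Hk h ah.
have {}bh := bh hN.
have hfin : Nrm p a h <= (fine (Nrm p a h))%:E.
  by rewrite fineK // ge0_fin_numE // Nrm_ge0.
set Y := fine _ in hfin; have Y0 : (0 <= Y)%R by apply: fine_ge0; exact: Nrm_ge0.
exists phi, (Tgn g n h); split; [exact: phiI|exact: (Tb _ bh)|].
apply: (bergman_norm_cvg0 q1 b1) => [j|y y0].
  exact: (analyticB (@analytic_Tgn g n _ ag (af _)) (@analytic_Tgn g n _ ag ah)).
have [m m0 gm] := Tgn_mass p1 pq a1 b1 ag linT.
have [c c0 Hc] := Tgn_Carleson n p1 pq a1 b1 r0 r1.
pose Z : R := (2 `^ p * (X + Y))%R.
have Z0 : (0 <= Z)%R by rewrite mulr_ge0 ?powR_ge0 // addr_ge0.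
(* Half of the tolerance y goes to the boundary term and half to the mass term; Z bounds [Nrm] of
   f_k - h, and the + 1 covers Z = 0. *)
pose l : R := (y / (2 * c * (Z `^ (q / p) + 1)))%R.
have ZZ : (0 < Z `^ (q / p) + 1)%R by rewrite ltr_wpDl ?powR_ge0.
have l0 : (0 < l)%R by rewrite divr_gt0 // !mulr_gt0.
have [d d0 gd] : exists2 d : R, (0 < d)%R & forall v, Disc v -> (om v < d)%R ->
    quot g n p q a b r (pt v) <= l%:E.
  by apply: limsup_mu_lt; rewrite L0 lte_fin.
have [s s01 ds] := exists_boundary_radius d0.
have y2 : (0 < y / (2 * c))%R by rewrite divr_gt0 // mulr_gt0.
have [eta eta0 etam] := exists_powR_small q1 m0 y2.
have [K HK] := Hh s eta s01 eta0; exists K => j Kj.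
rewrite (eq_Nrm q b (g := Tgn g n (fun w => f (phi j) w - h w)%R)); last first.
  by move=> z dz; rewrite (linear_opB p1 a1 linT (bf _) bh dz).
have small u : Disc u -> (d / 2 <= om u)%R -> (cabs (f (phi j) (pt u) - h (pt u)) <= eta)%R.
  by move=> Du ou; exact: (HK j Kj _ (ds u Du ou)).
have dZ := NrmB_le p0 (af (phi j)) ah (fX (phi j)) hfin.
have := Hc g _ l d Z m eta ag (analyticB (af _) ah) (ltW l0) d0 Z0 (ltW eta0) gm gd dZ small.
move=> hh; apply: (le_trans hh); rewrite lee_fin mulrDr.
have -> : (y = y / 2 + y / 2)%R by lra.
apply: lerD.
  rewrite mulrA /l (_ : c * (y / (2 * c * (Z `^ (q / p) + 1))) * Z `^ (q / p) =
     y / 2 * (Z `^ (q / p) / (Z `^ (q / p) + 1)))%R; last first.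
    move: ZZ; move: (Z `^ _)%R => z ZZ; field; rewrite (gt_eqF ZZ) (gt_eqF c0) //.
  apply: ler_piMr; first by rewrite divr_ge0 // ltW.
  by rewrite ler_pdivrMr // mul1r lerDl.
rewrite mulrC -ler_pdivlMr //; apply: (le_trans etam).
by rewrite invfM mulrA.
Qed.

End Operators.

(** * Test functions and the lower bound *)

Section LowerBound.
Context {R : realType}.
Local Notation C := R[i].
Local Notation leb := (@lebesgue_measure R).
Local Notation TR := (measurableTypeR R).
Local Notation T2 := (TR * TR)%type.
Local Notation L2 := (leb \x leb)%E.
Implicit Types (f g h F : C -> C) (u v : T2).

Local Open Scope ereal_scope.

(** For gm = m - (2 + a) / p the power of 1 - |v| normalizes the kernel in A^p_a, uniformly in v
    near the circle; nu is a scale fixed once for all. *)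
Definition testf (m : nat) (gm nu : R) v (z : C) : C :=
  ((nu * om v `^ gm)%:C * kpow m (pt v) z)%R.

Lemma cabs_testf m gm nu v z : (0 <= nu)%R ->
  cabs (testf m gm nu v z) = (nu * om v `^ gm * (cabs (kden (pt v) z))^-1 ^+ m)%R.
Proof. by move=> n0; rewrite cabsM cabsR ger0_norm ?mulr_ge0 ?powR_ge0 // cabs_kpow. Qed.

Lemma analytic_testf m gm nu v : Disc v -> analytic (testf m gm nu v).
Proof.
by move=> Dv; exact: (analyticM (@analytic_cst R _) (@analytic_kpow R m _ (Dv : (cabs (pt v) < 1)%R))).
Qed.

Lemma testf_Nrm (p a : R) m : (1 <= p)%R -> (-1 < a)%R -> (6 + a <= m%:R)%R ->
  exists2 c : R, (0 < c)%R & forall nu v, (0 <= nu)%R -> Disc v -> (om v <= 2^-1)%R ->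
  Nrm p a (testf m (m%:R - (2 + a) / p) nu v) <= (nu `^ p * c)%:E.
Proof.
move=> p1 a1 m6; have p0 : (0 < p)%R by lra.
have [c c0 H] := kpow_Nrm p1 a1 m6; exists c => // nu v nu0 Dv ov2.
have ov := om_gt0 Dv.
have v12 : (2^-1 <= cabs (pt v) < 1)%R by apply/andP; split; [move: ov2; rewrite /om; lra|exact: Dv].
have ak : analytic (kpow m (pt v)) := @analytic_kpow R m _ (Dv : (cabs (pt v) < 1)%R).
rewrite (Nrm_cmul _ _ p0 ak) cabsR ger0_norm ?mulr_ge0 ?powR_ge0 // powRM ?powR_ge0 //.
apply: le_trans (lee_wpmul2l _ (H _ v12)) _; first by rewrite lee_fin mulr_ge0 ?powR_ge0.
rewrite -/(om v) -EFinM lee_fin -mulrA; apply: ler_wpM2l; first exact: powR_ge0.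
rewrite -powRrM mulrCA -powRDp // (_ : (m%:R - (2 + a) / p) * p + (2 + a - m%:R * p) = 0)%R; last first.
  by field; rewrite gt_eqF.
by rewrite powRr0 mulr1.
Qed.

(** On the disc around v, |1 - conj v u| <= (1 - |v|^2) + |v| |u - v| <= 3 (1 - |v|), whence the
    factor 3^-m. *)
Lemma testf_tent (q a p r nu : R) m v u : (1 <= p)%R -> (0 < q)%R -> (0 < r)%R -> (r < 1)%R ->
  (0 < nu)%R -> Disc v -> tent r v u ->
  (nu * (3^-1 ^+ m) * om v `^ (- ((2 + a) / p))
     <= cabs (testf m (m%:R - (2 + a) / p) nu v (pt u)))%R.
Proof.
move=> p1 q0 r0 r1 nu0 Dv [Du uv]; have ov := om_gt0 Dv.
have v1 : (cabs (pt v) < 1)%R by exact: Dv.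
have k0 : (0 < cabs (kden (pt v) (pt u)))%R by rewrite cabs_gt0; exact: kden_neq0.
have k3 : (cabs (kden (pt v) (pt u)) <= 3 * om v)%R.
  have -> : kden (pt v) (pt u) = ((1 - (pt v)^* * pt v) - (pt v)^* * (pt u - pt v))%R.
    by rewrite /kden; ring.
  apply: le_trans (cabs_le_normD _ _) _; rewrite normcN cabsM cabs_conj.
  have h1 : (cabs (1 - (pt v)^* * pt v) <= 2 * om v)%R.
    have -> : (1 - (pt v)^* * pt v = (1 - cabs (pt v) ^+ 2)%:C)%R.
      rewrite cabs_sqr; case: (pt v) => x y; apply/eqP; rewrite eq_complex /=.
      by apply/andP; split; apply/eqP; ring.
    rewrite cabsR ger0_norm om_sqr.
      by rewrite mulrC ler_pM2r //; lra.
    by rewrite mulr_ge0 ?(ltW ov) // addr_ge0 ?cabs_ge0.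
  have h2 : (cabs (pt v) * cabs (pt u - pt v) <= om v)%R.
    apply: (@le_trans _ _ (cabs (pt u - pt v)%R)).
      by apply: ler_piMl; [exact: cabs_ge0|exact: ltW].
    by apply: le_trans (ltW uv) _; apply: ler_piMl; exact: ltW.
  by move: h1 h2; lra.
rewrite cabs_testf ?(ltW nu0) // powRDp // powR_mulrn ?(ltW ov) //.
rewrite -!mulrA; apply: ler_wpM2l; first exact: ltW.
rewrite [leLHS]mulrC [leRHS]mulrCA; apply: ler_wpM2l; first exact: powR_ge0.
rewrite -exprMn; apply: lerXn2r; rewrite ?nnegrE ?invr_ge0 // ?mulr_ge0 ?invr_ge0 ?cabs_ge0 ?(ltW ov) //.
by rewrite ler_pdivlMr // mulrC ler_pdivrMr // mulrC.
Qed.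

(** On |z| <= s the kernel is bounded independently of v, so the positive power gm of 1 - |v| forces
    local uniform decay; this makes the second of two test functions negligible near the first
    point. *)
Lemma testf_small m (gm nu s e : R) : (0 < gm)%R -> (0 <= nu)%R -> (0 <= s < 1)%R -> (0 < e)%R ->
  exists2 d : R, (0 < d)%R & forall v z, Disc v -> (om v < d)%R -> (cabs z <= s)%R ->
    (cabs (testf m gm nu v z) <= e)%R.
Proof.
move=> gm0 nu0 /andP[s0 s1] e0.
have K0 : (0 <= nu * (1 - s)^-1 ^+ m)%R.
  by rewrite mulr_ge0 // exprn_ge0 // invr_ge0; lra.
have K1 : (0 < nu * (1 - s)^-1 ^+ m + 1)%R by lra.
exists ((e / (nu * (1 - s)^-1 ^+ m + 1)) `^ gm^-1)%R.
  by rewrite powR_gt0 // divr_gt0.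
move=> v z Dv ovd zs; have ov := om_gt0 Dv.
have v1 : (cabs (pt v) < 1)%R by exact: Dv.
have z1 : (cabs z <= 1)%R by lra.
have [_ kz] := cabs_kden_ge (ltW v1) z1.
have og : (om v `^ gm <= e / (nu * (1 - s)^-1 ^+ m + 1))%R.
  have -> : (e / (nu * (1 - s)^-1 ^+ m + 1) = ((e / (nu * (1 - s)^-1 ^+ m + 1)) `^ gm^-1) `^ gm)%R.
    by rewrite -powRrM mulVf ?gt_eqF // powRr1 // divr_ge0 // ltW.
  by apply: ge0_ler_powR; rewrite ?nnegrE ?powR_ge0 ?(ltW ov) ?(ltW gm0) ?(ltW ovd).
rewrite cabs_testf //.
have hk : ((cabs (kden (pt v) z))^-1 ^+ m <= (1 - s)^-1 ^+ m)%R.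
  apply: lerXn2r; rewrite ?nnegrE ?invr_ge0 ?cabs_ge0 //; first by lra.
  rewrite lef_pV2 ?posrE; [by move: kz; lra|by move: kz; lra|by lra].
apply: (@le_trans _ _ (nu * (1 - s)^-1 ^+ m * (e / (nu * (1 - s)^-1 ^+ m + 1)))%R).
  rewrite mulrAC; apply: ler_pM => //; rewrite ?mulr_ge0 ?powR_ge0 // ?exprn_ge0 ?invr_ge0 ?cabs_ge0 //.
  by apply: ler_wpM2l.
rewrite mulrCA; apply: ler_piMr; first exact: ltW.
by rewrite ler_pdivrMr // mul1r lerDl.
Qed.

Lemma tent_lower (q e l : R) g f v (r : R) : (0 < q)%R -> analytic g -> analytic f -> (0 <= l)%R ->
  (forall u, tent r v u -> (l <= cabs (f (pt u)))%R) ->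
  (l `^ q)%:E * \int[L2]_(u in tent r v) weight g q e u <= Nrm q e (fun z => f z * cderiv g z)%R.
Proof.
move=> q0 ag af l0 H; have sT : tent r v `<=` Disc by move=> ? [].
have mT := measurable_tent r v.
have mw := measurable_weight q e ag.
rewrite -(integralZD L2 mT (fun u _ => weight_ge0 g q e u) (measurable_funTS mw) (powR_ge0 _ _)).
rewrite (NrmM_weight f g e q0).
apply: (@le_trans _ _ (\int[L2]_(u in tent r v) (weight g q e u * (cabs (f (pt u)) `^ q)%:E))).
  apply: ge0_le_integral.
  - exact: mT.
  - by move=> u _; rewrite mule_ge0 ?weight_ge0 // lee_fin powR_ge0.
  - by apply: measurable_funeM; exact: measurable_funTS.
  - exact: measurable_weight_powE.
  - move=> u Tu; rewrite muleC; apply: lee_wpmul2l; first exact: weight_ge0.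
    rewrite lee_fin; apply: ge0_ler_powR; rewrite ?nnegrE ?cabs_ge0 ?(ltW q0) //.
    exact: H.
apply: ge0_subset_integral => //.
- exact: measurable_Disc.
- by apply: measurable_weight_powE => //; exact: measurable_Disc.
- by move=> u _; rewrite mule_ge0 ?weight_ge0 // lee_fin powR_ge0.
Qed.

(** One compact K is treated at a time, with a real bound x of the norm of T - K, because the
    selected points depend on K; the infimum over K is left to the final argument. *)
Lemma essential_norm_lower (n : nat) (p q a b r : R) : (1 <= p)%R -> (p <= q)%R ->
  (-1 < a)%R -> (-1 < b)%R -> (0 < r)%R -> (r < 1)%R ->
  exists2 c : R, (0 < c)%R & forall g (K : operator) (l x : R), analytic g ->
  linear_operator p a q b (Tgn g n) -> compact_operator p a q b K -> (0 <= x)%R ->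
  operator_norm p a q b (fun f => (Tgn g n f \- K f)%R) <= x%:E -> (0 < l)%R ->
  l%:E < limsup_mu g n p q a b r -> (l <= c * x `^ q)%R.
Proof.
move=> p1 pq a1 b1 r0 r1; have q1 : (1 <= q)%R by lra.
have p0 : (0 < p)%R by lra.
have q0 : (0 < q)%R by lra.
set k := (q * (2 + a) / p)%R.
(* A large kernel power serves twice: [kpow_Nrm] requires it, and it makes gm positive. *)
have [m m6] : exists m : nat, (6 + a <= m%:R)%R.
  by exists (Num.bound (6 + a)%R); apply/ltW/archi_boundP; lra.
pose gm : R := (m%:R - (2 + a) / p)%R.
have gm0 : (0 < gm)%R.
  have : ((2 + a) / p <= 2 + a)%R by rewrite ler_pdivrMr //; apply: ler_peMr; lra.
  by rewrite /gm; move: m6; lra.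
have [c1 c10 H1] := testf_Nrm p1 a1 m6.
have [c2 c20 H2] := bergman_normP p1 a1.
have [c3 c30 H3] := bergman_normP q1 b1.
have [c4 c40 H4] := volt_Nrm_ge n q1 b1.
have [c5 c50 H5] := quot_tent n p q a b r.
(* Normalizes all differences of two test functions: their p-th power integral is at most nu^p 2^p
   (c1 + c1), and [c2] converts this into a norm at most 1. *)
pose nu : R := ((c2 * (2 `^ p * (c1 + c1)))^-1 `^ p^-1)%R.
have cc0 : (0 < c2 * (2 `^ p * (c1 + c1)))%R.
  by rewrite mulr_gt0 // mulr_gt0 ?powR_gt0 // addr_gt0.
have nu0 : (0 < nu)%R by rewrite powR_gt0 // invr_gt0.
have nup : (nu `^ p = (c2 * (2 `^ p * (c1 + c1)))^-1)%R.
  by rewrite -powRrM mulVf ?gt_eqF // powRr1 // invr_ge0 ltW.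
clearbody nu.
pose w : R := (nu * 3^-1 ^+ m)%R.
have w0 : (0 < w)%R by rewrite mulr_gt0 // exprn_gt0 // invr_gt0.
pose A : R := (c5 * (2 / w) `^ q * c4 * 2 `^ q)%R.
have A0 : (0 < A)%R by rewrite !mulr_gt0 ?powR_gt0 // divr_gt0.
exists (A * c3)%R; first exact: mulr_gt0.
move=> g K l x ag linT [linK compK] x0 TKx l0 lL.
suff main (e : R) : (0 < e)%R -> (l <= A * (c3 * x `^ q + 2 `^ q * (e + e)))%R.
  apply/ler_addgt0Pr => e e0.
  have B0 : (0 < A * 2 `^ q * 2)%R.
    by apply: mulr_gt0 => //; apply: mulr_gt0 => //; exact: powR_gt0.
  have e'0 : (0 < e / (A * 2 `^ q * 2))%R by exact: divr_gt0.
  apply: le_trans (main _ e'0) _; rewrite mulrDr mulrA lerD2l.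
  set t := (e / _)%R; rewrite (_ : A * (2 `^ q * (t + t)) = t * (A * 2 `^ q * 2))%R; last by ring.
  by rewrite /t divfK // gt_eqF.
move=> e0.
(* The shift i + 2 gives 1 - |v| < 1/2, as [testf_Nrm] requires. *)
have exv (i : nat) : exists v : T2, [/\ Disc v, (om v < i.+2%:R^-1)%R &
    l%:E < quot g n p q a b r (pt v)].
  by apply: limsup_mu_gt => //; rewrite invr_gt0 ltr0n.
have [vs vsP] := choice exv.
have Dv i : Disc (vs i) by have [] := vsP i.
have ov2 i : (om (vs i) <= 2^-1)%R.
  have [_ h _] := vsP i; apply: le_trans (ltW h) _.
  by rewrite lef_pV2 ?posrE ?ltr0n // ler_nat.
pose f i := testf m gm nu (vs i).
have af i : analytic (f i) by exact: analytic_testf.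
have fN i : Nrm p a (f i) <= (nu `^ p * c1)%:E by exact: H1 (ltW nu0) (Dv i) (ov2 i).
have bf i : bergman p a (f i).
  have [_ _ [_ h]] := H2 _ (af i); apply: h.
  by apply: le_lt_trans (fN i) _; rewrite ltry.
have nc0 : (0 <= nu `^ p * c1)%R by rewrite mulr_ge0 ?powR_ge0 // ltW.
have fB i : bergman_norm p a (f i) <= ((c2 * (nu `^ p * c1)) `^ p^-1)%:E.
  by have [_ h _] := H2 _ (af i); exact: h.
have fijB i j : bergman_norm p a (fun z => f i z - f j z)%R <= 1.
  have [_ h _] := H2 _ (analyticB (af i) (af j)).
  have hN := NrmB_le p0 (af i) (af j) (fN i) (fN j).
  apply: le_trans (h _ _ hN) _.
    by rewrite mulr_ge0 ?powR_ge0 // addr_ge0.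
  rewrite lee_fin -mulrDr (_ : c2 * (2 `^ p * (nu `^ p * (c1 + c1))) = 1)%R ?powR1 //.
  rewrite nup; set z := (_^-1)%R.
  have -> : (c2 * (2 `^ p * (z * (c1 + c1))) = c2 * (2 `^ p * (c1 + c1)) * z)%R by ring.
  by rewrite /z divff // gt_eqF.
have [phi [h [phiI bh cvg]]] := compK f _ bf fB.
have [Kb _ _] := linK; have [Tb _ _] := linT.
have aK F : bergman p a F -> analytic (K F) by move=> /Kb[].
have ah : analytic h by case: bh.
have [y y0 yq] : exists2 y : R, (0 < y)%R & (c3 * y `^ q <= e)%R.
  exact: exists_powR_small q1 (ltW c30) e0.
have [k0 Hk0] := ereal0_cvg (fun k => bergman_norm_ge0 q b _) cvg y0.
have Kh j : (k0 <= j)%N -> Nrm q b (fun z => K (f (phi j)) z - h z)%R <= e%:E.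
  move=> kj; have aKh := analyticB (aK _ (bf (phi j))) ah.
  have [hb _ _] := H3 _ aKh; apply: le_trans (hb y (ltW y0) (Hk0 j kj)) _.
  by rewrite lee_fin.
(* The first index is frozen here: the radius and the tolerance that select j below depend on this
   v. *)
pose i := phi k0; pose v := vs i.
have Dvi : Disc v by exact: Dv.
have ov := om_gt0 Dvi.
have s01 : (0 <= cabs (pt v) + r * om v < 1)%R.
  apply/andP; split.
    by apply: addr_ge0; [exact: cabs_ge0|apply: mulr_ge0; exact: ltW].
  have : (r * om v < om v)%R by rewrite gtr_pMl.
  by rewrite /om; lra.
(* Half of the lower bound of |f_i| on the disc around v, so that |f_j| <= et leaves at least et for
   the difference. *)
pose et : R := (w / 2 * om v `^ (- ((2 + a) / p)))%R.
have et0 : (0 < et)%R by rewrite mulr_gt0 ?powR_gt0 // divr_gt0.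
have [d d0 Hd] := testf_small m gm0 (ltW nu0) s01 et0.
have [N HN] : exists N : nat, (N.+2%:R^-1 < d)%R.
  have [N] := ltr_add_invr d0; rewrite add0r => hN; exists N.
  by apply: le_lt_trans hN; rewrite lef_pV2 ?posrE ?ltr0n // ler_nat.
pose j := phi (maxn k0 N).
have phi_ge t : (t <= phi t)%N.
  elim: t => // t IH; apply: (leq_ltn_trans IH); exact: phiI.
have ovj : (om (vs j) < d)%R.
  have [_ hj _] := vsP j; apply: lt_le_trans hj _; apply: le_trans (ltW HN).
  rewrite lef_pV2 ?posrE ?ltr0n // ler_nat !ltnS.
  by apply: leq_trans (phi_ge _); exact: leq_maxr.
pose D z : C := (f i z - f j z)%R.
have aD : analytic D := analyticB (af i) (af j).
have bD : bergman p a D := bergmanB p1 a1 (bf i) (bf j).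
have Dlow u : tent r v u -> (et <= cabs (D (pt u)))%R.
  move=> Tu; have h1 := testf_tent a m p1 q0 r0 r1 nu0 Dvi Tu.
  have us : (cabs (pt u) <= cabs (pt v) + r * om v)%R.
    have uv : (cabs (pt u - pt v) < r * om v)%R by case: Tu.
    by have := cabs_le_subD (pt u) (pt v); lra.
  have h2 := Hd _ _ (Dv j) ovj us.
  have h3 : (et + et <= cabs (f i (pt u)))%R.
    by apply: le_trans h1; rewrite -/w /et -mulrDl -splitr.
  have h4 : (cabs (f i (pt u)) - cabs (f j (pt u)) <= cabs (D (pt u)))%R by exact: cabs_le_subD.
  have h5 : (cabs (f j (pt u)) <= et)%R by exact: h2.
  apply: le_trans h4; rewrite lerBrDr; apply: le_trans h3.
  by rewrite lerD2l.
have low := tent_lower (b + n%:R * q) q0 ag aD (ltW et0) Dlow.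
have up := H4 _ (analyticM aD (analytic_cderiv ag)).
have aT F : bergman p a F -> analytic (Tgn g n F) by move=> /Tb[].
have NT : Nrm q b (Tgn g n D) <= (2 `^ q * (c3 * x `^ q + 2 `^ q * (e + e)))%:E.
  have aTD := aT _ bD; have aKD := aK _ bD.
  have N1 : Nrm q b (fun z => Tgn g n D z - K D z)%R <= (c3 * x `^ q)%:E.
    have [hb _ _] := H3 _ (analyticB aTD aKD); apply: hb => //.
    apply: le_trans TKx; apply: ereal_sup_ubound; exists D => //; split => //.
    exact: fijB.
  (* By linearity K (f_i - f_j) is a difference of two distances to the limit h, both small since
     the two indices lie beyond [k0] in the subsequence. *)
  have N2 : Nrm q b (K D) <= (2 `^ q * (e + e))%:E.
    rewrite (eq_Nrm q b (g := fun z => (K (f i) z - h z) - (K (f j) z - h z))%R); last first.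
      by move=> z dz; rewrite (linear_opB p1 a1 linK (bf i) (bf j) dz); ring.
    apply: (NrmB_le q0 (analyticB (aK _ (bf i)) ah) (analyticB (aK _ (bf j)) ah)).
      exact: (Kh k0 (leqnn _)).
    exact: (Kh _ (leq_maxl _ _)).
  rewrite (eq_Nrm q b (g := fun z => (Tgn g n D z - K D z) + K D z)%R); last first.
    by move=> z _; rewrite subrK.
  apply: le_trans (NrmD b q0 (analyticB aTD aKD) aKD) _.
  by rewrite EFinM EFinD; apply: lee_wpmul2l; [rewrite lee_fin powR_ge0|exact: leeD].
have [_ qJ] := H5 g v ag Dvi; rewrite -/k in qJ.
set J := \int[L2]_(u in tent r v) _ in low qJ *.
have J0 : 0 <= J by apply: integral_ge0 => u _; exact: weight_ge0.
have [_ _ lq] := vsP i.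
have lJ : (l * om v `^ k)%:E <= c5%:E * J.
  apply: le_trans qJ; rewrite EFinM; apply: lee_wpmul2r; first by rewrite lee_fin powR_ge0.
  exact: ltW.
have etq : (et `^ q = (w / 2) `^ q * om v `^ (- k))%R.
  rewrite /et powRM ?powR_ge0 ?divr_ge0 ?(ltW w0) // -powRrM; congr (_ * _ `^ _)%R.
  by rewrite /k; field; rewrite gt_eqF.
rewrite -lee_fin.
have -> : l%:E = ((2 / w) `^ q * et `^ q)%:E * (l * om v `^ k)%:E.
  rewrite -EFinM; congr EFin; rewrite etq mulrA -powRM ?divr_ge0 ?(ltW w0) //.
  rewrite (_ : 2 / w * (w / 2) = 1)%R; last by field; rewrite gt_eqF.
  rewrite powR1 mul1r mulrCA -powRDp // addNr powRr0 mulr1 //.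
apply: le_trans (lee_wpmul2l _ lJ) _; first by rewrite lee_fin mulr_ge0 ?powR_ge0.
apply: (@le_trans _ _ ((c5 * (2 / w) `^ q)%:E * ((et `^ q)%:E * J))).
  rewrite !muleA -!EFinM; apply: lee_wpmul2r => //; rewrite lee_fin.
  by rewrite le_eqVlt; apply/orP; left; apply/eqP; ring.
apply: le_trans (lee_wpmul2l _ (le_trans low up)) _.
  by rewrite lee_fin mulr_ge0 ?powR_ge0 // ltW.
rewrite muleA -EFinM; apply: le_trans (lee_wpmul2l _ NT) _.
  by rewrite lee_fin !mulr_ge0 ?powR_ge0 // ltW.
by rewrite -EFinM lee_fin /A !mulrA.
Qed.

End LowerBound.

Lemma lte_between (R : realType) (y : R) (x : \bar R) : (y%:E < x)%E ->
  exists2 l : R, y < l & (l%:E < x)%E.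
Proof.
case: x => [x||] //; last by exists (y + 1); rewrite ?ltry // ltrDl.
rewrite lte_fin => yx; exists ((y + x) / 2); rewrite ?lte_fin; lra.
Qed.

Theorem theorem4p2 (R : realType) (n : nat) (p q alpha beta r : R)
    (n_gt0 : (0 < n)%N) (p_ge1 : 1 <= p) (le_pq : p <= q)
    (alpha_gtN1 : -1 < alpha) (beta_gtN1 : -1 < beta)
    (le_qp : q / p <= (beta + 2) / (alpha + 2))
    (r_gt0 : 0 < r) (r_lt1 : r < 1) :
  exists2 c : R, 1 <= c &
    forall g : R[i] -> R[i], analytic g ->
      bounded_operator p alpha q beta (Tgn g n) ->
      [/\ (c^-1%:E * limsup_mu g n p q alpha beta r
             <= poweR (essential_norm p alpha q beta (Tgn g n)) q)%E,
          (poweR (essential_norm p alpha q beta (Tgn g n)) q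
             <= c%:E * limsup_mu g n p q alpha beta r)%E
        & compact_operator p alpha q beta (Tgn g n) <->
          limsup_mu g n p q alpha beta r = 0%E].
Proof.
have q1 : 1 <= q by lra.
have q0 : 0 < q by lra.
have [c1 c10 H1] := essential_norm_upper n p_ge1 le_pq alpha_gtN1 beta_gtN1 r_gt0 r_lt1.
have [c2 c20 H2] := essential_norm_lower n p_ge1 le_pq alpha_gtN1 beta_gtN1 r_gt0 r_lt1.
pose c := 1 + c1 + c2; have c0 : 0 < c by rewrite /c; lra.
exists c; first by rewrite /c; lra.
move=> g ag [linT _].
set L := limsup_mu _ _ _ _ _ _ _; set E := essential_norm _ _ _ _ _.
have L0 : (0 <= L)%E by exact: limsup_mu_ge0.
have E0 : (0 <= E)%E by exact: essential_norm_ge0.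
(* A real l strictly between the bound and L lets the estimate for real l cover the case L = +oo as
   well. *)
have lower (K : operator) (x : R) : compact_operator p alpha q beta K -> 0 <= x ->
    (operator_norm p alpha q beta (fun f => (Tgn g n f \- K f)%R) <= x%:E)%E ->
    (L <= (c2 * x `^ q)%:E)%E.
  move=> cK x0 Kx; rewrite leNgt; apply/negP => /lte_between[l l1 l2].
  have l0 : 0 < l.
    by apply: le_lt_trans l1; rewrite mulr_ge0 ?powR_ge0 // ltW.
  by have := H2 g K l x ag linT cK x0 Kx l0 l2; rewrite leNgt l1.
split.
- have EK (x : R) : (E < x%:E)%E -> (L <= (c2 * x `^ q)%:E)%E.
    move=> Ex; have x0 : 0 <= x by rewrite -lee_fin; apply: le_trans E0 (ltW Ex).
    have [_ [K cK <-] Kx] := ereal_inf_lt Ex.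
    exact: lower cK x0 (ltW Kx).
  clearbody E; case: E E0 EK => [e||] // e0 EK; last by rewrite poweRyr ?gt_eqF // leey.
  rewrite lee_fin in e0; rewrite poweR_EFin.
  (* Any real number above E bounds L, so L is finite. *)
  have := EK (e + 1); rewrite lte_fin ltrDl => /(_ ltr01).
  clearbody L; case: L L0 EK {lower} => [z||] // z0 EK _.
  rewrite lee_fin in z0; rewrite -EFinM lee_fin.
  have zc : 0 <= z / c2 by rewrite divr_ge0 // ltW.
  (* Taking the q-th root first leaves a bound linear in x, so letting x tend to 0 needs no
     continuity of the power. *)
  have ze : (z / c2) `^ q^-1 <= e.
    apply/ler_addgt0Pr => x x0; have ex : 0 <= e + x by rewrite addr_ge0 // ltW.
    have := EK (e + x); rewrite lte_fin ltrDl => /(_ x0); rewrite lee_fin => h.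
    rewrite -[leRHS](powRr1 ex) -(mulfV (lt0r_neq0 q0)) powRrM.
    apply: ge0_ler_powR; rewrite ?nnegrE ?powR_ge0 ?invr_ge0 ?(ltW q0) //.
    by rewrite ler_pdivrMr // mulrC.
  apply: (@le_trans _ _ (z / c2)).
    rewrite mulrC; apply: ler_wpM2l => //; rewrite lef_pV2 ?posrE //.
    by rewrite /c; lra.
  rewrite -[leLHS](powRr1 zc) -(mulVf (lt0r_neq0 q0)) powRrM.
  by apply: ge0_ler_powR; rewrite ?nnegrE ?powR_ge0 ?(ltW q0).
- have : forall l : R, 0 < l -> (L < l%:E)%E -> (poweR E q <= (c1 * l)%:E)%E.
    by move=> l l0; exact: H1.
  clearbody L; case: L L0 {lower} => [z||] // z0 H; last first.
    by rewrite gt0_muley ?lte_fin // leey.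
  rewrite lee_fin in z0.
  apply: (@le_trans _ _ (c1 * z)%:E); last first.
    by rewrite -EFinM lee_fin; apply: ler_wpM2r => //; rewrite /c; lra.
  apply/lee_addgt0Pr => e e0; have ec : 0 < e / c1 by rewrite divr_gt0.
  apply: le_trans (H (z + e / c1) _ _) _; rewrite ?lte_fin ?ltrDl //.
    by rewrite ltr_wpDl.
  by rewrite -EFinD lee_fin mulrDr mulrCA divff ?gt_eqF // mulr1.
- split => [cT|]; last exact: limsup0_compact.
  apply/eqP; rewrite eq_le L0 andbT.
  (* A compact T is its own approximant: T - T has operator norm 0, so the lower estimate with x = 0
     gives L <= 0. *)
  have := lower _ 0 cT (lexx _); rewrite powR0 ?gt_eqF // mulr0; apply.
  apply: ge_ereal_sup => _ [f _ <-].
  have -> : (Tgn g n f \- Tgn g n f)%R = (fun=> 0) by apply/funext => z /=; rewrite subrr.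
  by have [_] := bergman0 q1 beta_gtN1.
Qed.
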